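(* There exists an absolute constant $C>0$ such that for every $U_0\in J^3(\mathbb R^3)$, setting $$t(\rho):=\sup\Big\{t>0:\ \|U_0\|_{3,\rho}+\Big(e^{-\frac{\rho^2}{8t}}+\frac{t^{1/2}}{\rho}\Big)\|U_0\|_3<\frac1{4C}\Big\}\quad(\rho>0),\qquad T:=T(U_0):=\sup_{\rho>0}t(\rho),$$ one has $T(U_0)>0$ and the Navier-Stokes Cauchy problem $$U_t+U\cdot\nabla U+\nabla\pi=\Delta U,\quad \nabla\cdot U=0\ \text{ in }(0,T)\times\mathbb R^3,\qquad U=U_0\ \text{ on }\{0\}\times\mathbb R^3,$$ has a solution $(U,\pi)$ on $(0,T)\times\mathbb R^3$ with the following properties, where $c$ denotes constants independent of $U_0$ and $t$: (i) for all $t\in(0,T)$ and all $\theta\in[0,1)$, $U(t)\in C^{2,\theta}(\mathbb R^3)$, and for all $\eta\in(0,T)$, $U_t,\ D^2U\in C^{0,\frac\theta2}((\eta,T)\times\mathbb R^3)$; (ii) $\sup_{(0,T)}t^{\frac12}\|U(t)\|_\infty\le c\,\|U_0\|_3$; (iii) $\lim_{t\to0}t^{\frac12}\|U(t)\|_\infty=0$ and $\lim_{t\to0}t\,\|\nabla U(t)\|_\infty=0$; (iv) $\|U(t)\|_3\le c\,\|U_0\|_3$ for all $t\in[0,T)$, and $\lim_{t\to0}\|U(t)-U_0\|_3=0$; (v) $t^{\frac12}\|\pi(t)\|_3\le c\,\|U_0\|_3$ and $\pi(t)\in C^{1,\theta}(\mathbb R^3)$, for all $t\in(0,T)$ and $\theta\in[0,1)$.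 Finally, if the norm $\|U_0\|_3$ is suitably small (smaller than some absolute positive constant), then the Navier-Stokes Cauchy problem with initial datum $U_0$ has a solution $(U,\pi)$ on $(0,\infty)\times\mathbb R^3$ enjoying properties (i)-(v) with $T=\infty$.
   Context: $\|\cdot\|_p$ is the norm of $L^p(\mathbb R^3)$. $\mathscr C_0(\mathbb R^3)$ is the set of divergence-free vector fields in $C_0^\infty(\mathbb R^3)$, and $J^3(\mathbb R^3)$ is the closure of $\mathscr C_0(\mathbb R^3)$ in $L^3(\mathbb R^3)$. For $\rho>0$, $\|u\|_{3,\rho}^3:=\sup_{x\in\mathbb R^3}\int_{B(x,\rho)}|u(y)|^3\,dy$. The unknowns are the velocity $U:(0,T)\times\mathbb R^3\to\mathbb R^3$ and the pressure $\pi:(0,T)\times\mathbb R^3\to\mathbb R$; $U\cdot\nabla U:=U_k\,\partial_{x_k}U$. The supremum of the empty set in the definition of $t(\rho)$ is taken to be $0$. The initial condition is attained in the sense of the $L^3$-limit $\lim_{t\to0}\|U(t)-U_0\|_3=0$. *)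

(* Defs.v *)
From mathcomp Require Import all_boot all_order all_algebra.
From mathcomp Require Import all_classical all_reals all_analysis.

Set Implicit Arguments.
Unset Strict Implicit.
Unset Printing Implicit Defensive.

Import Order.TTheory GRing.Theory Num.Theory.
Import numFieldNormedType.Exports.

Local Open Scope classical_set_scope.
Local Open Scope ring_scope.

(* Points of R^3 are row vectors 'rV[R]_3, whose library norm `|x| is the sup
   norm.  It is used for topology, derivatives, boundedness and Hölder classes,
   which do not depend on the choice of an equivalent norm; balls and L^p norms
   use the Euclidean norm. *)
Definition enorm {R : realType} (x : 'rV[R]_3) : R :=
  Num.sqrt (\sum_(i < 3) x 0 i ^+ 2).

(* The library puts no measurable structure on 'rV[R]_3, so functions on R^3 are
   measured and integrated after transport to R * R * R by [vec3]. *)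
Notation space3 R :=
  (measurableTypeR R * measurableTypeR R * measurableTypeR R)%type.

Definition vec3 {R : realType} (y : space3 R) : 'rV[R]_3 :=
  \row_(i < 3) [:: y.1.1 : R; y.1.2 : R; y.2 : R]`_i.

Definition lebesgue3 (R : realType) : {measure set (space3 R) -> \bar R} :=
  (@lebesgue_measure R \x @lebesgue_measure R \x @lebesgue_measure R)%E.

Section FunctionSpaces.
Context {R : realType}.
Implicit Types (p : \bar R) (u phi : 'rV[R]_3 -> 'rV[R]_3).

Definition Lp_norm p (g : 'rV[R]_3 -> R) : \bar R :=
  Lnorm (lebesgue3 R) p (fun y => (g (vec3 y))%:E).

Definition vLp_norm p u : \bar R := Lp_norm p (fun x => enorm (u x)).

(* sup_x int_{B(x,rho)} |u|^3 is the cube of the local norm *)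
Definition local_L3_norm (rho : R) u : \bar R :=
  (ereal_sup (range (fun x : 'rV[R]_3 =>
     \int[lebesgue3 R]_(y in [set y | (enorm (vec3 y - x) < rho)%R])
        (enorm (u (vec3 y)) ^+ 3)%:E)) `^ 3^-1)%E.

Definition in_L3 u : Prop :=
  (forall i : 'I_3, measurable_fun setT
     (fun y : space3 R => u (vec3 y) 0 i : measurableTypeR R)) /\
  (vLp_norm 3%:E u < +oo)%E.

Section Derivatives.
Context {W : normedModType R}.
Implicit Types (f : 'rV[R]_3 -> W) (s : seq 'I_3) (k : nat).

Definition partial (i : 'I_3) f : 'rV[R]_3 -> W := 'D_(delta_mx 0 i) f.

Definition partials s f : 'rV[R]_3 -> W := foldr partial f s.

(* 'D_v is total, so existence of the derivatives is required separately *)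
Definition Ck k f : Prop :=
  (forall s, (size s < k)%N -> forall (i : 'I_3) (x : 'rV[R]_3),
     derivable (partials s f) x (delta_mx 0 i)) /\
  (forall s, (size s <= k)%N -> continuous (partials s f)).

End Derivatives.

(* The Banach space C^{0,theta}(D): bounded, continuous, and theta-Hölder on D;
   for theta = 0 the Hölder condition is implied by boundedness. *)
Definition C0_holder {E W : normedModType R} (theta : R) (D : set E)
    (f : E -> W) : Prop :=
  [/\ {within D, continuous f}, [bounded f x | x in D] &
      exists M : R, forall x y, D x -> D y ->
        `|f x - f y| <= M * `|x - y| `^ theta].

Definition Ck_holder {W : normedModType R} (k : nat) (theta : R)
    (f : 'rV[R]_3 -> W) : Prop :=
  [/\ Ck k f,
      forall s, (size s <= k)%N -> [bounded partials s f x | x in setT] &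
      forall s, size s = k -> C0_holder theta setT (partials s f)].

Definition divergence u (x : 'rV[R]_3) : R :=
  \sum_(i < 3) partial i (fun y => u y 0 i) x.

Definition test_field phi : Prop :=
  [/\ forall k, Ck k phi,
      compact (closure [set x | phi x != 0]) &
      forall x, divergence phi x = 0].

Definition J3 u : Prop :=
  in_L3 u /\
  forall eps : R, 0 < eps ->
    exists2 phi, test_field phi & (vLp_norm 3%:E (u \- phi)%R < eps%:E)%E.

End FunctionSpaces.

Section NavierStokes.
Context {R : realType}.
Implicit Types (u : 'rV[R]_3 -> 'rV[R]_3) (q : 'rV[R]_3 -> R).
Implicit Types (U : R -> 'rV[R]_3 -> 'rV[R]_3) (p : R -> 'rV[R]_3 -> R).

Definition gradient q (x : 'rV[R]_3) : 'rV[R]_3 := \row_i partial i q x.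

Definition laplacian u (x : 'rV[R]_3) : 'rV[R]_3 :=
  \sum_(k < 3) partials [:: k; k] u x.

Definition convection u (x : 'rV[R]_3) : 'rV[R]_3 :=
  \sum_(k < 3) u x 0 k *: partial k u x.

(* Euclidean (Frobenius) norm of the Jacobian matrix of u at x *)
Definition jacobian_norm u (x : 'rV[R]_3) : R :=
  Num.sqrt (\sum_(k < 3) \sum_(i < 3) partial k u x 0 i ^+ 2).

Definition time_derivative U (t : R) (x : 'rV[R]_3) : 'rV[R]_3 :=
  derive1 (fun s => U s x) t.

(* the possibly infinite open interval (0,T) *)
Definition time_interval (T : \bar R) : set R :=
  [set t | 0 < t /\ (t%:E < T)%E].

(* ereal_sup set0 is -oo; taking the maximum with 0 makes the supremum 0 when
   no t > 0 is admissible. *)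
Definition t_rho (C : R) u (rho : R) : \bar R :=
  maxe 0%E (ereal_sup [set t%:E | t in [set t : R | 0 < t /\
    (local_L3_norm rho u +
     (expR (- (rho ^+ 2 / (8 * t))) + Num.sqrt t / rho)%:E * vLp_norm 3%:E u
     < ((4 * C)^-1)%:E)%E]]).

Definition existence_time (C : R) u : \bar R :=
  ereal_sup [set t_rho C u rho | rho in [set rho : R | 0 < rho]].

Definition L3_initial_limit u U : Prop :=
  vLp_norm 3%:E (U t \- u) @[t --> 0^'+] --> 0%E.

(* Classical solution of the Cauchy problem on (0,T) with initial datum u *)
Definition NS_solution (T : \bar R) u U p : Prop :=
  [/\ forall t, time_interval T t ->
        [/\ Ck 2 (U t), Ck 1 (p t) & forall x, derivable (fun s => U s x) t 1],
      forall t x, time_interval T t ->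
        time_derivative U t x + convection (U t) x + gradient (p t) x =
        laplacian (U t) x,
      forall t x, time_interval T t -> divergence (U t) x = 0,
      U 0 = u &
      L3_initial_limit u U].

Definition regularity (T : \bar R) U : Prop :=
  forall theta : R, 0 <= theta < 1 ->
    (forall t, time_interval T t -> Ck_holder 2 theta (U t)) /\
    (forall eta, time_interval T eta ->
       let D := [set z : R * 'rV[R]_3 | eta < z.1 /\ (z.1%:E < T)%E] in
       C0_holder (theta / 2) D (fun z => time_derivative U z.1 z.2) /\
       forall i j : 'I_3,
         C0_holder (theta / 2) D (fun z => partials [:: i; j] (U z.1) z.2)).

Definition sup_decay (c : R) (T : \bar R) u U : Prop :=
  (ereal_sup [set (Num.sqrt t)%:E * vLp_norm +oo (U t) | t in time_interval T]
   <= c%:E * vLp_norm 3%:E u)%E.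

Definition initial_decay U : Prop :=
  ((Num.sqrt t)%:E * vLp_norm +oo (U t))%E @[t --> 0^'+] --> 0%E /\
  (t%:E * Lp_norm +oo (jacobian_norm (U t)))%E @[t --> 0^'+] --> 0%E.

Definition L3_control (c : R) (T : \bar R) u U : Prop :=
  (forall t : R, 0 <= t -> (t%:E < T)%E ->
     (vLp_norm 3%:E (U t) <= c%:E * vLp_norm 3%:E u)%E) /\
  L3_initial_limit u U.

Definition pressure_control (c : R) (T : \bar R) u p : Prop :=
  forall t, time_interval T t ->
    ((Num.sqrt t)%:E * Lp_norm 3%:E (p t) <= c%:E * vLp_norm 3%:E u)%E /\
    forall theta : R, 0 <= theta < 1 -> Ck_holder 1 theta (p t).

Definition solvable_with_properties (c : R) (T : \bar R) u : Prop :=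
  exists U p, NS_solution T u U p /\
    [/\ regularity T U, sup_decay c T u U, initial_decay U,
        L3_control c T u U & pressure_control c T u p].

End NavierStokes.

(* Main.v *)
(* The velocity is the limit of the Picard iterates of the mild formulation
   U = e^(t Laplacian) U0 - int_0^t e^((t-s) Laplacian) P div (U (x) U) ds.
   No Riesz transform is needed: each component of e^(t Laplacian) P div is a sum
   of operators int_t^oo D^s e^(tau Laplacian) dtau with |s| = 3, which are
   absolutely convergent superpositions of Gaussian averages.

   Data are measured by Gaussian window averages of |u|^3 in which a window of
   width l is allowed the bound (max(1, kap l) A)^3. All the operators preserve
   such bounds. With kap = 0 this is the L^3 norm. With kap = 1 / rho it is
   controlled by the local norm on balls of radius rho, through a covering by
   balls, so the condition defining t(rho) makes the iteration contract on
   (0, t) as soon as kap sqrt t is bounded. The same estimates with A arbitrarily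
   small give the limits at t = 0, since U0 is an L^3 limit of test fields.

   The L^3 bound of the pressure, sum_jk int_0^oo e^(tau Laplacian) D_jk (u_j u_k)
   dtau, comes from splitting the integral at tau = t: near 0 one derivative is
   put on the smooth product, far from 0 Hoelder's inequality in the window
   compensates the missing decay. *)

From HB Require Import structures.
Require Import Defs.
From mathcomp Require Import all_boot all_order all_algebra.
From mathcomp Require Import all_classical all_reals all_analysis.
From mathcomp Require Import ring lra measurable_realfun.

Set Implicit Arguments.
Unset Strict Implicit.
Unset Printing Implicit Defensive.

Import Order.TTheory GRing.Theory Num.Theory.
Import numFieldNormedType.Exports.

Local Open Scope classical_set_scope.
Local Open Scope ring_scope.

(** Window bounds are carried for every pair (kap, A) that the datum admits. Smallness is asked, at
    each time t, of one pair with kap sqrt t <= 1, and makes the iteration contract; the other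
    pairs, in particular kap = 0 with A of the size of the L^3 norm, pass linearly through the
    bilinear term, so that the final constants do not depend on the datum.

    The iterates and their limit are defined pointwise in (t, x), without reference to a time
    interval or to a smallness parameter. Bounds proved on a shorter interval with a smaller
    parameter thus concern the same function, which gives the limits at t = 0 without a uniqueness
    theorem.

    In the condition that defines t(rho), the term t^(1/2) / rho times the norm has two uses: it
    makes the whole L^3 norm small once sqrt t exceeds rho, and for kap = 1 / rho it keeps kap sqrt
    t times the norm bounded, which makes the pressure bound linear in the norm.

    Six space derivatives are carried: the time derivative costs three, and its Lipschitz bound in
    time three more. *)

Notation mR := measurableTypeR.
Notation "'mfun3' z , e" := (measurable_fun setT (fun z : space3 _ => e : mR _))
 (at level 200, z name, e at level 200).
Notation sqrt := Num.sqrt.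
Notation leb := (@lebesgue_measure _).
Notation e_ i := (delta_mx 0 i : 'rV[_]_3).
Notation D01 := (`]0, 1[%classic : set (mR _)).
Notation D1 := (`]1, +oo[%classic : set (mR _)).
Notation o1 := (lift ord0 ord0).
Notation o2 := (lift ord0 (lift ord0 ord0)).

Lemma le_of_eq d (T : porderType d) (x y : T) : x = y -> (x <= y)%O.
Proof. by move=> ->. Qed.

(** Hook for the positivity of constants that are introduced only later; it is redefined once they
    exist. *)
Ltac pos_leaf := fail.
Ltac pos := try assumption; lazymatch goal with
 | |- is_true (@Order.le _ _ _ (EFin _)) => rewrite lee_fin; pos
 | |- is_true (@Order.lt _ _ _ (EFin _)) => rewrite lte_fin; pos
 | |- is_true (0 <= _ - _) => by rewrite subr_ge0
 | |- is_true (0 < _ - _) => by rewrite subr_gt0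
 | |- is_true (0 <= _ * _) => apply: mulr_ge0; pos
 | |- is_true (0 < _ * _) => apply: mulr_gt0; pos
 | |- is_true (0 <= _^-1) => rewrite invr_ge0; pos
 | |- is_true (0 < _^-1) => rewrite invr_gt0; pos
 | |- is_true (0 <= _ ^+ 2) => exact: sqr_ge0
 | |- is_true (0 <= _ ^+ _) => apply: exprn_ge0; pos
 | |- is_true (0 < _ ^+ _) => apply: exprn_gt0; pos
 | |- is_true (0 <= _ + _) => apply: addr_ge0; pos
 | |- is_true (0 < _ + _) => first [apply: ltr_pwDl; pos | apply: ltr_wpDl; pos]
 | |- is_true (0 <= _) => first [pos_leaf | done | exact: sqrtr_ge0 | exact: expR_ge0 | by apply: ltW]
 | |- is_true (0 < _) => first [pos_leaf | done | by rewrite sqrtr_gt0 | exact: expR_gt0]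
 end.

(** * Measurability of functions continuous in finitely many real coordinates *)

Section Measurability.
Context {R : realType}.
Local Notation V := 'rV[R]_3.

(** There are countably many rational boxes, so preimages of open sets become countable unions of
    preimages of boxes, each measurable coordinate by coordinate. *)
Lemma open_box (W : set (R * V)) (t : R) (x : V) : open W -> W (t, x) ->
 exists (q0 : rat) (q : 'rV[rat]_3) (n : nat),
  [/\ `|t - ratr q0| < n.+1%:R^-1,
    (forall i, `|x 0 i - ratr (q 0 i)| < n.+1%:R^-1) &
    forall (s : R) (y : V), `|s - ratr q0| < n.+1%:R^-1 ->
     (forall i, `|y 0 i - ratr (q 0 i)| < n.+1%:R^-1) -> W (s, y)].
Proof.
move=> oW Wtx.
have /nbhs_ballP[e /= e0 eW] : nbhs (t, x) W by exact: open_nbhs_nbhs.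
(* The factor 2 leaves room for a triangle inequality: the box about the rational centre contains
   the point and stays in the ball of radius e about it. *)
pose n := Num.truncn (2 * e^-1).
have n0 : 0 < n.+1%:R^-1 :> R by pos.
have ne : 2 * n.+1%:R^-1 < e.
 rewrite -(@ltr_pM2r _ (e^-1 * n.+1%:R)); last pos.
 rewrite mulrACA mulVf ?pnatr_eq0// mulr1 mulrA divff ?gt_eqF// mul1r.
 exact: truncnS_gt.
have aq (r : R) : exists q : rat, `|r - ratr q| < n.+1%:R^-1.
 have rr : r - n.+1%:R^-1 < r + n.+1%:R^-1.
  by rewrite ltrD2l (lt_trans _ n0)// oppr_lt0.
 have [q] := rat_in_itvoo rr; by rewrite in_itv/= => rq; exists q; rewrite distrC ltr_distl.
have [q0 tq0] := aq t.
have /choice[q xq] := fun i => aq (x 0 i).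
exists q0, (\row_i q i), n; split => //.
 by move=> i; rewrite mxE.
move=> s y sq yq; apply: (eW (s, y)); split => /=.
 rewrite /ball /= (le_lt_trans (ler_distD (ratr q0) _ _))//.
 by rewrite (lt_trans _ ne)// mulr_natl mulr2n ltrD// distrC.
split=> // i j; rewrite ord1 /ball/= (le_lt_trans (ler_distD (ratr (q j)) _ _))//.
rewrite (lt_trans _ ne)// mulr_natl mulr2n ltrD// distrC.
by have := yq j; rewrite mxE distrC.
Qed.

Lemma preimage_open_measurable d (A : measurableType d) (D : set A)
  (c0 : A -> mR R) (c1 : A -> V) (W : set (R * V)) :
 measurable D -> measurable_fun D c0 ->
 (forall i, measurable_fun D (fun a => c1 a 0 i : mR R)) ->
 open W -> measurable (D `&` [set a | W (c0 a, c1 a)]).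
Proof.
move=> mD m0 m1 oW.
pose good (k : rat * 'rV[rat]_3 * nat) := forall (s : R) (y : V),
 `|s - ratr k.1.1| < k.2.+1%:R^-1 ->
 (forall i, `|y 0 i - ratr (k.1.2 0 i)| < k.2.+1%:R^-1) -> W (s, y).
pose B (k : rat * 'rV[rat]_3 * nat) := D `&`
 ([set a | `|c0 a - ratr k.1.1| < k.2.+1%:R^-1 :> R] `&`
  \big[setI/setT]_(i < 3)
   [set a | `|c1 a 0 i - ratr (k.1.2 0 i)| < k.2.+1%:R^-1]).
have mball (c : A -> mR R) (q r : R) : measurable_fun D c ->
  measurable (D `&` [set a | `|(c a : R) - q| < r]).
 move=> mc; have mb : measurable (ball q r).
  by apply: open_measurable; exact: ball_open.
 have := mc mD _ mb; congr measurable; congr setI; apply/seteqP.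
 by split=> a; rewrite /ball/= distrC.
have mB k : measurable (B k).
 rewrite /B big_ord_recl big_ord_recl big_ord_recl big_ord0 setIT.
 have mc i : measurable (D `&` [set a | `|c1 a 0 i - ratr (k.1.2 0 i)|
   < k.2.+1%:R^-1]) by exact: (mball (fun a => c1 a 0 i) _ _ (m1 i)).
 by rewrite setIIr; apply: measurableI; [exact: mball|rewrite setIIr;
  apply: measurableI; [exact: mc|rewrite setIIr; apply: measurableI;
  exact: mc]].
rewrite [X in measurable X](_ : _ = \bigcup_(k in good) B k).
 rewrite bigcup_mkcond; apply: countable_bigcupT_measurable => // k.
 by case: ifP.
apply/seteqP; split=> [a [Da Wa]|a [k gk [Da]]].
 have [q0 [q [n [h0 h1 hW]]]] := open_box oW Wa.
 exists (q0, q, n); first exact: hW.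
 split=> //; split=> //.
 by rewrite !big_ord_recl big_ord0 setIT; split; [|split]; exact: h1.
rewrite !big_ord_recl big_ord0 setIT => -[h0 [h1 [h2 h3]]]; split => //.
apply: gk => // i; case: i => [[|[|[|//]]]] ilt.
- by rewrite (_ : Ordinal ilt = ord0)//; exact: val_inj.
- by rewrite (_ : Ordinal ilt = o1)//; exact: val_inj.
- by rewrite (_ : Ordinal ilt = o2)//; exact: val_inj.
Qed.

(** F has to be continuous only on an open set that contains the values of the arguments; this
    admits inverses of positive functions and functions of positive times. *)
Lemma mfun_comp_open d (A : measurableType d) (D : set A)
  (c0 : A -> mR R) (c1 : A -> V) (O : set (R * V))
  (F : R * V -> R) :
 measurable_fun D c0 ->
 (forall i, measurable_fun D (fun a => c1 a 0 i : mR R)) ->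
 open O -> (forall z, O z -> {for z, continuous F}) ->
 (forall a, D a -> O (c0 a, c1 a)) ->
 measurable_fun D (fun a => F (c0 a, c1 a) : mR R).
Proof.
move=> m0 m1 oO cF DO mD.
apply: (measurability _ (RGenOpens.measurableE R)) => // _ [_ [a [b ->] <-]].
have oW : open (O `&` F @^-1` `]a, b[).
 rewrite openE => z [Oz Fz]; apply: filterI; first exact: open_nbhs_nbhs.
 by apply: (cF z Oz); apply: open_nbhs_nbhs; split=> //; exact: interval_open.
have := preimage_open_measurable mD m0 m1 oW; congr measurable.
apply/seteqP; split=> [x [Dx [_ /= Fx]]|x [Dx Fx]]; split => //=.
by split => //; exact: DO.
Qed.

Lemma open_fst (I : set R) : open I -> open [set z : R * V | I z.1].
Proof.
move=> oI; apply: (@open_comp _ _ (fst : R * V -> R) I) => // z _.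
exact: cvg_fst.
Qed.

Lemma mfun_inv_pos d (A : measurableType d) (D : set A) (k : A -> R) :
 measurable_fun D (k : A -> mR R) -> (forall a, D a -> 0 < k a) ->
 measurable_fun D (fun a => (k a)^-1 : mR R).
Proof.
move=> mk k0.
apply: (@mfun_comp_open _ A D k (fun=> 0) [set z | 0 < z.1] (fun z => z.1^-1)) => //.
- exact: open_fst (@open_gt R 0).
- by move=> z /= z0; apply: cvgV; [rewrite gt_eqF|exact: cvg_fst].
Qed.

End Measurability.

(** * Continuity and differentiation of integrals that depend on a parameter *)

Section ParametricIntegrals.
Context {R : realType}.

(** Turns a limit along a parameter in a normed space into limits of sequences, the form in which
    dominated convergence applies. *)
Lemma cvg_seq (Q : normedModType R) (F : Q -> R) (p : Q) (l : R) :
 (forall u : nat -> Q, u n @[n --> \oo] --> p -> F (u n) @[n --> \oo] --> l) ->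
 F q @[q --> p] --> l.
Proof.
move=> H; apply: contrapT => nF.
have [e e0 He] : exists2 e : R, 0 < e &
  forall n : nat, exists q, `|p - q| < n.+1%:R^-1 /\ e <= `|l - F q|.
 apply: contrapT => ne; apply: nF; apply/cvgrPdist_lt => e e0.
 apply: contrapT => nn; apply: ne; exists e => // n.
 apply: contrapT => nq; apply: nn.
 have n0 : 0 < n.+1%:R^-1 :> R by pos.
 have : \forall q \near p, `|p - q| < n.+1%:R^-1.
  by move/cvgrPdist_lt : (@cvg_id _ (nbhs p)) => /(_ _ n0).
 apply: filterS => q pq; rewrite ltNge; apply/negP => le; apply: nq.
 by exists q.
have /choice[u uP] := He.
have up : u n @[n --> \oo] --> p.
 apply/cvgrPdist_lt => r r0; near=> n.
 have [+ _] := uP n; move=> /lt_trans; apply.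
 by near: n; exact: near_infty_natSinv_lt (PosNum r0).
have /cvgrPdist_lt/(_ e e0)[N _ /(_ N (leqnn _))] := H u up.
by have [_] := uP N; rewrite leNgt => /negP.
Unshelve. all: by end_near. Qed.

Lemma cvg_pairN (Q W1 W2 : normedModType R) (f : Q -> W1) (g : Q -> W2) (p : Q) a b :
 f q @[q --> p] --> a -> g q @[q --> p] --> b ->
 (fun q => (f q, g q)) @ p --> ((a, b) : W1 * W2).
Proof. by move=> fa gb; apply: cvg_pair. Qed.

Lemma cvg_subscale (Q W : normedModType R) (f : Q -> W) (l : Q -> R) (g : Q -> W) (p : Q) (a : W) (l0 : R) (b : W) :
 f q @[q --> p] --> a -> l q @[q --> p] --> (l0 : R) -> g q @[q --> p] --> b ->
 (fun q => f q - l q *: g q) @ p --> a - l0 *: b.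
Proof. by move=> fa ll gb; apply: cvgB => //; exact: cvgZ. Qed.

Lemma near_all (Q : normedModType R) (p : Q) (P : Q -> Prop) :
 (forall q, P q) -> \forall q \near p, P q.
Proof. by move=> H; apply: nearW. Qed.

Lemma near_forall (Q : normedModType R) (p : Q) (T : finType) (P : T -> Q -> Prop) :
 (forall i, \forall q \near p, P i q) -> \forall q \near p, forall i, P i q.
Proof. by move=> H; apply: filter_forall. Qed.

Lemma is_derive_val (W : normedModType R) (F : W -> R) (x v : W) (d : R) :
 is_derive x v F d -> 'D_v F x = d.
Proof. by case. Qed.

Lemma is_derive_line (W : normedModType R) (F : W -> R) (y v : W) (d : R) :
 is_derive (0 : R) 1 (fun h : R => F (h *: v + y)) d -> is_derive y v F d.
Proof.
have E : (fun h : R => h^-1 *: (F ((h *: (1 : R) + 0) *: v + y) - F (0 *: v + y))) =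
  (fun h : R => h^-1 *: (F (h *: v + y) - F y)).
 by apply/funext => h; rewrite addr0 scaler1 scale0r add0r.
by move=> [H1 H2]; split; [move: H1; rewrite /derivable E|move: H2; rewrite /derive E].
Qed.

Lemma derivable_line (W : normedModType R) (F : W -> R) (y v : W) (t : R) :
 derivable F (t *: v + y) v ->
 is_derive t 1 (fun h : R => F (h *: v + y)) ('D_v F (t *: v + y)).
Proof.
have E : (fun h : R => h^-1 *: (F ((h *: (1 : R) + t) *: v + y) - F (t *: v + y))) =
  (fun h : R => h^-1 *: (F (h *: v + (t *: v + y)) - F (t *: v + y))).
 by apply/funext => h; rewrite scaler1 scalerDl addrA.
by move=> H; split; [rewrite /derivable E|rewrite /derive E].
Qed.
Context d (Om : measurableType d) (mu : {measure set Om -> \bar R}).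
Variables (D : set Om) (mD : measurable D).

Lemma cont_int (Q : normedModType R) (f : Q -> Om -> R) (g : Om -> R)
  (p : Q) :
 mu.-integrable D (EFin \o g) ->
 (\forall q \near p, measurable_fun D (f q)) ->
 (\forall q \near p, forall w, D w -> `|f q w| <= g w) ->
 {ae mu, forall w, D w -> f ^~ w q @[q --> p] --> f p w} ->
 (\int[mu]_(w in D) f q w)%R @[q --> p] --> (\int[mu]_(w in D) f p w)%R.
Proof.
move=> ig mf fg cf; apply: cvg_seq => u up.
have [N _ HN] := up _ (filterI mf fg).
(* Dropping the first N terms makes the hypotheses that hold near p valid for all terms. *)
rewrite -(cvg_shiftn N).
pose f_ n w := (f (u (n + N)%N) w)%:E.
have m_ n : measurable_fun D (f_ n).
 by apply/measurable_EFinP; have [] := HN (n + N)%N (leq_addl _ _).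
have b_ : {ae mu, forall w n, D w -> (`|f_ n w| <= (EFin \o g) w)%E}.
 apply: aeW => w n Dw; rewrite /= lee_fin.
 by have [_] := HN (n + N)%N (leq_addl _ _); exact.
have c_ : {ae mu, forall w, D w -> f_ ^~ w @ \oo --> (f p w)%:E}.
 apply: filterS cf => w H Dw; apply: cvg_EFin; first exact: nearW.
 apply: (cvg_comp (fun n : nat => u (n + N)%N) (f ^~ w) _ (H Dw)).
 by rewrite cvg_shiftn.
have mp : measurable_fun D (fun w => (f p w)%:E).
 by apply/measurable_EFinP; exact: (nbhs_singleton mf).
have [ip _ cI] := dominated_convergence mD m_ mp c_ ig b_.
apply: fine_cvg; rewrite fineK; first exact: cI.
exact: integrable_fin_num.
Qed.

(** A directional derivative is the derivative at 0 along the line h v + x, so the one-variable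
    theorem applies with a domination for |h| < 1. Derivatives in space, in time and in a length are
    all instances. *)
Lemma is_derive_int (W : normedModType R) (f : W -> Om -> R) (G : Om -> R)
  (x v : W) :
 (forall h : R, `|h| < 1 -> mu.-integrable D (EFin \o f (h *: v + x))) ->
 (forall (h : R) w, `|h| < 1 -> D w -> derivable (f ^~ w) (h *: v + x) v) ->
 mu.-integrable D (EFin \o G) ->
 (forall (h : R) w, `|h| < 1 -> D w -> `|'D_v (f ^~ w) (h *: v + x)| <= G w) ->
 is_derive x v (fun y => \int[mu]_(w in D) f y w)%R
  (\int[mu]_(w in D) 'D_v (f ^~ w) x)%R.
Proof.
move=> fi fd Gi fG.
pose h (t : R) w := f (t *: v + x) w.
have lined (F : W -> R) (t : R) : (fun s : R => s^-1 *: (F ((s *: (1 : R) + t) *: v + x) -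
   F (t *: v + x))) = (fun s => s^-1 *: (F (s *: v + (t *: v + x)) -
   F (t *: v + x))).
 by apply/funext => s; rewrite scaler1 scalerDl addrA.
have hd (t : R) w : `|t| < 1 -> D w -> derivable (h ^~ w) t 1.
 move=> t1 Dw; have := fd t w t1 Dw.
 by rewrite /derivable -(lined (f ^~ w) t).
have hE t w : 'D_1 (h ^~ w) t = 'D_v (f ^~ w) (t *: v + x).
 by rewrite /derive -(lined (f ^~ w) t).
have I1 (t : R) : `](-1)%R, 1%R[%classic t -> `|t| < 1.
 by rewrite /= in_itv/= ltr_norml.
pose G' y := `|G y|.
have Gi' : mu.-integrable D (EFin \o G') by exact: integrable_norm.
have I0 : `](-1)%R, 1%R[%classic (0 : R) by rewrite /= in_itv/= ltrN10 ltr01.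
have c := @cvg_differentiation_under_integral _ _ _ mu h D mD 0 (-1) 1 I0.
have {c} := c (fun t It => fi t (I1 _ It)) (fun t w It => @hd t w (I1 _ It)) G' (fun y => normr_ge0 _)
 Gi'.
have -> : (fun y => partial1of2 h 0 y) = (fun w => 'D_v (f ^~ w) x).
 by apply/funext => w; rewrite partial1of2E hE scale0r add0r.
move=> c.
have {}c : s^-1 *: ((\int[mu]_(w in D) f (s *: v + x) w) -
  (\int[mu]_(w in D) f x w)) @[s --> 0^'] --> (\int[mu]_(w in D) 'D_v (f ^~ w) x)%R.
 rewrite (_ : (fun s => _) = (fun s : R => s^-1 *: (\int[mu]_(y in D) h (s + 0) y -
   \int[mu]_(y in D) h 0 y))).
  apply: c => t w It Dw; rewrite partial1of2E hE (le_trans (fG _ _ (I1 _ It) Dw))//.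
  exact: ler_norm.
 apply/funext => s; congr (_ *: (_ - _)); apply: eq_Rintegral => w _.
  by rewrite /h addr0.
 by rewrite /h scale0r add0r.
apply: DeriveDef; first by apply/cvg_ex; eexists; exact: c.
exact/cvg_lim.
Qed.

End ParametricIntegrals.

Ltac cts := solve [repeat first [exact: cst_continuous | exact: cvg_cst | exact: cvg_id | exact: cvg_fst
 | exact: cvg_snd | apply: cvg_pairN | apply: cvgM | apply: cvgB | apply: cvgD
 | (apply: (@cvg_comp _ _ _ fst fst); [exact: cvg_fst|exact: cvg_fst])
 | (apply: (@cvg_comp _ _ _ snd fst); [exact: cvg_snd|exact: cvg_fst])
 | (apply: (@cvg_comp _ _ _ fst snd); [exact: cvg_fst|exact: cvg_snd])
 | (apply: (@cvg_comp _ _ _ snd snd); [exact: cvg_snd|exact: cvg_snd]) | by []]].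

(** * Sigma-finite products and Lebesgue measure on R^3 *)

Section SigmaFiniteProduct.
Local Open Scope ereal_scope.
Context {R : realType} d1 d2 (T1 : measurableType d1) (T2 : measurableType d2).
Variable m1 : {sigma_finite_measure set T1 -> \bar R}.
Variable m2 : {sigma_finite_measure set T2 -> \bar R}.

(* The sigma-finiteness of [m1 \x m2] in the library is not found by
  canonical inference, which only tries the finite measures. *)
Definition sigprod := (m1 \x m2).
HB.instance Definition _ := Measure.on sigprod.

Let sigprod_sigma_finite : sigma_finite setT sigprod.
Proof.
have /sigma_finiteP[F [TF ndF Foo]] := sigma_finiteT m1.
have /sigma_finiteP[G [TG ndG Goo]] := sigma_finiteT m2.
exists (fun n => F n `*` G n).
 rewrite -setXTT TF TG predeqE => -[x y]; split.
  move=> [/= [n _ Fnx] [k _ Gky]]; exists (maxn n k) => //; split.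
  - by move: x Fnx; exact/subsetPset/ndF/leq_maxl.
  - by move: y Gky; exact/subsetPset/ndG/leq_maxr.
 by move=> [n _ []/= ? ?]; split; exists n.
move=> k; have [? ?] := Foo k; have [? ?] := Goo k.
split; first exact: measurableX.
by rewrite /sigprod product_measure1E// lte_mul_pinfty// ge0_fin_numE.
Qed.

HB.instance Definition _ := Measure_isSigmaFinite.Build _ _ _ sigprod
 sigprod_sigma_finite.

End SigmaFiniteProduct.

Section Lebesgue3.
Context {R : realType}.
(** Unfolds to the same product as [lebesgue3], and carries the sigma-finite structure that
    Tonelli's theorem asks for. *)
Definition leb3 := sigprod (sigprod (@lebesgue_measure R) (@lebesgue_measure R)) (@lebesgue_measure R).
HB.instance Definition _ := SigmaFiniteMeasure.on leb3.
End Lebesgue3.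

(** * Affine changes of variables in R and in R^3 *)

Section ChangeOfVariables.
Context {R : realType}.
Local Notation V := 'rV[R]_3.
Local Open Scope ereal_scope.

(** By uniqueness of Lebesgue measure it is enough to compare lengths of intervals. *)
Lemma pushforward_affine (a b : R) : (0 < b)%R ->
 forall A, measurable A ->
 b%:E * leb ((fun x : mR R => (a + b * x)%R : mR R) @^-1` A) = leb A.
Proof.
move=> b0.
have mphi : measurable_fun [set: mR R]
  (fun x : mR R => (a + b * x)%R : mR R).
 by apply: measurable_funD => //; exact: measurable_funM.
pose nu : {measure set (mR R) -> \bar R} :=
 mscale (NngNum (ltW b0)) (pushforward leb (fun x : mR R => (a + b * x)%R : mR R)).
move=> A mA; rewrite (_ : _ * _ = nu mphi A)//.
apply/esym/lebesgue_measure_unique => //= _ [[c d]] _ <-.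
rewrite /nu /= /mscale /= /pushforward (_ : _ @^-1` _ = `](c - a) / b, (d - a) / b]%classic)%R; last first.
 apply/seteqP; split=> x /=; rewrite !in_itv/= => /andP[]; rewrite ltr_pdivrMr// ler_pdivlMr// => *.
  by apply/andP; split; lra.
 by apply/andP; split; lra.
rewrite !lebesgue_measure_itv/= !lte_fin ltr_pM2r ?invr_gt0// ltrD2r.
case: ifPn => cd; last by rewrite mule0.
by rewrite -EFinD -EFinM; congr (_%:E); field; rewrite gt_eqF.
Qed.

Lemma ge0_integral_affine (a b : R) (f : R -> \bar R) : (b != 0)%R ->
 measurable_fun setT f -> (forall x, 0 <= f x) ->
 \int[leb]_x f (a + b * x)%R = `|b|^-1%:E * \int[leb]_x f x.
Proof.
(* Negative slopes reduce to positive ones through the reflection x |-> -x, which preserves Lebesgue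
   measure. *)
suff H c (g : R -> \bar R) : (0 < c)%R -> measurable_fun setT g -> (forall x, 0 <= g x) ->
  \int[leb]_x g (a + c * x)%R = c^-1%:E * \int[leb]_x g x.
 move=> b0 mf f0; have [bp|bn] := ltP 0%R b.
  by rewrite H// gtr0_norm.
 have bn' : (0 < - b)%R by rewrite oppr_gt0 lt_neqAle b0.
 rewrite ler0_norm// -H//.
 pose g x := f (a + (- b) * x)%R.
 have mg : measurable_fun setT g.
  apply: measurableT_comp => //.
  by apply: measurable_funD => //; exact: measurable_funM.
 have mN : measurable_fun [set: mR R] (-%R : _ -> mR R) by exact: oppr_measurable.
 have := ge0_integral_pushforward mN leb measurableT mg (fun x _ => f0 _).
 rewrite preimage_setT.
 have -> : \int[pushforward leb (-%R : _ -> mR R)]_y g y = \int[leb]_y g y.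
  by apply: eq_measure_integral => A mA _; exact: lebesgue_measureN.
 by move=> ->; apply: eq_integral => x _; rewrite /g/= mulrNN.
move=> c0 mg g0.
have mphi : measurable_fun [set: mR R]
  (fun x : mR R => (a + c * x)%R : mR R).
 by apply: measurable_funD => //; exact: measurable_funM.
have P := ge0_integral_pushforward mphi leb measurableT mg (fun x _ => g0 x).
rewrite preimage_setT in P.
pose nu : {measure set (mR R) -> \bar R} :=
 mscale (NngNum (ltW c0)) (pushforward leb (fun x : mR R => (a + c * x)%R : mR R)).
have -> : \int[leb]_x g x = \int[nu mphi]_x g x.
 by apply: eq_measure_integral => A mA _; rewrite /= /mscale/= /pushforward/= pushforward_affine.
rewrite /nu ge0_integral_mscale//= muleA -EFinM mulVf ?gt_eqF// mul1e.
exact: (esym P).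
Qed.

(** Scaling factors multiply under Tonelli; used twice, this lifts the change of variables from the
    line to R^3. *)
Lemma ge0_integral_product_map d1 d2 (T1 : measurableType d1) (T2 : measurableType d2)
  (m1 : {sigma_finite_measure set T1 -> \bar R}) (m2 : {sigma_finite_measure set T2 -> \bar R})
  (p1 : T1 -> T1) (p2 : T2 -> T2) (k1 k2 : R) :
 (0 <= k1)%R -> (0 <= k2)%R ->
 measurable_fun setT p1 -> measurable_fun setT p2 ->
 (forall f, measurable_fun setT f -> (forall x, 0 <= f x) ->
  \int[m1]_x f (p1 x) = k1%:E * \int[m1]_x f x) ->
 (forall f, measurable_fun setT f -> (forall x, 0 <= f x) ->
  \int[m2]_x f (p2 x) = k2%:E * \int[m2]_x f x) ->
 forall f, measurable_fun setT f -> (forall x, 0 <= f x) ->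
  \int[sigprod m1 m2]_x f (p1 x.1, p2 x.2) = (k1 * k2)%:E * \int[sigprod m1 m2]_x f x.
Proof.
move=> k10 k20 mp1 mp2 H1 H2 f mf f0.
have mfp : measurable_fun setT (fun x : T1 * T2 => f (p1 x.1, p2 x.2)).
 apply: measurableT_comp => //; apply/measurable_fun_pairP; split.
  exact: (measurableT_comp mp1 measurable_fst).
 exact: (measurableT_comp mp2 measurable_snd).
rewrite (@fubini_tonelli1 _ _ _ _ _ m1 m2)//= (@fubini_tonelli1 _ _ _ _ _ m1 m2)//.
rewrite /fubini_F/=.
under eq_integral => x _.
 rewrite (H2 (fun y => f (p1 x, y)))//; last exact: (measurableT_comp mf (measurable_pair1 _)).
 over.
have mF : measurable_fun setT (fun x => \int[m2]_y f (x, y)).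
 exact: (measurable_fun_fubini_tonelli_F f).
rewrite ge0_integralZl//=.
- rewrite (H1 (fun x => \int[m2]_y f (x, y)))//; last by move=> x; exact: integral_ge0.
 by rewrite muleA -EFinM mulrC.
- exact: measurableT_comp mF mp1.
- by move=> x _; exact: integral_ge0.
Qed.

Definition affine3 (x : V) (b : R) (z : space3 R) : space3 R :=
 ((x ord0 ord0 + b * z.1.1, x ord0 o1 + b * z.1.2)%R,
  (x ord0 o2 + b * z.2)%R).

Lemma ord3P (P : 'I_3 -> Prop) : P ord0 -> P o1 ->
 P o2 -> forall i, P i.
Proof.
move=> P0 P1 P2 [[|[|[|//]]] ilt].
- by rewrite (_ : Ordinal ilt = ord0)//; exact: val_inj.
- by rewrite (_ : Ordinal ilt = o1)//; exact: val_inj.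
- by rewrite (_ : Ordinal ilt = o2)//; exact: val_inj.
Qed.

Lemma vec3_affine x b z : (vec3 (affine3 x b z) = x + b *: vec3 z)%R.
Proof. by apply/rowP; apply: ord3P; rewrite !mxE. Qed.

Lemma mfun_affine3 x b : measurable_fun setT (affine3 x b).
Proof.
have maff (c : R) : measurable_fun setT (fun t : mR R => (c + b * t)%R : mR R).
 by apply: measurable_funD => //; exact: measurable_funM.
apply/measurable_fun_pairP; split.
 apply/measurable_fun_pairP; split.
  exact: (measurableT_comp (maff _) (measurableT_comp measurable_fst measurable_fst)).
 exact: (measurableT_comp (maff _) (measurableT_comp measurable_snd measurable_fst)).
exact: (measurableT_comp (maff _) measurable_snd).
Qed.

Lemma ge0_integral_affine3 (x : V) (b : R) (f : space3 R -> \bar R) : (b != 0)%R ->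
 measurable_fun setT f -> (forall z, 0 <= f z) ->
 \int[leb3]_z f (affine3 x b z) = (`|b| ^- 3)%:E * \int[leb3]_z f z.
Proof.
move=> b0 mf f0.
have maff (c : R) : measurable_fun setT (fun t : mR R => (c + b * t)%R : mR R).
 by apply: measurable_funD => //; exact: measurable_funM.
have b1 : (0 <= `|b|^-1)%R by [].
rewrite (_ : (`|b| ^- 3 = `|b|^-1 * `|b|^-1 * `|b|^-1)%R); last first.
 by rewrite exprS expr2 !invfM mulrA.
have H1 (c : R) := fun g mg g0 => @ge0_integral_affine c b g b0 mg g0.
pose p2 (y : mR R * mR R) : mR R * mR R :=
 ((x ord0 ord0 + b * y.1)%R, (x ord0 o1 + b * y.2)%R).
have H2 := @ge0_integral_product_map _ _ _ _ leb leb _ _ _ _ b1 b1 (maff (x ord0 ord0))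
 (maff (x ord0 o1)) (H1 _) (H1 _).
have mp2 : measurable_fun setT p2.
 apply/measurable_fun_pairP; split.
  exact: (measurableT_comp (maff _) measurable_fst).
 exact: (measurableT_comp (maff _) measurable_snd).
exact: (@ge0_integral_product_map _ _ _ _ (sigprod leb leb) leb p2
 (fun t => x ord0 o2 + b * t)%R _ _ (mulr_ge0 b1 b1) b1 mp2 (maff _)
 H2 (H1 _) f mf f0).
Qed.

Lemma integral_translation3 (x : V) (f : space3 R -> \bar R) :
 measurable_fun setT f ->
 \int[leb3]_z f (affine3 x 1 z) = \int[leb3]_z f z.
Proof.
move=> mf; rewrite integralE [RHS]integralE.
have H g : measurable_fun setT g -> (forall z, 0 <= g z) ->
  \int[leb3]_z g (affine3 x 1 z) = \int[leb3]_z g z.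
 by move=> mg g0; rewrite ge0_integral_affine3 ?oner_neq0// normr1 expr1n invr1 mul1e.
rewrite -(H (f^\+)%E)// -?(H (f^\-)%E)//.
- congr (_ - _); apply: eq_integral => z _.
 by rewrite !funeposE.
 by rewrite !funenegE.
- exact: measurable_funeneg.
- exact: measurable_funepos.
Qed.

Lemma ge0_integral3_prod (f1 f2 f3 : R -> R) :
 measurable_fun setT f1 -> measurable_fun setT f2 -> measurable_fun setT f3 ->
 (forall x, 0 <= f1 x)%R -> (forall x, 0 <= f2 x)%R -> (forall x, 0 <= f3 x)%R ->
 \int[leb3]_z (f1 z.1.1 * f2 z.1.2 * f3 z.2)%:E =
 (\int[leb]_x (f1 x)%:E) * (\int[leb]_x (f2 x)%:E) * (\int[leb]_x (f3 x)%:E).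
Proof.
move=> m1 m2 m3 p1 p2 p3.
have mm1 : measurable_fun setT (fun y : mR R * mR R => (f1 y.1 * f2 y.2)%:E).
 apply/measurable_EFinP; apply: measurable_funM.
  exact: (measurableT_comp m1 measurable_fst).
 exact: (measurableT_comp m2 measurable_snd).
have mm : measurable_fun setT (fun z : space3 R => (f1 z.1.1 * f2 z.1.2 * f3 z.2)%:E).
 apply/measurable_EFinP; apply: measurable_funM.
  apply/measurable_EFinP; exact: (measurableT_comp mm1 measurable_fst).
 exact: (measurableT_comp m3 measurable_snd).
have I3 : 0 <= \int[leb]_x (f3 x)%:E by apply: integral_ge0 => x _; rewrite lee_fin.
have I2 : 0 <= \int[leb]_x (f2 x)%:E by apply: integral_ge0 => x _; rewrite lee_fin.
rewrite (@fubini_tonelli1 _ _ _ _ _ (sigprod leb leb) leb)//=; last first.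
 move=> z; pos.
rewrite /fubini_F/=.
under eq_integral => y _.
 under eq_integral do rewrite EFinM.
 rewrite ge0_integralZl ?lee_fin ?mulr_ge0//; last 2 first.
  exact/measurable_EFinP.
  by move=> x _; rewrite lee_fin.
 over.
rewrite ge0_integralZr//; last by move=> x _; pos.
congr (_ * _).
rewrite (@fubini_tonelli1 _ _ _ _ _ leb leb)//=; last first.
 move=> z; pos.
rewrite /fubini_F/=.
under eq_integral => y _.
 under eq_integral do rewrite EFinM.
 rewrite ge0_integralZl ?lee_fin//; last 2 first.
  exact/measurable_EFinP.
  by move=> x _; rewrite lee_fin.
 over.
rewrite ge0_integralZr//; first exact/measurable_EFinP.
by move=> x _; rewrite lee_fin.
Qed.

End ChangeOfVariables.

(** * Derivatives of the heat kernel and their Gaussian majorant *)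

Section GaussianKernels.
Context {R : realType}.
Local Notation V := 'rV[R]_3.

(** Rescaled Hermite polynomials: [hpoly n] times the heat kernel at time 1 is the derivative of
    order n of that kernel. *)
Fixpoint hpoly (n : nat) : {poly R} :=
 if n is n'.+1 then (hpoly n')^`() - 2^-1 *: ('X * hpoly n') else 1.

(** The one-dimensional heat kernel at time 1. *)
Definition gauss4 (x : R) : R := (sqrt (4 * pi))^-1 * expR (- (x ^+ 2 / 4)).

Definition hgauss n (x : R) : R := (hpoly n).[x] * gauss4 x.

Lemma is_derive_gauss4 (x : R) : is_derive x 1 gauss4 (- (x / 2) * gauss4 x).
Proof.
rewrite /gauss4; apply: is_derive_eq; rewrite /GRing.scale/=.
by set e := expR _; set c := (sqrt _)^-1; field.
Qed.

Lemma is_derive_hgauss n (x : R) : is_derive x 1 (hgauss n) (hgauss n.+1 x).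
Proof.
have dg := is_derive_gauss4 x.
have dp : is_derive x 1 (fun x => (hpoly n).[x]) ((hpoly n)^`()).[x].
 exact: is_derive_poly.
have := is_deriveM dp dg.
move=> H; apply: (is_derive_eq H).
by rewrite /hgauss/= hornerD hornerN hornerZ hornerM hornerX /GRing.scale/=; field.
Qed.

Lemma expr_exp_bound (i : nat) : exists2 c : R, 0 <= c &
 forall x : R, `|x| ^+ i <= c * expR (x ^+ 2 / 12).
Proof.
(* From v <= e^v with v = x^2 / (12 i), raised to the power i; the summand 1 serves |x| <= 1. *)
exists (1 + (12 * i%:R) ^+ i).
 pos.
move=> x; have e1 : 1 <= expR (x ^+ 2 / 12).
 by rewrite -expR0 ler_expR divr_ge0// sqr_ge0.
have H : `|x| ^+ i <= 1 + (x ^+ 2) ^+ i.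
 have [x1|x1] := leP `|x| 1.
  by rewrite (@le_trans _ _ 1)// ?exprn_ile1// lerDl exprn_ge0// sqr_ge0.
 rewrite -[x ^+ 2]real_normK ?num_real// -exprM mulnC.
 rewrite (@le_trans _ _ (`|x| ^+ (i * 2)))//; last by rewrite lerDr.
 by rewrite ler_weXn2l ?(ltW x1)// leq_pmulr.
apply: (le_trans H); rewrite mulrDl mul1r lerD//.
case: i {H} => [|i]; first by rewrite !expr0 mul1r.
have -> : expR (x ^+ 2 / 12) = expR (x ^+ 2 / (12 * i.+1%:R)) ^+ i.+1.
 rewrite -expRM_natl; congr expR.
 have : i.+1%:R != 0 :> R by rewrite pnatr_eq0.
 by move: (i.+1%:R) => k k0; field.
rewrite -exprMn lerXn2r ?nnegrE ?sqr_ge0//.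
rewrite -ler_pdivrMl; last pos.
by rewrite (le_trans _ (expR_ge1Dx _))// mulrC lerDr.
Qed.

Lemma poly_exp_bound (p : {poly R}) : exists2 c : R, 0 <= c &
 forall x : R, `|p.[x]| <= c * expR (x ^+ 2 / 12).
Proof.
have /choice[C CP] : forall i : nat, exists c : R, 0 <= c /\
  forall x : R, `|x| ^+ i <= c * expR (x ^+ 2 / 12).
 by move=> i; have [c] := expr_exp_bound i; exists c.
exists (\sum_(i < size p) `|p`_i| * C i).
 by apply: sumr_ge0 => i _; rewrite mulr_ge0//; have [] := CP i.
move=> x; rewrite horner_coef (le_trans (ler_norm_sum _ _ _))// mulr_suml.
apply: ler_sum => i _; rewrite normrM normrX -mulrA ler_wpM2l//.
by have [_] := CP i; exact.
Qed.

Lemma gauss4_gt0 x : 0 < gauss4 x.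
Proof.
by rewrite mulr_gt0 ?expR_gt0// invr_gt0 sqrtr_gt0 mulr_gt0// pi_gt0.
Qed.

(** The polynomial costs e^(y^2/12), which leaves e^(-y^2/6). For y = x + h and |h| <= 1 one has
    y^2/6 >= x^2/8 - 1/2, whence the factor e^(1/2). The shift by h is what differentiation under
    the integral sign will need. *)
Lemma hgauss_bound n : exists2 c : R, 0 <= c &
 forall x h : R, `|h| <= 1 -> `|hgauss n (x + h)| <= c * expR (- (x ^+ 2 / 8)).
Proof.
have [c c0 cP] := poly_exp_bound (hpoly n).
exists (c * (sqrt (4 * pi))^-1 * expR (2^-1)).
 pos.
move=> x h h1; rewrite normrM (ger0_norm (ltW (gauss4_gt0 _))).
apply: (le_trans (ler_wpM2r (ltW (gauss4_gt0 _)) (cP _))).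
rewrite /gauss4; set q := (sqrt _)^-1; set y := x + h.
have -> : c * expR (y ^+ 2 / 12) * (q * expR (- (y ^+ 2 / 4))) =
  c * q * expR (y ^+ 2 / 12 - y ^+ 2 / 4) by rewrite expRD; ring.
rewrite -[leRHS]mulrA -expRD ler_wpM2l// ?mulr_ge0// ?invr_ge0 ?sqrtr_ge0//.
rewrite ler_expR /y.
have hh : h ^+ 2 <= 1 by rewrite -real_normK ?num_real// exprn_ile1.
(* This square is 6 (y^2/6 - x^2/8 + h^2/2) with y = x + h. *)
have := sqr_ge0 (x / 2 + 2 * h); nra.
Qed.

Lemma cont_hgauss n : continuous (hgauss n).
Proof.
move=> x; apply/differentiable_continuous/derivable1_diffP.
by have [] := is_derive_hgauss n x.
Qed.

Lemma integral_gauss4 : (\int[leb]_x (gauss4 x)%:E = 1)%E.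
Proof.
have s0 : sqrt 2 != 0 :> R by rewrite gt_eqF// sqrtr_gt0.
rewrite -[RHS](integral_normal_pdf 0 (sqrt 2)); apply: eq_integral => x _.
rewrite normal_pdfE// /normal_peak /normal_fun /gauss4 sqr_sqrtr//.
congr (_%:E); congr ((sqrt _)^-1 * expR _); first by rewrite mulr2n; ring.
by rewrite subr0; field.
Qed.

(** An unnormalised Gaussian with twice the variance of [gauss4]; the slack absorbs polynomials and
    unit shifts. *)
Definition wgt (x : R) : R := expR (- (x ^+ 2 / 8)).

Lemma cont_wgt : continuous wgt.
Proof.
move=> x; apply: continuous_comp; last exact: continuous_expR.
apply: continuousN; apply: cvgMr_tmp; exact: exprn_continuous.
Qed.

Lemma integral_wgt : exists2 I : R, 0 <= I & (\int[leb]_x (wgt x)%:E = I%:E)%E.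
Proof.
have s0 : 2 != 0 :> R by [].
have p0 : 0 < normal_peak (2 : R) by exact: normal_peak_gt0.
exists (normal_peak 2)^-1; first pos.
have := integral_normal_pdf (0:R) 2.
rewrite normal_pdfE//.
under eq_integral do rewrite EFinM.
rewrite ge0_integralZl_EFin//; last 3 first.
- by move=> x _; rewrite lee_fin normal_fun_ge0.
- apply/measurable_EFinP; exact: measurable_normal_fun.
- exact: ltW.
have -> : (\int[leb]_x (wgt x)%:E = \int[leb]_x (normal_fun 0 2 x)%:E)%E.
 by apply: eq_integral => x _; rewrite /wgt /normal_fun subr0; congr (expR _)%:E; field.
move: p0; generalize (normal_peak (2 : R)) => p p0.
move: (\int[leb]_x (normal_fun 0 2 x)%:E)%E => J H.
by rewrite -[RHS]mule1 -H muleA -EFinM mulVf ?gt_eqF// mul1e.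
Qed.

(** D^s of the heat kernel of R^3 at time 1. Only the number of occurrences of each index matters,
    so mixed derivatives commute by construction. *)
Definition Kg (s : seq 'I_3) (y : V) : R := \prod_(i < 3) hgauss (count_mem i s) (y 0 i).
Definition Wg (y : V) : R := \prod_(i < 3) wgt (y 0 i).

Lemma WgE y : Wg y = expR (- (\sum_(i < 3) y 0 i ^+ 2) / 8).
Proof.
by rewrite /Wg !big_ord_recl !big_ord0 /wgt mulr1 addr0 -!expRD; congr expR; field.
Qed.

Lemma Wg_ge0 y : 0 <= Wg y. Proof. by rewrite WgE expR_ge0. Qed.

Lemma is_derive_coord (g : R -> R) (g' : R) (y : V) (i j : 'I_3) :
 is_derive (y 0 j) 1 g g' ->
 is_derive y (delta_mx 0 i : V) (fun y : V => g (y 0 j)) (if i == j then g' else 0).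
Proof.
move=> [dg gE].
have coordE (h : R) : (h *: (delta_mx 0 i : V) + y) 0 j = h * (i == j)%:R + y 0 j.
 by rewrite !mxE eqxx/= eq_sym.
have H : (fun h : R => h^-1 *: (g ((h *: (delta_mx 0 i : V) + y) 0 j) - g (y 0 j))) @ 0^'
  --> (if i == j then g' else 0).
 under eq_fun do rewrite coordE.
 case: eqP => _.
  rewrite -gE; exact: dg.
 under eq_fun do rewrite mulr0 add0r subrr scaler0.
 exact: cvg_cst.
apply: DeriveDef; first by apply/cvg_ex; eexists; exact: H.
exact/cvg_lim.
Qed.

Lemma is_derive_Kg s (y : V) i : is_derive y (delta_mx 0 i : V) (Kg s) (Kg (i :: s) y).
Proof.
have KE t : Kg t = fun y : V => hgauss (count_mem ord0 t) (y 0 ord0) *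
  (hgauss (count_mem o1 t) (y 0 o1) *
   hgauss (count_mem o2 t) (y 0 o2)).
 by apply/funext => z; rewrite /Kg !big_ord_recl big_ord0 mulr1.
rewrite !KE.
have D j := is_derive_coord i (is_derive_hgauss (count_mem j s) (y 0 j)).
have H := is_deriveM (D ord0) (is_deriveM (D o1) (D o2)).
apply: (is_derive_eq H); move: i {H D}.
by apply: ord3P; rewrite fctE /= ?add1n ?add0n /GRing.scale/=; ring.
Qed.

Lemma cont_coord_prod (f : 'I_3 -> R -> R) : (forall i, continuous (f i)) ->
 continuous (fun y : V => \prod_(i < 3) f i (y 0 i)).
Proof.
move=> cf; have -> : (fun y : V => \prod_(i < 3) f i (y 0 i)) = fun y : V =>
  f ord0 (y 0 ord0) * (f o1 (y 0 o1) *
   f o2 (y 0 o2)).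
 by apply/funext => z; rewrite !big_ord_recl big_ord0 mulr1.
move=> y; have c i : {for y, continuous (fun y : V => f i (y 0 i))}.
 by apply: (@continuous_comp _ _ _ (fun y : V => y 0 i) (f i)); [exact: coord_continuous|exact: cf].
exact: (cvgM (c _) (cvgM (c _) (c _))).
Qed.

Lemma cont_Kg s : continuous (Kg s).
Proof. exact: (cont_coord_prod (fun i => @cont_hgauss (count_mem i s))). Qed.

Lemma cont_Wg : continuous Wg.
Proof. exact: (cont_coord_prod (fun i => cont_wgt)). Qed.

Lemma Kg_shift_bound s : exists2 c : R, 0 <= c & forall y i (h : R),
 `|h| <= 1 -> `|Kg s (h *: (delta_mx 0 i : V) + y)| <= c * Wg y.
Proof.
have /choice[C CP] : forall i : 'I_3, exists c : R, 0 <= c /\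
  forall x h : R, `|h| <= 1 -> `|hgauss (count_mem i s) (x + h)| <= c * wgt x.
 by move=> i; have [c] := hgauss_bound (count_mem i s); exists c.
exists (\prod_(i < 3) C i); first by apply: prodr_ge0 => i _; have [] := CP i.
move=> y i h h1; rewrite /Kg /Wg normr_prod -big_split/=.
apply: ler_prod => j _; rewrite normr_ge0/= !mxE eqxx/= addrC.
have [_] := CP j; apply; case: eqP => _; first by rewrite mulr1.
by rewrite mulr0 normr0.
Qed.

Lemma mfun_vec3 (i : 'I_3) :
 measurable_fun setT (fun z : space3 R => vec3 z 0 i : mR R).
Proof.
move: i; apply: ord3P.
- rewrite (_ : (fun _ => _) = fst \o fst).
  exact: (measurableT_comp measurable_fst measurable_fst).
 by apply/funext => z; rewrite mxE.
- rewrite (_ : (fun _ => _) = snd \o fst).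
  exact: (measurableT_comp measurable_snd measurable_fst).
 by apply/funext => z; rewrite mxE.
- rewrite (_ : (fun _ => _) = snd); first exact: measurable_snd.
 by apply/funext => z; rewrite mxE.
Qed.

Lemma mfun_comp_continuous d (A : measurableType d) (D : set A)
  (c1 : A -> V) (F : V -> R) : 
 (forall i, measurable_fun D (fun a => c1 a 0 i : mR R)) ->
 continuous F -> measurable_fun D (fun a => F (c1 a) : mR R).
Proof.
move=> m1 cF.
apply: (@mfun_comp_open R _ A D (fun=> 0) c1 setT (fun z => F z.2)) => //.
- exact: openT.
- by move=> z _; apply: (@continuous_comp _ _ _ snd F); [exact: cvg_snd|exact: cF].
Qed.

Lemma mfun3_cont (F : V -> R) : continuous F ->
 (mfun3 z, F (vec3 z)).
Proof. by move=> cF; apply: mfun_comp_continuous => // i; exact: mfun_vec3. Qed.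

Lemma integral_coord_prod (f : 'I_3 -> R -> R) : (forall i, continuous (f i)) ->
 (forall i x, 0 <= f i x) ->
 (\int[leb3]_z (\prod_(i < 3) f i (vec3 z 0%R i))%:E =
  (\int[leb]_x (f ord0 x)%:E) * (\int[leb]_x (f o1 x)%:E) *
  (\int[leb]_x (f o2 x)%:E))%E.
Proof.
move=> cf f0; rewrite -ge0_integral3_prod//.
- by apply: eq_integral => z _; rewrite !big_ord_recl big_ord0 mulr1 mulrA !mxE.
- exact: continuous_measurable_fun.
- exact: continuous_measurable_fun.
- exact: continuous_measurable_fun.
Qed.

Lemma integral_Wg : exists2 I : R, 0 <= I & (\int[leb3]_z (Wg (vec3 z))%:E = I%:E)%E.
Proof.
have [I I0 IE] := integral_wgt; exists (I * I * I); first pos.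
rewrite (@integral_coord_prod (fun=> wgt))// ?IE//.
 by move=> _; exact: cont_wgt.
by move=> _ x; exact: expR_ge0.
Qed.

Lemma intg_Wg : leb3.-integrable setT (fun z => (Wg (vec3 z : V))%:E).
Proof.
have [I I0 IE] := integral_Wg; apply/integrableP; split.
 by apply/measurable_EFinP; exact: mfun3_cont cont_Wg.
under eq_integral do rewrite gee0_abs ?lee_fin ?Wg_ge0//.
by rewrite IE ltry.
Qed.

Lemma integral_Kg0 : (\int[leb3]_z (Kg [::] (vec3 z : V))%:E = 1)%E.
Proof.
have h0 : hgauss 0 = gauss4 by apply/funext => x; rewrite /hgauss/= hornerC mul1r.
rewrite (@integral_coord_prod (fun=> hgauss 0)).
- by rewrite h0 !integral_gauss4 !mule1.
- by move=> _; exact: cont_hgauss.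
- by move=> _ x; rewrite h0 ltW// gauss4_gt0.
Qed.

(** Trades the factor y_i, which differentiation in the length of the kernel produces, for a
    derivative of the kernel. *)
Lemma Kg1E i (y : V) : Kg [:: i] y = - (y 0 i / 2) * Kg [::] y.
Proof.
have h0 x : hgauss 0 x = gauss4 x by rewrite /hgauss/= hornerC mul1r.
have h1 x : hgauss 1 x = - (x / 2) * gauss4 x.
 by rewrite /hgauss/= mulr1 -polyC1 derivC hornerD hornerN hornerZ hornerX hornerC; field.
rewrite /Kg !big_ord_recl !big_ord0; move: i.
by apply: ord3P; rewrite /= !h0 !h1; ring.
Qed.

End GaussianKernels.

(** * Scaled heat operators: bounds, continuity, integration by parts *)

Section HeatOperators.
Context {R : realType}.
Local Notation V := 'rV[R]_3.
Implicit Types (f g : V -> R) (s : seq 'I_3).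

(** A single constant dominates the kernel, the kernel shifted by a unit, and the mass of W. Being
    at least 1, its powers can always be rounded up later. *)
Lemma cK_subproof s : exists c : R,
 [/\ 1 <= c, forall y i (h : R), `|h| <= 1 -> `|Kg s (h *: e_ i + y)| <= c * Wg y,
   forall y : V, `|Kg s y| <= c * Wg y &
   forall d : R, 0 <= d -> (\int[leb3]_z (d * Wg (vec3 z : V))%:E <= (c * d)%:E)%E].
Proof.
have [c c0 cP] := @Kg_shift_bound R s.
have [I I0 IE] := integral_Wg (R := R).
have Wm : measurable_fun setT (fun z => (Wg (vec3 z : V))%:E).
 by apply/measurable_EFinP; exact: mfun3_cont cont_Wg.
exists (c + I + 1); split.
- by rewrite lerDr addr_ge0.
- move=> y i h h1; rewrite (le_trans (cP _ _ _ h1))// ler_wpM2r ?Wg_ge0//.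
 by rewrite -addrA lerDl addr_ge0.
- move=> y; have := cP y ord0 0; rewrite normr0 scale0r add0r => /(_ ler01) /le_trans; apply.
 by rewrite ler_wpM2r ?Wg_ge0// -addrA lerDl addr_ge0.
- move=> d d0; under eq_integral do rewrite EFinM.
 rewrite ge0_integralZl_EFin//; last by move=> z _; rewrite lee_fin Wg_ge0.
 by rewrite IE -EFinM lee_fin mulrC ler_wpM2r// addrAC lerDr addr_ge0.
Qed.

Definition cK s : R := sval (cid (cK_subproof s)).

Lemma cK_ge1 s : 1 <= cK s.
Proof. by rewrite /cK; case: cid => c []. Qed.

Lemma cK_gt0 s : 0 < cK s.
Proof. exact: lt_le_trans (cK_ge1 s). Qed.

Lemma Kg_shift s y i (h : R) : `|h| <= 1 -> `|Kg s (h *: e_ i + y)| <= cK s * Wg y.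
Proof. by rewrite /cK; case: cid => c [_ /= H _ _]; exact: H. Qed.

Lemma Kg_le s (y : V) : `|Kg s y| <= cK s * Wg y.
Proof. by rewrite /cK; case: cid => c []. Qed.

Lemma integral_Wg_le s (d : R) : 0 <= d ->
 (\int[leb3]_z (d * Wg (vec3 z : V))%:E <= (cK s * d)%:E)%E.
Proof. by rewrite /cK; case: cid => c [_ _ _ /= H] /H. Qed.

Lemma intg_WgM (d : R) : leb3.-integrable setT (fun z => (d * Wg (vec3 z : V))%:E).
Proof. by under eq_fun do rewrite EFinM; apply: integrableZl => //; exact: intg_Wg. Qed.

(* [hk s (sqrt t)] is [t ^ (|s|/2) D^s e^(t Laplacian)]. *)
Definition hk s (l : R) f (x : V) : R :=
 (\int[leb3]_z (Kg s (vec3 z) * f (x - l *: vec3 z)))%R.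

Lemma cont_affine_comp f (x : V) (l : R) : continuous f ->
 continuous (fun y : V => f (x - l *: y)).
Proof.
move=> cf y; apply: (@continuous_comp _ _ _ (fun y : V => x - l *: y) f); last exact: cf.
by apply: cvg_subscale; [exact: cst_continuous|exact: cst_continuous|exact: cvg_id].
Qed.

Lemma mfun_hk s l f x : continuous f ->
 measurable_fun setT (fun z : space3 R => Kg s (vec3 z) * f (x - l *: vec3 z)).
Proof.
move=> cf; apply: measurable_funM.
 exact: mfun3_cont (@cont_Kg _ s).
exact: mfun3_cont (@cont_affine_comp f x l cf).
Qed.

Lemma le_intg d (T : measurableType d) (mu : {measure set T -> \bar R})
  (D : set T) (f g : T -> R) : measurable D -> measurable_fun D f ->
 mu.-integrable D (EFin \o g) -> (forall z, D z -> `|f z| <= g z) ->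
 mu.-integrable D (EFin \o f).
Proof.
move=> mD mf ig fg; apply: (le_integrable mD _ _ ig) => /=.
 exact/measurable_EFinP.
by move=> z Dz /=; rewrite lee_fin (le_trans (fg _ Dz))// ler_norm.
Qed.

Lemma intgZ_real d (T : measurableType d) (mu : {measure set T -> \bar R})
  (D : set T) (f : T -> R) (c : R) : measurable D ->
 mu.-integrable D (EFin \o f) -> mu.-integrable D (EFin \o (fun z => c * f z)).
Proof.
move=> mD fi; have := integrableZl mD c fi.
by apply: eq_integrable => // z _ /=; rewrite EFinM.
Qed.

Lemma intgD_real d (T : measurableType d) (mu : {measure set T -> \bar R})
  (D : set T) (f g : T -> R) : measurable D ->
 mu.-integrable D (EFin \o f) -> mu.-integrable D (EFin \o g) ->
 mu.-integrable D (EFin \o (fun z => f z + g z)).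
Proof.
move=> mD fi gi; have := integrableD mD fi gi.
by apply: eq_integrable => // z _ /=; rewrite EFinD.
Qed.

Lemma hk_int_bound s l f x (M : R) y : (forall x, `|f x| <= M) ->
 `|Kg s y * f (x - l *: y)| <= cK s * M * Wg y.
Proof.
by move=> fM; rewrite normrM mulrAC ler_pM// Kg_le.
Qed.

Lemma intg_hk s l f x (M : R) : continuous f -> (forall x, `|f x| <= M) ->
 leb3.-integrable setT (EFin \o (fun z => Kg s (vec3 z) * f (x - l *: vec3 z))).
Proof.
move=> cf fM; apply: (le_intg _ (mfun_hk _ _ _ cf) (intg_WgM (cK s * M))) => //.
by move=> z _; exact: hk_int_bound.
Qed.

Lemma Rintegral_le_ge0 d (T : measurableType d) (mu : {measure set T -> \bar R})
  (D : set T) (f g : T -> R) (c : R) : measurable D -> measurable_fun D f ->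
 measurable_fun D g -> (forall z, D z -> `|f z| <= g z) ->
 (\int[mu]_(z in D) (g z)%:E <= c%:E)%E -> `|\int[mu]_(z in D) f z| <= c.
Proof.
move=> mD mf mg fg gc.
have mf' : measurable_fun D (EFin \o f) by exact/measurable_EFinP.
have I1 : (\int[mu]_(z in D) `|(f z)%:E| <= c%:E)%E.
 apply: le_trans gc; apply: ge0_le_integral => //.
 - by apply: measurableT_comp.
 - exact/measurable_EFinP.
have fi : mu.-integrable D (EFin \o f).
 by apply/integrableP; split => //; rewrite (le_lt_trans I1)// ltry.
rewrite -lee_fin EFin_normr_Rintegral//.
exact: le_trans (le_abse_integral mu mD mf') I1.
Qed.

Lemma hk_bound s l f x (M : R) : continuous f -> (forall x, `|f x| <= M) ->
 `|hk s l f x| <= cK s * (cK s * M).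
Proof.
move=> cf fM; have M0 : 0 <= M by rewrite (le_trans _ (fM 0)).
apply: (@Rintegral_le_ge0 _ _ _ _ _ (fun z => cK s * M * Wg (vec3 z))) => //.
- exact: mfun_hk.
- apply/measurable_EFinP; exact: (measurable_int _ (intg_WgM _)).
- by move=> z _; exact: hk_int_bound.
- by apply: integral_Wg_le; rewrite mulr_ge0// ltW// cK_gt0.
Qed.

(* Space-time continuity together with boundedness locally uniform in time. *)
Definition stc (I : set R) (u : R -> V -> R) :=
 (forall t x, I t -> {for (t, x), continuous (fun z : R * V => u z.1 z.2)}) /\
 (forall t, I t -> exists M : R, \forall s \near t, forall x, `|u s x| <= M).

Lemma stc_cont I u t : stc I u -> I t -> continuous (u t).
Proof.
move=> [cu _] It x; have := cu t x It => c.
apply: (@continuous_comp _ _ _ (fun y : V => (t, y)) (fun z : R * V => u z.1 z.2)).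
 cts.
exact: c.
Qed.

Lemma stc_bounded I u t : stc I u -> I t -> exists M : R, forall x, `|u t x| <= M.
Proof.
by move=> [_ bu] It; have [M HM] := bu t It; exists M; exact: nbhs_singleton HM.
Qed.

(** The domination is the bound of u near t, which is uniform in space. Length 0 is included, so
    continuity down to the identity operator is part of the statement. *)
Lemma hk_cont I u s (l t : R) x : open I -> stc I u -> I t ->
 {for (l, (t, x)), continuous
   (fun q : R * (R * V) => hk s q.1 (u q.2.1) q.2.2)}.
Proof.
move=> oI su It.
have [M HM] := su.2 t It.
have It' : \forall s \near t, I s by exact: open_nbhs_nbhs.
have near2 (P : R -> Prop) : (\forall s \near t, P s) ->
  \forall q \near ((l, (t, x)) : R * (R * V)), P q.2.1.
 move=> HP; have c : (fun q : R * (R * V) => q.2.1) @ (l, (t, x)) --> t.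
  by apply: (@cvg_comp _ _ _ snd fst); [exact: cvg_snd|exact: cvg_fst].
 exact: (c _ HP).
apply: (cont_int measurableT
 (f := fun (q : R * (R * V)) (z : space3 R) => Kg s (vec3 z) * u q.2.1 (q.2.2 - q.1 *: vec3 z))
 (intg_WgM (cK s * M))).
- apply: filterS (near2 _ It') => q Iq; apply: mfun_hk.
 exact: stc_cont Iq.
- by apply: filterS (near2 _ HM) => q uM z _; exact: hk_int_bound.
- apply: aeW => z _; apply: cvgMl_tmp.
 have := su.1 t (x - l *: vec3 z) It => c.
 have p2 : (fun q : R * (R * V) => (q.2.1, q.2.2 - q.1 *: vec3 z)) @ (l, (t, x))
   --> ((t, x - l *: vec3 z) : R * V).
  apply: cvg_pairN.
   by apply: (@cvg_comp _ _ _ snd fst); [exact: cvg_snd|exact: cvg_fst].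
  apply: cvg_subscale; [|exact: cvg_fst|exact: cst_continuous].
  by apply: (@cvg_comp _ _ _ snd snd); [exact: cvg_snd|exact: cvg_snd].
 exact: (cvg_comp _ _ p2 c).
Qed.

Lemma is_derive_affine f (i : 'I_3) (x y : V) (l : R) : derivable f (x - l *: y) (e_ i) ->
 is_derive x (e_ i) (fun x => f (x - l *: y)) (partial i f (x - l *: y)).
Proof.
move=> df.
have H : (fun h : R => h^-1 *: (f (h *: e_ i + x - l *: y) - f (x - l *: y))) =
 (fun h : R => h^-1 *: (f (h *: e_ i + (x - l *: y)) - f (x - l *: y))).
 by apply/funext => h; rewrite addrA.
apply: DeriveDef; first by rewrite /derivable H.
by rewrite /derive H.
Qed.

Lemma is_derive_affineN (f : V -> R) (i : 'I_3) (x y : V) (l : R) :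
 (forall x, derivable f x (delta_mx 0 i)) ->
 is_derive y (delta_mx 0 i : V) (fun y => f (x - l *: y)) (- l * partial i f (x - l *: y)).
Proof.
move=> df; apply: is_derive_line.
pose g (h : R) := f (h *: (delta_mx 0 i : V) + (x - l *: y)).
have -> : (fun h : R => f (x - l *: (h *: (delta_mx 0 i : V) + y))) = (fun h => g (- l * h)).
 apply/funext => h; rewrite /g; congr (f _).
 by rewrite scalerDr scalerA mulNr scaleNr opprD addrCA.
have dg : is_derive (- l * 0) 1 g (partial i f (x - l *: y)).
 have := @derivable_line _ _ f (x - l *: y) (delta_mx 0 i) (- l * 0) (df _).
 by rewrite mulr0 scale0r add0r.
have dl : is_derive (0:R) 1 (fun h : R => - l * h) (- l).
 by apply: is_derive_eq; rewrite /GRing.scale/= ?mulr1 ?mulr0 ?addr0.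
have := @is_derive1_comp _ g (fun h : R => - l * h) 0 _ _ dg dl.
move=> H; apply: (is_derive_eq H).
by rewrite mulrC.
Qed.

Lemma MVT_coord f (i : 'I_3) (p : V) (r : R) : (forall x, derivable f x (e_ i)) ->
 exists2 c : R, `|c| <= `|r| & f (r *: e_ i + p) - f p = r * partial i f (c *: e_ i + p).
Proof.
move=> df.
have D (t : R) : is_derive t 1 (fun h : R => f (h *: e_ i + p)) (partial i f (t *: e_ i + p)).
 exact: derivable_line.
have cD : continuous (fun h : R => f (h *: e_ i + p)).
 by move=> t; apply/differentiable_continuous/derivable1_diffP; have [] := D t.
have [r0|r0|<-] := ltgtP 0 r.
- have [|c] := @MVT R _ _ 0 r r0 (fun t _ => D t); first exact: continuous_subspaceT.
 rewrite in_itv/= => /andP[c0 cr] E; exists c.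
  by rewrite !gtr0_norm// ltW.
 by move: E; rewrite scale0r add0r subr0 => ->; rewrite mulrC.
- have [|c] := @MVT R _ _ r 0 r0 (fun t _ => D t); first exact: continuous_subspaceT.
 rewrite in_itv/= => /andP[rc c0] E; exists c.
  by rewrite !ltr0_norm// lerN2 ltW.
 move: E; rewrite scale0r add0r sub0r => E.
 by rewrite -[LHS]opprB E mulrN opprK mulrC.
- by exists 0 => //; rewrite scale0r add0r subrr mul0r.
Qed.

Lemma norm_coord (y : V) (i : 'I_3) : `|y 0 i| <= `|y|.
Proof.
by rewrite [leRHS]mx_normrE; apply: (le_bigmax _ (fun k : 'I_1 * 'I_3 => `|y k.1 k.2|) (0, i)).
Qed.

Lemma norm_le_coord (y : V) (M : R) : 0 <= M -> (forall i, `|y 0 i| <= M) -> `|y| <= M.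
Proof.
move=> M0 H; rewrite [leLHS]mx_normrE; apply: bigmax_le => // -[i j] _ /=.
by rewrite ord1; exact: H.
Qed.

Lemma sum3 (F : 'I_3 -> R) :
 \sum_(i < 3) F i = F ord0 + (F o1 + F o2).
Proof. by rewrite !big_ord_recl big_ord0 addr0. Qed.

Lemma vec_decomp (y : V) : y = \sum_(i < 3) y 0 i *: e_ i.
Proof. by rewrite [LHS]row_sum_delta. Qed.

(** The increment is followed along one coordinate axis at a time, with the mean value theorem on
    each of three segments; continuity of the partial derivatives takes care of the intermediate
    points. *)
Lemma is_derive_C1 f (x v : V) :
 (forall i x, derivable f x (e_ i)) -> (forall i, continuous (partial i f)) ->
 is_derive x v f (\sum_(i < 3) v 0 i * partial i f x).
Proof.
move=> df cf.
pose v1 := v 0 ord0 *: e_ ord0.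
pose v2 := v 0 o1 *: e_ o1.
pose v3 := v 0 o2 *: e_ o2.
have vE : v = v3 + (v2 + v1).
 by rewrite [LHS]vec_decomp !big_ord_recl big_ord0 addr0 addrC -/v1 -/v2 -/v3 [v2 + v3]addrC addrA.
suff H : (fun h : R => h^-1 *: (f (h *: v + x) - f x)) @ 0^' -->
  \sum_(i < 3) v 0 i * partial i f x.
 by apply: DeriveDef; [apply/cvg_ex; eexists; exact: H|exact/cvg_lim].
apply/cvgrPdist_le => e e0.
(* Three segments, each weighted by at most |v|; the summand 1 keeps N positive when v = 0. *)
pose N := 3 * (`|v| + 1).
have N0 : 0 < N by rewrite mulr_gt0// ltr_pwDr.
have /= cfx i : \forall y \near x, `|partial i f x - partial i f y| <= e / N.
 by have /cvgrPdist_le := cf i x; apply; rewrite divr_gt0.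
have : \forall y \near x, forall i, `|partial i f x - partial i f y| <= e / N.
 exact: near_forall.
move=> /nbhs_ballP[d /= d0 Hd].
have Hd' (w : V) i : `|w| < d -> `|partial i f x - partial i f (w + x)| <= e / N.
 move=> wd; apply: Hd; rewrite -ball_normE /= opprD addrA addrAC.
 by rewrite subrr add0r normrN.
near=> h.
have h0 : h != 0 by near: h; exact: nbhs_dnbhs_neq.
have hd : `|h| * `|v| < d.
 have : `|h| < d / (`|v| + 1).
  by near: h; apply: dnbhs0_lt; rewrite divr_gt0// ltr_pwDr.
 rewrite ltr_pdivlMr ?ltr_pwDr// => /le_lt_trans; apply.
 by rewrite ler_wpM2l// lerDl.
have [c1 c1h E1] := MVT_coord x (h * v 0 ord0) (df ord0).
have [c2 c2h E2] := MVT_coord (h *: v1 + x) (h * v 0 o1) (df o1).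
have [c3 c3h E3] := MVT_coord (h *: v2 + (h *: v1 + x))
 (h * v 0 o2) (df o2).
have EE : f (h *: v + x) - f x = h * (v 0 ord0 * partial ord0 f (c1 *: e_ ord0 + x) +
  (v 0 o1 * partial o1 f (c2 *: e_ o1 + (h *: v1 + x)) +
  v 0 o2 * partial o2 f
   (c3 *: e_ o2 + (h *: v2 + (h *: v1 + x))))).
 rewrite !mulrDr !mulrA -E1 -E2 -E3 -!scalerA -/v1 -/v2 -/v3.
 by rewrite vE !scalerDr !addrA; ring.
rewrite EE [X in _ - X]mulrA mulVf// mul1r.
have hv i : `|h * v 0 i| <= `|h| * `|v| by rewrite normrM ler_wpM2l// norm_coord.
have cvi i (w : V) : `|w| < d -> `|v 0 i * partial i f x - v 0 i * partial i f (w + x)| <= e / 3.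
 move=> wd; rewrite -mulrBr normrM.
 apply: (@le_trans _ _ ((`|v| + 1) * (e / N))).
  by rewrite ler_pM// ?Hd'// (le_trans (norm_coord _ _))// lerDl.
 have v0 : `|v| + 1 != 0 by rewrite gt_eqF// ltr_pwDr.
 by rewrite /N; apply: le_of_eq; field.
have small (w : V) : (forall i, `|w 0 i| <= `|h * v 0 i|) -> `|w| < d.
 move=> H; apply: le_lt_trans hd; apply: norm_le_coord; first pos.
 by move=> i; exact: le_trans (H i) (hv i).
rewrite sum3.
have B1 := cvi ord0 (c1 *: e_ ord0) _.
have B2 := cvi o1 (c2 *: e_ o1 + h *: v1) _.
have B3 := cvi o2 (c3 *: e_ o2 + (h *: v2 + h *: v1)) _.
rewrite -!addrA in B2 B3.
have tri (a b c a' b' c' : R) : `|a - a'| <= e / 3 -> `|b - b'| <= e / 3 -> `|c - c'| <= e / 3 ->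
  `|a + (b + c) - (a' + (b' + c'))| <= e.
 move=> Ha Hb Hc; have -> : a + (b + c) - (a' + (b' + c')) = (a - a') + ((b - b') + (c - c')) by ring.
 have := ler_normD (a - a') ((b - b') + (c - c')).
 have := ler_normD (b - b') (c - c'); lra.
apply: tri; [apply: B1|apply: B2|apply: B3]; apply: small; apply: ord3P;
 rewrite !mxE /= ?mulr0 ?mulr1 ?addr0 ?add0r ?normr0 ?mul0r//.
Unshelve. all: by end_near. Qed.

(** The space C_b^k, on which all the operators below act and commute with derivatives. *)
Definition CB k f := forall s, (size s <= k)%N ->
 [/\ continuous (partials s f), (exists M : R, forall x, `|partials s f x| <= M) &
   (size s < k)%N -> forall i x, derivable (partials s f) x (e_ i)].

Lemma partials_cat (W : normedModType R) s t (f : V -> W) :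
 partials (s ++ t) f = partials s (partials t f).
Proof. by rewrite /partials foldr_cat. Qed.

Lemma CB_partials k f t : CB k f -> (size t <= k)%N -> CB (k - size t) (partials t f).
Proof.
move=> fk tk s sk; have := fk (s ++ t); rewrite size_cat addnC -leq_subRL// sk => /(_ isT).
rewrite partials_cat => -[cf bf df]; split => // sk'; apply: df.
by rewrite -ltn_subRL.
Qed.

Lemma CB_le k k' f : (k' <= k)%N -> CB k f -> CB k' f.
Proof.
move=> kk fk s sk; have [cf bf df] := fk s (leq_trans sk kk); split => // sk'.
by apply: df; exact: leq_trans sk' kk.
Qed.

Lemma CB_partial k f i : CB k.+1 f -> CB k (partial i f).
Proof. by move=> fk; have := @CB_partials k.+1 f [:: i] fk isT; rewrite subn1. Qed.

Lemma CB_cont k f : CB k f -> continuous f.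
Proof. by move=> /(_ [::] isT)[]. Qed.

Lemma CB_bnd k f : CB k f -> exists M : R, forall x, `|f x| <= M.
Proof. by move=> /(_ [::] isT)[]. Qed.

Lemma CB_derivable k f : CB k.+1 f -> forall i x, derivable f x (e_ i).
Proof. by move=> /(_ [::] isT)[_ _]; exact. Qed.

Lemma intg_hkCB k s l f x : CB k f ->
 leb3.-integrable setT (EFin \o (fun z => Kg s (vec3 z) * f (x - l *: vec3 z))).
Proof.
move=> fk; have [M fM] := CB_bnd fk.
exact: intg_hk (CB_cont fk) fM.
Qed.

Lemma hk_derive s l f x i : CB 1 f ->
 is_derive x (e_ i) (hk s l f) (hk s l (partial i f) x).
Proof.
move=> f1; have df := CB_derivable f1.
have [M' fM'] := CB_bnd (CB_partial i f1).
have D (y : V) (w : space3 R) : is_derive y (e_ i) (fun y => Kg s (vec3 w) * f (y - l *: vec3 w))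
  (Kg s (vec3 w) * partial i f (y - l *: vec3 w)).
 exact: (is_deriveZ (Kg s (vec3 w)) (is_derive_affine (df i _))).
have H := @is_derive_int _ _ _ leb3 setT measurableT _
 (fun (y : V) w => Kg s (vec3 w) * f (y - l *: vec3 w))
 (fun w => cK s * M' * Wg (vec3 w)) x (e_ i)
 (fun h _ => intg_hkCB s l _ f1)
 (fun h w _ _ => (D (h *: e_ i + x) w).(ex_derive)) (intg_WgM _).
apply: (is_derive_eq (H _)).
 by move=> h w _ _; rewrite (is_derive_val (D (h *: e_ i + x) w)); exact: hk_int_bound.
by apply: eq_Rintegral => w _; rewrite (is_derive_val (D x w)).
Qed.

(** The integral of the translates of g is constant, because Lebesgue measure is translation
    invariant. Its derivative at 0, taken under the integral sign, says that a derivative of g has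
    integral zero, so no boundary terms arise. The kernel bound under unit shifts provides the
    domination. *)
Lemma hk_ibp s l f x i : CB 1 f -> l * hk s l (partial i f) x = hk (i :: s) l f x.
Proof.
move=> f1; have df := CB_derivable f1.
have [M fM] := CB_bnd f1.
have [M' fM'] := CB_bnd (CB_partial i f1).
have M0 : 0 <= M by rewrite (le_trans _ (fM 0)).
have M'0 : 0 <= M' by rewrite (le_trans _ (fM' 0)).
pose g (y : V) := Kg s y * f (x - l *: y).
pose g' (y : V) := Kg (i :: s) y * f (x - l *: y) - l * (Kg s y * partial i f (x - l *: y)).
have D (y z : V) : is_derive y (e_ i) (fun y => g (y + z)) (g' (y + z)).
 have H : is_derive (y + z) (e_ i) g (g' (y + z)).
  have := is_deriveM (is_derive_Kg s (y + z) i) (@is_derive_affineN f i x (y + z) l (df i)).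
  by move=> H; apply: (is_derive_eq H); rewrite /GRing.scale/= /g'; ring.
 have E : (fun h : R => h^-1 *: (g (h *: e_ i + y + z) - g (y + z))) =
  (fun h : R => h^-1 *: (g (h *: e_ i + (y + z)) - g (y + z))).
  by apply/funext => h; rewrite addrA.
 by case: H => H1 H2; split; [rewrite /derivable E|rewrite /derive E].
have cg : continuous g.
 by move=> y; exact: (cvgM (@cont_Kg R s y) (@cont_affine_comp f x l (CB_cont f1) y)).
have ig (y : V) : leb3.-integrable setT (EFin \o (fun w => g (y + vec3 w))).
 have i0 : leb3.-integrable setT (EFin \o (fun w => g (vec3 w))) := intg_hkCB s l x f1.
 have mg : measurable_fun setT (fun w : space3 R => (g (vec3 w))%:E).
  by apply/measurable_EFinP; exact: mfun3_cont.
 have E (F : V -> \bar R) : (fun w : space3 R => F (y + vec3 w)) = (fun w => (F \o vec3) (affine3 y 1 w)).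
  by apply/funext => w; rewrite /= vec3_affine scale1r.
 have mga' : measurable_fun setT (fun w : space3 R => `|(g (vec3 w))%:E|%E).
  by apply: measurableT_comp.
 have E1 : (\int[leb3]_w `|(g (y + vec3 w))%:E| = \int[leb3]_w `|(g (vec3 w))%:E|)%E.
  rewrite -(@integral_translation3 R y (fun w => `|(g (vec3 w))%:E|%E) mga').
  by apply: eq_integral => w _; rewrite vec3_affine scale1r.
 move/integrableP : i0 => [_ i0]; apply/integrableP; split; last first.
  by rewrite /= E1.
 rewrite /comp (E (EFin \o g)).
 by apply: measurableT_comp; [exact: mg|exact: mfun_affine3].
have J (y : V) : \int[leb3]_w g (y + vec3 w) = \int[leb3]_w g (0 + vec3 w).
 have H (y' : V) : \int[leb3]_w g (y' + vec3 w) = \int[leb3]_w g (vec3 w).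
  have mg : measurable_fun setT (fun w : space3 R => (g (vec3 w))%:E).
   by apply/measurable_EFinP; exact: mfun3_cont.
  have E2 : (fun w : space3 R => (g (y' + vec3 w))%:E) = (fun w => (g (vec3 (affine3 y' 1 w)))%:E).
   by apply/funext => w; rewrite vec3_affine scale1r.
  transitivity (fine (\int[leb3]_w (g (vec3 (affine3 y' 1 w)))%:E)%E).
   by rewrite /Rintegral E2.
  by rewrite (integral_translation3 y' mg).
 by rewrite !H.
pose C := cK (i :: s) * M + `|l| * (cK s * M').
have bg' (h : R) (w : space3 R) : `|h| < 1 -> `|g' (h *: e_ i + 0 + vec3 w)| <= C * Wg (vec3 w).
 move=> h1; rewrite addr0 /g' (le_trans (ler_normB _ _))// mulrDl lerD//.
  by rewrite normrM mulrAC ler_pM// Kg_shift// ltW.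
 rewrite normrM -!mulrA ler_wpM2l// normrM mulrA mulrAC ler_pM// Kg_shift// ltW//.
have H := @is_derive_int _ _ _ leb3 setT measurableT _
 (fun (y : V) w => g (y + vec3 w)) (fun w => C * Wg (vec3 w)) 0 (e_ i)
 (fun h _ => ig _) (fun h w _ _ => (D (h *: e_ i + 0) (vec3 w)).(ex_derive)) (intg_WgM _).
have Hb : forall (h : R) w, `|h| < 1 -> setT w ->
  `|'D_(e_ i) (fun y : V => g (y + vec3 w)) (h *: e_ i + 0)| <= C * Wg (vec3 w).
 by move=> h w h1 _; rewrite (is_derive_val (D _ _)); exact: bg'.
have := is_derive_val (H Hb).
have -> : (fun y : V => \int[leb3]_w g (y + vec3 w)) = cst (\int[leb3]_w g (0 + vec3 w)).
 by apply/funext => y; exact: J.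
rewrite derive_cst => /esym.
have -> : \int[leb3]_w 'D_(e_ i) (fun y : V => g (y + vec3 w)) 0 =
  \int[leb3]_w (Kg (i :: s) (vec3 w) * f (x - l *: vec3 w) - l * (Kg s (vec3 w) * partial i f (x - l *: vec3 w))).
 by apply: eq_Rintegral => w _; rewrite (is_derive_val (D 0 (vec3 w))) /g' add0r.
have i1 := intg_hkCB (i :: s) l x f1.
have i2 := intg_hkCB s l x (CB_partial i f1).
rewrite RintegralB//; last first.
 exact: intgZ_real.
by rewrite RintegralZl// => /eqP; rewrite subr_eq0 => /eqP E; rewrite /hk E.
Qed.

Lemma hk0 f x : hk [::] 0 f x = f x.
Proof.
rewrite /hk; under eq_Rintegral do rewrite scale0r subr0.
rewrite RintegralZr//; last first.
 apply: (le_intg _ _ (intg_WgM (cK [::]))) => //.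
  exact: mfun3_cont (@cont_Kg _ _).
 by move=> z _; exact: Kg_le.
by rewrite /Rintegral integral_Kg0 mul1r.
Qed.

(** The heat equation in the variable l = sqrt t. Differentiating f(x - l z) brings down -z_i; the
    Gaussian turns z_i into -2 times a derivative of the kernel; an integration by parts moves that
    derivative to f with a factor l. *)
Lemma is_derive_hk_length f x (l : R) : CB 2 f ->
 is_derive l 1 (fun l => hk [::] l f x) (2 * l * \sum_(i < 3) hk [::] l (partial i (partial i f)) x).
Proof.
move=> f2; have f1 := CB_le (isT : (1 <= 2)%N) f2; have df := CB_derivable f1.
have /choice[M fM] i := CB_bnd (CB_partial i f1).
have cpf i : continuous (partial i f) := CB_cont (CB_partial i f1).
pose F (l : R) (w : space3 R) := Kg [::] (vec3 w) * f (x - l *: vec3 w).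
pose F' (l : R) (w : space3 R) := \sum_(i < 3) 2 * (Kg [:: i] (vec3 w) * partial i f (x - l *: vec3 w)).
have D (r : R) (w : space3 R) : is_derive r 1 (F ^~ w) (F' r w).
 have [H1 H2] := @is_derive_C1 f (r *: (- vec3 w) + x) (- vec3 w) df cpf.
 have := is_deriveZ (Kg [::] (vec3 w)) (@derivable_line _ _ f x (- vec3 w) r H1).
 rewrite H2 scalerN [- _ + x]addrC => H.
 have -> : F ^~ w = Kg [::] (vec3 w) \*: (fun h : R => f (h *: - vec3 w + x)).
  by apply/funext => h; rewrite /F /= scalerN addrC.
 apply: (is_derive_eq H); rewrite /F'.
 transitivity (Kg [::] (vec3 w) * \sum_(i < 3) (- vec3 w) 0 i * partial i f (x - r *: vec3 w)) => //.
 rewrite mulr_sumr; apply: eq_bigr => i _.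
 by rewrite Kg1E [in LHS]mxE; field.
pose G (w : space3 R) := (\sum_(i < 3) 2 * (cK [:: i] * M i)) * Wg (vec3 w).
have bF' (r : R) w : `|F' r w| <= G w.
 rewrite /F' (le_trans (ler_norm_sum _ _ _))// /G mulr_suml; apply: ler_sum => i _.
 by rewrite normrM ger0_norm// -mulrA ler_wpM2l//; exact: hk_int_bound.
have H := @is_derive_int _ _ _ leb3 setT measurableT _ F G l 1
 (fun h _ => intg_hkCB [::] _ x f2)
 (fun h w _ _ => (D (h *: 1 + l) w).(ex_derive)) (intg_WgM _).
apply: (is_derive_eq (H _)).
 by move=> h w _ _; rewrite (is_derive_val (D _ w)).
have -> : \int[leb3]_w 'D_1 (F ^~ w) l = \int[leb3]_w F' l w.
 by apply: eq_Rintegral => w _; rewrite (is_derive_val (D l w)).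
have ii i := intg_hkCB [:: i] l x (CB_partial i f1).
have ii' i : leb3.-integrable setT (EFin \o (fun w => 2 * (Kg [:: i] (vec3 w) * partial i f (x - l *: vec3 w)))).
 exact: intgZ_real.
have E i : \int[leb3]_w (2 * (Kg [:: i] (vec3 w) * partial i f (x - l *: vec3 w))) =
  2 * l * hk [::] l (partial i (partial i f)) x.
 have H1 := @hk_ibp [::] l (partial i f) x i (CB_partial i f2).
 by rewrite -mulrA H1; apply: RintegralZl.
rewrite /F'; under eq_Rintegral do rewrite sum3.
rewrite sum3 RintegralD//; last first.
 exact: intgD_real (ii' _) (ii' _).
by rewrite RintegralD// !E !mulrDr.
Qed.

Lemma hk_partials k t s l f : CB k f -> (size t <= k)%N -> partials t (hk s l f) = hk s l (partials t f).
Proof.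
move=> fk; elim: t => // i t IH tk /=; rewrite IH; last exact: ltnW.
apply/funext => x; have H := @hk_derive s l (partials t f) x i.
apply: is_derive_val; apply: H; apply: CB_le (CB_partials fk (ltnW tk)).
by rewrite subn_gt0.
Qed.

Lemma cont_hk s l f : continuous f -> (exists M : R, forall x, `|f x| <= M) -> continuous (hk s l f).
Proof.
move=> cf [M fM] x.
have su : stc setT (fun=> f).
 split; last by move=> t _; exists M; apply: near_all => ?; exact: fM.
 move=> t y _; apply: (@continuous_comp _ _ _ snd f); [exact: cvg_snd|exact: cf].
have := @hk_cont setT (fun=> f) s l 0 x openT su I => c.
apply: (@continuous_comp _ _ _ (fun x : V => (l, (0 : R, x))) (fun q : R * (R * V) => hk s q.1 f q.2.2)).
 cts.
exact: c.
Qed.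

Lemma CB_hk k s l f : CB k f -> CB k (hk s l f).
Proof.
move=> fk t tk; rewrite (hk_partials _ _ fk tk); have [cf bf df] := fk t tk.
have [M fM] := bf; split.
- exact: cont_hk.
- by exists (cK s * (cK s * M)) => x; exact: hk_bound.
- move=> tk' i x; have [] // := @hk_derive s l (partials t f) x i.
 by apply: CB_le (CB_partials fk tk); rewrite subn_gt0.
Qed.

Lemma hk_ibps k t s l f x : CB k f -> (size t <= k)%N ->
 l ^+ size t * hk s l (partials t f) x = hk (t ++ s) l f x.
Proof.
elim: t s f x k => [|i t IH] s f x k fk tk; first by rewrite mul1r.
rewrite -[i :: t]/([:: i] ++ t) partials_cat /= exprS -mulrA mulrCA hk_ibp; last first.
 by apply: CB_le (CB_partials fk (ltnW tk)); rewrite subn_gt0.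
rewrite (IH (i :: s) f x k fk (ltnW tk)) /hk; apply: eq_Rintegral => z _.
(* The kernel depends only on the counts of the indices, so the order of concatenation is
   irrelevant. *)
by congr (_ * _); rewrite /Kg; apply: eq_bigr => j _; rewrite /= !count_cat /= addnCA.
Qed.

End HeatOperators.

Ltac pos_leaf ::= lazymatch goal with
 | |- is_true (0 < cK _) => exact: cK_gt0
 | |- is_true (0 <= cK _) => exact: ltW (cK_gt0 _)
 | |- is_true (0 <= Wg _) => exact: Wg_ge0
 end.

(** * Jensen's inequality for the cube *)

Section Jensen.
Context {R : realType}.

Lemma jensen3 d (T : measurableType d) (mu : {measure set T -> \bar R})
  (D : set T) (k h : T -> R) (a m : R) : measurable D ->
 measurable_fun D k -> measurable_fun D h ->
 (forall w, D w -> 0 < k w) -> (forall w, D w -> 0 <= h w) ->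
 0 <= a -> 0 < m ->
 (\int[mu]_(w in D) (k w)%:E <= m%:E)%E ->
 (a%:E <= \int[mu]_(w in D) (h w)%:E)%E ->
 ((a ^+ 3)%:E <= (m ^+ 2)%:E * \int[mu]_(w in D) ((k w) ^- 2 * h w ^+ 3)%:E)%E.
Proof.
move=> mD mk mh k0 h0 a0 m0 km ah.
have mJ : measurable_fun D (fun w => k w ^- 2 * h w ^+ 3).
 apply: measurable_funM; last exact: measurable_funX.
 rewrite (_ : (fun _ => _) = (fun w => (k w)^-1 ^+ 2)); last by apply/funext => w; rewrite exprVn.
 by apply: measurable_funX; exact: (mfun_inv_pos mk k0).
have J0 w : D w -> (0 <= (k w ^- 2 * h w ^+ 3)%:E)%E.
 by move=> Dw; rewrite lee_fin mulr_ge0 ?invr_ge0 ?exprn_ge0 ?h0// ltW// k0.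
move: a0; rewrite le_eqVlt => /predU1P[<-|a0].
 by rewrite expr0n/= mule_ge0 ?lee_fin ?sqr_ge0//; apply: integral_ge0.
case E : (\int[mu]_(w in D) (k w ^- 2 * h w ^+ 3)%:E)%E => [j| |]; last 2 first.
- by rewrite gt0_muley ?leey// lte_fin exprn_gt0.
- by have := integral_ge0 mu J0; rewrite E.
pose s := a / m; have s0 : 0 < s by rewrite divr_gt0.
have amgm (y t : R) : 0 <= y -> 0 <= t -> 3 * t ^+ 2 * y <= y ^+ 3 + 2 * t ^+ 3.
 move=> y0 t0; rewrite -subr_ge0.
 have -> : y ^+ 3 + 2 * t ^+ 3 - 3 * t ^+ 2 * y = (y - t) ^+ 2 * (y + 2 * t) by ring.
 pos.
have pw w : D w -> h w <= (s ^- 2 / 3) * (k w ^- 2 * h w ^+ 3) + (2 * s / 3) * k w.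
 move=> Dw; have kw := k0 w Dw; have := amgm (h w / k w) s (divr_ge0 (h0 w Dw) (ltW kw)) (ltW s0).
 have q0 : 0 <= k w / (3 * s ^+ 2) by pos.
 move=> H; have {H} := ler_wpM2r q0 H.
 have kn : k w != 0 by rewrite gt_eqF.
 have sn : s != 0 by rewrite gt_eqF.
 rewrite [leLHS](_ : _ = h w); last by field; rewrite kn sn.
 rewrite [leRHS](_ : _ = s ^- 2 / 3 * (k w ^- 2 * h w ^+ 3) + 2 * s / 3 * k w)//.
 by field; rewrite kn sn.
have c1 : 0 <= s ^- 2 / 3 by pos.
have c2 : 0 <= 2 * s / 3 by pos.
have k0' w : D w -> (0 <= (k w)%:E)%E by move=> Dw; rewrite lee_fin ltW// k0.
have mJ' : measurable_fun D (fun w => (k w ^- 2 * h w ^+ 3)%:E) by exact/measurable_EFinP.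
have mk' : measurable_fun D (fun w => (k w)%:E) by exact/measurable_EFinP.
have H : (a%:E <= (s ^- 2 / 3)%:E * j%:E + (2 * s / 3)%:E * m%:E)%E.
 apply: (le_trans ah).
 apply: (@le_trans _ _ (\int[mu]_(w in D) ((s ^- 2 / 3)%:E * (k w ^- 2 * h w ^+ 3)%:E + (2 * s / 3)%:E * (k w)%:E))%E).
  apply: ge0_le_integral => //.
  - exact/measurable_EFinP.
  - by apply: emeasurable_funD; exact: measurable_funeM.
 rewrite ge0_integralD//; first last.
 - exact: measurable_funeM.
 - by move=> w Dw; rewrite mule_ge0 ?lee_fin// ltW// k0.
 - exact: measurable_funeM.
 - by move=> w Dw; rewrite mule_ge0 ?lee_fin//; have := J0 w Dw; rewrite lee_fin.
 by rewrite !ge0_integralZl_EFin// E leeD// lee_wpmul2l// lee_fin.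
move: H; rewrite -!EFinM -EFinD !lee_fin => H.
have an : a != 0 by rewrite gt_eqF.
have mn : m != 0 by rewrite gt_eqF.
have E1 : s ^- 2 / 3 * j + 2 * s / 3 * m = m ^+ 2 * j / (3 * a ^+ 2) + 2 / 3 * a.
 by rewrite /s; field; rewrite an mn.
have : a / 3 <= m ^+ 2 * j / (3 * a ^+ 2) by move: H; rewrite E1; lra.
rewrite ler_pdivlMr; last pos.
by congr (_ <= _); field.
Qed.

End Jensen.

(** * The Gaussian window norm and the heat operators *)

Section WindowNorm.
Context {R : realType}.
Local Notation V := 'rV[R]_3.
Implicit Types (f g : V -> R) (s : seq 'I_3) (kap A : R).

(* In the variable y = x - l z the integral is that of |f|^3 against a Gaussian
  window of width l. For kap = 0 the bound says that the L^3 norm is at most A;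
  for kap > 0 it is a bound for the L^3 norms on balls of radius 1 / kap. *)
Definition Nb kap f A : Prop := forall (x : V) (l : R), 0 < l ->
 ((l ^+ 3)%:E * \int[leb3]_z (Wg (vec3 z) * `|f (x - l *: vec3 z)| ^+ 3)%:E
  <= ((Num.max 1 (kap * l) * A) ^+ 3)%:E)%E.

Lemma mfun_Nb f x l : (mfun3 z, f (vec3 z)) ->
 measurable_fun setT (fun z => (Wg (vec3 z) * `|f (x - l *: vec3 z)| ^+ 3)%:E).
Proof.
move=> mf; apply/measurable_EFinP; apply: measurable_funM.
 exact: mfun3_cont cont_Wg.
apply: measurable_funX; apply: measurableT_comp => //.
rewrite (_ : (fun z : space3 R => f (x - l *: vec3 z)) = (fun z => (f \o vec3) (affine3 x (- l) z))).
 by apply: measurableT_comp; [exact: mf|exact: mfun_affine3].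
by apply/funext => z; rewrite /= vec3_affine scaleNr.
Qed.

Lemma Nb_int_ge0 f (x : V) (l : R) :
 (0 <= \int[leb3]_z (Wg (vec3 z) * `|f (x - l *: vec3 z)| ^+ 3)%:E)%E.
Proof. by apply: integral_ge0 => z _; rewrite lee_fin mulr_ge0// Wg_ge0. Qed.

Lemma Nb_le kap f g (m : R) A :
 (mfun3 z, f (vec3 z)) ->
 (mfun3 z, g (vec3 z)) ->
 0 <= m -> (forall x, `|f x| <= m * `|g x|) -> Nb kap g A -> Nb kap f (m * A).
Proof.
move=> mf mg m0 fg Ng x l l0.
rewrite mulrCA exprMn; apply: (@le_trans _ _ ((l ^+ 3)%:E *
  ((m ^+ 3)%:E * \int[leb3]_z (Wg (vec3 z) * `|g (x - l *: vec3 z)| ^+ 3)%:E))%E).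
 apply: lee_wpmul2l; first pos.
 rewrite -ge0_integralZl_EFin//; last 3 first.
 - move=> z _; pos.
 - exact: mfun_Nb.
 - pos.
 apply: ge0_le_integral => //.
 - move=> z _; pos.
 - exact: mfun_Nb.
 - by apply: measurable_funeM; exact: mfun_Nb.
 - move=> z _; rewrite -EFinM lee_fin [leRHS]mulrCA ler_wpM2l ?Wg_ge0// -exprMn.
  by rewrite lerXn2r// nnegrE// mulr_ge0.
rewrite muleCA [leRHS]EFinM; apply: lee_wpmul2l; last exact: Ng.
pos.
Qed.

Lemma Nb_weaken kap f A A' : 0 <= A -> A <= A' -> Nb kap f A -> Nb kap f A'.
Proof.
move=> A0 AA' Nf x l l0; apply: (le_trans (Nf x l l0)); rewrite lee_fin.
have m0 : 0 <= Num.max 1 (kap * l) by rewrite le_max ler01.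
by rewrite lerXn2r// ?nnegrE ?mulr_ge0// ?(le_trans A0)// ler_wpM2l.
Qed.

Lemma Nb_scale kap (q : R) g A : 0 <= q -> continuous g -> Nb kap g A -> Nb kap (fun y => q * g y) (q * A).
Proof.
move=> q0 cg; have mg := mfun3_cont cg; apply: Nb_le => //; first exact: (measurable_funM (measurable_cst _) mg).
by move=> y; rewrite normrM (ger0_norm q0).
Qed.

(** Minkowski's integral inequality. The bounds k serve as the Jensen weight: k^-2 times the cube of
    the bound of G w gives back k, whose integral is at most m. Tonelli exchanges the window with
    the integral over w. *)
Lemma Nb_integral d (Om : measurableType d) (mu : {sigma_finite_measure set Om -> \bar R})
  (D : set Om) (k : Om -> R) (G : Om -> V -> R) g kap (m : R) :
 measurable D -> measurable_fun D k -> (forall w, D w -> 0 < k w) -> 0 < m ->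
 (\int[mu]_(w in D) (k w)%:E <= m%:E)%E ->
 (forall x l, measurable_fun (D `*` setT)
   (fun p : Om * space3 R => G p.1 (x - l *: vec3 p.2) : mR R)) ->
 (mfun3 z, g (vec3 z)) ->
 (forall y, (`|g y|%:E <= \int[mu]_(w in D) `|G w y|%:E)%E) ->
 (forall w, D w -> Nb kap (G w) (k w)) -> Nb kap g m.
Proof.
move=> mD mk k0 m0 km mG mg gG NG x l l0.
have mDT : measurable (D `*` [set: space3 R]) by exact: measurableX.
pose h0 (p : Om * space3 R) : \bar R :=
 (k p.1 ^- 2 * (Wg (vec3 p.2) * `|G p.1 (x - l *: vec3 p.2)| ^+ 3))%:E.
pose h := h0 \_ (D `*` setT).
have mkp : measurable_fun (D `*` [set: space3 R]) (fun p : Om * space3 R => k p.1 : mR R).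
 move=> _ B mB; have := mk mD B mB => HB.
 rewrite (_ : _ `&` _ = (D `&` k @^-1` B) `*` setT); last first.
  by apply/seteqP; split=> [[a b] [[/= Da _] kB]|[a b] [[/= Da kB] _]].
 exact: measurableX.
have mh0 : measurable_fun (D `*` setT) h0.
 apply/measurable_EFinP; apply: measurable_funM.
  rewrite (_ : (fun _ => _) = (fun p => (k p.1)^-1 ^+ 2)); last by apply/funext => w; rewrite exprVn.
  by apply: measurable_funX; exact: (mfun_inv_pos mkp (fun p Dp => k0 _ Dp.1)).
 apply: measurable_funM.
  apply: measurable_funTS.
  exact: (measurableT_comp (mfun3_cont cont_Wg) measurable_snd).
 by apply: measurable_funX; apply: measurableT_comp => //; exact: mG.
have mh : measurable_fun setT h by exact/(measurable_restrictT _ mDT).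
have h00 p : (0 <= h p)%E.
 rewrite /h patchE; case: ifPn => // /set_mem[/= Dp _]; rewrite lee_fin.
 pos.
have hD w z : D w -> h (w, z) = h0 (w, z).
 by move=> Dw; rewrite /h patchE mem_set.
have hnD w z : ~ D w -> h (w, z) = 0%E.
 by move=> nDw; rewrite /h patchE memNset// => -[].
have l30 : 0 <= l ^+ 3 by pos.
have m20 : 0 <= m ^+ 2 by pos.
set mx := Num.max 1 (kap * l).
have mx0 : 0 <= mx by rewrite le_max ler01.
have S1 : (\int[leb3]_z (Wg (vec3 z) * `|g (x - l *: vec3 z)| ^+ 3)%:E <=
  (m ^+ 2)%:E * \int[leb3]_z \int[mu]_w h (w, z))%E.
 rewrite -ge0_integralZl_EFin//; last 2 first.
 - by move=> z _; exact: integral_ge0.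
 - exact: measurable_fun_fubini_tonelli_G.
 apply: ge0_le_integral => //.
 - move=> z _; pos.
 - exact: mfun_Nb.
 - by apply: measurable_funeM; exact: measurable_fun_fubini_tonelli_G.
 - move=> z _.
  have mGz : measurable_fun D (fun w => G w (x - l *: vec3 z) : mR R).
   have := mG x l => /(measurable_comp mDT _) H.
   have -> : (fun w => G w (x - l *: vec3 z)) =
    (fun p : Om * space3 R => G p.1 (x - l *: vec3 p.2)) \o (fun w => (w, z)) by [].
   apply: (@measurable_comp _ _ _ _ _ _ (D `*` setT)) => //.
    by move=> _ [w Dw <-].
   by apply: measurable_funTS; exact: measurable_pair2.
  have J := @jensen3 R _ Om mu D k (fun w => `|G w (x - l *: vec3 z)|) `|g (x - l *: vec3 z)| m mD mk
   (measurableT_comp (@normr_measurable R setT) mGz) k0 (fun w _ => normr_ge0 _) (normr_ge0 _) m0 km (gG _).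
  rewrite EFinM; apply: (le_trans (lee_wpmul2l _ J)); first pos.
  rewrite muleCA lee_wpmul2l ?lee_fin//.
  rewrite -ge0_integralZl_EFin//; last 3 first.
  - move=> w Dw; pos.
  - apply/measurable_EFinP; apply: measurable_funM.
    rewrite (_ : (fun _ => _) = (fun w => (k w)^-1 ^+ 2)); last by apply/funext => w; rewrite exprVn.
    by apply: measurable_funX; exact: (mfun_inv_pos mk k0).
   by apply: measurable_funX; apply: measurableT_comp.
  - exact: Wg_ge0.
  rewrite integral_mkcond; apply: ge0_le_integral => //.
  - by move=> w _; apply: erestrict_ge0 => // w' Dw'; rewrite mule_ge0 ?lee_fin ?Wg_ge0// mulr_ge0 ?invr_ge0 ?exprn_ge0// ltW// k0.
  - apply/(measurable_restrictT _ mD); apply: measurable_funeM.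
   apply/measurable_EFinP; apply: measurable_funM.
    rewrite (_ : (fun _ => _) = (fun w => (k w)^-1 ^+ 2)); last by apply/funext => w; rewrite exprVn.
    by apply: measurable_funX; exact: (mfun_inv_pos mk k0).
   by apply: measurable_funX; apply: measurableT_comp.
  - exact: (measurableT_comp mh (measurable_pair2 z)).
  - move=> w _; rewrite patchE; case: ifPn => [/set_mem Dw|/negP nDw].
    by rewrite hD// /h0 /= -EFinM lee_fin mulrCA.
   by rewrite h00.
apply: (le_trans (lee_wpmul2l _ S1)); first by rewrite lee_fin.
rewrite -(@fubini_tonelli _ _ _ _ R mu leb3 h mh h00).
rewrite muleCA -ge0_integralZl_EFin//; last 2 first.
- by move=> w _; exact: integral_ge0.
- exact: measurable_fun_fubini_tonelli_F.
apply: (@le_trans _ _ ((m ^+ 2)%:E * ((mx ^+ 3)%:E * \int[mu]_(w in D) (k w)%:E))%E).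
 rewrite lee_wpmul2l ?lee_fin//.
 rewrite -ge0_integralZl_EFin//; last 3 first.
 - by move=> w Dw; rewrite lee_fin ltW// k0.
 - exact/measurable_EFinP.
 - pos.
 rewrite [in leRHS]integral_mkcond; apply: ge0_le_integral => //.
 - by move=> w _; rewrite mule_ge0 ?lee_fin//; exact: integral_ge0.
 - by apply: measurable_funeM; exact: measurable_fun_fubini_tonelli_F.
 - apply/(measurable_restrictT _ mD); apply: measurable_funeM; exact/measurable_EFinP.
 - move=> w _; rewrite patchE; case: ifPn => [/set_mem Dw|/negP nDw]; last first.
   rewrite (eq_integral (cst 0%E)) ?integral_cst ?mul0e ?mule0// => z _.
   by rewrite hnD// => Dw; apply: nDw; exact: mem_set.
  rewrite (eq_integral (fun z => ((k w ^- 2)%:E * (Wg (vec3 z) * `|G w (x - l *: vec3 z)| ^+ 3)%:E)%E)); last first.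
   by move=> z _; rewrite hD// /h0 EFinM.
  have mGw : measurable_fun setT (fun z => (Wg (vec3 z) * `|G w (x - l *: vec3 z)| ^+ 3)%:E).
   apply/measurable_EFinP; apply: measurable_funM.
    exact: mfun3_cont cont_Wg.
   apply: measurable_funX; apply: measurableT_comp => //.
   have -> : (fun z => G w (x - l *: vec3 z)) =
    (fun p : Om * space3 R => G p.1 (x - l *: vec3 p.2)) \o (fun z => (w, z)) by [].
   apply: (@measurable_comp _ _ _ _ _ _ (D `*` setT)) => //.
    by move=> _ [z _ <-].
   exact: mG.
   exact: pair1_measurable.
  have kw := k0 w Dw; have kn : k w != 0 by rewrite gt_eqF.
  rewrite ge0_integralZl_EFin//; last 2 first.
  - move=> z _; pos.
  - pos.
  rewrite muleCA; apply: (le_trans (lee_wpmul2l _ (NG w Dw x l l0))).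
   pos.
  rewrite -EFinM lee_fin -/mx exprMn; apply: le_of_eq; field.
  exact: kn.
rewrite muleA -EFinM; apply: (le_trans (lee_wpmul2l _ km)).
 pos.
by rewrite -EFinM lee_fin -/mx exprMn; apply: le_of_eq; ring.
Qed.

Lemma Nb_Rintegral (D : set (mR R)) (k : R -> R) (G : R -> V -> R) kap (m : R) :
 open (D : set R) -> measurable D -> measurable_fun D (k : mR R -> mR R) -> (forall r, D r -> 0 < k r) -> 0 < m ->
 (\int[leb]_(r in D) (k r)%:E <= m%:E)%E ->
 (forall r y, D r -> {for (r, y), continuous (fun q : R * V => G q.1 q.2)}) ->
 (forall y, leb.-integrable D (EFin \o (fun r : mR R => G r y))) ->
 continuous (fun y => \int[leb]_(r in D) G r y) ->
 (forall r, D r -> Nb kap (G r) (k r)) -> Nb kap (fun y => \int[leb]_(r in D) G r y) m.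
Proof.
move=> oD mD mk k0 m0 km cG iG cI NG; apply: (@Nb_integral _ _ leb D k G) => //.
- move=> x l; apply: (@mfun_comp_open R _ _ _ fst (fun p => x - l *: vec3 p.2) [set z : R * V | D z.1]
  (fun q : R * V => G q.1 q.2)).
 + by apply: measurable_funTS; exact: measurable_fst.
 + move=> i; apply: measurable_funTS.
  have -> : (fun a : mR R * space3 R => (x - l *: vec3 a.2) 0 i) =
   (fun p => x 0 i - l * vec3 p.2 0 i) by apply/funext => p; rewrite !mxE.
  apply: measurable_funB => //; apply: measurable_funM => //.
  exact: (measurableT_comp (mfun_vec3 i) measurable_snd).
 + exact: open_fst.
 + by move=> [r y]; exact: cG.
 + by move=> p [].
- exact: (mfun3_cont cI).
- move=> y; rewrite (EFin_normr_Rintegral mD (iG y)).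
 exact: (le_abse_integral leb mD (measurable_int _ (iG y))).
Qed.

(** The smoothing estimate from L^3 to L^oo, where the norm is read off the window of width l
    centred at x. Jensen with the weight cK W produces the power 5 of cK inside the cube, rounded up
    to 6 because cK >= 1. *)
Lemma hk_Nb_bound s (l : R) f x kap A : 0 < l -> 0 <= A -> continuous f ->
 (exists M, forall x, `|f x| <= M) ->
 Nb kap f A -> l * `|hk s l f x| <= cK s ^+ 2 * (Num.max 1 (kap * l) * A).
Proof.
move=> l0 A0 cf [M fM] Nf.
set mx := Num.max 1 (kap * l); have mx0 : 0 <= mx by rewrite le_max ler01.
have c1 := @cK_ge1 R s; have c0 := @cK_gt0 R s.
have Wp (z : space3 R) : 0 < Wg (vec3 z) by rewrite WgE expR_gt0.
have mf : (mfun3 z, f (x - l *: vec3 z)).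
 exact: mfun3_cont (@cont_affine_comp R f x l cf).
have mW := mfun3_cont (@cont_Wg R).
pose h (z : space3 R) := cK s * Wg (vec3 z) * `|f (x - l *: vec3 z)|.
have mh : measurable_fun setT h.
 by apply: measurable_funM; [exact: measurable_funM|exact: measurableT_comp].
have ih := intg_hk s l x cf fM.
have B : (`|hk s l f x|%:E <= \int[leb3]_z (h z)%:E)%E.
 rewrite EFin_normr_Rintegral//.
 apply: (le_trans (le_abse_integral leb3 measurableT (measurable_int _ ih))).
 apply: ge0_le_integral => //.
 - by apply: measurableT_comp => //; exact: (measurable_int _ ih).
 - exact/measurable_EFinP.
 - by move=> z _; rewrite /= lee_fin normrM ler_wpM2r// Kg_le.
have := @jensen3 R _ _ leb3 setT (fun z => cK s * Wg (vec3 z)) h `|hk s l f x| (cK s ^+ 2)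
 measurableT _ mh _ _ (normr_ge0 _) _ _ B.
move=> /(_ (measurable_funM (measurable_cst _) mW)) /(_ (fun z _ => mulr_gt0 c0 (Wp z))).
move=> /(_ (fun z _ => mulr_ge0 (mulr_ge0 (ltW c0) (ltW (Wp z))) (normr_ge0 _))).
move=> /(_ (exprn_gt0 2 c0)) /(_ (integral_Wg_le s (ltW c0))).
rewrite (eq_integral (fun z => ((cK s)%:E * (Wg (vec3 z) * `|f (x - l *: vec3 z)| ^+ 3)%:E)%E)); last first.
 move=> z _; rewrite -EFinM; congr _%:E; rewrite /h; field.
 by rewrite !gt_eqF.
rewrite ge0_integralZl_EFin//; last 3 first.
- move=> z _; pos.
- by apply: mfun_Nb; exact: mfun3_cont.
- exact: ltW.
move=> H.
have {}H : ((l ^+ 3 * `|hk s l f x| ^+ 3)%:E <= (cK s ^+ 5 * (mx * A) ^+ 3)%:E)%E.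
 rewrite EFinM; apply: (le_trans (lee_wpmul2l _ H)); first pos.
 rewrite muleCA [X in (_ * X)%E]muleCA.
 apply: (le_trans (lee_wpmul2l _ (lee_wpmul2l _ (Nf x l l0)))).
 - pos.
 - by rewrite lee_fin ltW.
 by rewrite -!EFinM lee_fin; apply: le_of_eq; rewrite -/mx; ring.
move: H; rewrite lee_fin -exprMn => H.
have cc : cK s ^+ 5 * (mx * A) ^+ 3 <= (cK s ^+ 2 * (mx * A)) ^+ 3.
 rewrite [leRHS]exprMn -[X in _ <= X * _]exprM; apply: ler_wpM2r.
  pos.
 by rewrite ler_weXn2l.
move: (le_trans H cc); rewrite ler_pXn2r// nnegrE ?mulr_ge0 ?exprn_ge0 ?(ltW c0) ?(ltW l0)//.
Qed.

Lemma Nb_translate kap f A (d : V) : Nb kap f A -> Nb kap (fun y => f (y - d)) A.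
Proof.
move=> Nf x l l0; have := Nf (x - d) l l0; congr (_ * _ <= _)%E.
by apply: eq_integral => z _; rewrite addrAC.
Qed.

(** Minkowski over the translates of f by l z, which all have the window bound of f. *)
Lemma Nb_hk s l kap f A : 0 <= A -> continuous f -> (exists M, forall x, `|f x| <= M) ->
 Nb kap f A -> Nb kap (hk s l f) (cK s ^+ 2 * A).
Proof.
move=> A0 cf [M fM] Nf; have c0 := @cK_gt0 R s.
have Wp (z : space3 R) : 0 < Wg (vec3 z) by rewrite WgE expR_gt0.
have mW := mfun3_cont (@cont_Wg R).
(* Minkowski's inequality above needs positive bounds; A = 0 is reached as a limit of positive
   ones. *)
suff H A' : 0 < A' -> Nb kap f A' -> Nb kap (hk s l f) (cK s ^+ 2 * A').
 move: A0; rewrite le_eqVlt => /predU1P[AE|A0]; last exact: H.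
 rewrite -AE mulr0 => x r r0; have mx0 : 0 < Num.max 1 (kap * r) by rewrite lt_max ltr01.
 rewrite mulr0 expr0n/=; apply/lee_addgt0Pr => e e0; rewrite add0e.
 (* Chosen so that the quantity to be cubed is min(1, e), whose cube is at most e. *)
 pose a := Num.min 1 e / (cK s ^+ 2 * Num.max 1 (kap * r)).
 have m0 : 0 < Num.min 1 e by rewrite lt_min ltr01.
 have a0 : 0 < a by rewrite divr_gt0// mulr_gt0// exprn_gt0.
 have Na : Nb kap f a by apply: (Nb_weaken _ _ Nf); rewrite -AE// ltW.
 apply: (le_trans (H a a0 Na x r r0)); rewrite lee_fin.
 have -> : Num.max 1 (kap * r) * (cK s ^+ 2 * a) = Num.min 1 e.
  by rewrite /a; field; rewrite !gt_eqF// lt_max ltr01.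
 rewrite (@le_trans _ _ (Num.min 1 e))// ?ge_min ?lexx ?orbT//.
 by rewrite -[leRHS]expr1 ler_wiXn2l ?(ltW m0)// ge_min lexx.
move=> A0' NA.
apply: (@Nb_integral _ _ leb3 setT (fun z => cK s * A' * Wg (vec3 z))
 (fun z y => Kg s (vec3 z) * f (y - l *: vec3 z))) => //.
- exact: measurable_funM.
- move=> z _; pos.
- pos.
- by rewrite expr2 -mulrA; apply: integral_Wg_le; rewrite mulr_ge0// ltW.
- move=> x r; rewrite setXTT; apply: measurable_funM.
  exact: (measurableT_comp (mfun3_cont (@cont_Kg R s)) measurable_fst).
 apply: (@mfun_comp_continuous R _ _ _ (fun p : space3 R * space3 R => x - r *: vec3 p.2 - l *: vec3 p.1) f) => // i.
 have -> : (fun p : space3 R * space3 R => (x - r *: vec3 p.2 - l *: vec3 p.1) 0 i) =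
  (fun p => x 0 i - r * vec3 p.2 0 i - l * vec3 p.1 0 i) by apply/funext => p; rewrite !mxE.
 apply: measurable_funB.
  apply: measurable_funB => //; apply: measurable_funM => //.
  exact: (measurableT_comp (mfun_vec3 i) measurable_snd).
 apply: measurable_funM => //.
 exact: (measurableT_comp (mfun_vec3 i) measurable_fst).
- apply: mfun3_cont; apply: cont_hk => //; by exists M.
- move=> y; have ih := intg_hk s l y cf fM.
 rewrite EFin_normr_Rintegral//.
 apply: (le_trans (le_abse_integral leb3 measurableT (measurable_int _ ih))).
 by rewrite (eq_integral (fun z => (`|Kg s (vec3 z) * f (y - l *: vec3 z)|)%:E)).
- move=> z _; rewrite mulrAC.
 have cfd : continuous (fun y : V => f (y - l *: vec3 z)).
  move=> y; apply: (@continuous_comp _ _ _ (fun y : V => y - l *: vec3 z) f); last exact: cf.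
  by apply: cvg_subscale; [exact: cvg_id|exact: cst_continuous|exact: cst_continuous].
 apply: (@Nb_le _ _ (fun y => f (y - l *: vec3 z))).
 + by apply: measurable_funM => //; exact: (mfun3_cont cfd).
 + exact: (mfun3_cont cfd).
 + pos.
 + by move=> y; rewrite normrM ler_wpM2r// Kg_le.
 + exact: Nb_translate.
Qed.

End WindowNorm.

(** * Integrals of the heat operators over large times *)

Section NonlocalOperators.
Context {R : realType}.
Local Notation V := 'rV[R]_3.
Implicit Types (f g : V -> R) (s t : seq 'I_3) (kap A : R).

Lemma D1_gt0 (r : R) : D1 r -> 0 < r.
Proof. by rewrite /= in_itv/= andbT => /(lt_trans _)-> . Qed.

Lemma mD1 : measurable (D1 : set (mR R)). Proof. exact: measurable_itv. Qed.

Lemma mfun_inv2 : measurable_fun D1 (fun r : mR R => r ^- 2 : mR R).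
Proof.
rewrite (_ : (fun _ => _) = (fun r => r^-1 ^+ 2)); last by apply/funext => w; rewrite exprVn.
apply: measurable_funX; apply: mfun_inv_pos; first exact: measurable_id.
exact: D1_gt0.
Qed.

Lemma integral_inv2 : (\int[leb]_(r in D1) (r ^- 2 : R)%:E = 1)%E.
Proof.
have D (x : R) : 0 < x -> is_derive x 1 (fun r : R => - r^-1) (x ^- 2).
 move=> x0; have xn : x != 0 by rewrite gt_eqF.
 apply: (is_derive_eq (is_deriveN (is_deriveV xn (is_derive_id x 1)))).
 by rewrite /GRing.scale/=; field.
have c (x : R) : 0 < x -> {for x, continuous (fun r : R => r ^- 2)}.
 move=> x0; apply: cvgV; first by rewrite expf_neq0// gt_eqF.
 exact: exprn_continuous.
rewrite integral_itv_obnd_cbnd//; last first.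
 apply/measurable_EFinP.
 apply: mfun_inv2.
rewrite (@ge0_continuous_FTC2y R (fun r => r ^- 2) (fun r => - r^-1) 1 0).
- by rewrite invr1 EFinN oppeK add0e.
- move=> x x1; pos.
- apply/continuous_within_itvcyP; split.
  by move=> x; rewrite in_itv/= andbT => x1; apply: c; exact: lt_trans x1.
 by apply: cvg_at_right_filter; exact: (c 1 ltr01).
- rewrite -oppr0; apply: cvgN; apply/(@gtr0_cvgV0 _ _ _ _ id); last exact: cvg_id.
 exact: nbhs_pinfty_gt.
- by move=> x x1; have [] := D x (lt_trans ltr01 x1).
- by apply: cvg_at_right_filter; apply: cvgN; apply: (@cvgV _ _ _ _ id _ (oner_neq0 R)); exact: cvg_id.
- move=> x; rewrite in_itv/= andbT => x1.
 by rewrite derive1E; exact: is_derive_val (D x (lt_trans ltr01 x1)).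
Qed.

Lemma intg_inv2 (c : R) : leb.-integrable D1 (EFin \o (fun r : mR R => c * r ^- 2)).
Proof.
apply: intgZ_real; first exact: mD1.
apply/integrableP; split; first by apply/measurable_EFinP; exact: mfun_inv2.
under eq_integral => r rD.
 rewrite /= ger0_norm; last pos.
 over.
by rewrite integral_inv2 ltry.
Qed.

(* A singular integral operator of order |s| - 2: for |s| = 3 and mu = sqrt t
  this is [\int_t^oo D^s e^(tau Laplacian) f dtau], with tau = (mu r) ^ 2. *)
Definition Rk s (mu : R) f (x : V) : R :=
 (\int[leb]_(r in D1) (2 * mu^-1 * r ^- 2 * hk s (mu * r) f x))%R.

Lemma CB_stc k f : CB k f -> stc setT (fun _ : R => f).
Proof.
move=> fk; have [M fM] := CB_bnd fk; have cf := CB_cont fk; split.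
 move=> t y _; apply: (@continuous_comp _ _ _ snd f); [exact: cvg_snd|exact: cf].
by move=> t _; exists M; apply: near_all => ?; exact: fM.
Qed.

Lemma cont_hk_scaled k s (mu : R) f (q : R * V) : CB k f ->
 {for q, continuous (fun q : R * V => hk s (mu * q.1) f q.2)}.
Proof.
move=> fk; case: q => r x.
have := @hk_cont R setT (fun _ : R => f) s (mu * r) 0 x openT (CB_stc fk) I => c.
apply: (@continuous_comp _ _ _ (fun q : R * V => (mu * q.1, (0 : R, q.2)))
 (fun q : R * (R * V) => hk s q.1 f q.2.2)); last exact: c.
apply: cvg_pairN; first cts.
cts.
Qed.

Lemma mfun_hk_scaled k s (mu : R) f (x : V) : CB k f ->
 measurable_fun setT (fun r : mR R => hk s (mu * r) f x : mR R).
Proof.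
move=> fk; apply: continuous_measurable_fun => r.
apply: (@continuous_comp _ _ _ (fun r : R => (r, x)) (fun q : R * V => hk s (mu * q.1) f q.2)).
 cts.
exact: cont_hk_scaled fk.
Qed.

Lemma mfun_Rk k s (mu : R) f x : CB k f ->
 measurable_fun D1 (fun r : mR R =>
  2 * mu^-1 * r ^- 2 * hk s (mu * r) f x : mR R).
Proof.
move=> fk; apply: measurable_funM; last by apply: measurable_funTS; exact: mfun_hk_scaled fk.
by apply: measurable_funM => //; exact: mfun_inv2.
Qed.

Lemma Rk_int_bound s (mu r : R) f x (M : R) : 0 < mu -> 0 < r -> continuous f -> (forall x, `|f x| <= M) ->
 `|2 * mu^-1 * r ^- 2 * hk s (mu * r) f x| <= 2 * mu^-1 * (cK s * (cK s * M)) * r ^- 2.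
Proof.
move=> mu0 r0 cf fM; have q0 : 0 <= 2 * mu^-1 * r ^- 2.
 pos.
rewrite normrM ger0_norm//; apply: (le_trans (ler_wpM2l q0 (hk_bound s _ x cf fM))).
by apply: le_of_eq; ring.
Qed.

Lemma intg_Rk k s (mu : R) f x : 0 < mu -> CB k f ->
 leb.-integrable D1 (EFin \o (fun r : mR R => 2 * mu^-1 * r ^- 2 * hk s (mu * r) f x)).
Proof.
move=> mu0 fk; have [M fM] := CB_bnd fk.
apply: (le_intg mD1 (mfun_Rk s mu x fk) (intg_inv2 (2 * mu^-1 * (cK s * (cK s * M))))).
by move=> r /D1_gt0 r0; apply: Rk_int_bound => //; exact: CB_cont fk.
Qed.

Lemma Rk_le (s : seq 'I_3) (mu : R) f x (c : R) k : 0 < mu -> CB k f -> 0 <= c ->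
 (forall r, 0 < r -> 1 < r -> `|2 * mu^-1 * r ^- 2 * hk s (mu * r) f x| <= c * r ^- 2) -> `|Rk s mu f x| <= c.
Proof.
move=> mu0 fk c0 H.
apply: (@Rintegral_le_ge0 R _ _ leb D1 _ (fun r => c * r ^- 2) c mD1 (mfun_Rk s mu x fk)).
- by apply: measurable_funM => //; exact: mfun_inv2.
- move=> r Dr; apply: H; first exact: D1_gt0.
 by move: Dr; rewrite /= in_itv/= andbT.
under eq_integral do rewrite EFinM.
rewrite ge0_integralZl_EFin//; first by rewrite integral_inv2 mule1.
- move=> r _; pos.
- by apply/measurable_EFinP; exact: mfun_inv2.
Qed.

Lemma Rk_bound k s (mu : R) f x (M : R) : 0 < mu -> CB k f -> (forall x, `|f x| <= M) ->
 `|Rk s mu f x| <= 2 * mu^-1 * (cK s * (cK s * M)).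
Proof.
move=> mu0 fk fM; have M0 : 0 <= M by rewrite (le_trans _ (fM 0)).
have c0 := @cK_gt0 R s.
apply: (Rk_le mu0 fk).
 pos.
by move=> r r0 _; apply: Rk_int_bound => //; exact: CB_cont fk.
Qed.

(** All derivatives are put on the kernel at length mu r, where they gain (mu r)^-|t|; for r > 1 the
    factor max(1, kap mu r) / (mu r) of the smoothing estimate is at most 1 / mu + kap. *)
Lemma Rk_Nb_bound t s (mu : R) f x kap A : 0 < mu -> 0 <= kap -> 0 <= A ->
 CB (size t) f -> Nb kap f A ->
 mu ^+ size t * `|Rk s mu (partials t f) x| <= 2 * cK (t ++ s) ^+ 2 * A * (mu^-1 * (mu^-1 + kap)).
Proof.
move=> mu0 kap0 A0 ft Nf.
have fp : CB 0 (partials t f) by rewrite -(subnn (size t)); exact: CB_partials.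
have mut : 0 < mu ^+ size t by pos.
have c0 := @cK_gt0 R (t ++ s).
rewrite -ler_pdivlMl//; apply: (Rk_le mu0 fp).
 pos.
move=> r r0 r1.
have mr0 : 0 < mu * r by pos.
have E := @hk_ibps R (size t) t s (mu * r) f x ft (leqnn _).
have mrt : 0 < (mu * r) ^+ size t by pos.
have B := hk_Nb_bound (t ++ s) x mr0 A0 (CB_cont ft) (CB_bnd ft) Nf.
have E' : hk s (mu * r) (partials t f) x = ((mu * r) ^+ size t)^-1 * hk (t ++ s) (mu * r) f x.
 by rewrite -E mulKf// gt_eqF.
move: (hk (t ++ s) (mu * r) f x) B E' => h B E'.
have h1 : `|h| <= cK (t ++ s) ^+ 2 * A * (mu^-1 + kap).
 rewrite -(ler_pM2l mr0); apply: (le_trans B).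
 have -> : mu * r * (cK (t ++ s) ^+ 2 * A * (mu^-1 + kap)) =
  cK (t ++ s) ^+ 2 * ((r + kap * (mu * r)) * A) by field; rewrite gt_eqF.
 apply: ler_wpM2l; first pos.
 apply: ler_wpM2r => //; rewrite ge_max; apply/andP; split.
  by rewrite (le_trans (ltW r1))// lerDl mulr_ge0// ltW.
 by rewrite lerDr ltW.
have h2 : ((mu * r) ^+ size t)^-1 <= (mu ^+ size t)^-1.
 rewrite lef_pV2 ?posrE// lerXn2r ?nnegrE ?(ltW mu0) ?(ltW mr0)//.
 by rewrite ler_peMr// ltW.
have q0 : 0 <= 2 * mu^-1 * r ^- 2 by pos.
rewrite E' normrM (ger0_norm q0) normrM.
rewrite (@ger0_norm _ ((mu * r) ^- size t)); last pos.
have mun : mu ^+ size t != 0 by rewrite gt_eqF.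
have -> : mu ^- size t * (2 * cK (t ++ s) ^+ 2 * A * (mu^-1 * (mu^-1 + kap))) * r ^- 2 =
 2 * mu^-1 * r ^- 2 * (mu ^- size t * (cK (t ++ s) ^+ 2 * A * (mu^-1 + kap))).
 by move: (mu ^- _) (r ^- 2) (mu^-1) => a b c; ring.
apply: ler_wpM2l => //; apply: ler_pM => //; pos.
Qed.

Lemma Rk_cont I u s (mu t : R) x : open I -> stc I u -> I t -> 0 < mu ->
 {for (mu, (t, x)), continuous
   (fun q : R * (R * V) => Rk s q.1 (u q.2.1) q.2.2)}.
Proof.
move=> oI su It mu0.
have [M HM] := su.2 t It.
have It' : \forall s \near t, I s by exact: open_nbhs_nbhs.
have near1 (P : R -> Prop) : (\forall s \near mu, P s) ->
  \forall q \near ((mu, (t, x)) : R * (R * V)), P q.1.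
 by move=> HP; have c : fst @ ((mu, (t, x)) : R * (R * V)) --> mu by [exact: cvg_fst]; exact: (c _ HP).
have near2 (P : R -> Prop) : (\forall s \near t, P s) ->
  \forall q \near ((mu, (t, x)) : R * (R * V)), P q.2.1.
 move=> HP; have c : (fun q : R * (R * V) => q.2.1) @ (mu, (t, x)) --> t.
  by apply: (@cvg_comp _ _ _ snd fst); [exact: cvg_snd|exact: cvg_fst].
 exact: (c _ HP).
have mu2 : 0 < mu / 2 by pos.
have Hmu : \forall q \near ((mu, (t, x)) : R * (R * V)), mu / 2 < q.1.
 by apply: (near1 (fun m => mu / 2 < m)); apply: lt_nbhsr; rewrite ltr_pdivrMr// mulr_natr mulr2n ltrDl.
have M0 : 0 <= M by rewrite (le_trans _ (nbhs_singleton HM 0)).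
have c0 := @cK_gt0 R s.
apply: (cont_int mD1
 (f := fun (q : R * (R * V)) (r : mR R) => 2 * q.1^-1 * r ^- 2 * hk s (q.1 * r) (u q.2.1) q.2.2)
 (intg_inv2 (2 * (mu / 2)^-1 * (cK s * (cK s * M))))).
- apply: filterS2 (near2 _ It') (near2 _ HM) => q Iq Mq.
 apply: (@mfun_Rk 0); move=> [|//] _; split => //; first exact: stc_cont su Iq.
 by exists M.
- apply: filterS3 (near2 _ It') (near2 _ HM) Hmu => q Iq uM qmu r /D1_gt0 r0.
 have q0 : 0 < q.1 := lt_trans mu2 qmu.
 apply: (le_trans (Rk_int_bound s q.2.2 q0 r0 (stc_cont su Iq) uM)).
 rewrite ler_wpM2r ?invr_ge0 ?exprn_ge0 ?(ltW r0)//.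
 rewrite ler_wpM2r ?mulr_ge0 ?(ltW c0)// ler_wpM2l// lef_pV2 ?posrE//.
 exact: ltW.
- apply: aeW => r /D1_gt0 r0; apply: cvgM.
  apply: cvgM; last exact: cst_continuous.
  apply: cvgM; first exact: cst_continuous.
  by apply: cvgV; [rewrite gt_eqF|exact: cvg_fst].
 have := @hk_cont R I u s (mu * r) t x oI su It => c.
 have p2 : (fun q : R * (R * V) => (q.1 * r, q.2)) @ (mu, (t, x)) --> ((mu * r, (t, x)) : R * (R * V)).
  cts.
 exact: (cvg_comp _ _ p2 c).
Qed.

(** The integrand is differentiated under the integral; the weight r^-2 alone is integrable on (1,
    oo), so bounded derivatives of f are enough for the domination. *)
Lemma Rk_derive s (mu : R) f x i : 0 < mu -> CB 1 f ->
 is_derive x (e_ i) (Rk s mu f) (Rk s mu (partial i f) x).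
Proof.
move=> mu0 f1; have [M' fM'] := CB_bnd (CB_partial i f1).
have cp := CB_cont (CB_partial i f1).
have D (y : V) (r : R) : is_derive y (e_ i) (fun y => 2 * mu^-1 * r ^- 2 * hk s (mu * r) f y)
  (2 * mu^-1 * r ^- 2 * hk s (mu * r) (partial i f) y).
 exact: (is_deriveZ (2 * mu^-1 * r ^- 2) (hk_derive s (mu * r) y i f1)).
have H := @is_derive_int _ _ _ leb D1 mD1 _
 (fun (y : V) (r : mR R) => 2 * mu^-1 * r ^- 2 * hk s (mu * r) f y)
 (fun r => 2 * mu^-1 * (cK s * (cK s * M')) * r ^- 2) x (e_ i)
 (fun h _ => intg_Rk s _ mu0 f1)
 (fun h r _ _ => (D (h *: e_ i + x) r).(ex_derive)) (intg_inv2 _).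
apply: (is_derive_eq (H _)).
 by move=> h r _ /D1_gt0 r0; rewrite (is_derive_val (D (h *: e_ i + x) r)); exact: Rk_int_bound.
by apply: eq_Rintegral => r _; rewrite (is_derive_val (D x r)).
Qed.

Lemma Rk_partials k t s mu f : 0 < mu -> CB k f -> (size t <= k)%N ->
 partials t (Rk s mu f) = Rk s mu (partials t f).
Proof.
move=> mu0 fk; elim: t => // i t IH tk /=; rewrite IH; last exact: ltnW.
apply/funext => x; have H := @Rk_derive s mu (partials t f) x i mu0.
apply: is_derive_val; apply: H; apply: CB_le (CB_partials fk (ltnW tk)).
by rewrite subn_gt0.
Qed.

Lemma CB0 f : CB 0 f <-> continuous f /\ exists M : R, forall x, `|f x| <= M.
Proof.
split=> [f0|[cf bf]]; first by split; [exact: CB_cont f0|exact: CB_bnd f0].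
by move=> [|//] _; split.
Qed.

Lemma CB_Rk k s mu f : 0 < mu -> CB k f -> CB k (Rk s mu f).
Proof.
move=> mu0 fk t tk; rewrite (Rk_partials _ mu0 fk tk); have [cf bf df] := fk t tk.
have [M fM] := bf; have f0 : CB 0 (partials t f) by apply/CB0; split.
split.
- move=> x.
 have := @Rk_cont setT (fun _ : R => partials t f) s mu 0 x openT (CB_stc f0) I mu0 => c.
 apply: (@continuous_comp _ _ _ (fun x : V => (mu, (0 : R, x)))
  (fun q : R * (R * V) => Rk s q.1 (partials t f) q.2.2)); last exact: c.
 cts.
- by exists (2 * mu^-1 * (cK s * (cK s * M))) => x; exact: Rk_bound f0 fM.
- move=> tk' i x; have [] // := @Rk_derive s mu (partials t f) x i mu0.
 by apply: CB_le (CB_partials fk tk); rewrite subn_gt0.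
Qed.

Lemma Nb_Rk k s mu kap f A : 0 < mu -> 0 < A -> CB k f -> Nb kap f A ->
 Nb kap (Rk s mu f) (2 * mu^-1 * cK s ^+ 2 * A).
Proof.
move=> mu0 A0 fk Nf; have c0 := @cK_gt0 R s.
have C0 : 0 < 2 * mu^-1 * cK s ^+ 2 * A by pos.
have f0 : CB 0 f := CB_le (leq0n _) fk.
apply: (@Nb_Rintegral R D1 (fun r => 2 * mu^-1 * cK s ^+ 2 * A * r ^- 2)
 (fun r y => 2 * mu^-1 * r ^- 2 * hk s (mu * r) f y)) => //.
- by apply: measurable_funM => //; exact: mfun_inv2.
- move=> r /D1_gt0 r0; pos.
- under eq_integral do rewrite EFinM.
 rewrite ge0_integralZl_EFin//; first by rewrite integral_inv2 mule1.
 + move=> r _; pos.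
 + by apply/measurable_EFinP; exact: mfun_inv2.
 + exact: ltW.
- move=> r y /D1_gt0 r0; apply: cvgM; last exact: cont_hk_scaled f0.
 apply: cvgM; first exact: cvg_cst.
 apply: cvgV; first by rewrite expf_neq0// gt_eqF.
 by apply: (@cvg_comp _ _ _ fst (fun z : R => z ^+ 2)); [exact: cvg_fst|exact: exprn_continuous].
- by move=> y; exact: (intg_Rk s y mu0 f0).
- exact: CB_cont (CB_Rk s mu0 f0).
- move=> r /D1_gt0 r0.
 have q0 : 0 <= 2 * mu^-1 * r ^- 2 by pos.
 have -> : 2 * mu^-1 * cK s ^+ 2 * A * r ^- 2 = (2 * mu^-1 * r ^- 2) * (cK s ^+ 2 * A).
  by move: (r ^- 2) => a; ring.
 have ch : continuous (hk s (mu * r) f) by exact: cont_hk (CB_cont f0) (CB_bnd f0).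
 apply: Nb_scale q0 ch _; exact: Nb_hk (ltW A0) (CB_cont f0) (CB_bnd f0) Nf.
Qed.

Lemma hkB s l f g x : CB 0 f -> CB 0 g -> hk s l (fun y => f y - g y) x = hk s l f x - hk s l g x.
Proof.
move=> f0 g0; have if0 := intg_hkCB s l x f0; have ig0 := intg_hkCB s l x g0.
by rewrite /hk -RintegralB//; apply: eq_Rintegral => z _; rewrite mulrBr.
Qed.

Lemma RkB s mu f g x : 0 < mu -> CB 0 f -> CB 0 g ->
 Rk s mu (fun y => f y - g y) x = Rk s mu f x - Rk s mu g x.
Proof.
move=> mu0 f0 g0; rewrite /Rk -RintegralB//.
- by apply: eq_Rintegral => r _; rewrite hkB// mulrBr.
- exact: (intg_Rk s x mu0 f0).
- exact: (intg_Rk s x mu0 g0).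
Qed.

End NonlocalOperators.

(** * Derivative bounds that grow geometrically with the order *)

Section DerivativeBounds.
Context {R : realType}.
Local Notation V := 'rV[R]_3.
Implicit Types (f g : V -> R) (s : seq 'I_3) (M N a : R).

Lemma partials_rcons s i f : partials (rcons s i) f = partials s (partial i f).
Proof. by rewrite -cats1 partials_cat. Qed.

(** An amplitude M and an inverse length a. Parabolic smoothing at time t gives bounds of this form
    with a = t^(-1/2), so two numbers stand for a bound at each order. *)
Definition DB k M a f := CB k f /\
 forall s, (size s <= k)%N -> forall x, `|partials s f x| <= M * a ^+ size s.

(** Lists are split at their last index, the one that acts first on f; the induction hypotheses are
    then applied to the first derivatives of f. *)
Lemma DB_succ k M a f : 0 <= M -> 0 <= a -> continuous f -> (forall x, `|f x| <= M) ->
 (forall i x, derivable f x (e_ i)) ->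
 (forall i, DB k (M * a) a (partial i f)) -> DB k.+1 M a f.
Proof.
move=> M0 a0 cf fM df H; split.
 move=> s; case/lastP: s => [_|s i].
  by split => //; exists M.
 rewrite size_rcons ltnS partials_rcons => sk; have [cp bp dp] := (H i).1 s sk.
 by split.
move=> s; case/lastP: s => [_ x|s i]; first by rewrite expr0 mulr1.
rewrite size_rcons ltnS partials_rcons => sk x.
by rewrite exprS mulrA; exact: (H i).2.
Qed.

Lemma DB_CB k M a f : DB k M a f -> CB k f. Proof. by case. Qed.

Lemma DB0 k M a f : DB k M a f -> forall x, `|f x| <= M.
Proof. by move=> [_ /(_ [::] isT)] H x; have := H x; rewrite expr0 mulr1. Qed.

Lemma DB_ge0 k M a f : DB k M a f -> 0 <= M.
Proof. by move=> /DB0 /(_ 0); exact: le_trans. Qed.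

Lemma DB_partial k M a f i : DB k.+1 M a f -> DB k (M * a) a (partial i f).
Proof.
move=> [cf bf]; split; first exact: CB_partial.
move=> s sk x; rewrite -partials_rcons.
by have := bf (rcons s i) _ x; rewrite size_rcons exprS mulrA; exact.
Qed.

Lemma DB_partials k M a f s : (size s <= k)%N -> DB k M a f -> DB (k - size s) (M * a ^+ size s) a (partials s f).
Proof.
move=> sk [cf bf]; split; first exact: CB_partials.
move=> t tk x; rewrite -partials_cat -mulrA -exprD addnC -size_cat; apply: bf.
by rewrite size_cat addnC -leq_subRL.
Qed.

Lemma DB_weaken k k' M M' a a' f : (k' <= k)%N -> M <= M' -> 0 <= a -> a <= a' -> DB k M a f -> DB k' M' a' f.
Proof.
move=> kk MM a0 aa H; have M0 := DB_ge0 H; case: H => cf bf; split; first exact: CB_le cf.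
move=> s sk x; apply: (le_trans (bf s (leq_trans sk kk) x)).
by apply: ler_pM => //; rewrite ?exprn_ge0// lerXn2r// ?nnegrE// (le_trans a0).
Qed.

Lemma CB_DB k f : CB k f -> exists2 M : R, 0 <= M & DB k M 1 f.
Proof.
elim: k f => [|k IH] f cf.
 have [M fM] := CB_bnd cf; exists M; first exact: le_trans (fM 0).
 by split => // -[|//] _ x; rewrite expr0 mulr1.
have [M fM] := CB_bnd cf.
have M0 : 0 <= M by exact: le_trans (fM 0).
have /choice[N HN] : forall i, exists N : R, 0 <= N /\ DB k N 1 (partial i f).
 by move=> i; have [N N0 HN] := IH _ (CB_partial i cf); exists N.
have S0 : 0 <= \sum_(i < 3) N i by apply: sumr_ge0 => i _; case: (HN i).
exists (M + \sum_(i < 3) N i); first pos.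
apply: DB_succ => //.
- pos.
- exact: CB_cont cf.
- by move=> x; rewrite (le_trans (fM x))// lerDl.
- exact: CB_derivable cf.
- move=> i; rewrite mulr1; have [N0 Hi] := HN i.
 apply: DB_weaken Hi => //; rewrite (bigD1 i)//= addrCA lerDl addr_ge0//.
 by apply: sumr_ge0 => j _; case: (HN j).
Qed.

Lemma partialE f g i x : is_derive x (e_ i) f (g x) -> partial i f x = g x.
Proof. exact: is_derive_val. Qed.

Lemma partialD f g i : (forall x, derivable f x (e_ i)) -> (forall x, derivable g x (e_ i)) ->
 partial i (fun x => f x + g x) = (fun x => partial i f x + partial i g x).
Proof. by move=> df dg; apply/funext => x; exact: deriveD. Qed.

Lemma partialZ c f i : (forall x, derivable f x (e_ i)) ->
 partial i (fun x => c * f x) = (fun x => c * partial i f x).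
Proof. by move=> df; apply/funext => x; exact: deriveZ. Qed.

Lemma partialM f g i : (forall x, derivable f x (e_ i)) -> (forall x, derivable g x (e_ i)) ->
 partial i (fun x => f x * g x) = (fun x => partial i f x * g x + f x * partial i g x).
Proof.
move=> df dg; apply/funext => x; apply: etrans (deriveM (df x) (dg x)) _.
by rewrite addrC; congr (_ + _); exact: mulrC.
Qed.

Lemma DB_cont k M a f : DB k M a f -> continuous f.
Proof. by move=> [/CB_cont]. Qed.

Lemma cont_add f g : continuous f -> continuous g -> continuous (fun x => f x + g x).
Proof. by move=> cf cg x; exact: (continuousD (cf x) (cg x)). Qed.

Lemma cont_mul f g : continuous f -> continuous g -> continuous (fun x => f x * g x).
Proof. by move=> cf cg x; exact: (continuousM (cf x) (cg x)). Qed.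

Lemma DB_add k M N a f g : 0 <= a -> DB k M a f -> DB k N a g -> DB k (M + N) a (fun x => f x + g x).
Proof.
move=> a0; elim: k M N f g => [|k IH] M N f g df dg.
 split; last by case=> // _ x; rewrite expr0 mulr1 (le_trans (ler_normD _ _))// lerD// ?(DB0 df)// (DB0 dg).
 apply/CB0; split; first by apply: cont_add; [exact: DB_cont df|exact: DB_cont dg].
 by exists (M + N) => x; rewrite (le_trans (ler_normD _ _))// lerD// ?(DB0 df)// (DB0 dg).
have Df := CB_derivable (DB_CB df); have Dg := CB_derivable (DB_CB dg).
apply: DB_succ.
- by rewrite addr_ge0 ?(DB_ge0 df) ?(DB_ge0 dg).
- exact: a0.
- by apply: cont_add; [exact: DB_cont df|exact: DB_cont dg].
- by move=> x; rewrite (le_trans (ler_normD _ _))// lerD// ?(DB0 df)// (DB0 dg).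
- by move=> i x; exact: (derivableD (Df i x) (Dg i x)).
- move=> i; rewrite (partialD (Df i) (Dg i)) mulrDl; exact: (IH _ _ _ _ (DB_partial i df) (DB_partial i dg)).
Qed.

Lemma DB_scale k M a c f : 0 <= a -> DB k M a f -> DB k (`|c| * M) a (fun x => c * f x).
Proof.
move=> a0; elim: k M f => [|k IH] M f df.
 split; last by case=> // _ x; rewrite expr0 mulr1 normrM ler_wpM2l// (DB0 df).
 apply/CB0; split; first by apply: cont_mul; [exact: cst_continuous|exact: DB_cont df].
 by exists (`|c| * M) => x; rewrite normrM ler_wpM2l// (DB0 df).
have Df := CB_derivable (DB_CB df).
apply: DB_succ.
- by rewrite mulr_ge0// (DB_ge0 df).
- exact: a0.
- by apply: cont_mul; [exact: cst_continuous|exact: DB_cont df].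
- by move=> x; rewrite normrM ler_wpM2l// (DB0 df).
- by move=> i x; apply: derivableZ; exact: Df.
- by move=> i; rewrite (partialZ c (Df i)) -mulrA; exact: (IH _ _ (DB_partial i df)).
Qed.

(** Leibniz: a derivative of order n of a product has 2^n terms, which the doubled rate absorbs. *)
Lemma DB_mul k M N a f g : 0 <= a -> DB k M a f -> DB k N a g -> DB k (M * N) (2 * a) (fun x => f x * g x).
Proof.
move=> a0; elim: k M N f g => [|k IH] M N f g df dg.
 have b x : `|f x * g x| <= M * N by rewrite normrM ler_pM ?(DB0 df) ?(DB0 dg).
 split; last by case=> [|//] _ x; rewrite expr0 mulr1; exact: b.
 apply/CB0; split; last by exists (M * N).
 by apply: cont_mul; [exact: DB_cont df|exact: DB_cont dg].
have Df := CB_derivable (DB_CB df); have Dg := CB_derivable (DB_CB dg).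
apply: DB_succ.
- by rewrite mulr_ge0 ?(DB_ge0 df) ?(DB_ge0 dg).
- pos.
- by apply: cont_mul; [exact: DB_cont df|exact: DB_cont dg].
- by move=> x; rewrite normrM ler_pM ?(DB0 df) ?(DB0 dg).
- by move=> i x; exact: (derivableM (Df i x) (Dg i x)).
- move=> i; rewrite (partialM (Df i) (Dg i)).
 have -> : M * N * (2 * a) = M * a * N + M * (N * a) by ring.
 apply: DB_add; first pos.
  by apply: IH; [exact: DB_partial|exact: DB_weaken (leqnSn k) (lexx _) a0 (lexx _) dg].
 by apply: IH; [exact: DB_weaken (leqnSn k) (lexx _) a0 (lexx _) df|exact: DB_partial].
Qed.

Lemma CB_add k f g : CB k f -> CB k g -> CB k (fun x => f x + g x).
Proof.
move=> /CB_DB[M _ fM] /CB_DB[N _ gN]; exact: (DB_CB (DB_add ler01 fM gN)).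
Qed.

Lemma CB_scale k c f : CB k f -> CB k (fun x => c * f x).
Proof. by move=> /CB_DB[M _ fM]; exact: (DB_CB (DB_scale c ler01 fM)). Qed.

Lemma CB_mul k f g : CB k f -> CB k g -> CB k (fun x => f x * g x).
Proof.
move=> /CB_DB[M _ fM] /CB_DB[N _ gN]; exact: (DB_CB (DB_mul ler01 fM gN)).
Qed.

Lemma partials_add k s f g : CB k f -> CB k g -> (size s <= k)%N ->
 partials s (fun x => f x + g x) = (fun x => partials s f x + partials s g x).
Proof.
move=> fk gk; elim: s => // i s IH sk /=; rewrite IH; last exact: ltnW.
by have [_ _ df] := fk s (ltnW sk); have [_ _ dg] := gk s (ltnW sk); rewrite partialD//; [exact: df|exact: dg].
Qed.

Lemma partials_scale k s c f : CB k f -> (size s <= k)%N ->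
 partials s (fun x => c * f x) = (fun x => c * partials s f x).
Proof.
move=> fk; elim: s => // i s IH sk /=; rewrite IH; last exact: ltnW.
by have [_ _ df] := fk s (ltnW sk); rewrite partialZ//; exact: df.
Qed.

Lemma DB_sub k M N a f g : 0 <= a -> DB k M a f -> DB k N a g -> DB k (M + N) a (fun x => f x - g x).
Proof.
move=> a0 df dg; have := DB_add a0 df (DB_scale (-1) a0 dg).
rewrite normrN1 mul1r; congr (DB _ _ _ _).
by apply/funext => x; rewrite mulN1r.
Qed.

Lemma CB_sub k f g : CB k f -> CB k g -> CB k (fun x => f x - g x).
Proof.
move=> /CB_DB[M _ fM] /CB_DB[N _ gN]; exact: (DB_CB (DB_sub ler01 fM gN)).
Qed.

Lemma partials_sub k s f g : CB k f -> CB k g -> (size s <= k)%N ->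
 partials s (fun x => f x - g x) = (fun x => partials s f x - partials s g x).
Proof.
move=> fk gk sk.
have -> : (fun x => f x - g x) = (fun x => f x + (-1) * g x) by apply/funext => x; rewrite mulN1r.
rewrite (partials_add fk (CB_scale (-1) gk) sk) (partials_scale _ gk sk).
by apply/funext => x; rewrite mulN1r.
Qed.

Lemma CB_sum k n (F : 'I_n -> V -> R) : (forall i, CB k (F i)) -> CB k (fun x => \sum_(i < n) F i x).
Proof.
elim: n F => [|n IH] F Fk.
 rewrite (_ : (fun _ => _) = (fun=> 0)); last by apply/funext => x; rewrite big_ord0.
 have D0 i : partial i (fun=> 0 : R) = (fun=> 0) :> (V -> R) by apply/funext => x; exact: derive_cst.
 have P s : partials s (fun=> 0 : R) = (fun=> 0) :> (V -> R) by elim: s => //= i s ->; exact: D0.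
 move=> s _; rewrite P; split; first exact: cst_continuous.
  by exists 0 => x; rewrite normr0.
 by move=> _ i x; exact: derivable_cst.
rewrite (_ : (fun _ => _) = (fun x => F ord0 x + \sum_(i < n) F (lift ord0 i) x)); last first.
 by apply/funext => x; rewrite big_ord_recl.
by apply: CB_add => //; exact: IH.
Qed.

End DerivativeBounds.

(** * Differentiating integrals of smooth functions to order k *)

Section IntegralsOfSmoothFunctions.
Context {R : realType}.
Local Notation V := 'rV[R]_3.
Context d (Om : measurableType d) (mu : {measure set Om -> \bar R}).
Variables (D : set Om) (mD : measurable D) (k : nat) (G : Om -> V -> R) (b : nat -> Om -> R).
Hypothesis Gk : forall w, D w -> CB k (G w).
Hypothesis Gm : forall s, (size s <= k)%N -> forall x, measurable_fun D (fun w => partials s (G w) x : mR R).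
Hypothesis bi : forall s : seq 'I_3, (size s <= k)%N -> mu.-integrable D (EFin \o b (size s)).
Hypothesis Gb : forall s, (size s <= k)%N -> forall w x, D w -> `|partials s (G w) x| <= b (size s) w.

Lemma intg_partials s x : (size s <= k)%N -> mu.-integrable D (EFin \o (fun w => partials s (G w) x)).
Proof. by move=> sk; apply: (le_intg mD (Gm sk x) (bi sk)) => w Dw; exact: Gb. Qed.

Lemma is_derive_int_partials s i x : (size s < k)%N ->
 is_derive x (e_ i) (fun y => \int[mu]_(w in D) partials s (G w) y)%R
   (\int[mu]_(w in D) partials (i :: s) (G w) x)%R.
Proof.
move=> sk.
apply: (is_derive_int mD (f := fun y w => partials s (G w) y) (G := b (size s).+1)).
- by move=> h _; apply: intg_partials; exact: ltnW.
- by move=> h w _ Dw; have [_ _ df] := Gk Dw (ltnW sk); exact: df.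
- exact: (@bi (i :: s)).
- by move=> h w _ Dw; exact: (@Gb (i :: s)).
Qed.

Lemma partials_int s : (size s <= k)%N ->
 partials s (fun x => \int[mu]_(w in D) G w x)%R = (fun x => \int[mu]_(w in D) partials s (G w) x)%R.
Proof.
elim: s => // i s IH sk /=; rewrite IH; last exact: ltnW.
by apply/funext => x; exact: is_derive_val (is_derive_int_partials i x sk).
Qed.

Lemma CB_int : CB k (fun x => \int[mu]_(w in D) G w x)%R.
Proof.
move=> s sk; rewrite partials_int//; split.
- move=> x; apply: (cont_int mD (f := fun y w => partials s (G w) y) (bi sk)).
 + by apply: near_all => y; exact: Gm.
 + by apply: near_all => y w Dw; exact: Gb.
 + by apply: aeW => w Dw; have [cf _ _] := Gk Dw sk; exact: cf.
- exists (\int[mu]_(w in D) `|b (size s) w|)%R => x.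
 have ib := integrable_norm (bi sk).
 apply: (le_trans (le_normr_Rintegral mD (intg_partials x sk))).
 apply: le_Rintegral => //; first exact: integrable_norm (intg_partials x sk).
 by move=> w Dw; rewrite (le_trans (Gb sk x Dw))// ler_norm.
- by move=> sk' i x; have [] := is_derive_int_partials i x sk'.
Qed.

End IntegralsOfSmoothFunctions.

(** * The integrable endpoint weight on (0, 1) *)

Section UnitInterval.
Context {R : realType}.

Lemma fatou_le d (T : measurableType d) (mu : {measure set T -> \bar R}) (D : set T)
  (f_ : nat -> T -> R) (f : T -> R) (c : \bar R) : measurable D ->
 (forall n, measurable_fun D (f_ n : T -> mR R)) -> (forall n x, D x -> 0 <= f_ n x) ->
 (forall x, D x -> f_ n x @[n --> \oo] --> f x) ->
 (forall n, \int[mu]_(x in D) (f_ n x)%:E <= c)%E -> (\int[mu]_(x in D) (f x)%:E <= c)%E.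
Proof.
move=> mD mf f0 cf fc.
have mE n : measurable_fun D (fun x => (f_ n x)%:E) by apply/measurable_EFinP; exact: mf.
have := @fatou _ _ _ mu D mD (fun n x => (f_ n x)%:E) mE (fun n x Dx => f0 n x Dx).
rewrite (@eq_integral _ _ _ mu D (fun x => (f x)%:E)); last first.
 move=> x /set_mem Dx.
 have c1 : (f_ n x)%:E @[n --> \oo] --> (f x)%:E by apply: cvg_EFin; [exact: nearW|exact: cf].
 by rewrite is_cvg_limn_einfE; [exact/cvg_lim|apply/cvg_ex; eexists; exact: c1].
move=> H; apply: (le_trans H); rewrite limn_einf_lim; apply: lime_le; first exact: is_cvg_einfs.
apply: nearW => n; apply: le_trans (fc n).
by apply: ereal_inf_lbound; exists n => //=.
Qed.

Lemma mD01 : measurable (D01 : set (mR R)). Proof. exact: measurable_itv. Qed.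

Lemma D01P (r : R) : D01 r -> 0 < r /\ r < 1.
Proof. by rewrite /= in_itv/= => /andP. Qed.

Lemma mfun_cont01 (f : R -> R) : (forall r, 0 < r -> r < 1 -> {for r, continuous f}) ->
 measurable_fun D01 (f : mR R -> mR R).
Proof.
move=> cf; apply: open_continuous_measurable_fun; first exact: interval_open.
by move=> r; rewrite inE => /D01P[r0 r1]; exact: cf.
Qed.

Lemma cont_rsqrt (a b r : R) : 0 < a + b * r -> {for r, continuous (fun r => (sqrt (a + b * r))^-1)}.
Proof.
move=> h0; apply: cvgV; first by rewrite gt_eqF// sqrtr_gt0.
apply: (@continuous_comp _ _ _ (fun r => a + b * r) (@sqrt R)); last exact: sqrt_continuous.
cts.
Qed.

Lemma cont_rsqrt0 (r : R) : 0 < r -> {for r, continuous (fun r => (sqrt r)^-1)}.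
Proof. by move=> r0; apply: cvgV; [rewrite gt_eqF// sqrtr_gt0|exact: sqrt_continuous]. Qed.

Lemma cont_rsqrt1 (r : R) : r < 1 -> {for r, continuous (fun r : R => (sqrt (1 - r))^-1)}.
Proof.
move=> r1; have -> : (fun r : R => (sqrt (1 - r))^-1) = (fun r => (sqrt (1 + -1 * r))^-1).
 by apply/funext => w; rewrite mulN1r.
by apply: cont_rsqrt; rewrite mulN1r subr_gt0.
Qed.

(** The shift by e removes the endpoint singularity, so that the fundamental theorem applies on the
    closed interval; Fatou's lemma lets e tend to 0 afterwards. The bound 4 is that of 2 sqrt(1 +
    e). *)
Lemma integral_rsqrt_shift (e : R) : 0 < e -> e <= 1 ->
 (\int[leb]_(r in D01) ((sqrt (e + 1 * r))^-1)%:E <= 4%:E)%E.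
Proof.
move=> e0 e1.
have P (r : R) : 0 <= r -> 0 < e + 1 * r by move=> r0; pos.
have D (r : R) : 0 <= r -> is_derive r 1 (fun r : R => 2 * sqrt (e + 1 * r)) ((sqrt (e + 1 * r))^-1).
 move=> r0; have h0 := P r r0.
 have d1 : is_derive r 1 (fun r : R => e + 1 * r) 1.
  have := is_deriveD (is_derive_cst e r 1) (is_deriveZ 1 (is_derive_id r 1)).
  by rewrite add0r scale1r.
 have d2 := is_derive1_sqrt h0.
 have d3 := is_derive1_comp (f := @sqrt R) (g := fun r => e + 1 * r) d2 d1.
 apply: (is_derive_eq (is_deriveZ 2 d3)).
 rewrite /GRing.scale/= mulr1; field.
 by rewrite gt_eqF// sqrtr_gt0.
have cD (r : R) : 0 <= r -> {for r, continuous (fun r : R => 2 * sqrt (e + 1 * r))}.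
 by move=> r0; apply/differentiable_continuous/derivable1_diffP; case: (D r r0).
have cI (r : R) : 0 <= r -> {for r, continuous (fun r : R => (sqrt (e + 1 * r))^-1)}.
 by move=> r0; exact: cont_rsqrt (P _ r0).
have cW : {within `[0, 1], continuous (fun r : R => (sqrt (e + 1 * r))^-1)}.
 by apply: continuous_in_subspaceT => r; rewrite inE/= in_itv/= => /andP[r0 _]; exact: cI.
apply: (@le_trans _ _ (\int[leb]_(r in `[0%R, 1%R]) ((sqrt (e + 1 * r))^-1)%:E)%E).
 apply: ge0_subset_integral => //.
 - apply/measurable_EFinP; apply: subspace_continuous_measurable_fun; [exact: measurable_itv|exact: cW].
 - exact: subset_itv_oo_cc.
rewrite (@continuous_FTC2 R (fun r => (sqrt (e + 1 * r))^-1) (fun r => 2 * sqrt (e + 1 * r)) 0 1)//.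
- rewrite -EFinB lee_fin mulr0 addr0 mulr1.
 have : sqrt (e + 1) <= 2.
  rewrite -[leRHS]ger0_norm// -sqrtr_sqr ler_wsqrtr//; lra.
 have := sqrtr_ge0 e; lra.
- split.
 + by move=> r; rewrite in_itv/= => /andP[r0 _]; case: (D r (ltW r0)).
 + by apply: cvg_at_right_filter; exact: (cD 0).
 + by apply: cvg_at_left_filter; exact: (cD 1).
- move=> r; rewrite in_itv/= => /andP[r0 _]; rewrite derive1E; exact: is_derive_val (D r (ltW r0)).
Qed.

Lemma integral_rsqrt : (\int[leb]_(r in D01) ((sqrt r)^-1 : R)%:E <= 4%:E)%E.
Proof.
apply: (@fatou_le _ _ leb D01 (fun n r => (sqrt (n.+1%:R^-1 + 1 * r))^-1) _ _ mD01).
- move=> n; apply: mfun_cont01 => r r0 r1; apply: cont_rsqrt.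
 pos.
- move=> n r _; pos.
- move=> r /D01P[r0 r1]; apply: cvgV; first by rewrite gt_eqF// sqrtr_gt0.
 apply: (@cvg_comp _ _ _ (fun n : nat => n.+1%:R^-1 + 1 * r) (@sqrt R)); last exact: sqrt_continuous.
 have := cvgD (@cvg_harmonic R) (cvg_cst (1 * r)); rewrite add0r mul1r; exact.
- by move=> n; apply: integral_rsqrt_shift; rewrite ?invr_gt0// invf_le1// ler1n.
Qed.

Lemma integral_rsqrt_onem : (\int[leb]_(r in D01) ((sqrt (1 - r))^-1 : R)%:E <= 4%:E)%E.
Proof.
apply: le_trans integral_rsqrt.
pose g := (fun r : mR R => ((sqrt r)^-1)%:E) \_ D01.
have mg : measurable_fun setT g.
 apply/(measurable_restrictT _ mD01)/measurable_EFinP; apply: mfun_cont01 => r r0 _.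
 exact: cont_rsqrt0.
have g0 x : (0 <= g x)%E by apply: erestrict_ge0 => // y _; rewrite lee_fin invr_ge0 sqrtr_ge0.
have n1 : (-1 : R) != 0 by rewrite oppr_eq0 oner_eq0.
have := ge0_integral_affine 1 n1 mg g0; rewrite normrN1 invr1 mul1e => H.
rewrite integral_mkcond [in leRHS]integral_mkcond -/g -H.
apply: le_of_eq; apply: eq_integral => r _.
rewrite /g !patchE mulN1r.
have -> : (r \in D01) = (1 - r \in D01) => //.
by apply/idP/idP; rewrite !inE/= !in_itv/= subr_gt0 ltrBlDr ltrDl andbC.
Qed.

(** Majorant of the Duhamel integrands at time t r: the nonlinearity is singular at r = 0, the
    kernel at r = 1. *)
Definition wt (r : R) : R := (sqrt r)^-1 + (sqrt (1 - r))^-1.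

Lemma cont_wt r : 0 < r -> r < 1 -> {for r, continuous wt}.
Proof.
move=> r0 r1; apply: cvgD.
 exact: cont_rsqrt0.
exact: cont_rsqrt1.
Qed.

Lemma wt_gt0 r : 0 < r -> r < 1 -> 0 < wt r.
Proof. by move=> r0 r1; rewrite addr_gt0// invr_gt0 sqrtr_gt0// subr_gt0. Qed.

Lemma mfun_wt : measurable_fun D01 (wt : mR R -> mR R).
Proof. by apply: mfun_cont01 => r r0 r1; exact: cont_wt. Qed.

Lemma integral_wt (c : R) : 0 <= c -> (\int[leb]_(r in D01) (c * wt r)%:E <= (c * 8)%:E)%E.
Proof.
move=> c0.
have m1 : measurable_fun D01 (fun r : mR R => ((sqrt r)^-1)%:E).
 apply/measurable_EFinP; apply: mfun_cont01 => r r0 _.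
 exact: cont_rsqrt0.
have m2 : measurable_fun D01 (fun r : mR R => ((sqrt (1 - r))^-1)%:E).
 apply/measurable_EFinP; apply: mfun_cont01 => r _ r1.
 exact: cont_rsqrt1.
under eq_integral do rewrite EFinM.
rewrite ge0_integralZl_EFin//; last 2 first.
- by move=> r /D01P[r0 r1]; rewrite lee_fin ltW// wt_gt0.
- by apply/measurable_EFinP; exact: mfun_wt.
rewrite EFinM lee_wpmul2l ?lee_fin//.
under eq_integral do rewrite EFinD.
rewrite ge0_integralD//.
apply: (le_trans (leeD integral_rsqrt integral_rsqrt_onem)).
by rewrite -EFinD lee_fin; lra.
Qed.

Lemma intg_wt (c : R) : leb.-integrable D01 (EFin \o (fun r : mR R => c * wt r)).
Proof.
apply: intgZ_real; first exact: mD01.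
apply/integrableP; split; first by apply/measurable_EFinP; exact: mfun_wt.
apply: le_lt_trans (ltry (1 * 8)); apply: le_trans (integral_wt ler01).
apply: ge0_le_integral => //.
- by apply: measurableT_comp => //; apply/measurable_EFinP; exact: mfun_wt.
- by apply/measurable_EFinP; apply: measurable_funM => //; exact: mfun_wt.
- by move=> r /D01P[r0 r1]; rewrite /= mul1r ger0_norm// ltW// wt_gt0.
Qed.

Lemma le_integral01 (f : R -> R) (c : R) : 0 <= c -> measurable_fun D01 (f : mR R -> mR R) ->
 (forall r, 0 < r -> r < 1 -> `|f r| <= c * wt r) -> `|\int[leb]_(r in D01) f r| <= c * 8.
Proof.
move=> c0 mf fc; apply: (@Rintegral_le_ge0 R _ _ leb D01 f (fun r => c * wt r)) => //.
- by apply: measurable_funM => //; exact: mfun_wt.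
- by move=> r /D01P[r0 r1]; exact: fc.
- exact: integral_wt.
Qed.

End UnitInterval.

(** * The Duhamel integrals and their bounds *)

Section Duhamel.
Context {R : realType}.
Local Notation V := 'rV[R]_3.
Implicit Types (f g : V -> R) (s al : seq 'I_3) (kap A N : R).

(** Dominates [cK (al ++ s)] for all al with at most K indices. A sum over extensions is used
    instead of a maximum, so that each term is bounded by positivity of the others. *)
Fixpoint cKs K s : R := if K is K'.+1 then cKs K' s + \sum_(i < 3) cKs K' (i :: s) else cK s.

Lemma cKs_ge0 K s : 0 <= cKs K s.
Proof.
elim: K s => [|K IH] s /=; first exact: ltW (cK_gt0 s).
by rewrite addr_ge0// sumr_ge0.
Qed.

Lemma cK_le_cKs K s al : (size al <= K)%N -> cK (al ++ s) <= cKs K s.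
Proof.
elim: K s al => [|K IH] s al; first by case: al.
have S0 : 0 <= \sum_(i < 3) cKs K (i :: s) by rewrite sumr_ge0// => i _; exact: cKs_ge0.
case/lastP: al => [_|al i] /=; first by rewrite (le_trans (IH s [::] (leq0n _)))// lerDl.
rewrite size_rcons ltnS cat_rcons => alK.
rewrite (le_trans (IH (i :: s) al alK))// (bigD1 i)//= addrCA lerDl addr_ge0// ?cKs_ge0//.
by rewrite sumr_ge0// => j _; exact: cKs_ge0.
Qed.

Lemma cKs_gt0 K s : 0 < cKs K s.
Proof. exact: lt_le_trans (cK_gt0 s) (@cK_le_cKs K s [::] (leq0n _)). Qed.

(** The factor 2^(K+2) comes from 1/p <= 2 or 1/q <= 2 raised to the power |al| + 2 in the two cases
    below, the remaining 4 from their numerical constants. *)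
Definition cB K s : R := 2 ^+ (K + 4) * cKs K s ^+ 2.

Lemma cB_gt0 K s : 0 < cB K s.
Proof. by rewrite mulr_gt0// exprn_gt0// cKs_gt0. Qed.

(** Written for e = sqrt t, p = sqrt r, q = sqrt(1 - r). For small p, the length e q of the kernel
    is comparable with e, and the kernel takes the derivatives through the window bound. Otherwise f
    lives at a time comparable with t and keeps the derivatives. Each case leaves a single inverse
    length, 1/p or 1/q, which is integrable in r. *)
Lemma Rk_two_scales K s f x kap N (e p q : R) al :
 0 < e -> 0 < p -> 0 < q -> p ^+ 2 + q ^+ 2 = 1 -> 0 <= kap -> kap * e <= 1 -> 0 <= N ->
 DB K (N * (e * p)^-1 ^+ 2) (e * p)^-1 f -> Nb kap f (N * (e * p)^-1) -> (size al <= K)%N ->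
 e ^+ 2 * `|Rk s (e * q) (partials al f) x| <=
  cB K s * N * e^-1 * e^-1 ^+ size al * (p^-1 + q^-1).
Proof.
move=> e0 p0 q0 pq k0 ke N0 fD fN alK.
set n := size al; set E := e^-1; set P := p^-1; set Q := q^-1.
have E0 : 0 < E by rewrite invr_gt0.
have P0 : 0 < P by rewrite invr_gt0.
have Q0 : 0 < Q by rewrite invr_gt0.
have eq0 : 0 < e * q by pos.
have half (y : R) : 0 < y -> 2^-1 <= y ^+ 2 -> y^-1 <= 2.
 move=> y0 hy; rewrite -[leRHS]invrK lef_pV2 ?posrE ?invr_gt0//.
 by rewrite leNgt; apply/negP => h; have : y ^+ 2 < 2^-1 ^+ 2 by [rewrite ltrXn2r// ?nnegrE ltW]; nra.
have le2 (y : R) : 0 < y -> y <= 2 -> y ^+ (n + 2) <= 2 ^+ (K + 2).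
 move=> y0 hy; apply: (@le_trans _ _ (2 ^+ (n + 2))).
  by rewrite lerXn2r// ?nnegrE ltW.
 by rewrite ler_eXn2l ?ltr1n// leq_add2r.
have cc : cK (al ++ s) ^+ 2 <= cKs K s ^+ 2.
 by rewrite lerXn2r ?nnegrE ?cKs_ge0 ?(ltW (cK_gt0 _))// cK_le_cKs.
have cc0 : cK s ^+ 2 <= cKs K s ^+ 2.
 by rewrite lerXn2r ?nnegrE ?cKs_ge0 ?(ltW (cK_gt0 _))// (@cK_le_cKs K s [::]).
have c20 : 0 <= cKs K s ^+ 2 by pos.
have ck0 : 0 <= @cK R (al ++ s) ^+ 2 by pos.
have ck1 : 0 <= @cK R s ^+ 2 by pos.
have E20 : 0 <= E ^+ n by pos.
have eE : e * E = 1 by rewrite divff// gt_eqF.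
have epE : (e * p)^-1 = E * P by rewrite invfM.
have eqE : (e * q)^-1 = E * Q by rewrite invfM.
have EP0 : 0 <= E * P by pos.
have EQ0 : 0 <= E * Q by pos.
have Z1 : 0 <= cKs K s ^+ 2 * N * E * E ^+ n by pos.
have cBE : cB K s = 4 * 2 ^+ (K + 2) * cKs K s ^+ 2.
 by rewrite /cB -[(K + 4)%N]/(K + (2 + 2))%N addnA exprD; ring.
have K20 : 0 <= 2 ^+ (K + 2) :> R by pos.
have [ph|ph] := leP (p ^+ 2) 2^-1.
- have Q2 : Q <= 2 by apply: half => //; move: ph pq; lra.
 have q1 : q <= 1 by rewrite leNgt; apply/negP => h; have := sqr_ge0 p; nra.
 have A0 : 0 <= N * (e * p)^-1 by pos.
 have H := Rk_Nb_bound s x eq0 k0 A0 (CB_le alK (DB_CB fD)) fN.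
 have kQ : kap <= E * Q.
  rewrite -(ler_pM2r e0) (le_trans ke)// mulrAC [E * e]mulrC eE mul1r.
  by rewrite -[leLHS](divff (lt0r_neq0 q0)) ler_piMl// ltW.
 have X0 : 0 <= E ^+ n * Q ^+ n by pos.
 have H' : `|Rk s (e * q) (partials al f) x| <=
   E ^+ n * Q ^+ n * (2 * cK (al ++ s) ^+ 2 * (N * (E * P)) * (E * Q * (E * Q + kap))).
  rewrite -(ler_pM2l (exprn_gt0 n eq0)); apply: (le_trans H).
  rewrite epE eqE [leRHS]mulrA -[E ^+ n * Q ^+ n]exprMn -[(e * q) ^+ n * _]exprMn [e * q * (E * Q)]mulrACA eE mul1r.
  by rewrite divff ?gt_eqF// expr1n mul1r.
 apply: (@le_trans _ _ (e ^+ 2 * (E ^+ n * Q ^+ n * (2 * cKs K s ^+ 2 * (N * (E * P)) * (E * Q * (E * Q + E * Q)))))).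
  rewrite ler_wpM2l ?exprn_ge0 ?(ltW e0)//; apply: (le_trans H').
  rewrite ler_wpM2l// ler_pM//.
  + pos.
  + pos.
  + by apply: (ler_wpM2r (mulr_ge0 N0 EP0)); apply: ler_wpM2l.
  + by apply: (ler_wpM2l EQ0); rewrite lerD2l.
 have -> : e ^+ 2 * (E ^+ n * Q ^+ n * (2 * cKs K s ^+ 2 * (N * (E * P)) * (E * Q * (E * Q + E * Q)))) =
   (e * E) ^+ 2 * (4 * cKs K s ^+ 2 * N * E * E ^+ n * P) * Q ^+ (n + 2) by rewrite exprD; ring.
 rewrite eE expr1n mul1r cBE.
 have Z0 : 0 <= 4 * cKs K s ^+ 2 * N * E * E ^+ n by pos.
 apply: (@le_trans _ _ ((4 * cKs K s ^+ 2 * N * E * E ^+ n) * P * 2 ^+ (K + 2))).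
  by apply: ler_wpM2l; [pos|exact: le2].
 have -> : 4 * 2 ^+ (K + 2) * cKs K s ^+ 2 * N * E * E ^+ n * (P + Q) =
   (4 * cKs K s ^+ 2 * N * E * E ^+ n) * (P + Q) * 2 ^+ (K + 2) by ring.
 by apply: ler_wpM2r => //; apply: ler_wpM2l => //; rewrite lerDl ltW.
- have P2 : P <= 2 by apply: half => //; exact: ltW.
 have fp0 : CB 0 (partials al f) := CB_le (leq0n _) (CB_partials (DB_CB fD) alK).
 have H := Rk_bound s x eq0 fp0 (fun y => fD.2 al alK y).
 apply: (@le_trans _ _ (e ^+ 2 * (2 * (E * Q) * (cKs K s ^+ 2 * (N * (E * P) ^+ 2 * (E * P) ^+ n))))).
  rewrite ler_wpM2l ?exprn_ge0 ?(ltW e0)//; apply: (le_trans H).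
  rewrite eqE epE; apply: ler_wpM2l; first pos.
  rewrite mulrA -expr2; apply: ler_wpM2r => //.
  pos.
 have -> : e ^+ 2 * (2 * (E * Q) * (cKs K s ^+ 2 * (N * (E * P) ^+ 2 * (E * P) ^+ n))) =
   (e * E) ^+ 2 * (2 * cKs K s ^+ 2 * N * E * E ^+ n * Q) * P ^+ (n + 2).
  by rewrite [(E * P) ^+ n]exprMn exprD; ring.
 rewrite eE expr1n mul1r cBE.
 have Z0 : 0 <= 2 * cKs K s ^+ 2 * N * E * E ^+ n by pos.
 apply: (@le_trans _ _ ((2 * cKs K s ^+ 2 * N * E * E ^+ n) * Q * 2 ^+ (K + 2))).
  by apply: ler_wpM2l; [pos|exact: le2].
 have -> : 4 * 2 ^+ (K + 2) * cKs K s ^+ 2 * N * E * E ^+ n * (P + Q) =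
   (2 * cKs K s ^+ 2 * N * E * E ^+ n) * (2 * (P + Q)) * 2 ^+ (K + 2) by ring.
 by apply: ler_wpM2r => //; apply: ler_wpM2l => //; move: (ltW P0) (ltW Q0); lra.
Qed.

Definition rs (t : R) : R := (sqrt t)^-1.

(** The class to which all iterates belong. Smoothness is in space only; time enters through the
    joint continuity of the space derivatives, and M and b are functions of time. *)
Definition XX (I : set R) K (M b : R -> R) (u : R -> V -> R) :=
 (forall t, I t -> DB K (M t) (b t) (u t)) /\
 forall s, (size s <= K)%N -> forall t x, I t ->
  {for (t, x), continuous (fun q : R * V => partials s (u q.1) q.2)}.

(** Bounds that are locally uniform in time follow from continuity of the amplitude and of the
    rate. *)
Lemma XX_stc I K M b u s : open I -> XX I K M b u -> (forall t, I t -> {for t, continuous M}) ->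
 (forall t, I t -> {for t, continuous b}) -> (size s <= K)%N -> stc I (fun t => partials s (u t)).
Proof.
move=> oI [uD uc] cM cb sK; split; first by move=> t x It; exact: uc.
move=> t It.
have c : {for t, continuous (fun t => M t * b t ^+ size s)}.
 apply: cvgM; first exact: cM.
 by apply: (@continuous_comp _ _ _ b (fun y => y ^+ size s)); [exact: cb|exact: exprn_continuous].
exists (M t * b t ^+ size s + 1).
have n1 : \forall y \near t, M y * b y ^+ size s < M t * b t ^+ size s + 1.
 by apply: (c (fun z => z < M t * b t ^+ size s + 1)); apply: lt_nbhsl; rewrite ltrDl.
have n2 : \forall y \near t, I y by exact: open_nbhs_nbhs.
apply: filterS2 n1 n2 => y h Iy x; rewrite (le_trans ((uD y Iy).2 s sK x))//; exact: ltW.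
Qed.

(** With sigma = t r and |s| = 3, this is the integral over 0 < sigma < t and tau > t - sigma of D^s
    e^(tau Laplacian) u(sigma). The rescaling to (0, 1) makes the domain independent of t. *)
Definition Bk s (u : R -> V -> R) (t : R) (x : V) : R :=
 (\int[leb]_(r in D01) (t * Rk s (sqrt (t * (1 - r))) (u (t * r)) x))%R.

Section DuhamelBounds.
Variables (T : \bar R) (K : nat) (F : R -> V -> R) (N : R) (s : seq 'I_3).
Local Notation I := (time_interval T).
Hypothesis N0 : 0 <= N.
Hypothesis FX : XX I K (fun t => N * rs t ^+ 2) rs F.
(** The window scale may depend on t, but at that scale the bound has to hold at the other times as
    well, because the integral at time t sees all earlier ones. *)
Hypothesis FN : forall t, I t -> exists kap, [/\ 0 <= kap, kap * sqrt t <= 1 &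
 forall t', I t' -> Nb kap (F t') (N * rs t')].

Lemma open_I : open I.
Proof.
case: T => [r| |].
- rewrite (_ : time_interval _ = `]0, r[%classic); first exact: interval_open.
 apply/seteqP; split=> x; rewrite /time_interval/= in_itv/=; first by rewrite lte_fin => -[-> ->].
 by move=> /andP[x0 xr]; split=> //; rewrite lte_fin.
- rewrite (_ : time_interval _ = `]0, +oo[%classic); first exact: interval_open.
 by apply/seteqP; split=> x; rewrite /time_interval/= in_itv/= andbT; [case|move=> ->; split=> //; exact: ltry].
- rewrite (_ : time_interval _ = set0); first exact: open0.
 by apply/seteqP; split=> x //= [].
Qed.

Lemma I_gt0 t : I t -> 0 < t. Proof. by case. Qed.

Lemma I_scale t r : I t -> 0 < r -> r < 1 -> I (t * r).
Proof.
move=> [t0 tT] r0 r1; split; first pos.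
by apply: le_lt_trans tT; rewrite lee_fin ler_piMr// ltW.
Qed.

Lemma rs_gt0 t : 0 < t -> 0 < rs t.
Proof. by move=> t0; rewrite invr_gt0 sqrtr_gt0. Qed.

Lemma cont_rs t : 0 < t -> {for t, continuous rs}.
Proof. exact: cont_rsqrt0. Qed.

Lemma F_stc al : (size al <= K)%N -> stc I (fun t => partials al (F t)).
Proof.
apply: XX_stc FX _ _; first exact: open_I.
 move=> t /I_gt0 t0; apply: cvgM; first exact: cst_continuous.
 by apply: (@continuous_comp _ _ _ rs (fun y => y ^+ 2)); [exact: cont_rs|exact: exprn_continuous].
by move=> t /I_gt0; exact: cont_rs.
Qed.

Lemma sqrt_scale (t r : R) : 0 < t -> 0 < r -> r < 1 -> 0 < sqrt (t * (1 - r)).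
Proof. by move=> t0 r0 r1; rewrite sqrtr_gt0 mulr_gt0// subr_gt0. Qed.

Lemma Bk_integrand_cont al t x r : (size al <= K)%N -> I t -> 0 < r -> r < 1 ->
 {for ((t, x), r), continuous (fun q : (R * V) * R =>
   q.1.1 * Rk s (sqrt (q.1.1 * (1 - q.2))) (partials al (F (q.1.1 * q.2))) q.1.2)}.
Proof.
move=> alK It r0 r1; have t0 := I_gt0 It.
have c1 : (fun q : (R * V) * R => q.1.1) @ ((t, x), r) --> t.
 by apply: (@cvg_comp _ _ _ fst fst); exact: cvg_fst.
have c2 : (fun q : (R * V) * R => q.1.2) @ ((t, x), r) --> x.
 by apply: (@cvg_comp _ _ _ fst snd); [exact: cvg_fst|exact: cvg_snd].
have c3 : (fun q : (R * V) * R => q.2) @ ((t, x), r) --> r by exact: cvg_snd.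
apply: cvgM; first exact: c1.
have c := @Rk_cont R I (fun t => partials al (F t)) s _ _ x open_I (F_stc alK) (I_scale It r0 r1) (sqrt_scale t0 r0 r1).
apply: (@continuous_comp _ _ _ (fun q : (R * V) * R => (sqrt (q.1.1 * (1 - q.2)), (q.1.1 * q.2, q.1.2)))
 (fun q : R * (R * V) => Rk s q.1 (partials al (F q.2.1)) q.2.2)); last exact: c.
apply: cvg_pairN; last by apply: cvg_pairN => //; exact: cvgM.
apply: (@continuous_comp _ _ _ (fun q : (R * V) * R => q.1.1 * (1 - q.2)) (@sqrt R)); last exact: sqrt_continuous.
by apply: cvgM => //; apply: cvgB => //; exact: cst_continuous.
Qed.

Lemma mfun_Bk_integrand al t x : (size al <= K)%N -> I t -> measurable_fun D01
 (fun r : mR R => t * Rk s (sqrt (t * (1 - r))) (partials al (F (t * r))) x : mR R).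
Proof.
move=> alK It; apply: mfun_cont01 => r r0 r1.
apply: (@continuous_comp _ _ _ (fun r : R => ((t, x), r)) (fun q : (R * V) * R =>
   q.1.1 * Rk s (sqrt (q.1.1 * (1 - q.2))) (partials al (F (q.1.1 * q.2))) q.1.2));
 last exact: Bk_integrand_cont.
cts.
Qed.

Lemma Bk_integrand_bound al t x r : (size al <= K)%N -> I t -> 0 < r -> r < 1 ->
 `|t * Rk s (sqrt (t * (1 - r))) (partials al (F (t * r))) x| <=
  cB K s * N * rs t * rs t ^+ size al * wt r.
Proof.
move=> alK It r0 r1; have t0 := I_gt0 It; have Itr := I_scale It r0 r1.
have [kap [k0 kt FNk]] := FN It.
have r1' : 0 < 1 - r by rewrite subr_gt0.
rewrite normrM gtr0_norm// -[in X in X * _](sqr_sqrtr (ltW t0)) sqrtrM ?(ltW t0)//.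
apply: (@Rk_two_scales K s (F (t * r)) x kap N (sqrt t) (sqrt r) (sqrt (1 - r)) al) => //.
- pos.
- pos.
- pos.
- by rewrite !sqr_sqrtr ?ltW// addrCA subrr addr0.
- by rewrite -sqrtrM ?(ltW t0)//; exact: FX.1.
- by rewrite -sqrtrM ?(ltW t0)//; exact: FNk.
Qed.

Lemma CB_Bk_integrand t r : I t -> 0 < r -> r < 1 -> CB K (fun x => t * Rk s (sqrt (t * (1 - r))) (F (t * r)) x).
Proof.
move=> It r0 r1; apply: CB_scale; apply: CB_Rk; first exact: sqrt_scale (I_gt0 It) r0 r1.
exact: DB_CB (FX.1 _ (I_scale It r0 r1)).
Qed.

Lemma partials_Bk_integrand al t r : (size al <= K)%N -> I t -> 0 < r -> r < 1 ->
 partials al (fun x => t * Rk s (sqrt (t * (1 - r))) (F (t * r)) x) =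
 (fun x => t * Rk s (sqrt (t * (1 - r))) (partials al (F (t * r))) x).
Proof.
move=> alK It r0 r1; have Fk := DB_CB (FX.1 _ (I_scale It r0 r1)).
have m0 := sqrt_scale (I_gt0 It) r0 r1.
by rewrite (partials_scale _ (CB_Rk s m0 Fk) alK) (Rk_partials s m0 Fk alK).
Qed.

Let Bk_hyps t : I t ->
 [/\ forall r : R, D01 r -> CB K (fun x => t * Rk s (sqrt (t * (1 - r))) (F (t * r)) x),
  forall al, (size al <= K)%N -> forall x, measurable_fun D01
   (fun r : mR R => partials al (fun x => t * Rk s (sqrt (t * (1 - r))) (F (t * r)) x) x : mR R),
  forall al : seq 'I_3, (size al <= K)%N -> leb.-integrable D01 (EFin \o (fun r : mR R => cB K s * N * rs t * rs t ^+ size al * wt r)) &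
  forall al, (size al <= K)%N -> forall (r : R) x, D01 r ->
   `|partials al (fun x => t * Rk s (sqrt (t * (1 - r))) (F (t * r)) x) x| <= cB K s * N * rs t * rs t ^+ size al * wt r].
Proof.
move=> It; split.
- by move=> r /D01P[r0 r1]; exact: CB_Bk_integrand.
- move=> al alK x; apply: eq_measurable_fun (mfun_Bk_integrand x alK It).
 by move=> r /set_mem/D01P[r0 r1]; rewrite partials_Bk_integrand.
- by move=> al alK; exact: intg_wt.
- by move=> al alK r x /D01P[r0 r1]; rewrite partials_Bk_integrand//; exact: Bk_integrand_bound.
Qed.

Lemma intg_Bk al t x : (size al <= K)%N -> I t -> leb.-integrable D01 (EFin \o
 (fun r : mR R => t * Rk s (sqrt (t * (1 - r))) (partials al (F (t * r))) x)).
Proof.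
move=> alK It; apply: (le_intg mD01 (mfun_Bk_integrand x alK It)
 (intg_wt (cB K s * N * rs t * rs t ^+ size al))).
by move=> r /D01P[r0 r1]; exact: Bk_integrand_bound.
Qed.

Lemma Bk_partials al t : (size al <= K)%N -> I t ->
 partials al (Bk s F t) = Bk s (fun t => partials al (F t)) t.
Proof.
move=> alK It; have [h1 h2 h3 h4] := Bk_hyps It.
apply: etrans (partials_int mD01 h1 h2 (b := fun n r => cB K s * N * rs t * rs t ^+ n * wt r) h3 h4 alK) _.
apply/funext => x; apply: eq_Rintegral => r /set_mem/D01P[r0 r1].
by rewrite partials_Bk_integrand.
Qed.

(** The forcing has size 1/t and the operator, of order one, size t^(-1/2); integration over a time
    t leaves t^(-1/2), the size of the velocity. Derivatives keep the rate t^(-1/2). *)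
Lemma XX_Bk : XX I K (fun t => 8 * cB K s * N * rs t) rs (Bk s F).
Proof.
have cN t n : I t -> 0 <= cB K s * N * rs t * rs t ^+ n.
 move=> /I_gt0/rs_gt0 t0.
 exact: mulr_ge0 (mulr_ge0 (mulr_ge0 (ltW (cB_gt0 K s)) N0) (ltW t0)) (exprn_ge0 _ (ltW t0)).
split.
 move=> t It; have [h1 h2 h3 h4] := Bk_hyps It; split.
  exact: (CB_int mD01 h1 h2 (b := fun n r => cB K s * N * rs t * rs t ^+ n * wt r) h3 h4).
 move=> al alK x; rewrite Bk_partials//.
 have -> : 8 * cB K s * N * rs t * rs t ^+ size al = cB K s * N * rs t * rs t ^+ size al * 8 by ring.
 apply: le_integral01; first exact: cN.
  exact: mfun_Bk_integrand.
 by move=> r r0 r1; exact: Bk_integrand_bound.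
move=> al alK t x It; have t0 := I_gt0 It.
have n1 : \forall q \near ((t, x) : R * V), I q.1.
 have c : fst @ ((t, x) : R * V) --> t by exact: cvg_fst.
 by apply: (c I); apply: open_nbhs_nbhs; split => //; exact: open_I.
(* Rates near t stay below [rs t + 1], which gives one majorant for a whole neighbourhood. *)
have n2 : \forall q \near ((t, x) : R * V), rs q.1 < rs t + 1.
 have c : (fun q : R * V => rs q.1) @ ((t, x) : R * V) --> rs t.
  by apply: (@cvg_comp _ _ _ fst rs _ (nbhs t)); [exact: cvg_fst|exact: cont_rs].
 by apply: (c (fun y => y < rs t + 1)); apply: lt_nbhsl; rewrite ltrDl.
pose G (q : R * V) := Bk s (fun t => partials al (F t)) q.1 q.2.
suff H : G q @[q --> ((t, x) : R * V)] --> G (t, x).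
 have E : {near ((t, x) : R * V), G =1 (fun q => partials al (Bk s F q.1) q.2)}.
  by apply: filterS n1 => q Iq /=; rewrite (Bk_partials alK Iq).
 have E0 : G (t, x) = partials al (Bk s F t) x by rewrite (Bk_partials alK It).
 by rewrite E0 in H; exact: (cvg_trans (near_eq_cvg E) H).
apply: (cont_int mD01 (f := fun (q : R * V) (r : mR R) =>
 q.1 * Rk s (sqrt (q.1 * (1 - r))) (partials al (F (q.1 * r))) q.2)
 (intg_wt (cB K s * N * (rs t + 1) * (rs t + 1) ^+ size al))).
- by apply: filterS n1 => q Iq; exact: mfun_Bk_integrand.
- apply: filterS2 n1 n2 => q Iq rq r /D01P[r0 r1].
 apply: (le_trans (Bk_integrand_bound q.2 alK Iq r0 r1)).
 have q0 := rs_gt0 (I_gt0 Iq); have c0 := cB_gt0 K s.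
 rewrite ler_wpM2r ?(ltW (wt_gt0 r0 r1))//.
 apply: ler_pM.
 + pos.
 + pos.
 + by apply: (ler_wpM2l (mulr_ge0 (ltW c0) N0)); exact: ltW.
 + rewrite lerXn2r ?nnegrE ?(ltW q0) ?(ltW rq)//; exact: (le_trans (ltW q0) (ltW rq)).
- apply: aeW => r /D01P[r0 r1].
 apply: (@continuous_comp _ _ _ (fun q : R * V => (q, r)) (fun q : (R * V) * R =>
   q.1.1 * Rk s (sqrt (q.1.1 * (1 - q.2))) (partials al (F (q.1.1 * q.2))) q.1.2));
  last exact: Bk_integrand_cont.
 cts.
Qed.

(** 32 is 2 x 2 x 8: the constant of the kernel, the inequality 1/(p q) <= 2 (1/p + 1/q) valid for
    p^2 + q^2 = 1, and the integral of the weight. *)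
Lemma Nb_Bk kap N' t : I t -> 0 < N' -> (forall t', I t' -> Nb kap (F t') (N' * rs t')) ->
 Nb kap (Bk s F t) (32 * cK s ^+ 2 * N').
Proof.
move=> It N0' FN'; have t0 := I_gt0 It; have c0 := @cK_gt0 R s.
have k0 : 0 < 4 * cK s ^+ 2 * N' by pos.
apply: (@Nb_Rintegral R D01 (fun r => 4 * cK s ^+ 2 * N' * wt r)
 (fun r y => t * Rk s (sqrt (t * (1 - r))) (F (t * r)) y)).
- exact: interval_open.
- exact: mD01.
- by apply: measurable_funM => //; exact: mfun_wt.
- by move=> r /D01P[r0 r1]; rewrite mulr_gt0// wt_gt0.
- pos.
- have -> : 32 * cK s ^+ 2 * N' = 4 * cK s ^+ 2 * N' * 8 by ring.
 by apply: integral_wt; exact: ltW.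
- move=> r y /D01P[r0 r1].
 apply: (@continuous_comp _ _ _ (fun q : R * V => ((t, q.2), q.1)) (fun q : (R * V) * R =>
  q.1.1 * Rk s (sqrt (q.1.1 * (1 - q.2))) (partials [::] (F (q.1.1 * q.2))) q.1.2));
  last exact: Bk_integrand_cont.
 cts.
- by move=> y; exact: (@intg_Bk [::] t y (leq0n K) It).
- exact: CB_cont (DB_CB (XX_Bk.1 t It)).
- move=> r /D01P[r0 r1]; have Itr := I_scale It r0 r1.
 have m0 := sqrt_scale t0 r0 r1; have A0 : 0 < N' * rs (t * r) by rewrite mulr_gt0// rs_gt0// I_gt0.
 have Fk := DB_CB (FX.1 _ Itr).
 have H := Nb_Rk s m0 A0 Fk (FN' _ Itr).
 have r1' : 0 < 1 - r by rewrite subr_gt0.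
 have sr := sqrt_scale t0 r0 r1.
 have cR : continuous (Rk s (sqrt (t * (1 - r))) (F (t * r))) := CB_cont (CB_Rk s m0 Fk).
 apply: (@Nb_weaken _ kap _ (t * (2 * (sqrt (t * (1 - r)))^-1 * cK s ^+ 2 * (N' * rs (t * r))))).
 + by rewrite !mulr_ge0 ?invr_ge0 ?exprn_ge0// ltW.
 + rewrite /rs /wt !sqrtrM ?(ltW t0)//.
  have e0 : 0 < sqrt t by pos.
  have p0 : 0 < sqrt r by pos.
  have q0 : 0 < sqrt (1 - r) by pos.
  have pq : sqrt r ^+ 2 + sqrt (1 - r) ^+ 2 = 1.
   by rewrite !sqr_sqrtr ?ltW// addrCA subrr addr0.
  rewrite -[in X in X * _](sqr_sqrtr (ltW t0)).
  move: (sqrt t) (sqrt r) (sqrt (1 - r)) e0 p0 q0 pq => e p q e0 p0 q0 pq.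
  rewrite [leLHS](_ : _ = 2 * cK s ^+ 2 * N' * (p * q)^-1); last by field; rewrite !gt_eqF.
  rewrite [leRHS](_ : _ = 2 * cK s ^+ 2 * N' * (2 * (p^-1 + q^-1))); last by ring.
  rewrite ler_wpM2l ?mulr_ge0 ?exprn_ge0 ?(ltW c0) ?(ltW N0')//.
  have -> : 2 * (p^-1 + q^-1) = (2 * (p + q)) * (p * q)^-1 by field; rewrite !gt_eqF.
  rewrite ler_peMl ?invr_ge0 ?mulr_ge0 ?(ltW p0) ?(ltW q0)//; nra.
 + exact: Nb_scale (ltW t0) cR H.
Qed.

End DuhamelBounds.
End Duhamel.

(** * Substitution and the fundamental theorem of calculus on intervals *)

Section IntegralsOnIntervals.
Context {R : realType}.
Local Notation mR := (mR R).
Local Notation pre a b D := ((fun r : R => (a + b * r)%R) @^-1` D : set mR).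

Lemma ge0_integral_affine_set (a b : R) (D : set mR) (h : R -> \bar R) : 0 < b ->
 measurable D -> measurable_fun D (h : mR -> \bar R) -> (forall x, D x -> (0 <= h x)%E) ->
 (\int[leb]_(r in (pre a b D)) h (a + b * r)%R = b^-1%:E * \int[leb]_(x in D) h x)%E.
Proof.
move=> b0 mD mh h0.
have mg : measurable_fun setT (h \_ D) by exact/(measurable_restrictT _ mD).
have g0 x : (0 <= (h \_ D) x)%E by apply: erestrict_ge0.
rewrite integral_mkcond [in RHS]integral_mkcond.
have := ge0_integral_affine a (lt0r_neq0 b0) mg g0; rewrite gtr0_norm// => <-.
Qed.

Lemma mfun_affine (a b : R) : measurable_fun setT (fun r : mR => a + b * r : mR).
Proof. by apply: measurable_funD => //; exact: measurable_funM. Qed.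

Lemma mfun_comp_affine (a b : R) (D : set mR) d (Y : measurableType d) (h : mR -> Y) : measurable D -> measurable_fun D h ->
 measurable_fun (pre a b D) (fun r => h (a + b * r)).
Proof.
move=> mD mh; apply: (@measurable_comp _ _ _ _ _ _ D h _ (fun r : mR => a + b * r : mR)) => //.
 by move=> _ [r Dr <-].
by apply: measurable_funTS; exact: mfun_affine.
Qed.

Lemma intg_affine_set (a b : R) (D : set mR) (f : R -> R) : 0 < b -> measurable D ->
 leb.-integrable D (EFin \o f) -> leb.-integrable (pre a b D) (EFin \o (fun r => f (a + b * r))).
Proof.
move=> b0 mD /integrableP[mf fi]; apply/integrableP; split.
 exact: (mfun_comp_affine mD mf).
have H := @ge0_integral_affine_set a b D (fun x => `|(EFin \o f) x|%E) b0 mD.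
rewrite H//; last by apply: measurableT_comp.
by rewrite lte_mul_pinfty// lee_fin invr_ge0 ltW.
Qed.

Lemma Rintegral_affine_set (a b : R) (D : set mR) (f : R -> R) : 0 < b -> measurable D ->
 leb.-integrable D (EFin \o f) ->
 \int[leb]_(r in (pre a b D)) f (a + b * r) = b^-1 * \int[leb]_(x in D) f x.
Proof.
move=> b0 mD fi; have mf := measurable_int _ fi.
rewrite /Rintegral integralE [in RHS]integralE.
have P := @ge0_integral_affine_set a b D ((EFin \o f)^\+)%E b0 mD (measurable_funepos mf) (fun x _ => funepos_ge0 _ x).
have Q := @ge0_integral_affine_set a b D ((EFin \o f)^\-)%E b0 mD (measurable_funeneg mf) (fun x _ => funeneg_ge0 _ x).
have -> : (\int[leb]_(x in (pre a b D)) (fun r : mR => (f (a + b * r)%R)%:E)^\+ x)%E =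
 (b^-1%:E * \int[leb]_(x in D) ((EFin \o f)^\+) x)%E.
 by rewrite -P; apply: eq_integral => r _; rewrite !funeposE.
have -> : (\int[leb]_(x in (pre a b D)) (fun r : mR => (f (a + b * r)%R)%:E)^\- x)%E =
 (b^-1%:E * \int[leb]_(x in D) ((EFin \o f)^\-) x)%E.
 by rewrite -Q; apply: eq_integral => r _; rewrite !funenegE.
have fp := integrable_pos_fin_num mD fi; have fn := integrable_neg_fin_num mD fi.
have key (p q : \bar R) : p \is a fin_num -> q \is a fin_num ->
 fine (b^-1%:E * p - b^-1%:E * q)%E = b^-1 * fine (p - q)%E.
 by move: p q => [p||] [q||]//= _ _; rewrite mulrBr.
exact: key.
Qed.

Lemma affine01 (a b : R) : a < b -> pre a (b - a) `]a, b[%classic = D01.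
Proof.
move=> ab; apply/seteqP; split=> r /=; rewrite !in_itv/= => /andP[r0 r1].
 by move: r0 r1; rewrite ltrDl -ltrBrDl pmulr_rgt0 ?subr_gt0// gtr_pMr ?subr_gt0// => -> ->.
by rewrite ltrDl mulr_gt0 ?subr_gt0//= -ltrBrDl gtr_pMr ?subr_gt0.
Qed.

Lemma Rintegral_affine01 (a b : R) (f : R -> R) : a < b -> leb.-integrable `]a, b[ (EFin \o f) ->
 \int[leb]_(x in `]a, b[) f x = (b - a) * \int[leb]_(r in D01) f (a + (b - a) * r).
Proof.
move=> ab fi; have ba : 0 < b - a by rewrite subr_gt0.
rewrite -(affine01 ab) (Rintegral_affine_set a ba (measurable_itv _) fi).
by rewrite mulrA divff ?mul1r// gt_eqF.
Qed.

Lemma intg_affine01 (a b : R) (f : R -> R) : a < b ->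
 leb.-integrable D01 (EFin \o (fun r => f (a + (b - a) * r))) -> leb.-integrable `]a, b[ (EFin \o f).
Proof.
move=> ab fi; have ba : 0 < b - a by rewrite subr_gt0.
have c0 : 0 < (b - a)^-1 by pos.
have := intg_affine_set (- a / (b - a)) c0 (measurable_itv _) fi.
have bn : b - a != 0 by rewrite gt_eqF.
congr (leb.-integrable _ _); last first.
 by apply/funext => x /=; congr (f _)%:E; field.
apply/seteqP; split=> x /=; rewrite !in_itv/=.
 have -> : - a * (b - a)^-1 + (b - a)^-1 * x = (x - a) / (b - a) by field.
 by rewrite ltr_pdivlMr// mul0r ltr_pdivrMr// mul1r subr_gt0 ltrBlDr subrK.
have -> : - a * (b - a)^-1 + (b - a)^-1 * x = (x - a) / (b - a) by field.
by rewrite ltr_pdivlMr// mul0r ltr_pdivrMr// mul1r subr_gt0 ltrBlDr subrK.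
Qed.

Lemma Rintegral_split (a c : R) (b : itv_bound R) (f : R -> R) : a <= c -> (BRight c <= b)%O ->
 leb.-integrable [set` Interval (BRight a) b] (EFin \o f) ->
 \int[leb]_(x in [set` Interval (BRight a) b]) f x =
 \int[leb]_(x in `]a, c[) f x + \int[leb]_(x in [set` Interval (BRight c) b]) f x.
Proof.
move=> ac cb fi; have := @Rintegral_itvB R f (BRight a) b c fi; rewrite bnd_simp => /(_ ac cb) <-.
rewrite Rintegral_itv_bndo_bndc; first by rewrite addrC subrK.
apply: integrableS fi => //; apply: subset_itvl.
by apply: le_trans cb; rewrite bnd_simp.
Qed.

Lemma intg_segment (f : R -> R) (a b : R) : (forall y, a <= y <= b -> {for y, continuous f}) ->
 leb.-integrable `[a, b] (EFin \o f).
Proof.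
move=> cf; apply: continuous_compact_integrable; first exact: segment_compact.
by apply: continuous_in_subspaceT => y; rewrite inE/= in_itv; exact: cf.
Qed.

(** The base point a - e is taken near a, because the functions in use are singular at 0 or given by
    integrals up to infinity. *)
Lemma is_derive_FTC (F f : R -> R) (a e : R) : 0 < e ->
 (forall y, a - e <= y <= a + e -> {for y, continuous f}) ->
 (forall y, a - e < y -> y < a + e -> F y = F (a - e) + \int[leb]_(x in `](a - e), y[) f x) ->
 is_derive a 1 F (f a).
Proof.
move=> e0 cf FE.
have ae : a < a + e by rewrite ltrDl.
have ea : a - e < a by rewrite ltrBlDr ltrDl.
have fi0 := intg_segment cf.
have fi : leb.-integrable [set` Interval (BRight (a - e)) (BRight (a + e))] (EFin \o f).
 by apply: integrableS fi0 => //; exact: subset_itv_oc_cc.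
have [||d1 d2] := @continuous_FTC1 R f (BRight (a - e)) a (a + e) ae fi.
- exact: ea.
- by apply: cf; rewrite (ltW ae) (ltW ea).
pose G y := \int[leb]_(t in [set` Interval (BRight (a - e)) (BRight y)]) f t.
have dG : is_derive a 1 G (f a) by apply: DeriveDef; [exact: d1|rewrite -derive1E; exact: d2].
have dF : is_derive a 1 (fun y => F (a - e) + G y) (0 + f a) by exact: is_deriveD.
rewrite add0r in dF.
apply: near_eq_is_derive dF.
have n1 : \forall y \near a, a - e < y by exact: lt_nbhsr.
have n2 : \forall y \near a, y < a + e by exact: lt_nbhsl.
apply: filterS2 n1 n2 => y y1 y2; rewrite (FE _ y1 y2) /G; congr (_ + _).
rewrite Rintegral_itv_bndo_bndc//.
apply: integrableS fi => //; apply: subset_itvl.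
by rewrite bnd_simp ltW.
Qed.

(** Caratheodory's form of the derivative, for products h Q(h) in which Q is only known to be
    continuous at 0. *)
Lemma is_derive_slope (F Q : R -> R) (a : R) : (\forall h \near (0 : R), F (h + a) - F a = h * Q h) ->
 {for 0, continuous Q} -> is_derive a 1 F (Q 0).
Proof.
move=> FQ cQ.
have c : h^-1 *: (F (h *: 1 + a) - F a) @[h --> 0^'] --> Q 0.
 apply: cvg_trans (cvg_within_filter _ cQ).
 apply: near_eq_cvg; near=> h.
 have hn : h != 0 by near: h; exact: nbhs_dnbhs_neq.
 have -> : F (h *: 1 + a) - F a = h * Q h.
  rewrite scaler1; near: h; exact: (nbhs_dnbhs FQ).
 by rewrite /GRing.scale/= mulKf.
apply: DeriveDef; first by apply/cvg_ex; eexists; exact: c.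
exact/cvg_lim.
Unshelve. all: by end_near. Qed.

Lemma derive_pos_const (F : R -> R) : (forall y : R, 0 < y -> is_derive y 1 F 0) ->
 forall a b, 0 < a -> 0 < b -> F a = F b.
Proof.
move=> dF.
have H a b : 0 < a -> a <= b -> F a = F b.
 move=> a0 ab.
 have [||c _ E] := @MVT_segment R F (fun=> 0) a b ab.
 - by move=> x; rewrite in_itv/= => /andP[ax _]; apply: dF; exact: lt_trans ax.
 - apply: continuous_in_subspaceT => x; rewrite inE/= in_itv/= => /andP[ax _].
  apply/differentiable_continuous/derivable1_diffP.
  by case: (dF x (lt_le_trans a0 ax)).
 - by apply/eqP; rewrite eq_sym -subr_eq0 E mul0r.
by move=> a b a0 b0; case: (leP a b) => [ab|/ltW ba]; [exact: H|rewrite (H b a)].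
Qed.

(** The principle behind the operator identities below: both sides are differentiated in the length,
    and decay at infinity fixes the constant. *)
Lemma derive_pos_zero (F : R -> R) (c : R) : (forall y : R, 0 < y -> is_derive y 1 F 0) ->
 (forall y, 1 <= y -> `|F y| <= c / y) -> forall a, 0 < a -> F a = 0.
Proof.
move=> dF Fc a a0; apply/eqP; rewrite -normr_eq0; apply/negPn/negP => Fn.
have F0 : 0 < `|F a| by rewrite lt_def Fn normr_ge0.
(* A point so far out that c / y is smaller than |F a|. *)
have y1 : 1 <= 1 + `|c| / `|F a| by rewrite lerDl divr_ge0.
have := Fc _ y1; rewrite (derive_pos_const dF (lt_le_trans ltr01 y1) a0) ler_pdivlMr ?(lt_le_trans ltr01 y1)//.
by rewrite mulrDr mulr1 mulrC divfK// leNgt ltr_pwDl// ler_norm.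
Qed.

End IntegralsOnIntervals.

(** * Differentiating the long-time heat integrals in their lower limit *)

Section Generators.
Context {R : realType}.
Local Notation V := 'rV[R]_3.
Implicit Types (f g : V -> R) (s al : seq 'I_3).

Lemma hk_perm s s' (l : R) f x : perm_eq s s' -> hk s l f x = hk s' l f x.
Proof.
move=> /permP ss; rewrite /hk; congr (fine _); apply: eq_integral => z _; congr (_%:E); congr (_ * _).
by rewrite /Kg; apply: eq_bigr => i _; rewrite ss.
Qed.

Lemma cont_compR (g h : R -> R) (a : R) : {for a, continuous h} -> {for h a, continuous g} ->
 {for a, continuous (fun t => g (h t))}.
Proof. by move=> ch cg; exact: continuous_comp. Qed.

Lemma cont_mulR (g h : R -> R) (a : R) : {for a, continuous h} -> {for a, continuous g} ->
 {for a, continuous (fun t => h t * g t)}.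
Proof. by move=> ch cg; exact: cvgM. Qed.

Lemma cont_hk_length k s f x : CB k f -> continuous (fun l : R => hk s l f x).
Proof.
move=> fk l; have -> : (fun l : R => hk s l f x) = (fun l => hk s (1 * l) f x).
 by apply/funext => y; rewrite mul1r.
apply: (@continuous_comp _ _ _ (fun l : R => (l, x)) (fun q : R * V => hk s (1 * q.1) f q.2)).
 cts.
exact: cont_hk_scaled fk.
Qed.

Lemma Rk_unscaled s (mu : R) f x : 0 < mu -> CB 0 f ->
 leb.-integrable `]mu, +oo[ (EFin \o (fun l : mR R => 2 * l ^- 2 * hk s l f x)) /\
 Rk s mu f x = \int[leb]_(l in `]mu, +oo[) (2 * l ^- 2 * hk s l f x).
Proof.
move=> mu0 f0; have iR := intg_Rk s x mu0 f0.
have m1 : 0 < mu^-1 by pos.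
have E : (fun r : R => 0 + mu^-1 * r) @^-1` D1 = `]mu, +oo[%classic.
 apply/seteqP; split=> r /=; rewrite !in_itv/= !andbT add0r mulrC.
  by rewrite ltr_pdivlMr// mul1r.
 by rewrite ltr_pdivlMr// mul1r.
have E2 (r : R) : mu < r -> 2 * mu^-1 * (0 + mu^-1 * r) ^- 2 * hk s (mu * (0 + mu^-1 * r)) f x =
  mu * (2 * r ^- 2 * hk s r f x).
 move=> mr; have r0 := lt_trans mu0 mr; rewrite add0r mulVKf ?gt_eqF//.
 by field; rewrite !gt_eqF.
have mD : measurable (`]mu, +oo[%classic : set (mR R)) by exact: measurable_itv.
have H1 := intg_affine_set 0 m1 mD1 iR.
have H2 := Rintegral_affine_set 0 m1 mD1 iR.
rewrite E in H1; rewrite E in H2.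
have H3 : leb.-integrable `]mu, +oo[ (EFin \o (fun l : mR R => 2 * l ^- 2 * hk s l f x)).
 have := intgZ_real (mu^-1) mD H1.
 apply: (eq_integrable mD).
 by move=> r; rewrite inE/= in_itv/= andbT => mr; rewrite E2// mulKf// gt_eqF.
split; first exact: H3.
have : mu^-1 * (\int[leb]_(l in `]mu, +oo[) (mu * (2 * l ^- 2 * hk s l f x))) = Rk s mu f x.
 rewrite (_ : Rk s mu f x = mu^-1 * (mu^-1^-1 * Rk s mu f x)); last by rewrite mulVKf// gt_eqF.
 congr (_ * _); rewrite /Rk -H2; apply: eq_Rintegral => r.
 by rewrite inE/= in_itv/= andbT => mr; rewrite E2.
by move=> <-; rewrite (RintegralZl _ mD H3) mulKf// gt_eqF.
Qed.

Lemma is_derive_Rk_length s (mu : R) f x : 0 < mu -> CB 0 f ->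
 is_derive mu 1 (fun m => Rk s m f x) (- (2 * mu ^- 2 * hk s mu f x)).
Proof.
move=> mu0 f0; have mu2 : 0 < mu / 2 by pos.
have pos y : mu - mu / 2 <= y -> 0 < y by move=> h; have := mu2; lra.
have D : is_derive mu 1 (fun m => - Rk s m f x) (2 * mu ^- 2 * hk s mu f x).
 apply: (@is_derive_FTC R (fun m => - Rk s m f x) (fun l => 2 * l ^- 2 * hk s l f x) mu (mu / 2) mu2).
  move=> y /andP[/pos y0 _]; apply: cont_mulR; last exact: (@cont_hk_length 0 s f x f0 y).
  apply: cont_mulR; first exact: cst_continuous.
  by apply: cvgV; [rewrite expf_neq0// gt_eqF|exact: exprn_continuous].
 move=> y y1 y2; have [i1 ->] := Rk_unscaled s x (pos _ (lexx _)) f0.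
 have [i2 ->] := Rk_unscaled s x (pos _ (ltW y1)) f0.
 by rewrite (Rintegral_split (ltW y1) _ i1)// opprD addrAC addNr add0r.
have -> : (fun m : R => Rk s m f x) = - (fun m : R => - Rk s m f x).
 by apply/funext => m; rewrite /GRing.opp/= opprK.
exact: is_deriveN D.
Qed.

(** Both sides have the same derivative in mu and decay like 1 / mu; hypothesis gh is the equality
    of the derivatives term by term. It is the common source of the next two identities, where the
    Laplacian falls on the function or on the kernel. *)
Lemma Rk_sum_zero (u : 'I_3 -> seq 'I_3) (g : 'I_3 -> V -> R) (h : V -> R) x (c : R) :
 (forall i, CB 0 (g i)) -> CB 2 h ->
 (forall i y, 0 < y -> y ^- 2 * hk (u i) y (g i) x = y * hk [::] y (partials [:: i; i] h) x) ->
 (forall y, 1 <= y -> `|hk [::] y h x| <= c / y) ->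
 forall mu, 0 < mu -> \sum_(i < 3) Rk (u i) mu (g i) x = - hk [::] mu h x.
Proof.
move=> g0 h2 gh hc mu mu0; apply/eqP; rewrite -subr_eq0 opprK; apply/eqP.
have /choice[M HM] : forall i, exists M : R, forall y, `|g i y| <= M by move=> i; exact: CB_bnd (g0 i).
pose F y := Rk (u ord0) y (g ord0) x + (Rk (u o1) y (g o1) x +
 Rk (u o2) y (g o2) x) + hk [::] y h x.
have FE y : F y = \sum_(i < 3) Rk (u i) y (g i) x + hk [::] y h x by rewrite sum3.
rewrite -FE.
pose C := (\sum_(i < 3) 2 * (cK (u i) * (cK (u i) * M i))) + c.
apply: (@derive_pos_zero R F C) => //.
- move=> y y0.
 have d i := @is_derive_Rk_length (u i) y (g i) x y0 (g0 i).
 have dh := @is_derive_hk_length R h x y h2.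
 have D := is_deriveD (is_deriveD (d ord0) (is_deriveD (d o1) (d o2))) dh.
 apply: (is_derive_eq D).
 have G i : 2 * y ^- 2 * hk (u i) y (g i) x = 2 * y * hk [::] y (partial i (partial i h)) x.
  by rewrite -mulrA gh// mulrA.
 have key (p1 p2 p3 q1 q2 q3 : R) : p1 = q1 -> p2 = q2 -> p3 = q3 ->
  - p1 + (- p2 - p3) + (q1 + (q2 + q3)) = 0 by move=> -> -> ->; ring.
 by rewrite sum3 !mulrDr; exact: key (G _) (G _) (G _).
- move=> y y1; have y0 : 0 < y := lt_le_trans ltr01 y1.
 rewrite FE (le_trans (ler_normD _ _))// /C mulrDl lerD ?hc//.
 rewrite (le_trans (ler_norm_sum _ _ _))// mulr_suml ler_sum// => i _.
 by rewrite (le_trans (Rk_bound (u i) x y0 (g0 i) (HM i)))// mulrAC.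
Qed.

Lemma hk_decay s (y : R) f x M : CB (size s) f -> (0 < size s)%N -> (forall x, `|f x| <= M) -> 1 <= y ->
 `|hk [::] y (partials s f) x| <= (cK s * (cK s * M)) / y.
Proof.
move=> fs s0 fM y1; have y0 : 0 < y := lt_le_trans ltr01 y1.
have := @hk_ibps R (size s) s [::] y f x fs (leqnn _); rewrite cats0 => E.
have ys : 0 < y ^+ size s by pos.
have -> : hk [::] y (partials s f) x = (y ^+ size s)^-1 * hk s y f x by rewrite -E mulKf// gt_eqF.
have b := hk_bound s y x (CB_cont fs) fM.
rewrite normrM gtr0_norm ?invr_gt0// mulrC ler_pM ?invr_ge0 ?(ltW ys)//.
by rewrite lef_pV2 ?posrE// -[leLHS]expr1 ler_weXn2l.
Qed.

(** The derivative of e^(tau Laplacian) in tau is integrated over tau > mu^2, and only the lower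
    endpoint survives. *)
Lemma Rk_Laplacian s (mu : R) f x : size s = 3 -> CB 5 f -> 0 < mu ->
 \sum_(i < 3) Rk s mu (partials [:: i; i] f) x = - hk [::] mu (partials s f) x.
Proof.
move=> s3 f5 mu0; have [M fM] := CB_bnd f5.
have fs : CB 2 (partials s f) by have := @CB_partials R 5 f s f5; rewrite s3; exact.
apply: (@Rk_sum_zero (fun=> s) (fun i => partials [:: i; i] f) (partials s f) x (cK s * (cK s * M)) _ fs _ _ mu mu0).
- by move=> i; apply: CB_le (CB_partials f5 (isT : (size [:: i; i] <= 5)%N)).
- move=> i y y0.
 have E1 := @hk_ibps R 5 [:: i; i] s y f x f5 isT.
 have E2 := @hk_ibps R 5 ([:: i; i] ++ s) [::] y f x f5; rewrite size_cat s3 cats0 partials_cat in E2.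
 have {}E2 := E2 isT; rewrite -E1 /= in E2.
 have yn : y != 0 by rewrite gt_eqF.
 move: E2; move: (hk s _ _ _) (hk [::] _ _ _) => a b E2.
 have -> : a = y ^- 2 * (y ^+ 2 * a) by rewrite mulKf// expf_neq0.
 by rewrite -E2; field.
- by move=> y y1; apply: hk_decay => //; rewrite s3//; exact: CB_le f5.
Qed.

Lemma Rk_trace j (mu : R) f x : CB 3 f -> 0 < mu ->
 \sum_(i < 3) Rk [:: i; i; j] mu f x = - hk [::] mu (partial j f) x.
Proof.
move=> f3 mu0; have [M fM] := CB_bnd f3.
apply: (@Rk_sum_zero (fun i => [:: i; i; j]) (fun=> f) (partial j f) x (cK [:: j] * (cK [:: j] * M)) _ (CB_partial j f3) _ _ mu mu0).
- by move=> _; exact: CB_le f3.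
- move=> i y y0.
 have E := @hk_ibps R 3 [:: i; i; j] [::] y f x f3 isT; rewrite /= in E; rewrite -E /=.
 by field; rewrite gt_eqF.
- by move=> y y1; apply: (@hk_decay [:: j]) => //; exact: CB_le f3.
Qed.

(** D^s e^(tau Laplacian) f for tau >= 0, frozen at its value at 0 for negative tau. *)
Definition Hh s f (tau : R) x : R := hk [::] (sqrt tau) (partials s f) x.

(** For |s| = 3 this is D^s (- Laplacian)^-1 f, the integral over all tau > 0 split at tau = 1: the
    derivatives rest on f below 1 and on the kernel beyond. *)
Definition R0 s f x : R := Rk s 1 f x + \int[leb]_(r in D01) Hh s f r x.

(* The continuation of [tau |-> Rk s (sqrt tau) f x] to tau <= 0: it is C^1,
  and affine on the negative half line because sqrt vanishes there. *)
Definition Gt s f (tau : R) x : R := R0 s f x - tau * \int[leb]_(r in D01) Hh s f (tau * r) x.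

Lemma integral01_cst (c : R) : \int[leb]_(r in D01) c = c.
Proof.
rewrite Rintegral_cst//= lebesgue_measure_itv/= lte_fin ltr01 oppr0 addr0 /=.
by rewrite mulr1.
Qed.

Lemma intg01_cst (c : R) : leb.-integrable D01 (EFin \o (fun=> c)).
Proof.
apply: (@le_intg _ _ _ leb D01 (fun=> c) (fun r => `|c| * wt r)) => //.
 exact: intg_wt.
move=> r /D01P[r0 r1]; rewrite ler_peMr//.
have a1 : 1 <= (sqrt r)^-1.
 by rewrite invf_ge1 ?sqrtr_gt0// -[leRHS]sqrtr1 ler_wsqrtr// ltW.
by rewrite /wt (le_trans a1)// lerDl invr_ge0 sqrtr_ge0.
Qed.

Section Generator.
Variables (s : seq 'I_3) (f : V -> R).
Hypothesis s3 : size s = 3.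
Hypothesis f3 : CB 3 f.

Let fs : CB 0 (partials s f).
Proof. by have := @CB_partials R 3 f s f3; rewrite s3; exact. Qed.

Lemma cont_Hh x : continuous (fun tau => Hh s f tau x).
Proof.
by move=> tau; apply: (@cont_compR (fun l => hk [::] l (partials s f) x));
 [exact: sqrt_continuous|exact: (@cont_hk_length 0 [::] (partials s f) x fs _)].
Qed.

Lemma Hh_bound M : (forall x, `|partials s f x| <= M) -> forall tau x, `|Hh s f tau x| <= cK [::] * (cK [::] * M).
Proof. by move=> fM tau x; apply: hk_bound => //; exact: CB_cont fs. Qed.

Lemma intg_Hh_scaled (tau : R) x : leb.-integrable D01 (EFin \o (fun r : mR R => Hh s f (tau * r) x)).
Proof.
have [M fM] := CB_bnd fs.
apply: (@le_intg _ _ _ leb D01 _ (fun=> cK [::] * (cK [::] * M))) => //.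
- apply: mfun_cont01 => r _ _.
 apply: (@continuous_comp _ _ _ (fun r : R => tau * r) (fun tau => Hh s f tau x)); last exact: cont_Hh.
 cts.
- exact: intg01_cst.
- by move=> r _; exact: Hh_bound.
Qed.

Lemma Hh_neg (tau : R) x : tau <= 0 -> Hh s f tau x = Hh s f 0 x.
Proof. by move=> t0; rewrite /Hh ler0_sqrtr// sqrtr0. Qed.

Let Phi x (tau : R) := tau * \int[leb]_(r in D01) Hh s f (tau * r) x.

Let is_derive_Phi (x : V) (tau : R) : is_derive tau 1 (Phi x) (Hh s f tau x).
Proof.
have cH : forall y : R, {for y, continuous (fun tau : R => Hh s f tau x)} by move=> y; exact: cont_Hh.
(* [Phi] is linear for tau < 0 and an indefinite integral for tau > 0; at 0 its slope is the average
   itself, which is continuous. *)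
have [tn|tp|->] := ltgtP tau 0.
- rewrite (Hh_neg _ (ltW tn)).
 have D : is_derive tau 1 (fun t : R => t * Hh s f 0 x) (Hh s f 0 x).
  have := is_deriveM (is_derive_id tau (1 : R)) (is_derive_cst (Hh s f 0 x) tau 1).
  by rewrite /GRing.scale/= mulr0 add0r mulr1.
 apply: near_eq_is_derive D.
 have n1 : \forall y \near tau, y < 0 by exact: lt_nbhsl.
 apply: filterS n1 => y y0; rewrite /Phi; congr (_ * _).
 rewrite -[LHS]integral01_cst; apply: eq_Rintegral => r /set_mem/D01P[r0 _].
 by rewrite Hh_neg// nmulr_rle0// ltW.
- have PE y : 0 < y -> Phi x y = \int[leb]_(z in `]0, y[) Hh s f z x.
  move=> y0; rewrite (Rintegral_affine01 y0).
   have -> : (fun r : R => Hh s f (0 + (y - 0) * r) x) = (fun r => Hh s f (y * r) x).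
    by apply/funext => r; rewrite subr0 add0r.
   by rewrite subr0.
  apply: (intg_affine01 y0); have := intg_Hh_scaled y x.
  by congr (leb.-integrable _ _); apply/funext => r /=; rewrite subr0 add0r.
 have t2 : 0 < tau / 2 by pos.
 apply: (@is_derive_FTC R (Phi x) (fun z => Hh s f z x) tau (tau / 2) t2).
  by move=> y _; exact: cH.
 move=> y y1 y2; have a0 : 0 < tau - tau / 2 by have := t2; lra.
 rewrite !PE//; last exact: lt_trans y1.
 apply: Rintegral_split; [exact: ltW|by rewrite bnd_simp|].
 apply: integrableS (intg_segment (a := 0) (b := y) (fun y _ => cH y)) => //.
 exact: subset_itv_oo_cc.
- have -> : Hh s f 0 x = \int[leb]_(r in D01) Hh s f (0 * r) x.
  rewrite -[LHS]integral01_cst; apply: eq_Rintegral => r _; by rewrite mul0r.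
 apply: (@is_derive_slope R (Phi x) (fun h => \int[leb]_(r in D01) Hh s f (h * r) x) 0).
  by apply: (@near_all R R^o) => h; rewrite addr0 /Phi mul0r subr0.
 have [M fM] := CB_bnd fs.
 apply: (cont_int mD01 (f := fun (h : R) (r : mR R) => Hh s f (h * r) x)
  (intg01_cst (cK [::] * (cK [::] * M)))).
 + by apply: (@near_all R R^o) => h; have /integrableP[/measurable_EFinP] := intg_Hh_scaled h x.
 + by apply: (@near_all R R^o) => h r _; exact: Hh_bound.
 + apply: aeW => r _.
  apply: (@continuous_comp _ _ _ (fun h : R => h * r) (fun tau => Hh s f tau x)); last exact: cH.
  cts.
Qed.

Lemma is_derive_Gt (x : V) (tau : R) : is_derive tau 1 (fun t => Gt s f t x) (- Hh s f tau x).
Proof.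
have := is_deriveB (is_derive_cst (R0 s f x) tau 1) (is_derive_Phi x tau).
by rewrite sub0r.
Qed.

(** Both sides have the derivative -Hh in tau, and they agree at tau = 1, where [R0] is split. *)
Lemma Gt_pos (x : V) (tau : R) : 0 < tau -> Gt s f tau x = Rk s (sqrt tau) f x.
Proof.
move=> t0; apply/eqP; rewrite -subr_eq0; apply/eqP.
pose F t := Gt s f t x - Rk s (sqrt t) f x.
have F1 : F 1 = 0.
 rewrite /F /Gt /R0 sqrtr1 mul1r; under [X in _ - X - _]eq_Rintegral do rewrite mul1r.
 by rewrite addrK subrr.
rewrite -/(F tau) -F1; apply: derive_pos_const => // y y0.
have sy : 0 < sqrt y by pos.
have d1 := @is_derive_Rk_length s (sqrt y) f x sy (CB_le (leq0n 3) f3).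
have d2 := is_derive1_comp (f := fun m => Rk s m f x) (g := @sqrt R) d1 (is_derive1_sqrt y0).
apply: (is_derive_eq (is_deriveB (is_derive_Gt x y) d2)).
have E := @hk_ibps R 3 s [::] (sqrt y) f x f3; rewrite cats0 s3 in E.
rewrite /Hh -E// /GRing.scale/=.
by field; rewrite gt_eqF.
Qed.

End Generator.

Lemma Hh_cont I (u : R -> V -> R) s (tau t : R) x : open I -> stc I (fun t => partials s (u t)) -> I t ->
 {for ((tau, (t, x)) : R * (R * V)), continuous (fun q : R * (R * V) => Hh s (u q.2.1) q.1 q.2.2)}.
Proof.
move=> oI su It; have c := @hk_cont R I (fun t => partials s (u t)) [::] (sqrt tau) t x oI su It.
apply: (@continuous_comp _ _ _ (fun q : R * (R * V) => (sqrt q.1, q.2))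
 (fun q : R * (R * V) => hk [::] q.1 (partials s (u q.2.1)) q.2.2)); last exact: c.
apply: cvg_pairN; last exact: cvg_snd.
by apply: (@cvg_comp _ _ _ fst (@sqrt R) _ (nbhs tau)); [exact: cvg_fst|exact: sqrt_continuous].
Qed.

Lemma Hh_average_cont I (u : R -> V -> R) s (tau t : R) x : open I -> stc I (fun t => partials s (u t)) -> I t ->
 {for ((tau, (t, x)) : R * (R * V)), continuous (fun q : R * (R * V) => \int[leb]_(r in D01) Hh s (u q.2.1) (q.1 * r) q.2.2)}.
Proof.
move=> oI su It; have [M HM] := su.2 t It.
have near2 (P : R -> Prop) : (\forall s \near t, P s) ->
  \forall q \near ((tau, (t, x)) : R * (R * V)), P q.2.1.
 move=> HP; have c : (fun q : R * (R * V) => q.2.1) @ (tau, (t, x)) --> t.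
  by apply: (@cvg_comp _ _ _ snd fst); [exact: cvg_snd|exact: cvg_fst].
 exact: (c _ HP).
have It' : \forall s \near t, I s by exact: open_nbhs_nbhs.
have cr (r : R) (q : R * (R * V)) : I q.2.1 -> {for q, continuous (fun q : R * (R * V) => Hh s (u q.2.1) (q.1 * r) q.2.2)}.
 case: q => a [b y] /= Ib; have c := @Hh_cont I u s (a * r) b y oI su Ib.
 apply: (@continuous_comp _ _ _ (fun q : R * (R * V) => (q.1 * r, q.2))
  (fun q : R * (R * V) => Hh s (u q.2.1) q.1 q.2.2)); last exact: c.
 cts.
apply: (cont_int mD01 (f := fun (q : R * (R * V)) (r : mR R) => Hh s (u q.2.1) (q.1 * r) q.2.2)
  (intg01_cst (cK [::] * (cK [::] * M)))).
- apply: filterS (near2 _ It') => q Iq; apply: mfun_cont01 => r _ _.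
 have cp := stc_cont su Iq; have bp := stc_bounded su Iq.
 have f0 : CB 0 (partials s (u q.2.1)) by apply/CB0; split.
 apply: (@cont_compR (fun l => hk [::] l (partials s (u q.2.1)) q.2.2) (fun r : R => sqrt (q.1 * r)));
  last exact: (@cont_hk_length 0 [::] (partials s (u q.2.1)) q.2.2 f0 _).
 apply: (@cont_compR (@sqrt R) (fun r : R => q.1 * r)); last exact: sqrt_continuous.
 by apply: cont_mulR; [exact: cst_continuous|exact: cvg_id].
- apply: filterS2 (near2 _ It') (near2 _ HM) => q Iq Mq r _.
 by apply: hk_bound => //; exact: stc_cont su Iq.
- by apply: aeW => r _; exact: (cr r (tau, (t, x)) It).
Qed.

Lemma R0_cont I (u : R -> V -> R) s (t : R) x : open I -> stc I u -> stc I (fun t => partials s (u t)) -> I t ->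
 {for ((t, x) : R * V), continuous (fun q : R * V => R0 s (u q.1) q.2)}.
Proof.
move=> oI su ss It.
have p : (fun q : R * V => (1, q)) @ (t, x) --> ((1, (t, x)) : R * (R * V)).
 cts.
apply: cvgD.
 apply: (@continuous_comp _ _ _ (fun q : R * V => (1 : R, q)) (fun q : R * (R * V) => Rk s q.1 (u q.2.1) q.2.2)).
  exact: p.
 exact: (@Rk_cont R I u s 1 t x oI su It ltr01).
have H : {for (t, x), continuous (fun q : R * V => \int[leb]_(r in D01) Hh s (u q.1) (1 * r) q.2)}.
 apply: (@continuous_comp _ _ _ (fun q : R * V => (1 : R, q))
  (fun q : R * (R * V) => \int[leb]_(r in D01) Hh s (u q.2.1) (q.1 * r) q.2.2)); first exact: p.
 exact: (@Hh_average_cont I u s 1 t x oI ss It).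
have E : (fun q : R * V => \int[leb]_(r in D01) Hh s (u q.1) (1 * r) q.2) =
  (fun q : R * V => \int[leb]_(r in D01) Hh s (u q.1) r q.2).
 by apply/funext => q; apply: eq_Rintegral => r _; rewrite mul1r.
by rewrite E in H; exact: H.
Qed.

Lemma Gt_cont I (u : R -> V -> R) s (tau t : R) x : open I -> stc I u -> stc I (fun t => partials s (u t)) -> I t ->
 {for ((tau, (t, x)) : R * (R * V)), continuous (fun q : R * (R * V) => Gt s (u q.2.1) q.1 q.2.2)}.
Proof.
move=> oI su ss It; apply: cvgB.
 apply: (@continuous_comp _ _ _ snd (fun q : R * V => R0 s (u q.1) q.2)); first exact: cvg_snd.
 exact: (@R0_cont I u s t x oI su ss It).
by apply: cvgM; [exact: cvg_fst|exact: (@Hh_average_cont I u s tau t x oI ss It)].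
Qed.

End Generators.

(** * Time derivative of the Duhamel integrals *)

Section DuhamelDerivative.
Context {R : realType}.
Local Notation V := 'rV[R]_3.

Lemma MVT_le (g dg : R -> R) (M a b : R) :
 (forall y : R, Num.min a b <= y <= Num.max a b -> is_derive y 1 g (dg y)) ->
 (forall y, Num.min a b <= y <= Num.max a b -> `|dg y| <= M) -> `|g b - g a| <= M * `|b - a|.
Proof.
have H p q : p <= q -> (forall y : R, p <= y <= q -> is_derive y 1 g (dg y)) ->
  (forall y, p <= y <= q -> `|dg y| <= M) -> `|g q - g p| <= M * `|q - p|.
 move=> pq dgy hM; have cg : {within `[p, q], continuous g}.
  apply: continuous_in_subspaceT => y; rewrite inE/= in_itv => yI.
  by apply/differentiable_continuous/derivable1_diffP; case: (dgy y yI).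
 have [|c cpq ->] := @MVT_segment R g dg p q pq _ cg.
  by move=> y /subset_itv_oo_cc; rewrite in_itv; exact: dgy.
 by rewrite normrM ler_wpM2r//; apply: hM; move: cpq; rewrite in_itv.
have [ab|/ltW ba] := leP a b; first exact: H.
by rewrite distrC [in X in _ <= X]distrC; exact: H.
Qed.

Lemma RintegralD3 d (Y : measurableType d) (mu : {measure set Y -> \bar R}) (D : set Y) (f1 f2 f3 : Y -> R) :
 measurable D -> mu.-integrable D (EFin \o f1) -> mu.-integrable D (EFin \o f2) -> mu.-integrable D (EFin \o f3) ->
 \int[mu]_(x in D) f1 x + (\int[mu]_(x in D) f2 x + \int[mu]_(x in D) f3 x) =
 \int[mu]_(x in D) (f1 x + (f2 x + f3 x)).
Proof.
move=> mD i1 i2 i3; rewrite [RHS]RintegralD//; first by rewrite [in RHS]RintegralD.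
exact: intgD_real.
Qed.

Variables (T : \bar R) (K : nat) (F : R -> V -> R) (N : R) (s : seq 'I_3).
Local Notation I := (time_interval T).
Hypothesis N0 : 0 <= N.
Hypothesis FX : XX I K (fun t => N * rs t ^+ 2) rs F.
Hypothesis FN : forall t, I t -> exists kap, [/\ 0 <= kap, kap * sqrt t <= 1 &
 forall t', I t' -> Nb kap (F t') (N * rs t')].
(** Three derivatives for s and two for the Laplacian. *)
Hypothesis K5 : (5 <= K)%N.
Hypothesis s3 : size s = 3.

Let sK : (size s <= K)%N. Proof. by rewrite s3; exact: leq_trans K5. Qed.

Let F5 t : I t -> CB 5 (F t).
Proof. by move=> It; apply: CB_le K5 (DB_CB (FX.1 _ It)). Qed.

Let F3 t : I t -> CB 3 (F t).
Proof. by move=> It; apply: CB_le (F5 It). Qed.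

Let stcF : stc I F := @F_stc R T K F N FX [::] isT.
Let stcFs := @F_stc R T K F N FX s sK.

Lemma rs_scale (t r : R) : 0 <= t -> rs (t * r) = rs t * rs r.
Proof. by move=> t0; rewrite /rs sqrtrM// invfM. Qed.

Lemma rs_le_wt (r : R) : rs r <= wt r.
Proof. by rewrite lerDl invr_ge0 sqrtr_ge0. Qed.

Lemma wt_ge1 (r : R) : 0 < r -> r < 1 -> 1 <= wt r.
Proof.
move=> r0 r1; apply: le_trans (rs_le_wt r).
by rewrite invf_ge1 ?sqrtr_gt0// -[leRHS]sqrtr1 ler_wsqrtr// ltW.
Qed.

(** The domination for differentiating in time by increments of at most t / 4. For r >= 1/2 the
    forcing at time t r is as smooth as at time t / 2. For r < 1/2 the heat operator has run for a
    time at least t / 4 and takes the three derivatives, and only the size of the forcing near r = 0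
    is left, which the weight dominates. *)
Lemma Hh_Duhamel_bound t x : I t -> exists2 C : R, 0 <= C & forall r tau, 0 < r -> r < 1 ->
 t * (1 - r) - t / 4 <= tau <= 2 * t -> `|Hh s (F (t * r)) tau x| <= C * wt r.
Proof.
move=> It; have t0 := I_gt0 It; have [kap [k0 kt FNk]] := FN It.
have rt2 := rs_gt0 (divr_gt0 t0 (ltr0Sn R 1)).
pose M := N * rs (t / 2) ^+ 2 * rs (t / 2) ^+ 3.
have M0 : 0 <= M by rewrite !mulr_ge0// ?exprn_ge0// ltW.
pose e := sqrt t / 2.
have st : 0 < sqrt t by pos.
have e0 : 0 < e by rewrite divr_gt0.
(* Three derivatives and one length of the smoothing estimate give the power 4; e is sqrt(t / 4),
   and the factor 2 bounds max(1, kap m). *)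
pose C2 := e ^- 4 * (cK s ^+ 2 * (2 * (N * rs t))).
have ck : 0 < @cK R s := @cK_gt0 R s.
have rt := rs_gt0 t0.
have C20 : 0 <= C2.
 apply: mulr_ge0; first pos.
 pos.
have c00 : 0 <= cK [::] * (cK [::] * M) by pos.
exists (cK [::] * (cK [::] * M) + C2); first pos.
move=> r tau r0 r1 /andP[tau1 tau2].
have Itr := I_scale It r0 r1; have Ftr := FX.1 _ Itr.
have w0 := wt_gt0 r0 r1; have w1 := wt_ge1 r0 r1.
have [rh|rh] := leP 2^-1 r.
- apply: (@le_trans _ _ (cK [::] * (cK [::] * M))); last first.
  by rewrite mulrDl (le_trans (ler_peMr c00 w1))// lerDl mulr_ge0// ltW.
 apply: (Hh_bound s3 (F3 Itr)) => y.
 apply: (le_trans (Ftr.2 s sK y)); rewrite s3.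
 have h : rs (t * r) <= rs (t / 2).
  by rewrite lef_pV2 ?posrE ?sqrtr_gt0 ?divr_gt0 ?mulr_gt0// ler_wsqrtr// ler_wpM2l// ltW.
 have h0 := ltW (rs_gt0 (I_gt0 Itr)).
 apply: ler_pM; rewrite ?mulr_ge0 ?exprn_ge0//.
  by rewrite ler_wpM2l// lerXn2r ?nnegrE// (ltW rt2).
 by rewrite lerXn2r ?nnegrE// (ltW rt2).
- have tau4 : t / 4 <= tau by apply: le_trans tau1; nra.
 have tau0 : 0 < tau by apply: lt_le_trans tau4; rewrite divr_gt0.
 set m := sqrt tau.
 have m0 : 0 < m by pos.
 have em : e <= m.
  have -> : e = sqrt (t / 4).
   rewrite sqrtrM ?(ltW t0)// /e; congr (_ * _).
   have -> : 4^-1 = 2^-1 ^+ 2 :> R by rewrite exprVn -natrX.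
   by rewrite sqrtr_sqr ger0_norm.
  exact: ler_wsqrtr.
 have km : Num.max 1 (kap * m) <= 2.
  rewrite ge_max ler1n/=.
  have : m <= 2 * sqrt t.
   rewrite -[2]ger0_norm// -sqrtr_sqr -sqrtrM ?sqr_ge0// ler_wsqrtr//.
   by apply: (le_trans tau2); rewrite ler_wpM2r ?(ltW t0)//; lra.
  move=> /(ler_wpM2l k0) /le_trans; apply; rewrite mulrCA; lra.
 have A0 : 0 <= N * rs (t * r) by exact: mulr_ge0 N0 (ltW (rs_gt0 (I_gt0 Itr))).
 have b := hk_Nb_bound s x m0 A0 (CB_cont (F3 Itr)) (CB_bnd (F3 Itr)) (FNk _ Itr).
 have E := @hk_ibps R 3 s [::] m (F (t * r)) x (F3 Itr); rewrite cats0 s3 in E.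
 have {}E := E isT.
 have -> : Hh s (F (t * r)) tau x = m ^- 4 * (m * hk s m (F (t * r)) x).
  by rewrite -E /Hh -/m; field; rewrite gt_eqF.
 have m4 : m ^- 4 <= e ^- 4 by rewrite lef_pV2 ?posrE ?exprn_gt0// lerXn2r ?nnegrE// ltW.
 apply: (@le_trans _ _ (C2 * rs r)); last first.
  rewrite mulrDl; apply: (@le_trans _ _ (C2 * wt r)); first by rewrite ler_wpM2l// rs_le_wt.
  by rewrite lerDr mulr_ge0// ltW.
 rewrite normrM ger0_norm ?invr_ge0 ?exprn_ge0 ?(ltW m0)// /C2 -mulrA.
 apply: ler_pM => //; first pos.
 rewrite normrM gtr0_norm//; apply: (le_trans b).
 rewrite [leRHS](_ : _ = cK s ^+ 2 * (2 * (N * rs (t * r)))); last by rewrite rs_scale ?(ltW t0)//; ring.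
 by apply: ler_wpM2l; [exact: ltW (exprn_gt0 2 ck)|exact: ler_wpM2r].
Qed.

(** The integrand of [Bk] at time c as a function of the earlier time sg; thanks to the continuation
    [Gt] it is continuous up to sg = c and beyond. *)
Let phi (x : V) (c sg : R) := Gt s (F sg) (c - sg) x.

Let phi_cont x c sg : I sg -> {for sg, continuous (fun sg => phi x c sg)}.
Proof.
move=> Isg.
apply: (@continuous_comp _ _ _ (fun sg : R => (c - sg, (sg, x))) (fun q : R * (R * V) => Gt s (F q.2.1) q.1 q.2.2)).
 apply: cvg_pairN; first cts.
 cts.
exact: (@Gt_cont R I F s (c - sg) sg x (@open_I R T) stcF stcFs Isg).
Qed.

Let Bk_phi x c : I c -> leb.-integrable `]0, c[ (EFin \o phi x c) /\ Bk s F c x = \int[leb]_(sg in `]0, c[) phi x c sg.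
Proof.
move=> Ic; have c0 := I_gt0 Ic.
have i1 := @intg_Bk R T K F N s N0 FX FN [::] c x isT Ic.
have E (r : R) : 0 < r -> r < 1 -> phi x c (0 + (c - 0) * r) = Rk s (sqrt (c * (1 - r))) (F (c * r)) x.
 move=> r0 r1; rewrite /phi add0r subr0 (_ : c - c * r = c * (1 - r)); last by rewrite mulrBr mulr1.
 by rewrite (@Gt_pos R s (F (c * r)) s3 (F3 (I_scale Ic r0 r1)))// mulr_gt0// subr_gt0.
have i2 : leb.-integrable D01 (EFin \o (fun r : mR R => phi x c (0 + (c - 0) * r))).
 have := intgZ_real c^-1 mD01 i1.
 apply: (eq_integrable mD01) => r /set_mem/D01P[r0 r1].
 by rewrite /= (E _ r0 r1) mulKf// gt_eqF.
have i3 := intg_affine01 c0 i2.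
split; first exact: i3.
rewrite (Rintegral_affine01 c0 i3) -(RintegralZl _ mD01 i2).
apply: eq_Rintegral => r /set_mem/D01P[r0 r1].
by rewrite (E _ r0 r1) subr0.
Qed.

(** The part of [Bk s F (t + h0 k)] in which the forcing is integrated over (0, t), rescaled to (0,
    1). For k < 0 it runs past t + h0 k and sees [Gt] at negative tau, so increments of both signs
    are treated alike. *)
Let fA (t h0 : R) (x : V) (k r : R) := t * Gt s (F (t * r)) (h0 * k + t * (1 - r)) x.

(** Differentiation under the integral produces -Hh at tau = t (1 - r), which [Rk_Laplacian]
    recognises as the Laplacian of the integrand of [Bk]. *)
Let fA_facts t h0 x : I t -> 0 < h0 -> h0 <= t / 4 ->
 [/\ forall k : R, `|k| < 1 -> leb.-integrable D01 (EFin \o (fA t h0 x k : mR R -> R)) &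
  is_derive (0 : R) 1 (fun k => \int[leb]_(r in D01) fA t h0 x k r)
   (h0 * \sum_(i < 3) partials [:: i; i] (Bk s F t) x)].
Proof.
move=> It h00 h04; have t0 := I_gt0 It.
have [C C0 HC] := Hh_Duhamel_bound x It.
have D (k r : R) : 0 < r -> r < 1 -> is_derive k 1 (fun k => fA t h0 x k r)
  (t * (- Hh s (F (t * r)) (h0 * k + t * (1 - r)) x * h0)).
 move=> r0 r1; have f3 := F3 (I_scale It r0 r1).
 have d1 : is_derive k 1 (fun k : R => h0 * k + t * (1 - r)) h0.
  have := is_deriveD (is_deriveZ h0 (is_derive_id k (1 : R))) (is_derive_cst (t * (1 - r)) k 1).
  by rewrite addr0 /GRing.scale/= mulr1.
 have d2 := is_derive_Gt s3 f3 x (h0 * k + t * (1 - r)).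
 have d3 := is_derive1_comp (f := fun tau => Gt s (F (t * r)) tau x) (g := fun k : R => h0 * k + t * (1 - r)) d2 d1.
 exact: (is_deriveZ t d3).
have rng (k r : R) : `|k| <= 1 -> 0 < r -> r < 1 -> t * (1 - r) - t / 4 <= h0 * k + t * (1 - r) <= 2 * t.
 move=> k1 r0 r1; have : `|h0 * k| <= h0 by rewrite normrM gtr0_norm// ger_pMr.
 rewrite ler_norml => /andP[a1 a2]; have tr0 : 0 < t * r by pos.
 rewrite mulrBr mulr1; apply/andP; split; lra.
have Db (k r : R) : `|k| <= 1 -> 0 < r -> r < 1 ->
  `|t * (- Hh s (F (t * r)) (h0 * k + t * (1 - r)) x * h0)| <= t * h0 * C * wt r.
 move=> k1 r0 r1; rewrite normrM gtr0_norm// normrM normrN (gtr0_norm h00).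
 rewrite [leRHS](_ : _ = t * (C * wt r * h0)); last by ring.
 rewrite ler_wpM2l ?(ltW t0)// ler_wpM2r ?(ltW h00)//.
 exact: HC (rng _ _ k1 r0 r1).
have mf k : measurable_fun D01 (fA t h0 x k : mR R -> mR R).
 apply: mfun_cont01 => r r0 r1; apply: cont_mulR; first exact: cst_continuous.
 apply: (@continuous_comp _ _ _ (fun r : R => (h0 * k + t * (1 - r), (t * r, x)))
  (fun q : R * (R * V) => Gt s (F q.2.1) q.1 q.2.2)).
  cts.
 exact: (@Gt_cont R I F s _ (t * r) x (@open_I R T) stcF stcFs (I_scale It r0 r1)).
have fA0 r : 0 < r -> r < 1 -> fA t h0 x 0 r = t * Rk s (sqrt (t * (1 - r))) (F (t * r)) x.
 move=> r0 r1; rewrite /fA mulr0 add0r.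
 by rewrite (@Gt_pos R s (F (t * r)) s3 (F3 (I_scale It r0 r1)))// mulr_gt0// subr_gt0.
have i0 : leb.-integrable D01 (EFin \o (fA t h0 x 0 : mR R -> R)).
 have := @intg_Bk R T K F N s N0 FX FN [::] t x isT It.
 by apply: (eq_integrable mD01) => r /set_mem/D01P[r0 r1] /=; rewrite fA0.
(* Integrability at k is deduced from that at 0, where the integrand is the one of [Bk], and from
   the mean value bound for the increment. *)
have ik (k : R) : `|k| < 1 -> leb.-integrable D01 (EFin \o (fA t h0 x k : mR R -> R)).
 move=> k1.
 have id : leb.-integrable D01 (EFin \o (fun r : mR R => fA t h0 x k r - fA t h0 x 0 r)).
  apply: (le_intg mD01 _ (intg_wt (t * h0 * C))).
   by apply: measurable_funB; exact: mf.
  move=> r /D01P[r0 r1].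
  have M1 y : Num.min 0 k <= y <= Num.max 0 k ->
    `|t * (- Hh s (F (t * r)) (h0 * y + t * (1 - r)) x * h0)| <= t * h0 * C * wt r.
   move=> /andP[y1 y2]; apply: Db => //.
   move: k1; rewrite ltr_norml => /andP[k1 k2]; rewrite ler_norml.
   rewrite (le_trans _ y1)/= ?(le_trans y2)//.
    by rewrite ge_max ler01 ltW.
   by rewrite le_min lerN10 ltW.
  have := MVT_le (fun y _ => D y r r0 r1) M1; rewrite subr0 => H; apply: (le_trans H).
  rewrite ler_piMr ?(ltW k1)// mulr_ge0 ?(ltW (wt_gt0 r0 r1))//.
  pos.
 have := intgD_real mD01 id i0.
 by apply: (eq_integrable mD01) => r _; rewrite /= subrK.
split=> //.
have Dv (k r : R) : 0 < r -> r < 1 -> 'D_1 (fun k => fA t h0 x k r) k = t * (- Hh s (F (t * r)) (h0 * k + t * (1 - r)) x * h0).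
 by move=> r0 r1; exact: (@derive_val _ _ _ _ _ _ _ (D k r r0 r1)).
have H := @is_derive_int R _ _ leb D01 mD01 R^o (fun (k : R) (r : mR R) => fA t h0 x k r)
 (fun r => t * h0 * C * wt r) (0 : R) (1 : R).
have {H} H := H _ _ (intg_wt (t * h0 * C)) _.
apply: (is_derive_eq (H _ _ _)).
- by move=> h h1; rewrite /GRing.scale/= mulr1 addr0; exact: ik.
- by move=> h r _ /D01P[r0 r1]; case: (D (h *: (1 : R) + 0) r r0 r1).
- move=> h r h1 /D01P[r0 r1]; rewrite Dv// /GRing.scale/= mulr1 addr0.
 by apply: Db => //; exact: ltW.
- transitivity (h0 * \sum_(i < 3) Bk s (fun t => partials [:: i; i] (F t)) t x); last first.
  congr (_ * _); apply: eq_bigr => i _.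
  by rewrite (@Bk_partials R T K F N s N0 FX FN [:: i; i] t (leq_trans _ K5) It).
 have ii (i : 'I_3) := @intg_Bk R T K F N s N0 FX FN [:: i; i] t x (leq_trans (isT : (2 <= 5)%N) K5) It.
 rewrite sum3; apply/esym.
 apply: etrans (congr1 (fun z => h0 * z) (RintegralD3 mD01 (ii ord0) (ii o1) (ii o2))) _.
 have i3 := intgD_real mD01 (ii ord0) (intgD_real mD01 (ii o1) (ii o2)).
 rewrite -(RintegralZl _ mD01 i3).
 apply: eq_Rintegral => r /set_mem/D01P[r0 r1]; rewrite Dv// mulr0 add0r.
 have L := Rk_Laplacian x s3 (F5 (I_scale It r0 r1)) (sqrt_scale t0 r0 r1).
 rewrite sum3 in L.
 have key (a b c h : R) : a + (b + c) = - h -> h0 * (t * a + (t * b + t * c)) = t * (- h * h0).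
  by move=> e; rewrite -!mulrDr e; ring.
 exact: key L.
Qed.

(** Runs through the interval between t and t + h0 k from its left end, whatever the sign of k. *)
Let sg (t h0 k r : R) := t + (h0 * k - `|h0 * k|) / 2 + `|h0 * k| * r.

Let sg_range t h0 k r : 0 < r -> r < 1 -> `|sg t h0 k r - t| <= `|h0 * k| /\ `|t + h0 * k - sg t h0 k r| <= `|h0 * k|.
Proof.
move=> r0 r1; rewrite /sg; move: (h0 * k) => z.
have := normr_ge0 z; have [z0|z0] := leP 0 z.
 rewrite ger0_norm// => _; split; rewrite ler_norml; apply/andP; split; nra.
rewrite ltr0_norm// => _; split; rewrite ler_norml; apply/andP; split; nra.
Qed.

(** Mean of the integrand over that interval: the part of the integral which is new for k > 0, or in
    excess for k < 0, contributes h0 k Q, whose slope at k = 0 is the boundary term. *)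
Let Q (t h0 : R) (x : V) (k : R) := \int[leb]_(r in D01) phi x (t + h0 * k) (sg t h0 k r).

Let Bk_split t h0 x (k : R) : I t -> 0 < h0 -> h0 <= t / 4 -> (forall y, `|y - t| <= h0 -> I y) -> `|k| < 1 ->
 Bk s F (t + h0 * k) x = \int[leb]_(r in D01) fA t h0 x k r + h0 * k * Q t h0 x k.
Proof.
move=> It h00 h04 hI k1; have t0 := I_gt0 It.
have hk1 : `|h0 * k| <= h0 by rewrite normrM gtr0_norm// ger_pMr// ltW.
have Ic : I (t + h0 * k) by apply: hI; rewrite addrC addKr.
have [ic ->] := Bk_phi x Ic; set c := t + h0 * k in ic *; have c0 := I_gt0 Ic.
have [iA _] := fA_facts x It h00 h04; have {}iA := iA _ k1.
have E (r : R) : phi x c (0 + (t - 0) * r) = Gt s (F (t * r)) (h0 * k + t * (1 - r)) x.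
 have e : c - (0 + (t - 0) * r) = h0 * k + t * (1 - r) by rewrite /c; ring.
 by rewrite /phi e add0r subr0.
have i2 : leb.-integrable D01 (EFin \o (fun r : mR R => phi x c (0 + (t - 0) * r))).
 have := intgZ_real t^-1 mD01 iA.
 by apply: (eq_integrable mD01) => r _; rewrite /= E /fA mulKf// gt_eqF.
have i3 := intg_affine01 t0 i2.
have -> : \int[leb]_(r in D01) fA t h0 x k r = \int[leb]_(sg in `]0, t[) phi x c sg.
 rewrite (Rintegral_affine01 t0 i3) -(RintegralZl _ mD01 i2).
 by apply: eq_Rintegral => r _; rewrite E subr0.
have [k0|k0|k0] := ltgtP k 0.
- have hk0 : h0 * k < 0 by rewrite pmulr_rlt0.
 have ct : c < t by rewrite /c gtrDl.
 rewrite (Rintegral_split (ltW c0) _ i3); last by rewrite bnd_simp; exact: ct.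
 have i4 : leb.-integrable `]c, t[ (EFin \o phi x c).
  by apply: integrableS i3 => //; apply: subset_itvr; rewrite bnd_simp ltW.
 rewrite (Rintegral_affine01 ct i4).
 have -> : Q t h0 x k = \int[leb]_(r in D01) phi x c (c + (t - c) * r).
  apply: eq_Rintegral => r _; congr (phi _ _ _); by rewrite /sg /c ltr0_norm//; field.
 rewrite -addrA -mulrDl (_ : t - c + h0 * k = 0) ?mul0r ?addr0//.
 by rewrite /c; ring.
- have hk0 : 0 < h0 * k by pos.
 have tc : t < c by rewrite /c ltrDl.
 rewrite (Rintegral_split (ltW t0) _ ic); last by rewrite bnd_simp; exact: tc.
 have i4 : leb.-integrable `]t, c[ (EFin \o phi x c).
  by apply: integrableS ic => //; apply: subset_itvr; rewrite bnd_simp ltW.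
 apply: (congr1 (fun z => \int[leb]_(y in `]0, t[) phi x c y + z)); rewrite (Rintegral_affine01 tc i4).
 have -> : c - t = h0 * k by rewrite /c addrC addKr.
 apply: (congr1 (fun z => h0 * k * z)); apply: eq_Rintegral => r _; congr (phi _ _ _).
 by rewrite /sg gtr0_norm// subrr mul0r addr0.
- by rewrite /c k0 mulr0 addr0 mul0r addr0.
Qed.

Let Q_cont t h0 x : I t -> 0 < h0 -> (forall y, `|y - t| <= h0 -> I y) ->
 {for 0, continuous (Q t h0 x)} /\ Q t h0 x 0 = R0 s (F t) x.
Proof.
move=> It h00 hI.
pose G (q : R * (R * V)) := Gt s (F q.2.1) q.1 q.2.2.
have cG (a b : R) (y : V) : I b -> {for (a, (b, y)), continuous G}.
 by move=> Ib; exact: (@Gt_cont R I F s a b y (@open_I R T) stcF stcFs Ib).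
pose p (k r : R) : R * (R * V) := (t + h0 * k - sg t h0 k r, (sg t h0 k r, x)).
have pr (r : R) : {for 0, continuous (fun k => p k r)}.
 have c1 : h0 * k @[k --> (0 : R)] --> h0 * 0 by cts.
 have c2 : `|h0 * k| @[k --> (0 : R)] --> `|h0 * 0| by exact: cvg_norm.
 have c3 : sg t h0 k r @[k --> (0 : R)] --> sg t h0 0 r.
  apply: cvgD; last by apply: cvgM => //; exact: cst_continuous.
  apply: cvgD; first exact: cst_continuous.
  by apply: cvgM; [exact: cvgB|exact: cst_continuous].
 apply: cvg_pairN; last by apply: cvg_pairN; [exact: c3|exact: cst_continuous].
 by apply: cvgB; [apply: cvgD; [exact: cst_continuous|exact: c1]|exact: c3].
have sg0 r : sg t h0 0 r = t by rewrite /sg mulr0 normr0 subr0 !mul0r !addr0.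
have Isg k r : `|k| < 1 -> 0 < r -> r < 1 -> I (sg t h0 k r).
 move=> k1 r0 r1; apply: hI; have [H _] := sg_range t h0 k r0 r1.
 by rewrite (le_trans H)// normrM gtr0_norm// ger_pMr// ltW.
have k1near : \forall k \near (0 : R), `|k| < 1.
 have c : `|k| @[k --> (0 : R)] --> `|0 : R| by apply: cvg_norm; exact: cvg_id.
 by apply: (c (fun y => y < 1)); apply: lt_nbhsl; rewrite normr0.
split; last first.
 rewrite /Q -[RHS]integral01_cst; apply: eq_Rintegral => r _.
 by rewrite /phi mulr0 addr0 sg0 subrr /Gt mul0r subr0.
(* Continuity of G at the diagonal point bounds the integrand near it; this is the domination for
   Q. *)
have B : \forall q \near ((0, (t, x)) : R * (R * V)), `|G q| < `|G (0, (t, x))| + 1.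
 have c : `|G q| @[q --> ((0, (t, x)) : R * (R * V))] --> `|G (0, (t, x))| by apply: cvg_norm; exact: cG.
 by apply: (c (fun y => y < `|G (0, (t, x))| + 1)); apply: lt_nbhsl; rewrite ltrDl.
have [e /= e0 eB] := (nbhs_ballP _ _).1 B.
have knear : \forall k \near (0 : R), `|h0 * k| < e.
 have c : `|h0 * k| @[k --> (0 : R)] --> `|h0 * 0|.
  by apply: cvg_norm; cts.
 by apply: (c (fun y => y < e)); apply: lt_nbhsl; rewrite mulr0 normr0.
apply: (cont_int mD01 (f := fun (k : R) (r : mR R) => phi x (t + h0 * k) (sg t h0 k r))
  (intg01_cst (`|G (0, (t, x))| + 1))).
- apply: filterS k1near => k k1; apply: mfun_cont01 => r r0 r1.
 apply: (@cont_compR R (fun y => phi x (t + h0 * k) y) (fun r : R => sg t h0 k r)).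
  cts.
 exact: phi_cont (Isg _ _ k1 r0 r1).
- apply: filterS knear => k ke r /D01P[r0 r1]; apply: ltW; apply: (eB (p k r)).
 have [H1 H2] := sg_range t h0 k r0 r1.
 split => /=; first by rewrite /ball/= sub0r normrN (le_lt_trans H2).
 split => /=; first by rewrite /ball/= distrC (le_lt_trans H1).
 exact: ballxx.
- apply: aeW => r /D01P[r0 r1].
 apply: (@continuous_comp _ _ _ (fun k => p k r) G); first exact: pr.
 by apply: cG; rewrite sg0.
Qed.

(** Leibniz's rule when the upper end and the integrand both depend on t: the Laplacian comes from
    the integrand, [R0] from the diagonal, where tau = 0. *)
Lemma is_derive_Bk t x : I t -> is_derive t 1 (fun t => Bk s F t x)
 (\sum_(i < 3) partials [:: i; i] (Bk s F t) x + R0 s (F t) x).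
Proof.
move=> It; have t0 := I_gt0 It.
have : nbhs t I by apply: open_nbhs_nbhs; split => //; exact: open_I.
move=> /nbhs_ballP[e /= e0 eI].
(* Keeps t + h0 k in the time interval and tau in the range of the domination. *)
pose h0 := Num.min (e / 2) (t / 4).
have h00 : 0 < h0 by rewrite lt_min !divr_gt0.
have h04 : h0 <= t / 4 by rewrite ge_min lexx orbT.
have hI y : `|y - t| <= h0 -> I y.
 move=> yt; apply: eI; rewrite /ball/= distrC (le_lt_trans yt)// /h0 gt_min; apply/orP; left.
 by rewrite ltr_pdivrMr// mulr_natr mulr2n ltrDl.
have [_ dA] := fA_facts x It h00 h04.
have [cQ Q0] := Q_cont x It h00 hI.
have dQ : is_derive (0 : R) 1 (fun k => h0 * k * Q t h0 x k) (h0 * Q t h0 x 0).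
 apply: (@is_derive_slope R (fun k => h0 * k * Q t h0 x k) (fun k => h0 * Q t h0 x k) 0).
  by apply: (@near_all R R^o) => h; rewrite addr0 mulr0 mul0r subr0 mulrCA mulrA.
 by apply: cont_mulR => //; exact: cst_continuous.
have k1near : \forall k \near (0 : R), `|k| < 1.
 have c : `|k| @[k --> (0 : R)] --> `|0 : R| by apply: cvg_norm; exact: cvg_id.
 by apply: (c (fun y => y < 1)); apply: lt_nbhsl; rewrite normr0.
have dB : is_derive (0 : R) 1 (fun k => Bk s F (t + h0 * k) x)
  (h0 * \sum_(i < 3) partials [:: i; i] (Bk s F t) x + h0 * Q t h0 x 0).
 have := is_deriveD dA dQ; apply: near_eq_is_derive.
 by apply: filterS k1near => k k1; rewrite (Bk_split x It h00 h04 hI k1).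
have d1 : is_derive t 1 (fun y : R => h0^-1 * (y - t)) h0^-1.
 have := is_deriveZ h0^-1 (is_deriveB (is_derive_id t (1 : R)) (is_derive_cst t t 1)).
 by rewrite subr0 /GRing.scale/= mulr1.
have dB' : is_derive (h0^-1 * (t - t)) 1 (fun k => Bk s F (t + h0 * k) x)
  (h0 * \sum_(i < 3) partials [:: i; i] (Bk s F t) x + h0 * Q t h0 x 0).
 by rewrite subrr mulr0.
have H := is_derive1_comp (f := fun k => Bk s F (t + h0 * k) x) (g := fun y : R => h0^-1 * (y - t)) dB' d1.
have H2 : is_derive t 1 ((fun k => Bk s F (t + h0 * k) x) \o (fun y : R => h0^-1 * (y - t)))
  (\sum_(i < 3) partials [:: i; i] (Bk s F t) x + R0 s (F t) x).
 by apply: (is_derive_eq H); rewrite Q0 -mulrDr mulrAC divff ?mul1r// gt_eqF.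
apply: near_eq_is_derive H2; apply: (@near_all R R^o) => y.
have e1 : t + h0 * (h0^-1 * (y - t)) = y by rewrite mulVKf ?gt_eqF// addrC subrK.
by change (Bk s F (t + h0 * (h0^-1 * (y - t))) x = Bk s F y x); rewrite e1.
Qed.

End DuhamelDerivative.

(** * Uniform limits, and the triangle inequality for window bounds *)

Section Limits.
Context {R : realType}.
Local Notation V := 'rV[R]_3.
Implicit Types (f g : V -> R) (s al : seq 'I_3).

Lemma cauchy_limit (a : nat -> R) (e : nat -> R) : (forall n m, (n <= m)%N -> `|a m - a n| <= e n) ->
 e n @[n --> \oo] --> 0 ->
 a n @[n --> \oo] --> lim (a n @[n --> \oo]) /\ forall n, `|a n - lim (a n @[n --> \oo])| <= e n.
Proof.
move=> ca e0.
have ac : cvgn a.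
 apply/cauchy_cvgP/cauchyP => eps eps0.
 move/cvgrPdist_lt: (e0) => /(_ _ eps0)[N _ HN].
 exists (a N); exists N => // m /= Nm.
 rewrite /ball/= distrC (le_lt_trans (ca _ _ Nm))//.
 by have := HN N (leqnn N); rewrite sub0r normrN; apply: le_lt_trans; exact: ler_norm.
split; first exact: ac.
move=> n; have c1 : `|a n - a m| @[m --> \oo] --> `|a n - lim (a n @[n --> \oo])|.
 by apply: cvg_norm; apply: cvgB; [exact: cvg_cst|exact: ac].
apply: (ler_cvg_to c1 (cvg_cst (e n))).
by exists n => // m /= nm; rewrite distrC; exact: ca.
Qed.

Lemma cont_ulim (Q : normedModType R) (g_ : nat -> Q -> R) (g : Q -> R) (p : Q) (e : nat -> R) :
 (forall n, {for p, continuous (g_ n)}) -> (\forall q \near p, forall n, `|g_ n q - g q| <= e n) ->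
 e n @[n --> \oo] --> 0 -> {for p, continuous g}.
Proof.
move=> cg ge e0; apply/cvgrPdist_lt => eps eps0.
have eps3 : 0 < eps / 3 by pos.
move/cvgrPdist_lt: (e0) => /(_ _ eps3)[N _ HN].
have eN : e N < eps / 3.
 by have := HN N (leqnn N); rewrite sub0r normrN; apply: le_lt_trans; exact: ler_norm.
have c1 : \forall q \near p, `|g_ N p - g_ N q| < eps / 3 by move/cvgrPdist_lt: (cg N) => /(_ _ eps3).
have gp := nbhs_singleton ge.
apply: filterS2 c1 ge => q q1 q2.
have -> : g p - g q = (g p - g_ N p) + ((g_ N p - g_ N q) + (g_ N q - g q)) by ring.
have := ler_normD (g p - g_ N p) ((g_ N p - g_ N q) + (g_ N q - g q)).
have := ler_normD (g_ N p - g_ N q) (g_ N q - g q).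
have := gp N; rewrite distrC; have := q2 N; move: q1 eN; lra.
Qed.

(** The increment of f_n minus h g(x) is estimated by the mean value theorem, with a bound e n + eps
    times |h| that holds for all n; only then does n tend to infinity. *)
Lemma is_derive_ulim (W : normedModType R) (f_ g_ : nat -> W -> R) (f g : W -> R) (x v : W) (d : R) (e : nat -> R) :
 0 < d ->
 (forall n (h : R), `|h| < d -> is_derive (h *: v + x) v (f_ n) (g_ n (h *: v + x))) ->
 (forall h : R, `|h| < d -> f_ n (h *: v + x) @[n --> \oo] --> f (h *: v + x)) ->
 (forall n (h : R), `|h| < d -> `|g_ n (h *: v + x) - g (h *: v + x)| <= e n) ->
 e n @[n --> \oo] --> 0 ->
 {for (0 : R), continuous (fun h : R => g (h *: v + x))} ->
 is_derive x v f (g x).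
Proof.
move=> d0 df cf ge e0 cg; apply: is_derive_line.
have g0 : g (0 *: v + x) = g x by rewrite scale0r add0r.
pose F h := f (h *: v + x).
have c : h^-1 *: (F (h *: 1 + 0) - F 0) @[h --> (0 : R)^'] --> g x.
 apply/cvgrPdist_le => eps eps0.
 have n1 : \forall h \near (0 : R), `|g x - g (h *: v + x)| < eps.
  by move/cvgrPdist_lt: cg => /(_ _ eps0); rewrite g0.
 have [r /= r0 rB] := (nbhs_ballP _ _).1 n1.
 near=> h.
 have hn : h != 0 by near: h; exact: nbhs_dnbhs_neq.
 have hd : `|h| < d.
  near: h; apply: nbhs_dnbhs; have c : `|k| @[k --> (0 : R)] --> `|0 : R| by apply: cvg_norm; exact: cvg_id.
  by apply: (c (fun y => y < d)); apply: lt_nbhsl; rewrite normr0.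
 have hr : `|h| < r.
  near: h; apply: nbhs_dnbhs; have c : `|k| @[k --> (0 : R)] --> `|0 : R| by apply: cvg_norm; exact: cvg_id.
  by apply: (c (fun y => y < r)); apply: lt_nbhsl; rewrite normr0.
 rewrite scaler1 addr0.
 have btw (z : R) : Num.min 0 h <= z <= Num.max 0 h -> `|z| <= `|h|.
  move=> /andP[z1 z2]; have [h0|h0] := leP 0 h.
   move: z1 z2; rewrite (min_idPl h0) (max_idPr h0) => z1 z2.
   by rewrite !ger0_norm.
  move: z1 z2; rewrite (min_idPr (ltW h0)) (max_idPl (ltW h0)) => z1 z2.
  by rewrite (ler0_norm z2) (ltr0_norm h0) lerN2.
 have B n : `|f_ n (h *: v + x) - f_ n x - h * g x| <= (e n + eps) * `|h|.
  have D (z : R) : `|z| < d -> is_derive z 1 (fun z => f_ n (z *: v + x) - z * g x) (g_ n (z *: v + x) - g x).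
   move=> zd; have dz := df n z zd.
   have D1 := derivable_line dz.(ex_derive); rewrite (is_derive_val dz) in D1.
   have D2 : is_derive z 1 (fun z : R => z * g x) (g x).
    have := is_deriveM (is_derive_id z (1 : R)) (is_derive_cst (g x) z 1).
    by rewrite /GRing.scale/= mulr0 add0r mulr1.
   exact: is_deriveB D1 D2.
  have := @MVT_le R (fun z => f_ n (z *: v + x) - z * g x) (fun z => g_ n (z *: v + x) - g x) (e n + eps) 0 h.
  rewrite scale0r add0r mul0r !subr0 addrAC; apply.
   by move=> z /btw zh; apply: D; exact: le_lt_trans hd.
  move=> z /btw zh; have zd := le_lt_trans zh hd.
  have -> : g_ n (z *: v + x) - g x = (g_ n (z *: v + x) - g (z *: v + x)) + (g (z *: v + x) - g x) by ring.
  apply: (le_trans (ler_normD _ _)); apply: lerD; first exact: ge.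
  rewrite distrC; apply: ltW; apply: (rB z).
  by rewrite /ball/= sub0r normrN; exact: le_lt_trans hr.
 have L : `|F h - F 0 - h * g x| <= eps * `|h|.
  have c1 : `|f_ n (h *: v + x) - f_ n x - h * g x| @[n --> \oo] --> `|F h - F 0 - h * g x|.
   apply: cvg_norm; apply: cvgB; last exact: cvg_cst.
   apply: cvgB; first exact: cf.
   by have := cf 0; rewrite normr0 scale0r add0r /F scale0r add0r; exact.
  have c2 : (e n + eps) * `|h| @[n --> \oo] --> (0 + eps) * `|h|.
   by apply: cvgM; [apply: cvgD; [exact: e0|exact: cvg_cst]|exact: cvg_cst].
  rewrite add0r in c2.
  by apply: (ler_cvg_to c1 c2); exists 0%N => // n _; exact: B.
 have -> : g x - h^-1 *: (F h - F 0) = - (h^-1 * (F h - F 0 - h * g x)).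
  by rewrite /GRing.scale/= [in RHS]mulrBr mulKf// opprB.
 rewrite normrN normrM normfV ler_pdivrMl ?normr_gt0//; apply: (le_trans L); by rewrite mulrC.
apply: DeriveDef; first by apply/cvg_ex; eexists; exact: c.
exact/cvg_lim.
Unshelve. all: by end_near. Qed.

(** Convexity of the cube, with the weights A / (A + B) and B / (A + B) applied to f / A and g / B:
    Minkowski's inequality when the norms are known only through bounds. *)
Lemma NbD kap f g A B : 0 < A -> 0 < B ->
 (mfun3 z, f (vec3 z)) ->
 (mfun3 z, g (vec3 z)) ->
 Nb kap f A -> Nb kap g B -> Nb kap (fun x => f x + g x) (A + B).
Proof.
move=> A0 B0 mf mg Nf Ng x l l0; have l3 : 0 <= l ^+ 3 by pos.
have S0 : 0 < A + B by pos.
set cf : R := (A + B) ^+ 2 * A ^- 2; set cg : R := (A + B) ^+ 2 * B ^- 2.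
have cf0 : 0 <= cf by rewrite mulr_ge0 ?invr_ge0 ?exprn_ge0// ltW.
have cg0 : 0 <= cg by rewrite mulr_ge0 ?invr_ge0 ?exprn_ge0// ltW.
have pt (p q : R) : 0 <= p -> 0 <= q -> (p + q) ^+ 3 <= cf * p ^+ 3 + cg * q ^+ 3.
 move=> p0 q0; set m := (p + q) / (A + B).
 have m0 : 0 <= m by rewrite divr_ge0 ?addr_ge0// ltW.
 have tan (y : R) : 0 <= y -> 3 * m ^+ 2 * y - 2 * m ^+ 3 <= y ^+ 3.
  move=> y0; rewrite -subr_ge0.
  have -> : y ^+ 3 - (3 * m ^+ 2 * y - 2 * m ^+ 3) = (y - m) ^+ 2 * (y + 2 * m) by ring.
  pos.
 have H := lerD (ler_wpM2l (ltW A0) (tan (p / A) (divr_ge0 p0 (ltW A0))))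
         (ler_wpM2l (ltW B0) (tan (q / B) (divr_ge0 q0 (ltW B0)))).
 have {}H := ler_wpM2l (exprn_ge0 2 (ltW S0)) H.
 have An : A != 0 by rewrite gt_eqF.
 have Bn : B != 0 by rewrite gt_eqF.
 have Sn : A + B != 0 by rewrite gt_eqF.
 rewrite [leLHS](_ : _ = (p + q) ^+ 3) in H; last by rewrite /m; field; rewrite An Bn Sn.
 rewrite [leRHS](_ : _ = cf * p ^+ 3 + cg * q ^+ 3) in H; last by rewrite /cf /cg; field; rewrite An Bn.
 exact: H.
have mfg : (mfun3 z, f (vec3 z) + g (vec3 z)).
 exact: measurable_funD.
pose IF (h : V -> R) : \bar R := (\int[leb3]_z (Wg (vec3 z) * `|h (x - l *: vec3 z)| ^+ 3)%:E)%E.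
have h1 : (IF (fun x => (f x + g x)%R) <= cf%:E * IF f + cg%:E * IF g)%E.
 rewrite /IF -ge0_integralZl_EFin//; last 2 first.
 - move=> z _; pos.
 - exact: mfun_Nb.
 rewrite -ge0_integralZl_EFin//; last 2 first.
 - move=> z _; pos.
 - exact: mfun_Nb.
 rewrite -ge0_integralD//; last 4 first.
 - by move=> z _; rewrite mule_ge0 ?lee_fin// mulr_ge0// Wg_ge0.
 - by apply: measurable_funeM; exact: mfun_Nb.
 - by move=> z _; rewrite mule_ge0 ?lee_fin// mulr_ge0// Wg_ge0.
 - by apply: measurable_funeM; exact: mfun_Nb.
 apply: ge0_le_integral => //.
 - move=> z _; pos.
 - exact: (@mfun_Nb _ (fun x => f x + g x)).
 - by apply: emeasurable_funD; apply: measurable_funeM; exact: mfun_Nb.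
 - move=> z _; rewrite -!EFinM -EFinD lee_fin.
  rewrite [leRHS](_ : _ = Wg (vec3 z) * (cf * `|f (x - l *: vec3 z)| ^+ 3 + cg * `|g (x - l *: vec3 z)| ^+ 3)); last by ring.
  apply: ler_wpM2l; first exact: Wg_ge0.
  apply: le_trans (pt _ _ (normr_ge0 _) (normr_ge0 _)).
  by rewrite lerXn2r ?nnegrE ?addr_ge0// ler_normD.
apply: (le_trans (lee_wpmul2l _ h1)); first by rewrite lee_fin.
rewrite ge0_muleDr ?mule_ge0 ?lee_fin ?Nb_int_ge0//.
rewrite muleCA [((l ^+ 3)%:E * (cg%:E * _))%E]muleCA.
apply: (le_trans (leeD (lee_wpmul2l _ (Nf x l l0)) (lee_wpmul2l _ (Ng x l l0)))); rewrite ?lee_fin//.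
rewrite /cf /cg; set mx := Num.max _ _.
apply: le_of_eq; field.
by rewrite !gt_eqF.
Qed.

Lemma NbN kap f A : Nb kap f A -> Nb kap (fun x => - f x) A.
Proof. by move=> Nf x l l0; under eq_integral do rewrite normrN; exact: Nf. Qed.

Lemma NbB kap f g A B : 0 < A -> 0 < B ->
 (mfun3 z, f (vec3 z)) ->
 (mfun3 z, g (vec3 z)) ->
 Nb kap f A -> Nb kap g B -> Nb kap (fun x => f x - g x) (A + B).
Proof.
move=> A0 B0 mf mg Nf Ng; apply: NbD => //; last exact: NbN.
have -> : (fun z : space3 R => - g (vec3 z)) = (fun z => 0 - g (vec3 z)) by apply/funext => z; rewrite sub0r.
by apply: measurable_funB.
Qed.

Lemma Nb_cst0 kap A : 0 <= A -> Nb kap (fun=> 0 : R) A.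
Proof.
move=> A0 x l l0; under eq_integral do rewrite normr0 expr0n mulr0.
by rewrite integral0 mule0 lee_fin exprn_ge0// mulr_ge0// le_max ler01.
Qed.

Lemma Nb_lim kap (f_ : nat -> V -> R) f A :
 (forall n, (mfun3 z, f_ n (vec3 z))) ->
 (forall x, f_ n x @[n --> \oo] --> f x) -> (forall n, Nb kap (f_ n) A) -> Nb kap f A.
Proof.
move=> mf cf Nf x l l0; have l3 : 0 < l ^+ 3 by pos.
rewrite -lee_pdivlMl//; set c := ((l ^+ 3)^-1%:E * _)%E.
apply: (@fatou_le R _ _ leb3 setT (fun n z => Wg (vec3 z) * `|f_ n (x - l *: vec3 z)| ^+ 3)) => //.
- by move=> n; apply/measurable_EFinP; exact: mfun_Nb.
- move=> n z _; pos.
- move=> z _; apply: cvgM; first exact: cvg_cst.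
 have c1 : `|f_ n (x - l *: vec3 z)| @[n --> \oo] --> `|f (x - l *: vec3 z)| by apply: cvg_norm; exact: cf.
 exact: (cvg_comp _ _ c1 (@exprn_continuous R 3 _)).
- by move=> n; rewrite /c lee_pdivlMl//; exact: Nf.
Qed.

End Limits.

(** * Space-time classes: sums, products and completeness *)

Section SpaceTimeClasses.
Context {R : realType}.
Local Notation V := 'rV[R]_3.
Variables (I : set R) (b : R -> R).
Hypothesis b0 : forall t, I t -> 0 <= b t.
Implicit Types (u v : R -> V -> R) (M N : R -> R).

Lemma XX_weaken K M N u : (forall t, I t -> M t <= N t) -> XX I K M b u -> XX I K N b u.
Proof.
move=> MN [h1 h2]; split=> // t It.
exact: DB_weaken (leqnn K) (MN t It) (b0 It) (lexx _) (h1 t It).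
Qed.

Lemma XX_partial K M u i : XX I K.+1 M b u -> XX I K (fun t => M t * b t) b (fun t => partial i (u t)).
Proof.
move=> [h1 h2]; split; first by move=> t It; apply: DB_partial; exact: h1.
move=> s sK t x It; have := h2 (rcons s i); rewrite size_rcons => /(_ sK t x It).
have E : (fun q : R * V => partials (rcons s i) (u q.1) q.2) = (fun q => partials s (partial i (u q.1)) q.2).
 by apply/funext => q; rewrite partials_rcons.
by rewrite E.
Qed.

Hypothesis oI : open I.

Let nearI (t : R) (x : V) : I t -> \forall q \near ((t, x) : R * V), I q.1.
Proof.
move=> It; have c : fst @ ((t, x) : R * V) --> t by exact: cvg_fst.
by apply: (c I); apply: open_nbhs_nbhs.
Qed.

(** Identities between derivatives hold for times in I only, so continuity is transferred through a
    neighbourhood of t inside I. *)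
Let cont_near (f g : R * V -> R) (t : R) (x : V) : I t -> (forall q, I q.1 -> f q = g q) ->
 {for (t, x), continuous f} -> {for (t, x), continuous g}.
Proof.
move=> It fg cf; have E : {near ((t, x) : R * V), f =1 g}.
 by apply: filterS (nearI x It) => q Iq; exact: fg.
have e : f (t, x) = g (t, x) by exact: fg.
by rewrite /prop_for /continuous_at -e; exact: (cvg_trans (near_eq_cvg E) cf).
Qed.

Lemma XX_add K M N u v : XX I K M b u -> XX I K N b v -> XX I K (fun t => M t + N t) b (fun t x => u t x + v t x).
Proof.
move=> [u1 u2] [v1 v2]; split; first by move=> t It; apply: DB_add; [exact: b0|exact: u1|exact: v1].
move=> s sK t x It; apply: (cont_near It (f := fun q => partials s (u q.1) q.2 + partials s (v q.1) q.2)).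
 by move=> q Iq; rewrite (partials_add (DB_CB (u1 _ Iq)) (DB_CB (v1 _ Iq)) sK).
by apply: cvgD; [exact: u2|exact: v2].
Qed.

Lemma XX_opp K M u : XX I K M b u -> XX I K M b (fun t x => - u t x).
Proof.
move=> [u1 u2]; have E t : (fun x => - u t x) = (fun x => (-1) * u t x).
 by apply/funext => x; rewrite mulN1r.
split=> [t It|s sK t x It].
 by rewrite E; have := DB_scale (-1) (b0 It) (u1 t It); rewrite normrN1 mul1r.
apply: (cont_near It (f := fun q => - partials s (u q.1) q.2)); last by apply: cvgN; exact: u2.
by move=> q Iq; rewrite E (partials_scale _ (DB_CB (u1 _ Iq)) sK) mulN1r.
Qed.

Lemma XX_sub K M N u v : XX I K M b u -> XX I K N b v -> XX I K (fun t => M t + N t) b (fun t x => u t x - v t x).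
Proof. by move=> hu hv; exact: XX_add hu (XX_opp hv). Qed.

(** Brings the doubled rate of a product back to a. With K fixed, the class is closed under products
    up to the factor 2^K. *)
Lemma DB_absorb K (M a : R) (f : V -> R) : 0 <= a -> DB K M (2 * a) f -> DB K (2 ^+ K * M) a f.
Proof.
move=> a0 H; have M0 := DB_ge0 H; case: H => cf bf; split=> // s sK x.
apply: (le_trans (bf s sK x)); rewrite exprMn mulrA ler_wpM2r ?exprn_ge0// mulrC ler_wpM2r//.
by rewrite ler_eXn2l ?ltr1n.
Qed.

Let XX_mul_cont k : forall M N u v, XX I k M b u -> XX I k N b v -> forall s, (size s <= k)%N -> forall t x, I t ->
 {for (t, x), continuous (fun q : R * V => partials s (fun x => u q.1 x * v q.1 x) q.2)}.
Proof.
elim: k => [|k IH] M N u v hu hv s.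
 case: s => // _ t x It; apply: cvgM; first exact: (hu.2 [::] isT t x It).
 exact: (hv.2 [::] isT t x It).
case/lastP: s => [_ t x It|s i].
 by apply: cvgM; [exact: (hu.2 [::] isT t x It)|exact: (hv.2 [::] isT t x It)].
rewrite size_rcons ltnS => sk t x It.
have hu' : XX I k M b u.
 by split=> [y Iy|al alk]; [exact: DB_weaken (leqnSn k) (lexx _) (b0 Iy) (lexx _) (hu.1 y Iy)|exact: hu.2 _ (leqW alk)].
have hv' : XX I k N b v.
 by split=> [y Iy|al alk]; [exact: DB_weaken (leqnSn k) (lexx _) (b0 Iy) (lexx _) (hv.1 y Iy)|exact: hv.2 _ (leqW alk)].
have c1 := IH _ _ _ _ (XX_partial i hu) hv' s sk t x It.
have c2 := IH _ _ _ _ hu' (XX_partial i hv) s sk t x It.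
apply: (cont_near It) (cvgD c1 c2) => q Iq /=.
have du := CB_derivable (DB_CB (hu.1 _ Iq)); have dv := CB_derivable (DB_CB (hv.1 _ Iq)).
rewrite partials_rcons (partialM (du i) (dv i)).
have e1 := CB_mul (CB_partial i (DB_CB (hu.1 _ Iq))) (DB_CB (hv'.1 _ Iq)).
have e2 := CB_mul (DB_CB (hu'.1 _ Iq)) (CB_partial i (DB_CB (hv.1 _ Iq))).
by rewrite (partials_add e1 e2 sk).
Qed.

Lemma XX_mul K M N u v : XX I K M b u -> XX I K N b v ->
 XX I K (fun t => 2 ^+ K * (M t * N t)) b (fun t x => u t x * v t x).
Proof.
move=> hu hv; split; last exact: XX_mul_cont hu hv.
by move=> t It; apply: DB_absorb; [exact: b0|apply: DB_mul; [exact: b0|exact: hu.1|exact: hv.1]].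
Qed.

Lemma XX_cst0 K M : (forall t, I t -> 0 <= M t) -> XX I K M b (fun _ _ => 0).
Proof.
move=> M0; have D0 i : partial i (fun=> 0 : R) = (fun=> 0) :> (V -> R) by apply/funext => x; exact: derive_cst.
have P s : partials s (fun=> 0 : R) = (fun=> 0) :> (V -> R) by elim: s => //= i s ->; exact: D0.
split=> [t It|s _ t x It].
 split=> [|s _ x]; last by rewrite P normr0 mulr_ge0 ?M0// exprn_ge0// b0.
 have := @CB_sum R K 0 (fun _ _ => 0); have -> : (fun x : V => \sum_(i < 0) (0 : R)) = (fun=> 0).
  by apply/funext => x; rewrite big_ord0.
 by apply=> -[].
have -> : (fun q : R * V => partials s (fun=> 0 : R) q.2) = (fun=> 0) by apply/funext => q; rewrite P.
exact: cst_continuous.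
Qed.

(** Completeness in the weighted norm: L denotes the limits of the derivatives, which induction on
    the order identifies with the derivatives of the limit. *)
Lemma XX_lim K (m : R -> R) (eps : nat -> R) (M_ : nat -> R -> R) (u_ : nat -> R -> V -> R) :
 (forall t, I t -> {for t, continuous m}) -> (forall t, I t -> {for t, continuous b}) ->
 eps n @[n --> \oo] --> 0 -> (forall n, 0 <= eps n) -> (forall t, I t -> 0 <= m t) ->
 (forall n, XX I K (M_ n) b (u_ n)) ->
 (forall n k, (n <= k)%N -> XX I K (fun t => eps n * m t) b (fun t x => u_ k t x - u_ n t x)) ->
 let u := fun t x => lim (u_ n t x @[n --> \oo]) in
 (forall t x, I t -> u_ n t x @[n --> \oo] --> u t x) /\
 forall n, XX I K (fun t => eps n * m t) b (fun t x => u_ n t x - u t x).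
Proof.
move=> cm cb e0 eps0 m0 hu hc u.
pose L s t x := lim (partials s (u_ n t) x @[n --> \oo]).
pose w (t : R) (s : seq 'I_3) := m t * b t ^+ size s.
have hL s t x : (size s <= K)%N -> I t -> partials s (u_ n t) x @[n --> \oo] --> L s t x /\
  forall n, `|partials s (u_ n t) x - L s t x| <= eps n * w t s.
 move=> sK It; apply: cauchy_limit; last first.
  by rewrite -[X in _ --> X](mul0r (w t s)); apply: cvgM; [exact: e0|exact: cvg_cst].
 move=> n k nk; have [h _] := hc n k nk; have := (h t It).2 s sK x.
 by rewrite (partials_sub (DB_CB ((hu k).1 t It)) (DB_CB ((hu n).1 t It)) sK) -mulrA.
have cL s t x : (size s <= K)%N -> I t -> {for (t, x), continuous (fun q : R * V => L s q.1 q.2)}.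
 move=> sK It.
 have cw : {for t, continuous (fun t => w t s)}.
  apply: cont_mulR; first exact: cm.
  by apply: (@cont_compR R (fun y => y ^+ size s) b); [exact: cb|exact: exprn_continuous].
 apply: (cont_ulim (g_ := fun n (q : R * V) => partials s (u_ n q.1) q.2) (e := fun n => eps n * (w t s + 1))).
 - by move=> n; exact: (hu n).2.
 - have n1 : \forall q \near ((t, x) : R * V), w q.1 s < w t s + 1.
   have c : fst @ ((t, x) : R * V) --> t by exact: cvg_fst.
   have c2 := cvg_comp _ _ c cw.
   by apply: (c2 (fun y => y < w t s + 1)); apply: lt_nbhsl; rewrite ltrDl.
  apply: filterS2 (nearI x It) n1 => q Iq wq n.
  by rewrite (le_trans ((hL s q.1 q.2 sK Iq).2 n))// ler_wpM2l// ltW.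
 - by rewrite -[X in _ --> X](mul0r (w t s + 1)); apply: cvgM; [exact: e0|exact: cvg_cst].
have cLx s t : (size s <= K)%N -> I t -> continuous (L s t).
 move=> sK It x; apply: (@continuous_comp _ _ _ (fun x : V => (t, x)) (fun q : R * V => L s q.1 q.2)).
  cts.
 exact: cL.
have dL s i t x : (size s < K)%N -> I t -> is_derive x (e_ i) (L s t) (L (i :: s) t x).
 move=> sK It; apply: (@is_derive_ulim R _ (fun n => partials s (u_ n t)) (fun n => partials (i :: s) (u_ n t))
   (L s t) (L (i :: s) t) x (e_ i) 1 (fun n => eps n * w t (i :: s))) => //.
 - move=> n h _; have [_ _ d] := DB_CB ((hu n).1 t It) (ltnW sK).
  by apply: DeriveDef => //; exact: d.
 - by move=> h _; exact: (hL s t _ (ltnW sK) It).1.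
 - by move=> n h _; exact: (hL (i :: s) t _ sK It).2.
 - by rewrite -[X in _ --> X](mul0r (w t (i :: s))); apply: cvgM; [exact: e0|exact: cvg_cst].
 - apply: (@continuous_comp _ _ _ (fun h : R => h *: e_ i + x) (L (i :: s) t)); last exact: cLx.
  apply: (@cvgD _ _ _ _ _ (fun h : R => h *: e_ i) (fun=> x)); last exact: cst_continuous.
  by apply: (@cvgZ _ _ _ _ _ (fun h : R => h) (fun=> e_ i)); [exact: cvg_id|exact: cst_continuous].
have PL s t : (size s <= K)%N -> I t -> partials s (u t) = L s t.
 move=> + It; elim: s => // i s IH sK /=; rewrite IH; last exact: ltnW.
 by apply/funext => x; exact: is_derive_val (dL s i t x sK It).
have CBu t : I t -> CB K (u t).
 move=> It s sK; rewrite PL//; split; first exact: cLx.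
  have [M _] := CB_DB (DB_CB ((hu 0%N).1 t It)) => -[_ hM].
  exists (M + eps 0%N * w t s) => x; have := hM s sK x; rewrite expr1n mulr1 => h1.
  have h2 := (hL s t x sK It).2 0%N.
  have -> : L s t x = partials s (u_ 0%N t) x - (partials s (u_ 0%N t) x - L s t x) by ring.
  by rewrite (le_trans (ler_normB _ _))// lerD.
 by move=> sK' i x; case: (dL s i t x sK' It).
split; first by move=> t x It; exact: (hL [::] t x isT It).1.
move=> n; split=> [t It|s sK t x It].
 have hn := DB_CB ((hu n).1 t It).
 split=> [|s sK x]; first exact: CB_sub hn (CBu t It).
 by rewrite (partials_sub hn (CBu t It) sK) (PL s t sK It) -mulrA; exact: (hL s t x sK It).2.
apply: (cont_near It (f := fun q => partials s (u_ n q.1) q.2 - L s q.1 q.2)).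
 by move=> q Iq; rewrite (partials_sub (DB_CB ((hu n).1 _ Iq)) (CBu _ Iq) sK) (PL s _ sK Iq).
by apply: cvgB; [exact: (hu n).2|exact: cL].
Qed.

End SpaceTimeClasses.

(** * The bilinear term and the Picard iteration *)

Section BilinearEstimates.
Context {R : realType}.
Local Notation V := 'rV[R]_3.
Implicit Types (u v F G : R -> V -> R) (s : seq 'I_3) (m : R).
(** [P] abstracts the pairs of window scale and window bound that the datum admits. Each time has a
    pair of size at most delta; the other pairs are carried along. *)
Variables (T : \bar R) (K : nat) (delta : R) (P : R -> R -> Prop).
Local Notation I := (time_interval T).
Hypothesis delta0 : 0 < delta.
Hypothesis P_pos : forall kap A, P kap A -> 0 <= kap /\ 0 < A.
Hypothesis P_cover : forall t, I t -> exists kap A, [/\ P kap A, kap * sqrt t <= 1 & A <= delta].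

(** The amplitude m is relative to the linear flow, so norms become plain numbers. The sup bounds
    use the small delta, the window bounds hold for every admissible pair. *)
Definition BD m u := XX I K (fun t => m * delta * rs t) rs u /\
 forall kap A, P kap A -> forall t, I t -> Nb kap (u t) (m * A).

(** The class of products: one factor is measured by its sup bound delta t^(-1/2), the other by its
    window bound A. Thus delta is gained and A enters linearly. *)
Definition FF m F := XX I K (fun t => m * delta ^+ 2 * rs t ^+ 2) rs F /\
 forall kap A, P kap A -> forall t, I t -> Nb kap (F t) (m * delta * A * rs t).

Let rs0 t : I t -> 0 <= rs t. Proof. by move=> /I_gt0/rs_gt0/ltW. Qed.

Lemma XX_measurable (M b : R -> R) u t : XX I K M b u -> I t ->
 (mfun3 z, u t (vec3 z)).
Proof. by move=> uX It; apply: mfun3_cont; exact: CB_cont (DB_CB (uX.1 t It)). Qed.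

Lemma BD_weaken m m' u : 0 <= m -> m <= m' -> BD m u -> BD m' u.
Proof.
move=> m0 mm [u1 u2]; split.
 apply: XX_weaken u1; first exact: rs0.
 by move=> t It; rewrite -!mulrA ler_wpM2r// mulr_ge0 ?rs0// ltW.
move=> kap A PA t It; have [_ A0] := P_pos PA.
by apply: Nb_weaken (u2 _ _ PA t It); rewrite ?mulr_ge0// ?ler_wpM2r// ltW.
Qed.

Lemma BD_add m m' u v : 0 < m -> 0 < m' -> BD m u -> BD m' v -> BD (m + m') (fun t x => u t x + v t x).
Proof.
move=> m0 m0' [u1 u2] [v1 v2]; split.
 apply: XX_weaken (XX_add rs0 (@open_I R T) u1 v1); first exact: rs0.
 by move=> t It; rewrite !mulrDl.
move=> kap A PA t It; have [_ A0] := P_pos PA; rewrite mulrDl.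
apply: NbD; rewrite ?mulr_gt0//; [exact: XX_measurable u1 It|exact: XX_measurable v1 It|exact: u2|exact: v2].
Qed.

Lemma BD_opp m u : BD m u -> BD m (fun t x => - u t x).
Proof.
move=> [u1 u2]; split; first exact: (XX_opp rs0 (@open_I R T) u1).
by move=> kap A PA t It; apply: NbN; exact: u2.
Qed.

Lemma BD_sub m m' u v : 0 < m -> 0 < m' -> BD m u -> BD m' v -> BD (m + m') (fun t x => u t x - v t x).
Proof. by move=> m0 m0' hu hv; exact: BD_add hu (BD_opp hv). Qed.

Lemma BD_sum n m (u : 'I_n.+1 -> R -> V -> R) : 0 < m -> (forall i, BD m (u i)) ->
 BD (n.+1%:R * m) (fun t x => \sum_(i < n.+1) u i t x).
Proof.
move=> m0; elim: n u => [|n IH] u hu.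
 by rewrite mul1r; under [X in BD _ X]eq_fun do under eq_fun do rewrite big_ord1.
have -> : (fun t x => \sum_(i < n.+2) u i t x) = (fun t x => u ord0 t x + \sum_(i < n.+1) u (lift ord0 i) t x).
 by apply/funext => t; apply/funext => x; rewrite big_ord_recl.
have -> : n.+2%:R * m = m + n.+1%:R * m by rewrite -natr1 mulrDl mul1r addrC.
apply: BD_add => //; first pos.
exact: IH.
Qed.

Lemma FF_add m m' F G : 0 < m -> 0 < m' -> FF m F -> FF m' G -> FF (m + m') (fun t x => F t x + G t x).
Proof.
move=> m0 m0' [u1 u2] [v1 v2]; split.
 apply: XX_weaken (XX_add rs0 (@open_I R T) u1 v1); first exact: rs0.
 by move=> t It; rewrite !mulrDl.
move=> kap A PA t It; have [_ A0] := P_pos PA; have r0 := rs_gt0 (I_gt0 It); rewrite !mulrDl.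
apply: NbD; rewrite ?mulr_gt0//; [exact: XX_measurable u1 It|exact: XX_measurable v1 It|exact: u2|exact: v2].
Qed.

Lemma FF_mul m m' u v : 0 <= m -> 0 <= m' -> BD m u -> BD m' v -> FF (2 ^+ K * (m * m')) (fun t x => u t x * v t x).
Proof.
move=> m0 m0' [u1 u2] [v1 v2]; split.
 apply: XX_weaken (XX_mul rs0 (@open_I R T) u1 v1); first exact: rs0.
 by move=> t It; apply: le_of_eq; ring.
move=> kap A PA t It; have [_ A0] := P_pos PA; have r0 := rs_gt0 (I_gt0 It).
have d0 := ltW delta0.
have H : Nb kap (fun x => u t x * v t x) (m * delta * rs t * (m' * A)).
 apply: (@Nb_le R kap _ (v t)).
 - by apply: measurable_funM; [exact: XX_measurable u1 It|exact: XX_measurable v1 It].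
 - exact: XX_measurable v1 It.
 - pos.
 - by move=> x; rewrite normrM ler_wpM2r// (DB0 (u1.1 t It)).
 - exact: v2.
have z0 : 0 <= m * m' * (delta * A * rs t).
 pos.
apply: Nb_weaken H.
 pos.
rewrite [leLHS](_ : _ = m * m' * (delta * A * rs t)); last by ring.
rewrite [leRHS](_ : _ = 2 ^+ K * (m * m' * (delta * A * rs t))); last by ring.
by rewrite ler_peMl// exprn_ege1// ler1n.
Qed.

Lemma FF_hyp m F : 0 <= m -> FF m F -> forall t, I t -> exists kap, [/\ 0 <= kap, kap * sqrt t <= 1 &
 forall t', I t' -> Nb kap (F t') (m * delta ^+ 2 * rs t')].
Proof.
move=> m0 [_ HF] t It; have [kap [A [PA kt Ad]]] := P_cover It.
have [k0 A0] := P_pos PA; exists kap; split=> // t' It'.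
have r0 := ltW (rs_gt0 (I_gt0 It')); have d0 := ltW delta0.
apply: Nb_weaken (HF _ _ PA _ It').
 pos.
by rewrite ler_wpM2r// -mulrA ler_wpM2l// expr2 ler_wpM2l.
Qed.

Definition cBD s : R := 8 * cB K s + 32 * cK s ^+ 2.

Lemma cBD_gt0 s : 0 < cBD s.
Proof.
by apply: addr_gt0; [exact: mulr_gt0 (ltr0Sn _ 7) (cB_gt0 K s)|exact: mulr_gt0 (ltr0Sn _ 31) (exprn_gt0 2 (cK_gt0 s))].
Qed.

(** The factor delta gained here is the source of the contraction. *)
Lemma Bk_BD m F s : 0 < m -> FF m F -> BD (cBD s * m * delta) (Bk s F).
Proof.
move=> m0 HF; have N0 : 0 <= m * delta ^+ 2 by pos.
have hyp := FF_hyp (ltW m0) HF.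
have b1 := @cB_gt0 R K s; have b2 : 0 < @cK R s ^+ 2 := exprn_gt0 2 (cK_gt0 s).
split.
 apply: XX_weaken (XX_Bk s N0 HF.1 hyp); first exact: rs0.
 move=> t It; have r0 := rs0 It.
 rewrite [leLHS](_ : _ = 8 * cB K s * (m * delta ^+ 2 * rs t)); last by ring.
 rewrite [leRHS](_ : _ = cBD s * (m * delta ^+ 2 * rs t)); last by ring.
 by apply: ler_wpM2r; [pos|rewrite lerDl; pos].
move=> kap A PA t It; have [_ A0] := P_pos PA.
have N' : 0 < m * delta * A by pos.
apply: Nb_weaken (Nb_Bk s N0 HF.1 hyp It N' (fun t' It' => HF.2 _ _ PA t' It')).
 pos.
rewrite [leRHS](_ : _ = cBD s * (m * delta * A)); last by ring.
by apply: ler_wpM2r; [exact: ltW N'|rewrite lerDr; pos].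
Qed.

Lemma Bk_sub m m' F G s t x : 0 <= m -> 0 <= m' -> FF m F -> FF m' G -> I t ->
 Bk s (fun t x => F t x - G t x) t x = Bk s F t x - Bk s G t x.
Proof.
move=> m0 m0' HF HG It.
have N0 : 0 <= m * delta ^+ 2 by pos.
have N0' : 0 <= m' * delta ^+ 2 by pos.
have iF := @intg_Bk R T K F _ s N0 HF.1 (FF_hyp m0 HF) [::] t x isT It.
have iG := @intg_Bk R T K G _ s N0' HG.1 (FF_hyp m0' HG) [::] t x isT It.
rewrite /Bk; apply: etrans (RintegralB mD01 iF iG).
apply: eq_Rintegral => r /set_mem/D01P[r0 r1]; have Itr := I_scale It r0 r1.
have cF := CB_le (leq0n K) (DB_CB (HF.1.1 _ Itr)); have cG := CB_le (leq0n K) (DB_CB (HG.1.1 _ Itr)).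
by rewrite (RkB s x (sqrt_scale (I_gt0 It) r0 r1) cF cG) mulrBr.
Qed.

(** Summed over j and k, the first term is the gradient part of the Leray projector. The second,
    with its sign, is the part with the identity, that is e^((t - s) Laplacian) applied to div (u_i
    u): the trace of the third derivatives, integrated in tau, is minus the value at the lower
    endpoint. *)
Definition Dterm (u : 'I_3 -> R -> V -> R) (i j k : 'I_3) (t : R) (x : V) : R :=
 Bk [:: i; j; k] (fun t x => u j t x * u k t x) t x - Bk [:: k; k; j] (fun t x => u i t x * u j t x) t x.

Definition Duh (u : 'I_3 -> R -> V -> R) (i : 'I_3) (t : R) (x : V) : R :=
 \sum_(j < 3) \sum_(k < 3) Dterm u i j k t x.

Definition cD : R := \sum_(i < 3) \sum_(j < 3) \sum_(k < 3) cBD [:: i; j; k].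

Lemma cBD_le i j k : cBD [:: i; j; k] <= cD.
Proof.
have n0 i' j' k' : 0 <= cBD [:: i'; j'; k'] := ltW (cBD_gt0 _).
have S (G : 'I_3 -> R) l : (forall l, 0 <= G l) -> G l <= \sum_(l < 3) G l.
 by move=> G0; rewrite (bigD1 l)//= lerDl sumr_ge0.
have n1 i' j' : 0 <= \sum_(k < 3) cBD [:: i'; j'; k] by rewrite sumr_ge0.
have n2 i' : 0 <= \sum_(j < 3) \sum_(k < 3) cBD [:: i'; j; k] by rewrite sumr_ge0.
apply: (le_trans (S (fun k => cBD [:: i; j; k]) k (n0 i j))).
apply: (le_trans (S (fun j => \sum_(k < 3) cBD [:: i; j; k]) j (n1 i))).
exact: (S (fun i => \sum_(j < 3) \sum_(k < 3) cBD [:: i; j; k]) i n2).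
Qed.

Lemma cD_gt0 : 0 < cD.
Proof. exact: lt_le_trans (cBD_gt0 _) (cBD_le ord0 ord0 ord0). Qed.

(** 18 counts nine pairs (j, k) with two terms each; 2^K is the loss in the products. *)
Definition cE : R := 18 * cD * 2 ^+ K.

Lemma cE_gt0 : 0 < cE.
Proof. exact: mulr_gt0 (mulr_gt0 (ltr0Sn _ 17) cD_gt0) (exprn_gt0 _ (ltr0Sn _ 1)). Qed.

Let Bk_BD' m F i j k : 0 < m -> FF m F -> BD (cD * m * delta) (Bk [:: i; j; k] F).
Proof.
move=> m0 HF; apply: BD_weaken (Bk_BD _ m0 HF).
 exact: mulr_ge0 (mulr_ge0 (ltW (cBD_gt0 _)) (ltW m0)) (ltW delta0).
by apply: ler_wpM2r; [exact: ltW|apply: ler_wpM2r; [exact: ltW|exact: cBD_le]].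
Qed.

Let BD_sum9 m (G : 'I_3 -> 'I_3 -> R -> V -> R) : 0 < m -> (forall j k, BD m (G j k)) ->
 BD (9 * m) (fun t x => \sum_(j < 3) \sum_(k < 3) G j k t x).
Proof.
move=> m0 hG; have -> : 9 * m = 3 * (3 * m) by ring.
apply: (@BD_sum 2 (3 * m) (fun j t x => \sum_(k < 3) G j k t x)); first pos.
by move=> j; exact: (@BD_sum 2 m (G j)).
Qed.

Lemma Duh_BD m (u : 'I_3 -> R -> V -> R) : 0 < m -> (forall i, BD m (u i)) ->
 forall i, BD (cE * m ^+ 2 * delta) (Duh u i).
Proof.
move=> m0 hu i; set q := cD * (2 ^+ K * (m * m)) * delta.
have k0 : 0 < 2 ^+ K * (m * m) by pos.
have q0 : 0 < q by exact: mulr_gt0 (mulr_gt0 cD_gt0 k0) delta0.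
have -> : cE * m ^+ 2 * delta = 9 * (q + q) by rewrite /q /cE; ring.
apply: (@BD_sum9 (q + q) (fun j k => Dterm u i j k)); first pos.
move=> j k; apply: BD_sub => //.
 exact: (Bk_BD' _ _ _ k0 (FF_mul (ltW m0) (ltW m0) (hu j) (hu k))).
exact: (Bk_BD' _ _ _ k0 (FF_mul (ltW m0) (ltW m0) (hu i) (hu j))).
Qed.

Lemma BD_ext m u v : (forall t x, I t -> u t x = v t x) -> BD m u -> BD m v.
Proof.
move=> uv [[u1 u2] u3]; have E t : I t -> u t = v t by move=> It; apply/funext => x; exact: uv.
split; last by move=> kap A PA t It; rewrite -(E t It); exact: u3.
split=> [t It|s sK t x It]; first by rewrite -(E t It); exact: u1.
have c := u2 s sK t x It.
have n1 : \forall q \near ((t, x) : R * V), I q.1.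
 have c' : fst @ ((t, x) : R * V) --> t by exact: cvg_fst.
 by apply: (c' I); apply: open_nbhs_nbhs; split => //; exact: open_I.
have E2 : {near ((t, x) : R * V), (fun q : R * V => partials s (u q.1) q.2) =1 (fun q => partials s (v q.1) q.2)}.
 by apply: filterS n1 => q Iq; rewrite (E _ Iq).
by rewrite /prop_for /continuous_at /= -(E t It); exact: (cvg_trans (near_eq_cvg E2) c).
Qed.

Lemma Duh_sub_BD m d (u v : 'I_3 -> R -> V -> R) : 0 < m -> 0 < d -> (forall i, BD m (u i)) -> (forall i, BD m (v i)) ->
 (forall i, BD d (fun t x => u i t x - v i t x)) ->
 forall i, BD (cE * (2 * m * d) * delta) (fun t x => Duh u i t x - Duh v i t x).
Proof.
move=> m0 d0 hu hv huv i; set q := cD * (2 ^+ K * (d * m) + 2 ^+ K * (m * d)) * delta.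
have k1 : 0 < 2 ^+ K * (d * m) by pos.
have k2 : 0 < 2 ^+ K * (m * d) by pos.
have kk := addr_gt0 k1 k2.
have q0 : 0 < q by exact: mulr_gt0 (mulr_gt0 cD_gt0 kk) delta0.
have hF j k : FF (2 ^+ K * (d * m) + 2 ^+ K * (m * d))
  (fun t x => u j t x * u k t x - v j t x * v k t x).
 have -> : (fun t x => u j t x * u k t x - v j t x * v k t x) =
   (fun t x => (u j t x - v j t x) * u k t x + v j t x * (u k t x - v k t x)).
  by apply/funext => t; apply/funext => x; ring.
 apply: FF_add => //; first exact: FF_mul (ltW d0) (ltW m0) (huv j) (hu k).
 exact: FF_mul (ltW m0) (ltW d0) (hv j) (huv k).
have -> : cE * (2 * m * d) * delta = 9 * (q + q) by rewrite /q /cE; ring.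
pose G j k t x := Bk [:: i; j; k] (fun t x => u j t x * u k t x - v j t x * v k t x) t x -
 Bk [:: k; k; j] (fun t x => u i t x * u j t x - v i t x * v j t x) t x.
apply: (@BD_ext _ (fun t x => \sum_(j < 3) \sum_(k < 3) G j k t x)).
 have n0 : 0 <= 2 ^+ K * (m * m) by pos.
 have fu j k := FF_mul (ltW m0) (ltW m0) (hu j) (hu k).
 have fv j k := FF_mul (ltW m0) (ltW m0) (hv j) (hv k).
 move=> t x It; rewrite /Duh -sumrB; apply: eq_bigr => j _; rewrite -sumrB; apply: eq_bigr => k _.
 rewrite /G /Dterm (Bk_sub _ x n0 n0 (fu j k) (fv j k) It) (Bk_sub _ x n0 n0 (fu i j) (fv i j) It).
 by move: (Bk _ _ _ _) (Bk _ _ _ _) (Bk _ _ _ _) (Bk _ _ _ _) => a1 a2 a3 a4; ring.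
apply: (@BD_sum9 (q + q) G); first pos.
by move=> j k; apply: BD_sub => //; exact: Bk_BD'.
Qed.

Section Picard.
Variable L : 'I_3 -> R -> V -> R.

Fixpoint picard (n : nat) : 'I_3 -> R -> V -> R :=
 if n is n'.+1 then fun i t x => L i t x - Duh (picard n') i t x else L.

(** Refers to none of T, K, delta and [P]: bounds obtained for different choices of these concern
    one and the same function. *)
Definition solution (i : 'I_3) (t : R) (x : V) : R := lim (picard n i t x @[n --> \oo]).

(** At amplitude 2 both the size of the bilinear term and its Lipschitz constant are controlled by 4
    cE delta, hence by 1/2. *)
Hypothesis small : 8 * cE * delta <= 1.
Hypothesis hL : forall i, BD 1 (L i).

Let cvg_half_powers : 2 ^- n @[n --> \oo] --> (0 : R).
Proof.
have -> : (fun n => 2 ^- n : R) = (fun n => 2^-1 ^+ n) by apply/funext => n; rewrite exprVn.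
by apply: cvg_expr; rewrite ger0_norm ?invr_ge0// invf_lt1 ?ltr1n.
Qed.

Let c0 : 0 < cE * delta. Proof. exact: mulr_gt0 cE_gt0 delta0. Qed.

Lemma picard_BD n i : BD 2 (picard n i).
Proof.
elim: n i => [|n IH] i /=; first by apply: BD_weaken (hL i); rewrite ?ler1n.
have H := Duh_BD (ltr0Sn R 1) IH i.
have {}H : BD 1 (Duh (picard n) i).
 by apply: BD_weaken H; move: small c0; [move=> _ c; rewrite mulrAC mulr_ge0// ltW|move=> sm c; nra].
by have := BD_sub ltr01 ltr01 (hL i) H; rewrite -(natrD _ 1 1).
Qed.

Lemma picard_step n i : BD (2 ^- n) (fun t x => picard n.+1 i t x - picard n i t x).
Proof.
elim: n i => [|n IH] i.
 apply: (@BD_ext _ (fun t x => - Duh L i t x)); first by move=> t x _ /=; ring.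
 apply: BD_opp; have H := Duh_BD ltr01 hL i; rewrite expr0 invr1.
 by apply: BD_weaken H; move: small c0; [move=> _ c; rewrite mulrAC mulr_ge0 ?exprn_ge0// ltW|move=> sm c; nra].
apply: (@BD_ext _ (fun t x => - (Duh (picard n.+1) i t x - Duh (picard n) i t x))).
 by move=> t x _ /=; move: (Duh _ _ _ _) (Duh _ _ _ _) => a1 a2; ring.
apply: BD_opp; have p0 : 0 < 2 ^- n :> R by pos.
have H := Duh_sub_BD (ltr0Sn R 1) p0 (picard_BD n.+1) (picard_BD n) IH i.
apply: BD_weaken H.
 by rewrite mulrAC mulr_ge0 ?(ltW c0)// mulr_ge0// ltW.
have -> : 2 ^- n.+1 = 2^-1 * 2 ^- n :> R by rewrite exprS invfM.
move: small c0 p0; move: (2 ^- n) => z sm c z0; nra.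
Qed.

Lemma picard_cauchy n k i : (n <= k)%N -> BD (2 * 2 ^- n) (fun t x => picard k i t x - picard n i t x).
Proof.
move=> nk; rewrite -(subnK nk); move: (k - n)%N => d {nk k}; elim: d n => [|k IH] n.
 apply: (@BD_ext _ (fun _ _ => 0)); first by move=> t x _; rewrite subrr.
 have p0 : 0 <= 2 * 2 ^- n :> R by pos.
 split; first by apply: XX_cst0; [exact: rs0|move=> t It; rewrite mulr_ge0 ?rs0// mulr_ge0// ltW].
 by move=> kap A PA t It; apply: Nb_cst0; have [_ A0] := P_pos PA; rewrite mulr_ge0// ltW.
have p0 : 0 < 2 ^- n :> R by pos.
have p1 : 0 < 2 * 2 ^- n.+1 :> R by pos.
have -> : 2 * 2 ^- n = 2 * 2 ^- n.+1 + 2 ^- n :> R by rewrite exprS invfM; field; rewrite expf_neq0.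
apply: (@BD_ext _ (fun t x => (picard (k + n.+1) i t x - picard n.+1 i t x) + (picard n.+1 i t x - picard n i t x))).
 by move=> t x _; rewrite addSnnS; move: (picard _ _ _ _) (picard _ _ _ _) (picard _ _ _ _) => a1 a2 a3; ring.
by apply: BD_add => //; exact: picard_step.
Qed.

Lemma picard_limit i : (forall t x, I t -> picard n i t x @[n --> \oo] --> solution i t x) /\
 forall n, BD (2 * 2 ^- n) (fun t x => picard n i t x - solution i t x).
Proof.
have e0 : 2 * 2 ^- n @[n --> \oo] --> (0 : R).
 rewrite -[X in _ --> X](mulr0 (2 : R)); apply: cvgM; first exact: cvg_cst.
 exact: cvg_half_powers.
have ep n : 0 <= 2 * 2 ^- n :> R by pos.
have crs t : I t -> {for t, continuous (@rs R)} by move=> /I_gt0; exact: cont_rs.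
have [||||h1 h2] := @XX_lim R I rs (@open_I R T) K (fun t => delta * rs t) (fun n => 2 * 2 ^- n)
 (fun n t => 2 * delta * rs t) (fun n => picard n i) _ crs e0 ep.
- by move=> t It; apply: cont_mulR; [exact: cst_continuous|exact: crs].
- by move=> t It; rewrite mulr_ge0 ?rs0// ltW.
- by move=> n; exact: (picard_BD n i).1.
- move=> n k nk; apply: XX_weaken (picard_cauchy i nk).1; first exact: rs0.
 by move=> t It; rewrite mulrA.
split; first exact: h1.
move=> n; split.
 apply: XX_weaken (h2 n); first exact: rs0.
 by move=> t It; rewrite mulrA.
move=> kap A PA t It.
apply: (@Nb_lim R kap (fun k x => picard n i t x - picard (k + n) i t x)).
- move=> k; apply: measurable_funB; [exact: XX_measurable (picard_BD n i).1 It|exact: XX_measurable (picard_BD (k + n) i).1 It].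
- move=> x; apply: cvgB; first exact: cvg_cst.
 by have := h1 t x It; rewrite -(cvg_shiftn n).
- move=> k; have := (picard_cauchy i (leq_addl k n)).2 kap A PA t It => /NbN.
 by congr (Nb _ _ _); apply/funext => x; rewrite opprB.
Qed.

(** 3 is 1 for the linear flow plus 2 for the geometric series of the Picard steps. *)
Lemma solution_BD i : BD 3 (solution i).
Proof.
have h := (picard_limit i).2 0%N; rewrite expr0 invr1 mulr1 in h.
have -> : 3 = 1 + 2 :> R by rewrite -(natrD _ 1 2).
apply: (@BD_ext _ (fun t x => L i t x - (picard 0 i t x - solution i t x))).
 by move=> t x _ /=; rewrite opprB addrC subrK.
by apply: BD_sub.
Qed.

(** The Lipschitz bound of the bilinear term, read as a sup bound at the fixed time t, lets the
    recursion pass to the limit. *)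
Lemma solution_Duhamel i t x : I t -> solution i t x = L i t x - Duh solution i t x.
Proof.
move=> It; have [h1 h2] := picard_limit i.
have c1 : picard n.+1 i t x @[n --> \oo] --> solution i t x.
 by have := h1 t x It; rewrite -(cvg_shiftS (fun n => picard n i t x)).
have p0 n : 0 < 2 * 2 ^- n :> R by pos.
have p3 n j : BD 3 (picard n j) by apply: BD_weaken (picard_BD n j); rewrite ?ler_nat.
have hs n := Duh_sub_BD (ltr0Sn R 2) (p0 n) (p3 n) solution_BD (fun i => (picard_limit i).2 n) i.
have e0 := cvg_half_powers.
have c2 : Duh (picard n) i t x @[n --> \oo] --> Duh solution i t x.
 apply/subr_cvg0; apply/norm_cvg0P.
 have c3 : 2 ^- n * (cE * 12 * delta * delta * rs t) @[n --> \oo] --> (0 : R).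
  by rewrite -[X in _ --> X](mul0r (cE * 12 * delta * delta * rs t)); apply: cvgM; [exact: e0|exact: cvg_cst].
 apply: (squeeze_cvgr _ (cvg_cst 0) c3); apply: nearW => n; rewrite normr_ge0/=.
 apply: (le_trans (DB0 ((hs n).1.1 t It) x)).
 by apply: le_of_eq; ring.
apply: (cvg_unique _ c1) => //.
by apply: cvgB; [exact: cvg_cst|exact: c2].
Qed.

End Picard.
End BilinearEstimates.

(** * The inverse Laplacian: regularity, trace identity, pressure potential *)

Section LimitOperators.
Context {R : realType}.
Local Notation V := 'rV[R]_3.
Implicit Types (f g : V -> R) (s al : seq 'I_3).

(** A derivative on f may be exchanged with one of the kernel: multiplied by the length mu r, both
    sides become the same kernel operator. *)
Lemma Rk_perm s s' i i' (mu : R) f x : 0 < mu -> CB 1 f -> perm_eq (i :: s) (i' :: s') ->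
 Rk s mu (partial i f) x = Rk s' mu (partial i' f) x.
Proof.
move=> mu0 f1 ss; apply: eq_Rintegral => r /set_mem/D1_gt0 r0.
have mr : mu * r != 0 by rewrite gt_eqF// mulr_gt0.
have E : hk s (mu * r) (partial i f) x = hk s' (mu * r) (partial i' f) x.
 have key (m a b c d : R) : m != 0 -> m * a = b -> m * c = d -> b = d -> a = c.
  by move=> m0 <- <- /(mulfI m0).
 exact: (key _ _ _ _ _ mr (hk_ibp s (mu * r) x i f1) (hk_ibp s' (mu * r) x i' f1) (hk_perm _ _ _ ss)).
by rewrite E.
Qed.

Section Hh_smooth.
Variables (s : seq 'I_3) (k : nat) (f : V -> R).
Hypothesis fk : CB (k + size s) f.

Let fs : CB k (partials s f).
Proof. by have := CB_partials fk (leq_addl k (size s)); rewrite addnK. Qed.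

Lemma CB_Hh tau : CB k (Hh s f tau).
Proof. exact: CB_hk. Qed.

Lemma partials_Hh al tau : (size al <= k)%N -> partials al (Hh s f tau) = Hh (al ++ s) f tau.
Proof. by move=> alk; rewrite /Hh (hk_partials _ _ fs alk) partials_cat. Qed.

Lemma Hh_le al M tau x : (size al <= k)%N -> (forall x, `|partials (al ++ s) f x| <= M) ->
 `|Hh (al ++ s) f tau x| <= cK [::] * (cK [::] * M).
Proof.
move=> alk fM; apply: hk_bound => //.
by have [] := fk (s := al ++ s); rewrite size_cat ?leq_add2r.
Qed.

Lemma mfun_Hh_scaled al (mu : R) x : (size al <= k)%N ->
 measurable_fun D01 (fun r : mR R => Hh (al ++ s) f (mu * r) x : mR R).
Proof.
move=> alk; apply: mfun_cont01 => r _ _.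
have fc : CB 0 (partials (al ++ s) f).
 by rewrite partials_cat; apply: CB_le (CB_partials fs alk).
apply: (@cont_compR R (fun l => hk [::] l (partials (al ++ s) f) x) (fun r : R => sqrt (mu * r)));
 last exact: (@cont_hk_length R 0 [::] (partials (al ++ s) f) x fc _).
apply: (@cont_compR R (@sqrt R) (fun r : R => mu * r)); last exact: sqrt_continuous.
by apply: cont_mulR; [exact: cst_continuous|exact: cvg_id].
Qed.

Let Hh_hyps (mu : R) : exists C : R,
 [/\ (forall r : R, D01 r -> CB k (fun x => Hh s f (mu * r) x)),
  (forall al, (size al <= k)%N -> forall x, measurable_fun D01
   (fun r : mR R => partials al (fun x => Hh s f (mu * r) x) x : mR R)),
  (forall al : seq 'I_3, (size al <= k)%N -> leb.-integrable D01 (EFin \o (fun r : mR R => C))) &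
  (forall al, (size al <= k)%N -> forall (r : R) x, D01 r -> `|partials al (fun x => Hh s f (mu * r) x) x| <= C)].
Proof.
have [M M0 [_ hM]] := CB_DB fk; exists (cK [::] * (cK [::] * M)); split.
- by move=> r _; exact: CB_Hh.
- move=> al alk x.
 have E : (fun r : mR R => partials al (fun x => Hh s f (mu * r) x) x) =
   (fun r => Hh (al ++ s) f (mu * r) x).
  by apply/funext => r; exact: (congr1 (fun g => g x) (partials_Hh (mu * r) alk)).
 by rewrite E; exact: mfun_Hh_scaled.
- by move=> _ _; exact: intg01_cst.
- move=> al alk r x _.
 have E : partials al (fun x => Hh s f (mu * r) x) x = Hh (al ++ s) f (mu * r) x.
  exact: (congr1 (fun g => g x) (partials_Hh (mu * r) alk)).
 rewrite E; apply: Hh_le => // y.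
 have := hM (al ++ s); rewrite size_cat leq_add2r => /(_ alk y).
 by rewrite expr1n mulr1.
Qed.

Lemma CB_Hh_average (mu : R) : CB k (fun x => \int[leb]_(r in D01) Hh s f (mu * r) x).
Proof.
have [C [h1 h2 h3 h4]] := Hh_hyps mu.
exact: (CB_int mD01 h1 h2 (b := fun _ _ => C) h3 h4).
Qed.

Lemma partials_Hh_average al (mu : R) : (size al <= k)%N ->
 partials al (fun x => \int[leb]_(r in D01) Hh s f (mu * r) x) =
 (fun x => \int[leb]_(r in D01) Hh (al ++ s) f (mu * r) x).
Proof.
move=> alk; have [C [h1 h2 h3 h4]] := Hh_hyps mu.
apply: etrans (partials_int mD01 h1 h2 (b := fun _ _ => C) h3 h4 alk) _.
apply/funext => x; apply: eq_Rintegral => r _.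
exact: (congr1 (fun g => g x) (partials_Hh (mu * r) alk)).
Qed.

Lemma Hh_average_le al M (mu : R) x : (size al <= k)%N -> (forall x, `|partials (al ++ s) f x| <= M) ->
 `|\int[leb]_(r in D01) Hh (al ++ s) f (mu * r) x| <= cK [::] * (cK [::] * M).
Proof.
move=> alk fM; set C := cK [::] * (cK [::] * M).
have C0 : 0 <= C by rewrite (le_trans (normr_ge0 _) (Hh_le 0 x alk fM)).
rewrite -[leRHS](integral01_cst C).
have ih : leb.-integrable D01 (EFin \o (fun r : mR R => Hh (al ++ s) f (mu * r) x)).
 apply: (le_intg mD01 (mfun_Hh_scaled mu x alk) (intg01_cst C)).
 by move=> r _; exact: Hh_le.
apply: (le_trans (le_normr_Rintegral mD01 ih)).
apply: le_Rintegral; [exact: mD01|exact: integrable_norm ih|exact: intg01_cst|].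
by move=> r _; exact: Hh_le.
Qed.

Lemma R0_partials_CB : CB k (R0 s f) /\ forall al, (size al <= k)%N ->
 partials al (R0 s f) = (fun x => Rk s 1 (partials al f) x + \int[leb]_(r in D01) Hh (al ++ s) f (1 * r) x).
Proof.
have fk' : CB k f by apply: CB_le fk; exact: leq_addr.
have E : R0 s f = (fun x => Rk s 1 f x + \int[leb]_(r in D01) Hh s f (1 * r) x).
 by apply/funext => x; apply: (congr1 (fun z => Rk s 1 f x + z)); apply: eq_Rintegral => r _; rewrite mul1r.
have h1 := CB_Rk s ltr01 fk'; have h2 := CB_Hh_average 1.
split; first by rewrite E; exact: (CB_add h1 h2).
move=> al alk; rewrite E (partials_add h1 h2 alk) (Rk_partials s ltr01 fk' alk).
apply/funext => x; apply: (congr1 (fun z => Rk s 1 (partials al f) x + z)).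
exact: (congr1 (fun g => g x) (partials_Hh_average 1 alk)).
Qed.

Definition cR : R := 2 * cK s ^+ 2 + cK [::] ^+ 2.

Lemma cR_ge0 : 0 <= cR.
Proof. by rewrite addr_ge0 ?mulr_ge0// ?exprn_ge0// ltW// cK_gt0. Qed.

(** The short-time part keeps the |s| derivatives on f, which is the whole loss; the long-time part
    has them in the kernel. *)
Lemma DB_R0 M : DB (k + size s) M 1 f -> DB k (cR * M) 1 (R0 s f).
Proof.
move=> [_ hM]; split; first exact: R0_partials_CB.1.
have fk' : CB k f by apply: CB_le fk; exact: leq_addr.
move=> al alk x; rewrite R0_partials_CB.2// expr1n mulr1.
have b1 : forall y, `|partials al f y| <= M.
 by move=> y; have := hM al (leq_trans alk (leq_addr _ _)) y; rewrite expr1n mulr1.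
have b2 : forall y, `|partials (al ++ s) f y| <= M.
 by move=> y; have := hM (al ++ s); rewrite size_cat leq_add2r expr1n mulr1 => /(_ alk y).
have c0 : CB 0 (partials al f) := CB_le (leq0n _) (CB_partials fk' alk).
apply: (le_trans (ler_normD _ _)).
apply: (le_trans (lerD (Rk_bound s x ltr01 c0 b1) (Hh_average_le 1 x alk b2))).
by rewrite /cR invr1; apply: le_of_eq; ring.
Qed.

End Hh_smooth.

(** The integral over tau may be split at mu^2 instead of 1. *)
Lemma R0E s f (mu : R) x : size s = 3 -> CB 3 f -> 0 < mu ->
 R0 s f x = Rk s mu f x + mu ^+ 2 * \int[leb]_(r in D01) Hh s f (mu ^+ 2 * r) x.
Proof.
move=> s3 f3 mu0; have m2 : 0 < mu ^+ 2 by pos.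
have := @Gt_pos R s f s3 f3 x (mu ^+ 2) m2; rewrite sqrtr_sqr gtr0_norm// => <-.
by rewrite /Gt subrK.
Qed.

(** For tau > 0 the sum G vanishes by [Rk_trace]. Continuity of the continuation [Gt] carries the
    identity to tau = 0, where the scaled integral form is singular. *)
Lemma R0_trace j f x : CB 3 f -> \sum_(k < 3) R0 [:: k; k; j] f x = - partial j f x.
Proof.
move=> f3; pose G (tau : R) := Gt [:: ord0; ord0; j] f tau x + (Gt [:: o1; o1; j] f tau x +
 Gt [:: o2; o2; j] f tau x) + Hh [:: j] f tau x.
have f1 : CB 0 (partials [:: j] f) by apply: CB_le (CB_partials f3 (isT : (size [:: j] <= 3)%N)).
have cGt i : {for (0 : R), continuous (fun tau : R => Gt [:: i; i; j] f tau x)}.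
 by apply/differentiable_continuous/derivable1_diffP; case: (@is_derive_Gt R [:: i; i; j] f erefl f3 x 0).
have cH : {for (0 : R), continuous (fun tau : R => Hh [:: j] f tau x)}.
 apply: (@cont_compR R (fun l => hk [::] l (partials [:: j] f) x) (@sqrt R)); first exact: sqrt_continuous.
 exact: (@cont_hk_length R 0 [::] (partials [:: j] f) x f1 _).
have cG : G tau @[tau --> (0 : R)] --> G 0.
 by apply: cvgD; [apply: cvgD; [exact: cGt|apply: cvgD; exact: cGt]|exact: cH].
have G0 (tau : R) : 0 < tau -> G tau = 0.
 move=> t0; have st : 0 < sqrt tau by pos.
 rewrite /G !(Gt_pos _ f3 x t0)//; have := Rk_trace j x f3 st; rewrite sum3 => ->.
 by rewrite /Hh addNr.
have cr : G tau @[tau --> (0 : R)^'+] --> G 0 by exact: cvg_at_right_filter cG.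
have c0 : G tau @[tau --> (0 : R)^'+] --> (0 : R).
 have n0 : \forall t \near (0 : R)^'+, (fun=> 0 : R) t = G t.
  by apply: filterS (nbhs_right_gt (0 : R)) => t t0; rewrite G0.
 exact: (cvg_trans (near_eq_cvg n0) (@cvg_cst _ (0 : R) _ ((0 : R)^'+) _)).
have E : G 0 = 0 by apply: cvg_unique cr c0.
have EG i : Gt [:: i; i; j] f 0 x = R0 [:: i; i; j] f x by rewrite /Gt mul0r subr0.
move: E; rewrite /G !EG /Hh sqrtr0 hk0 => /eqP; rewrite addr_eq0 => /eqP <-.
by rewrite sum3.
Qed.

Lemma R0_partials_cont I (u : R -> V -> R) s k al (t : R) x : open I -> (forall t, I t -> CB (k + size s) (u t)) ->
 (forall be, (size be <= k + size s)%N -> stc I (fun t => partials be (u t))) -> (size al <= k)%N -> I t ->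
 {for ((t, x) : R * V), continuous (fun q : R * V => partials al (R0 s (u q.1)) q.2)}.
Proof.
move=> oI uk us alk It.
have alk' : (size al <= k + size s)%N := leq_trans alk (leq_addr _ _).
have alsk : (size (al ++ s) <= k + size s)%N by rewrite size_cat leq_add2r.
have p : (fun q : R * V => (1, q)) @ (t, x) --> ((1, (t, x)) : R * (R * V)).
 cts.
have c1 : {for ((t, x) : R * V), continuous (fun q : R * V => Rk s 1 (partials al (u q.1)) q.2)}.
 apply: (@continuous_comp _ _ _ (fun q : R * V => (1 : R, q)) (fun q : R * (R * V) => Rk s q.1 (partials al (u q.2.1)) q.2.2)).
  exact: p.
 exact: (@Rk_cont R I (fun t => partials al (u t)) s 1 t x oI (us al alk') It ltr01).
have c2 : {for ((t, x) : R * V), continuous (fun q : R * V => \int[leb]_(r in D01) Hh (al ++ s) (u q.1) (1 * r) q.2)}.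
 apply: (@continuous_comp _ _ _ (fun q : R * V => (1 : R, q))
  (fun q : R * (R * V) => \int[leb]_(r in D01) Hh (al ++ s) (u q.2.1) (q.1 * r) q.2.2)); first exact: p.
 exact: (@Hh_average_cont R I u (al ++ s) 1 t x oI (us _ alsk) It).
have n1 : \forall q \near ((t, x) : R * V), I q.1.
 have c : fst @ ((t, x) : R * V) --> t by exact: cvg_fst.
 by apply: (c I); apply: open_nbhs_nbhs.
pose G (q : R * V) := Rk s 1 (partials al (u q.1)) q.2 + \int[leb]_(r in D01) Hh (al ++ s) (u q.1) (1 * r) q.2.
have cG : G q @[q --> ((t, x) : R * V)] --> G (t, x) by exact: (cvgD c1 c2).
have EG q : I q.1 -> G q = partials al (R0 s (u q.1)) q.2.
 by move=> Iq; rewrite ((R0_partials_CB (uk _ Iq)).2 al alk).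
have E : {near ((t, x) : R * V), G =1 (fun q => partials al (R0 s (u q.1)) q.2)}.
 by apply: filterS n1 => q Iq; exact: EG.
have E0 : G (t, x) = partials al (R0 s (u t)) x := EG (t, x) It.
rewrite E0 in cG; exact: (cvg_trans (near_eq_cvg E) cG).
Qed.

(** D^s (- Laplacian)^-1 for |s| = 2, with tau = mu^2 r below the split and tau = (mu r)^2 above.
    For merely bounded f the far part diverges logarithmically; an L^3 bound supplies the missing
    decay. *)
Definition P2 s (mu : R) f (x : V) : R :=
 \int[leb]_(r in D01) (mu ^+ 2 * Hh s f (mu ^+ 2 * r) x) +
 \int[leb]_(r in D1) (2 * r^-1 * hk s (mu * r) f x).

Section PressureDerivative.
Variables (s : seq 'I_3) (f : V -> R) (mu A : R).
Hypotheses (s2 : size s = 2) (f3 : CB 3 f) (mu0 : 0 < mu) (A0 : 0 <= A) (NA : Nb 0 f A).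

Lemma mfun_P2_far k (g : V -> R) x : CB k g -> measurable_fun D1
 (fun r : mR R => 2 * r^-1 * hk s (mu * r) g x : mR R).
Proof.
move=> gk; apply: measurable_funM; last by apply: measurable_funTS; exact: mfun_hk_scaled gk.
apply: measurable_funM => //; apply: mfun_inv_pos; first exact: measurable_id.
exact: D1_gt0.
Qed.

Lemma P2_far_bound r x : 0 < r -> `|2 * r^-1 * hk s (mu * r) f x| <= 2 * mu^-1 * cK s ^+ 2 * A * r ^- 2.
Proof.
move=> r0; have mr : 0 < mu * r by pos.
have b := hk_Nb_bound s x mr A0 (CB_cont f3) (CB_bnd f3) NA.
rewrite mul0r (max_idPl ler01) mul1r in b.
have b' : `|hk s (mu * r) f x| <= (mu * r)^-1 * (cK s ^+ 2 * A) by rewrite -(ler_pM2l mr) mulVKf// gt_eqF.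
rewrite normrM gtr0_norm ?mulr_gt0 ?invr_gt0//.
have q0 : 0 <= 2 * r^-1 by pos.
apply: (le_trans (ler_wpM2l q0 b')); apply: le_of_eq; field.
by rewrite !gt_eqF.
Qed.

Lemma intg_P2_far x : leb.-integrable D1 (EFin \o (fun r : mR R => 2 * r^-1 * hk s (mu * r) f x)).
Proof.
apply: (le_intg mD1 (mfun_P2_far x f3) (intg_inv2 (2 * mu^-1 * cK s ^+ 2 * A))).
by move=> r /D1_gt0 r0; exact: P2_far_bound.
Qed.

Let f12 : CB (1 + size s) f. Proof. by rewrite s2. Qed.

Lemma P2E x : P2 s mu f x = mu ^+ 2 * \int[leb]_(r in D01) Hh s f (mu ^+ 2 * r) x +
 \int[leb]_(r in D1) (2 * r^-1 * hk s (mu * r) f x).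
Proof.
congr (_ + _); apply: RintegralZl; first exact: mD01.
have [M M0 [_ hM]] := CB_DB f12.
apply: (le_intg mD01 (mfun_Hh_scaled f12 (al := [::]) (mu ^+ 2) x isT) (intg01_cst (cK [::] * (cK [::] * M)))).
move=> r _; apply: (@Hh_le s 1 f f12 [::]) => // y.
by have := hM s; rewrite s2 expr1n mulr1 => /(_ isT y).
Qed.

(** One more derivative turns the potential into the order-three operator of the equation, whatever
    the split mu. *)
Lemma is_derive_P2 x i : is_derive x (e_ i) (P2 s mu f) (R0 (i :: s) f x).
Proof.
have si : size (i :: s) = 3 by rewrite /= s2.
rewrite (R0E x si f3 mu0) addrC.
have E : P2 s mu f = (fun x => mu ^+ 2 * \int[leb]_(r in D01) Hh s f (mu ^+ 2 * r) x +
 \int[leb]_(r in D1) (2 * r^-1 * hk s (mu * r) f x)) by apply/funext => y; exact: P2E.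
rewrite E; apply: is_deriveD.
 have cb := CB_Hh_average f12 (mu ^+ 2).
 have := @partials_Hh_average s 1 f f12 [:: i] (mu ^+ 2) isT.
 move=> e; have d : is_derive x (e_ i) (fun x => \int[leb]_(r in D01) Hh s f (mu ^+ 2 * r) x)
   (\int[leb]_(r in D01) Hh (i :: s) f (mu ^+ 2 * r) x).
  apply: DeriveDef; first exact: (CB_derivable cb).
  exact: (congr1 (fun g => g x) e).
 exact: (is_deriveZ (mu ^+ 2) d).
have f1 : CB 1 f by exact: CB_le f3.
have [M fM] := CB_bnd f3.
have D (y : V) (r : R) : 0 < r -> is_derive y (e_ i) (fun y => 2 * r^-1 * hk s (mu * r) f y)
  (2 * mu^-1 * r ^- 2 * hk (i :: s) (mu * r) f y).
 move=> r0; have mr : mu * r != 0 by rewrite gt_eqF// mulr_gt0.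
 apply: (is_derive_eq (is_deriveZ (2 * r^-1) (hk_derive s (mu * r) y i f1))).
 rewrite -(hk_ibp s (mu * r) y i f1) /GRing.scale/=; field.
 by rewrite !gt_eqF.
have H := @is_derive_int _ _ _ leb D1 mD1 _
 (fun (y : V) (r : mR R) => 2 * r^-1 * hk s (mu * r) f y)
 (fun r => 2 * mu^-1 * (cK (i :: s) * (cK (i :: s) * M)) * r ^- 2) x (e_ i)
 (fun h _ => intg_P2_far _) _ (intg_inv2 _).
apply: (is_derive_eq (H _ _)).
- by move=> h r _ /D1_gt0 r0; case: (D (h *: e_ i + x) r r0).
- move=> h r _ /D1_gt0 r0; rewrite (is_derive_val (D (h *: e_ i + x) r r0)).
 by apply: Rk_int_bound => //; exact: CB_cont f3.
- by apply: eq_Rintegral => r /set_mem/D1_gt0 r0; rewrite (is_derive_val (D x r r0)).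
Qed.

Lemma P2_bounded : exists M : R, forall x, `|P2 s mu f x| <= M.
Proof.
have [M fM] := CB_bnd (CB_Hh_average f12 (mu ^+ 2)).
exists (mu ^+ 2 * M + 2 * mu^-1 * cK s ^+ 2 * A) => x; rewrite P2E (le_trans (ler_normD _ _))// lerD//.
 by rewrite normrM ger0_norm ?sqr_ge0// ler_wpM2l ?sqr_ge0.
have c0 : 0 <= 2 * mu^-1 * cK s ^+ 2 * A.
 pos.
apply: (@Rintegral_le_ge0 R _ _ leb D1 _ (fun r => 2 * mu^-1 * cK s ^+ 2 * A * r ^- 2) _ mD1 (mfun_P2_far x f3)).
- by apply: measurable_funM => //; exact: mfun_inv2.
- by move=> r /D1_gt0 r0; exact: P2_far_bound.
under eq_integral do rewrite EFinM.
rewrite ge0_integralZl_EFin//; first by rewrite integral_inv2 mule1.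
- move=> r _; pos.
- by apply/measurable_EFinP; exact: mfun_inv2.
Qed.

Lemma P2_cont : continuous (P2 s mu f).
Proof.
have E : P2 s mu f = (fun x => mu ^+ 2 * \int[leb]_(r in D01) Hh s f (mu ^+ 2 * r) x +
 \int[leb]_(r in D1) (2 * r^-1 * hk s (mu * r) f x)) by apply/funext => y; exact: P2E.
rewrite E; apply: cont_add.
 exact: (CB_cont (CB_scale (mu ^+ 2) (CB_Hh_average f12 (mu ^+ 2)))).
move=> x; apply: (cont_int mD1 (f := fun y r => 2 * r^-1 * hk s (mu * r) f y)
 (intg_inv2 (2 * mu^-1 * cK s ^+ 2 * A))).
- by apply: near_all => y; exact: mfun_P2_far f3.
- by apply: near_all => y r /D1_gt0 r0; exact: P2_far_bound.
- apply: aeW => r _; have c := @cont_hk R s (mu * r) f (CB_cont f3) (CB_bnd f3) x.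
 exact: (cvgM (@cvg_cst _ (2 * r^-1) _ (nbhs x) _) c).
Qed.

End PressureDerivative.

End LimitOperators.

(** * The L^3 bound of the pressure *)

Section PressureBounds.
Context {R : realType}.
Local Notation V := 'rV[R]_3.
Implicit Types (f g u v : V -> R) (s al : seq 'I_3).

(** By Tonelli, the average only moves the centre of the window of u, and the window bound does not
    depend on the centre. *)
Lemma Nb_cube_average kap g u (l b A : R) s : 0 <= b -> 0 <= A -> continuous g -> continuous u ->
 (forall y, ((`|g y| ^+ 3)%:E <= (b ^+ 3)%:E * \int[leb3]_z (Wg (vec3 z) * `|u (y - l *: vec3 z)| ^+ 3)%:E)%E) ->
 Nb kap u A -> Nb kap g (cK s * (b * A)).
Proof.
move=> b0 A0 cg cu gu Nu x r r0.
set mx := Num.max 1 (kap * r); have mx0 : 0 <= mx by rewrite le_max ler01.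
have c1 := @cK_ge1 R s; have r3 : 0 <= r ^+ 3 by pos.
have b3 : 0 <= b ^+ 3 by pos.
have mW := mfun3_cont (@cont_Wg R).
pose h (p : space3 R * space3 R) : \bar R :=
 (Wg (vec3 p.1) * (Wg (vec3 p.2) * `|u (x - r *: vec3 p.1 - l *: vec3 p.2)| ^+ 3))%:E.
have mh : measurable_fun setT h.
 apply/measurable_EFinP; apply: measurable_funM.
  exact: (measurableT_comp mW measurable_fst).
 apply: measurable_funM; first exact: (measurableT_comp mW measurable_snd).
 apply: measurable_funX; apply: measurableT_comp => //.
 apply: (@mfun_comp_continuous R _ _ _ (fun p : space3 R * space3 R => x - r *: vec3 p.1 - l *: vec3 p.2) u) => // i.
 have -> : (fun p : space3 R * space3 R => (x - r *: vec3 p.1 - l *: vec3 p.2) 0 i) =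
  (fun p => x 0 i - r * vec3 p.1 0 i - l * vec3 p.2 0 i) by apply/funext => p; rewrite !mxE.
 apply: measurable_funB.
  apply: measurable_funB => //; apply: measurable_funM => //.
  exact: (measurableT_comp (mfun_vec3 i) measurable_fst).
 apply: measurable_funM => //.
 exact: (measurableT_comp (mfun_vec3 i) measurable_snd).
have h0 p : (0 <= h p)%E by rewrite lee_fin !mulr_ge0 ?Wg_ge0// exprn_ge0.
have S1 : (\int[leb3]_z (Wg (vec3 z) * `|g (x - r *: vec3 z)| ^+ 3)%:E <=
  (b ^+ 3)%:E * \int[leb3]_z \int[leb3]_w h (z, w))%E.
 rewrite -ge0_integralZl_EFin//; last 2 first.
 - by move=> z _; exact: integral_ge0.
 - exact: measurable_fun_fubini_tonelli_F.
 apply: ge0_le_integral => //.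
 - move=> z _; pos.
 - exact: mfun_Nb (mfun3_cont cg).
 - by apply: measurable_funeM; exact: measurable_fun_fubini_tonelli_F.
 move=> z _; rewrite EFinM.
 apply: (le_trans (lee_wpmul2l _ (gu _))); first pos.
 rewrite muleCA lee_wpmul2l ?lee_fin//.
 rewrite -ge0_integralZl_EFin//.
 - move=> w _; pos.
 - exact: mfun_Nb (mfun3_cont cu).
 - exact: Wg_ge0.
apply: (le_trans (lee_wpmul2l _ S1)); first by rewrite lee_fin.
rewrite (@fubini_tonelli _ _ _ _ R leb3 leb3 h mh h0) muleCA.
have S2 : ((r ^+ 3)%:E * \int[leb3]_w \int[leb3]_z h (z, w) <=
  \int[leb3]_w ((mx * A) ^+ 3 * Wg (vec3 w))%:E)%E.
 rewrite -ge0_integralZl_EFin//; last 2 first.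
 - by move=> z _; exact: integral_ge0.
 - exact: measurable_fun_fubini_tonelli_G.
 apply: ge0_le_integral => //.
 - by move=> w _; rewrite mule_ge0 ?lee_fin//; exact: integral_ge0.
 - by apply: measurable_funeM; exact: measurable_fun_fubini_tonelli_G.
 - by apply/measurable_EFinP; exact: measurable_funM.
 move=> w _; have := Nu (x - l *: vec3 w) r r0; rewrite -/mx => H.
 have E : (\int[leb3]_z h (z, w) = (Wg (vec3 w))%:E *
   \int[leb3]_z (Wg (vec3 z) * `|u (x - l *: vec3 w - r *: vec3 z)| ^+ 3)%:E)%E.
  rewrite -ge0_integralZl_EFin.
  - by apply: eq_integral => z _; rewrite /h -EFinM /= mulrCA addrAC.
  - exact: measurableT.
  - move=> z _; pos.
  - exact: mfun_Nb (mfun3_cont cu).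
  - exact: Wg_ge0.
 rewrite E muleCA [leRHS]EFinM muleC; apply: (le_trans _ (lee_wpmul2r _ H)); last pos.
 by [].
apply: (le_trans (lee_wpmul2l _ S2)); first by rewrite lee_fin.
have m30 : 0 <= (mx * A) ^+ 3 by pos.
apply: (le_trans (lee_wpmul2l _ (integral_Wg_le s m30))); first by rewrite lee_fin.
rewrite -EFinM lee_fin.
have -> : b ^+ 3 * (cK s * (mx * A) ^+ 3) = cK s * (mx * (b * A)) ^+ 3 by ring.
have -> : (mx * (cK s * (b * A))) ^+ 3 = cK s ^+ 3 * (mx * (b * A)) ^+ 3 by ring.
by apply: ler_wpM2r; [rewrite exprn_ge0 ?mulr_ge0|rewrite -[leLHS]expr1 ler_weXn2l].
Qed.

Definition cM s : R := cK s * (1 + cK s) ^+ 2.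

Lemma cM_gt0 s : 0 < cM s.
Proof. by apply: mulr_gt0; [exact: cK_gt0|apply: exprn_gt0; apply: addr_gt0; [exact: ltr01|exact: cK_gt0]]. Qed.

(* Hoelder's inequality for the Gaussian window in y - l z: |u| in L^3, |v| in
  L^3 with the local bound, against the weight W(|v|^3/alpha + alpha). *)
Lemma hk_mul_cube s (l : R) u v y kap A : 0 < l -> 0 < A -> CB 0 u -> CB 0 v -> Nb kap v A ->
 ((`|hk s l (fun x => u x * v x) y| ^+ 3)%:E <=
  (((1 + cK s) ^+ 2 * (Num.max 1 (kap * l) * A / l)) ^+ 3)%:E *
  \int[leb3]_z (Wg (vec3 z) * `|u (y - l *: vec3 z)| ^+ 3)%:E)%E.
Proof.
move=> l0 A0 u0 v0 Nv.
have c1 := @cK_ge1 R s; have c0 := @cK_gt0 R s.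
set mx := Num.max 1 (kap * l); have mx0 : 0 < mx by rewrite lt_max ltr01.
set a := mx * A / l; have a0 : 0 < a by rewrite divr_gt0// mulr_gt0.
(* Balances the two parts of the weight: the Gaussian average of |v|^3 is at most a^3 = al^2, so
   |v|^3 / al and al have the same size on average. *)
set al := sqrt (a ^+ 3); have al0 : 0 < al by rewrite sqrtr_gt0 exprn_gt0.
have al2 : al ^+ 2 = a ^+ 3 by rewrite sqr_sqrtr// exprn_ge0// ltW.
have Wp (z : space3 R) : 0 < Wg (vec3 z) by rewrite WgE expR_gt0.
have mW := mfun3_cont (@cont_Wg R).
have cu := CB_cont u0; have cv := CB_cont v0.
have mu' : (mfun3 z, u (y - l *: vec3 z)).
 exact: mfun3_cont (@cont_affine_comp R u y l cu).
have mv' : (mfun3 z, v (y - l *: vec3 z)).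
 exact: mfun3_cont (@cont_affine_comp R v y l cv).
have uv0 : CB 0 (fun x => u x * v x) by exact: CB_mul.
have [M uvM] := CB_bnd uv0.
have ih := intg_hk s l y (CB_cont uv0) uvM.
pose k (z : space3 R) := Wg (vec3 z) * (`|v (y - l *: vec3 z)| ^+ 3 / al + al).
pose h (z : space3 R) := cK s * (Wg (vec3 z) * (`|u (y - l *: vec3 z)| * `|v (y - l *: vec3 z)|)).
have mk : measurable_fun setT k.
 apply: measurable_funM => //; apply: measurable_funD => //; apply: measurable_funM => //.
 by apply: measurable_funX; exact: measurableT_comp.
have mh : measurable_fun setT h.
 apply: measurable_funM => //; apply: measurable_funM => //.
 by apply: measurable_funM; exact: measurableT_comp.
have k0 z : setT z -> 0 < k z.
 move=> _; apply: mulr_gt0 => //; apply: ltr_wpDl => //.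
 pos.
have h0 z : setT z -> 0 <= h z.
 move=> _; apply: mulr_ge0; first exact: ltW.
 pos.
have B : (`|hk s l (fun x => u x * v x) y|%:E <= \int[leb3]_z (h z)%:E)%E.
 rewrite EFin_normr_Rintegral//.
 apply: (le_trans (le_abse_integral leb3 measurableT (measurable_int _ ih))).
 apply: ge0_le_integral => //.
 - by apply: measurableT_comp => //; exact: (measurable_int _ ih).
 - exact/measurable_EFinP.
 - by move=> z _; rewrite /= lee_fin normrM [`|u _ * v _|]normrM /h [leRHS]mulrA ler_wpM2r ?mulr_ge0// Kg_le.
have km : (\int[leb3]_z (k z)%:E <= (al * (1 + cK s))%:E)%E.
 have -> : (\int[leb3]_z (k z)%:E = \int[leb3]_z ((al^-1)%:E * (Wg (vec3 z) * `|v (y - l *: vec3 z)| ^+ 3)%:E + (al * Wg (vec3 z))%:E))%E.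
  by apply: eq_integral => z _; rewrite -EFinM -EFinD /k; congr _%:E; ring.
 rewrite ge0_integralD//; last 4 first.
 - by move=> z _; rewrite mule_ge0// lee_fin ?invr_ge0 ?(ltW al0)// mulr_ge0 ?exprn_ge0// ltW.
 - by apply: measurable_funeM; exact: mfun_Nb (mfun3_cont cv).
 - move=> z _; pos.
 - by apply/measurable_EFinP; exact: measurable_funM.
 rewrite mulrDr mulr1 EFinD; apply: leeD; last first.
  by apply: (le_trans (integral_Wg_le s (ltW al0))); rewrite lee_fin mulrC.
 rewrite ge0_integralZl_EFin//; last 3 first.
 - move=> z _; pos.
 - exact: mfun_Nb (mfun3_cont cv).
 - pos.
 have l3 : 0 < l ^+ 3 by pos.
 have := Nv y l l0; rewrite -lee_pdivlMl// => H.
 apply: (le_trans (lee_wpmul2l _ H)); first pos.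
 rewrite -!EFinM lee_fin -/mx le_eqVlt; apply/orP; left; apply/eqP.
 have -> : (l ^+ 3)^-1 * (mx * A) ^+ 3 = al ^+ 2 by rewrite al2 /a; field; rewrite gt_eqF.
 by field; rewrite gt_eqF.
have m0 : 0 < al * (1 + cK s) by pos.
apply: (le_trans (@jensen3 R _ _ leb3 setT k h _ _ measurableT mk mh k0 h0 (normr_ge0 _) m0 km B)).
have H : (\int[leb3]_z (k z ^- 2 * h z ^+ 3)%:E <=
  (cK s ^+ 3)%:E * \int[leb3]_z (Wg (vec3 z) * `|u (y - l *: vec3 z)| ^+ 3)%:E)%E.
 rewrite -ge0_integralZl_EFin//; last 3 first.
 - move=> z _; pos.
 - exact: mfun_Nb (mfun3_cont cu).
 - pos.
 apply: ge0_le_integral => //.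
 - by move=> z _; rewrite lee_fin mulr_ge0 ?invr_ge0 ?exprn_ge0 ?h0// ltW// k0.
 - apply/measurable_EFinP; apply: measurable_funM; last exact: measurable_funX.
  rewrite (_ : (fun _ => _) = (fun z => (k z)^-1 ^+ 2)); last by apply/funext => w; rewrite exprVn.
  by apply: measurable_funX; exact: (mfun_inv_pos mk k0).
 - by apply: measurable_funeM; exact: mfun_Nb (mfun3_cont cu).
 move=> z _; rewrite -EFinM lee_fin /k /h.
 have := Wp z; have := normr_ge0 (u (y - l *: vec3 z)); have := normr_ge0 (v (y - l *: vec3 z)).
 move: (Wg _) (`|u _|) (`|v _|) => w p q q0 p0 w0.
 have q3 : 0 <= q ^+ 3 by pos.
 set d := q ^+ 3 / al + al; have d0 : 0 < d by rewrite ltr_wpDl// divr_ge0// ltW.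
 (* By the inequality of arithmetic and geometric means; here the square of the weight pays for
    |v|^3. *)
 have dq : q ^+ 3 <= d ^+ 2.
  rewrite /d -[leLHS](divfK (lt0r_neq0 al0)); have : 0 <= q ^+ 3 / al by pos.
  move: (q ^+ 3 / al) => t t0; nra.
 rewrite ler_pdivrMl; last pos.
 have -> : (cK s * (w * (p * q))) ^+ 3 = (cK s ^+ 3 * p ^+ 3 * w ^+ 3) * q ^+ 3 by ring.
 have -> : (w * d) ^+ 2 * (cK s ^+ 3 * (w * p ^+ 3)) = (cK s ^+ 3 * p ^+ 3 * w ^+ 3) * d ^+ 2 by ring.
 by rewrite ler_wpM2l// !mulr_ge0 ?exprn_ge0// ltW.
apply: (le_trans (lee_wpmul2l _ H)); first pos.
rewrite muleA -EFinM; apply: lee_wpmul2r; first exact: Nb_int_ge0.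
rewrite lee_fin -/mx -/a exprMn al2.
have -> : a ^+ 3 * (1 + cK s) ^+ 2 * cK s ^+ 3 = a ^+ 3 * ((1 + cK s) ^+ 2 * cK s ^+ 3) by ring.
have -> : ((1 + cK s) ^+ 2 * a) ^+ 3 = a ^+ 3 * ((1 + cK s) ^+ 2 * (1 + cK s) ^+ 4) by ring.
apply: ler_wpM2l; first pos.
apply: ler_wpM2l; first pos.
apply: (@le_trans _ _ ((1 + cK s) ^+ 3)); first by rewrite lerXn2r// ?nnegrE ?addr_ge0 ?(ltW c0)// lerDr.
by rewrite ler_weXn2l// lerDl ltW.
Qed.

Lemma hk_mul_Nb s (l : R) u v kap kap' A A' : 0 < l -> 0 < A -> 0 <= A' -> CB 0 u -> CB 0 v ->
 Nb kap' u A' -> Nb kap v A ->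
 Nb kap' (hk s l (fun x => u x * v x)) (cM s * (Num.max 1 (kap * l) * A / l) * A').
Proof.
move=> l0 A0 A0' u0 v0 Nu Nv; have uv0 : CB 0 (fun x => u x * v x) by exact: CB_mul.
have -> : cM s * (Num.max 1 (kap * l) * A / l) * A' =
 cK s * (((1 + cK s) ^+ 2 * (Num.max 1 (kap * l) * A / l)) * A') by rewrite /cM; ring.
apply: (@Nb_cube_average kap' _ u l _ A' s) => //.
- apply: mulr_ge0; first exact: sqr_ge0.
 by rewrite divr_ge0 ?(ltW l0)// mulr_ge0 ?(ltW A0)// le_max ler01.
- exact: cont_hk (CB_cont uv0) (CB_bnd uv0).
- exact: CB_cont u0.
- by move=> y; exact: hk_mul_cube.
Qed.

(** A smooth substitute for cutting an integral at r = 1 / rho: rho times this weight is at least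
    r^-2 / 4 where rho r > 1, and its integral over r > 1 is at most rho. *)
Definition far_weight (rho r : R) : R := rho / (1 + rho * r) ^+ 2.

Lemma mfun_far_weight (rho : R) : 0 <= rho -> measurable_fun D1 (far_weight rho : mR R -> mR R).
Proof.
move=> rho0; apply: measurable_funM => //; apply: mfun_inv_pos.
 by apply: measurable_funX; apply: measurable_funD => //; exact: measurable_funM.
move=> r /D1_gt0 r0; pos.
Qed.

Lemma integral_far_weight (rho : R) : 0 <= rho -> (\int[leb]_(r in D1) (rho * far_weight rho r)%:E <= rho%:E)%E.
Proof.
rewrite le_eqVlt => /predU1P[<-|rho0].
 by under eq_integral do rewrite mul0r; rewrite integral0.
have P (r : R) : 0 < r -> 0 < 1 + rho * r by move=> r0; pos.
under eq_integral do rewrite EFinM.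
have w0 r : 0 < r -> 0 <= far_weight rho r.
 by move=> r0; rewrite divr_ge0 ?exprn_ge0// ltW// P.
have mw := mfun_far_weight (ltW rho0).
rewrite ge0_integralZl_EFin ?(ltW rho0)//; last 2 first.
- by move=> r /D1_gt0 r0; rewrite lee_fin w0.
- exact/measurable_EFinP.
rewrite -[leRHS]mule1 lee_wpmul2l ?lee_fin ?(ltW rho0)//.
have D (x : R) : 0 < x -> is_derive x 1 (fun r : R => - (1 + rho * r)^-1) (far_weight rho x).
 move=> x0; have xn : 1 + rho * x != 0 by rewrite gt_eqF// P.
 have d1 : is_derive x 1 (fun r : R => 1 + rho * r) rho.
  have := is_deriveD (is_derive_cst (1 : R) x 1) (is_deriveZ rho (is_derive_id x 1)).
  by rewrite add0r /GRing.scale/= mulr1.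
 apply: (is_derive_eq (is_deriveN (@is_deriveV R (fun r : R => 1 + rho * r) _ _ _ xn d1))).
 by rewrite /far_weight /GRing.scale/=; field.
have c (x : R) : 0 < x -> {for x, continuous (far_weight rho)}.
 move=> x0; apply: cont_mulR; first exact: cst_continuous.
 apply: cvgV; first by rewrite expf_neq0// gt_eqF// P.
 apply: (@cont_compR R (fun z => z ^+ 2) (fun r => 1 + rho * r)); last exact: exprn_continuous.
 cts.
have cA (x : R) : 0 < x -> {for x, continuous (fun r : R => - (1 + rho * r)^-1)}.
 by move=> x0; apply/differentiable_continuous/derivable1_diffP; case: (D x x0).
rewrite integral_itv_obnd_cbnd//; last exact/measurable_EFinP.
rewrite (@ge0_continuous_FTC2y R (far_weight rho) (fun r => - (1 + rho * r)^-1) 1 0).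
- by rewrite -EFinB lee_fin sub0r opprK invf_le1 ?lerDl mulr1 ?(ltW rho0)// ltr_wpDr// ltW.
- by move=> x x1; apply: w0; exact: lt_le_trans x1.
- apply/continuous_within_itvcyP; split.
  by move=> x; rewrite in_itv/= andbT => x1; apply: c; exact: lt_trans x1.
 by apply: cvg_at_right_filter; exact: (c 1 ltr01).
- rewrite -oppr0; apply: cvgN; apply/gtr0_cvgV0.
  by near=> x; apply: P; near: x; exact: nbhs_pinfty_gt.
 apply/cvgryPge => M; apply: filterS (nbhs_pinfty_gt (num_real (rho^-1 * `|M|))) => x /ltW.
 by rewrite ler_pdivrMl// => h; apply: (le_trans (ler_norm M)); apply: (le_trans h); rewrite lerDr.
- by move=> x x1; have [] := D x (lt_trans ltr01 x1).
- by apply: cvg_at_right_filter; exact: (cA 1 ltr01).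
- move=> x; rewrite in_itv/= andbT => x1.
 by rewrite derive1E; exact: is_derive_val (D x (lt_trans ltr01 x1)).
Unshelve. all: by end_near. Qed.

Section PressureNorm.
Variables (j k : 'I_3) (u v : V -> R) (mu kap A A' B : R).
Hypotheses (u3 : CB 3 u) (v3 : CB 3 v) (mu0 : 0 < mu) (kap0 : 0 <= kap) (A0 : 0 < A) (A0' : 0 < A') (B0 : 0 < B).
Hypotheses (Nu : Nb 0 u A') (Nv0 : Nb 0 v A') (Nv : Nb kap v A).
Let f x := u x * v x.
Hypothesis NB : Nb 0 (partial k f) B.
Variable Af : R.
Hypotheses (Af0 : 0 <= Af) (Nf : Nb 0 f Af).
Local Notation s := [:: j; k].

Let f3 : CB 3 f. Proof. exact: CB_mul. Qed.

Let intg_P2_near x : leb.-integrable D01 (EFin \o (fun r : mR R => Hh s f (mu ^+ 2 * r) x)).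
Proof.
have f12 : CB (1 + size s) f := f3; have [M M0 [_ hM]] := CB_DB f12.
apply: (le_intg mD01 (mfun_Hh_scaled f12 (al := [::]) (mu ^+ 2) x isT) (intg01_cst (cK [::] * (cK [::] * M)))).
move=> r _; apply: (@Hh_le R s 1 f f12 [::]) => // y.
by have := hM s isT y; rewrite expr1n mulr1.
Qed.

Let P2_near_scale x : \int[leb]_(r in D01) (mu ^+ 2 * Hh s f (mu ^+ 2 * r) x) =
 mu ^+ 2 * \int[leb]_(r in D01) Hh s f (mu ^+ 2 * r) x.
Proof. by apply: RintegralZl; [exact: mD01|exact: intg_P2_near]. Qed.

Let cont_P2_near : continuous (fun x => \int[leb]_(r in D01) (mu ^+ 2 * Hh s f (mu ^+ 2 * r) x)).
Proof.
have f12 : CB (1 + size s) f := f3.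
have -> : (fun x => \int[leb]_(r in D01) (mu ^+ 2 * Hh s f (mu ^+ 2 * r) x)) =
  (fun x => mu ^+ 2 * \int[leb]_(r in D01) Hh s f (mu ^+ 2 * r) x).
 by apply/funext => x; exact: P2_near_scale.
exact: (CB_cont (CB_scale (mu ^+ 2) (CB_Hh_average f12 (mu ^+ 2)))).
Qed.

Let cont_P2_far : continuous (fun x => \int[leb]_(r in D1) (2 * r^-1 * hk s (mu * r) f x)).
Proof.
have f12 : CB (1 + size s) f := f3.
have c1 : continuous (P2 s mu f).
 by move=> x; apply: P2_cont; [exact: erefl|exact: f3|exact: mu0|exact: Af0|exact: Nf].
have c2 := CB_cont (CB_scale (mu ^+ 2) (CB_Hh_average f12 (mu ^+ 2))).
have -> : (fun x => \int[leb]_(r in D1) (2 * r^-1 * hk s (mu * r) f x)) =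
 (fun x => P2 s mu f x - mu ^+ 2 * \int[leb]_(r in D01) Hh s f (mu ^+ 2 * r) x).
 by apply/funext => x; rewrite /P2 P2_near_scale addrC addKr.
by move=> x; exact: continuousB (c1 x) (c2 x).
Qed.

(** One of the two derivatives goes to the product; the other stays in the kernel and costs 1 / l
    with l = mu sqrt r, which is integrable in r. *)
Lemma Nb_P2_near : Nb 0 (fun x => \int[leb]_(r in D01) (mu ^+ 2 * Hh s f (mu ^+ 2 * r) x))
 (mu * cK [:: j] ^+ 2 * B * 8).
Proof.
have c0 := @cK_gt0 R [:: j].
have C0 : 0 < mu * cK [:: j] ^+ 2 * B by pos.
have f12 : CB (1 + size s) f := f3.
have k1 : CB 1 (partial k f) by apply: CB_partial; exact: CB_le f3.
have stf : stc setT (fun _ : R => partials s f).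
 apply: (@CB_stc R 1); exact: (CB_partials f3 (isT : (size s <= 3)%N)).
have cH (q : R * V) : {for q, continuous (fun q : R * V => mu ^+ 2 * Hh s f (mu ^+ 2 * q.1) q.2)}.
 case: q => r y; apply: cvgM; first exact: cvg_cst.
 have c := @Hh_cont R setT (fun _ : R => f) s (mu ^+ 2 * r) 0 y openT stf I.
 have ci : (fun q : R * V => (mu ^+ 2 * q.1, (0 : R, q.2))) @ ((r, y) : R * V) --> ((mu ^+ 2 * r, (0, y)) : R * (R * V)).
  apply: cvg_pairN; last cts.
  cts.
 exact: (cvg_comp _ _ ci c).
apply: (@Nb_Rintegral R D01 (fun r => mu * cK [:: j] ^+ 2 * B * wt r)
 (fun r y => mu ^+ 2 * Hh s f (mu ^+ 2 * r) y)).
- exact: interval_open.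
- exact: mD01.
- by apply: measurable_funM => //; exact: mfun_wt.
- by move=> r /D01P[r0 r1]; apply: mulr_gt0 => //; exact: wt_gt0.
- pos.
- by apply: integral_wt; exact: ltW.
- by move=> r y _; exact: cH.
- by move=> y; exact: intgZ_real (mu ^+ 2) mD01 (intg_P2_near y).
- exact: cont_P2_near.
- move=> r /D01P[r0 r1].
 set l := sqrt (mu ^+ 2 * r).
 have lE : l = mu * sqrt r by rewrite /l sqrtrM ?sqr_ge0// sqrtr_sqr gtr0_norm.
 have sr : 0 < sqrt r by pos.
 have l0 : 0 < l by rewrite lE mulr_gt0.
 have E : (fun y => mu ^+ 2 * Hh s f (mu ^+ 2 * r) y) = (fun y => (mu ^+ 2 / l) * hk [:: j] l (partial k f) y).
  apply/funext => y; have e := hk_ibp [::] l y j k1.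
  have key (a b c m : R) : 0 < c -> c * a = b -> m * a = (m / c) * b.
   by move=> c1 <-; field; rewrite gt_eqF.
  exact: key l0 e.
 have q1 : 0 <= mu ^+ 2 / l := divr_ge0 (exprn_ge0 2 (ltW mu0)) (ltW l0).
 rewrite E; apply: (@Nb_weaken _ _ _ ((mu ^+ 2 / l) * (cK [:: j] ^+ 2 * B))).
 + exact: (mulr_ge0 q1 (mulr_ge0 (exprn_ge0 2 (ltW c0)) (ltW B0))).
 + rewrite [leLHS](_ : _ = mu * cK [:: j] ^+ 2 * B * rs r); last by rewrite lE /rs; field; rewrite !gt_eqF.
  by apply: ler_wpM2l; [exact: ltW|exact: rs_le_wt].
 have ck := CB_cont k1; have bk := CB_bnd k1.
 have ch : continuous (hk [:: j] l (partial k f)) by exact: cont_hk.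
 apply: Nb_scale q1 ch _; exact: (Nb_hk [:: j] l (ltW B0) ck bk NB).
Qed.

(** Two bounds for the heat operator on the product are combined. While kap mu r <= 1 the window
    bound A of v applies; beyond, its L^3 bound A' does, but only from r = 1 / (kap mu) on, which
    yields the factor kap mu. The outcome is linear in A' as long as A and A' kap mu stay
    bounded. *)
Lemma Nb_P2_far : Nb 0 (fun x => \int[leb]_(r in D1) (2 * r^-1 * hk s (mu * r) f x))
 (2 * cM s * mu^-1 * A' * (A + 4 * A' * (kap * mu))).
Proof.
have c0 := cM_gt0 s.
set c := 2 * cM s * mu^-1 * A'; have cc : 0 < c by rewrite mulr_gt0// mulr_gt0 ?invr_gt0// mulr_gt0.
set rho := kap * mu; have rho0 : 0 <= rho by rewrite mulr_ge0// ltW.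
have w0 r : D1 r -> 0 <= rho * far_weight rho r.
 move=> /D1_gt0 r0; rewrite mulr_ge0// divr_ge0// exprn_ge0// addr_ge0//; pos.
have u0 : CB 0 u := CB_le (leq0n _) u3.
have v0 : CB 0 v := CB_le (leq0n _) v3.
have f0 : CB 0 f := CB_le (leq0n _) f3.
have mw := mfun_far_weight rho0.
apply: (@Nb_Rintegral R D1 (fun r => c * A * r ^- 2 + c * 4 * A' * (rho * far_weight rho r))
 (fun r y => 2 * r^-1 * hk s (mu * r) f y)).
- exact: interval_open.
- exact: mD1.
- apply: measurable_funD; first by apply: measurable_funM => //; exact: mfun_inv2.
 by apply: measurable_funM => //; exact: measurable_funM.
- move=> r Dr; have r0 := D1_gt0 Dr; apply: ltr_pwDl.
  pos.
 by rewrite mulr_ge0 ?w0// mulr_ge0 ?(ltW A0')// mulr_ge0// ltW.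
- pos.
- have e1 : 0 <= c * A by pos.
 have e2 : 0 <= c * 4 * A' by pos.
 under eq_integral do rewrite EFinD.
 rewrite ge0_integralD//; last 4 first.
 + move=> r Dr; pos.
 + by apply/measurable_EFinP; apply: measurable_funM => //; exact: mfun_inv2.
 + by move=> r Dr; rewrite lee_fin mulr_ge0// w0.
 + by apply/measurable_EFinP; apply: measurable_funM => //; exact: measurable_funM.
 have -> : c * (A + 4 * A' * rho) = c * A * 1 + c * 4 * A' * rho by ring.
 rewrite EFinD; apply: leeD.
  under eq_integral do rewrite EFinM.
  rewrite ge0_integralZl_EFin//; first by rewrite integral_inv2 mule1 mulr1.
  + move=> r _; pos.
  + by apply/measurable_EFinP; exact: mfun_inv2.
 under eq_integral do rewrite EFinM.
 rewrite ge0_integralZl_EFin//; try (by move=> r Dr; rewrite lee_fin w0); try (by apply/measurable_EFinP; exact: measurable_funM).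
 by rewrite [leRHS]EFinM lee_wpmul2l ?lee_fin// integral_far_weight.
- move=> r y /D1_gt0 r0; apply: cvgM; last exact: cont_hk_scaled f0.
 by apply: cvgM; [exact: cvg_cst|apply: cvgV; [rewrite gt_eqF|exact: cvg_fst]].
- by move=> y; exact: (@intg_P2_far R s f mu Af f3 mu0 Af0 Nf y).
- exact: cont_P2_far.
- move=> r Dr; have r0 := D1_gt0 Dr.
 have mr : 0 < mu * r by pos.
 have ch : continuous (hk s (mu * r) f) by exact: cont_hk (CB_cont f0) (CB_bnd f0).
 have q0 : 0 <= 2 * r^-1 by pos.
 have H0 := hk_mul_Nb s mr A0' (ltW A0') u0 v0 Nu Nv0; rewrite mul0r (max_idPl ler01) mul1r in H0.
 have H1 := hk_mul_Nb s mr A0 (ltW A0') u0 v0 Nu Nv.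
 have [h|h] := leP (rho * r) 1.
  have E : kap * (mu * r) <= 1 by rewrite mulrA.
  rewrite (max_idPl E) mul1r in H1.
  apply: (@Nb_weaken _ _ _ (2 * r^-1 * (cM s * (A / (mu * r)) * A'))).
  + pos.
  + rewrite [leLHS](_ : _ = c * A * r ^- 2); last by rewrite /c; field; rewrite !gt_eqF.
   by rewrite lerDl mulr_ge0 ?w0// mulr_ge0 ?(ltW A0')// mulr_ge0// ltW.
  exact: Nb_scale q0 ch H1.
 apply: (@Nb_weaken _ _ _ (2 * r^-1 * (cM s * (A' / (mu * r)) * A'))).
 + pos.
 + rewrite [leLHS](_ : _ = c * 4 * A' * (r ^- 2 / 4)); last by rewrite /c; field; rewrite !gt_eqF.
  have d0 : 0 < 1 + rho * r by pos.
  apply: ler_wpDl; first pos.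
  apply: ler_wpM2l; first pos.
  rewrite /far_weight mulrA ler_pdivlMr ?exprn_gt0// -ler_pdivlMl ?divr_gt0 ?invr_gt0 ?exprn_gt0//.
  rewrite [leRHS](_ : _ = (2 * (rho * r)) ^+ 2); last by field; rewrite gt_eqF.
  rewrite lerXn2r ?nnegrE ?(ltW d0)//; lra.
 exact: Nb_scale q0 ch H0.
Qed.

Lemma Nb_P2 : Nb 0 (P2 s mu f)
 (mu * cK [:: j] ^+ 2 * B * 8 + 2 * cM s * mu^-1 * A' * (A + 4 * A' * (kap * mu))).
Proof.
have f12 : CB (1 + size s) f := f3.
apply: NbD.
- pos.
- rewrite mulr_gt0//; last pos.
 by rewrite mulr_gt0// mulr_gt0 ?invr_gt0// mulr_gt0// cM_gt0.
- exact: (mfun3_cont cont_P2_near).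
- exact: (mfun3_cont cont_P2_far).
- exact: Nb_P2_near.
- exact: Nb_P2_far.
Qed.

End PressureNorm.
End PressureBounds.

(** * The Navier-Stokes equation for the limit *)

Section Equation.
Context {R : realType}.
Local Notation V := 'rV[R]_3.
Implicit Types (s al : seq 'I_3).

Lemma partials_sum k s n (F : 'I_n -> V -> R) : (forall i, CB k (F i)) -> (size s <= k)%N ->
 partials s (fun x => \sum_(i < n) F i x) = (fun x => \sum_(i < n) partials s (F i) x).
Proof.
move=> Fk sk; elim: n F Fk => [|n IH] F Fk.
 have D0 i : partial i (fun=> 0 : R) = (fun=> 0) :> (V -> R) by apply/funext => x; exact: derive_cst.
 rewrite (_ : (fun _ => _) = (fun=> 0)); last by apply/funext => x; rewrite big_ord0.
 rewrite (_ : (fun x => \sum_(i < 0) _) = (fun=> 0)); last by apply/funext => x; rewrite big_ord0.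
 by elim: s sk => //= i s IHs sk; rewrite IHs ?D0// ltnW.
rewrite (_ : (fun x => \sum_(i < n.+1) F i x) = (fun x => F ord0 x + \sum_(i < n) F (lift ord0 i) x)); last first.
 by apply/funext => x; rewrite big_ord_recl.
rewrite (partials_add (Fk ord0) (CB_sum (fun i => Fk (lift ord0 i))) sk) IH//.
by apply/funext => x; rewrite big_ord_recl.
Qed.

Lemma is_derive_sum3 (W : normedModType R) (f : 'I_3 -> W -> R) (df : 'I_3 -> R) (x v : W) :
 (forall i, is_derive x v (f i) (df i)) -> is_derive x v (fun y => \sum_(i < 3) f i y) (\sum_(i < 3) df i).
Proof.
move=> H; have E : (fun y => \sum_(i < 3) f i y) = (fun y => f ord0 y + (f o1 y + f o2 y)).
 by apply/funext => y; rewrite sum3.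
rewrite E sum3; exact: is_deriveD (H _) (is_deriveD (H _) (H _)).
Qed.

Variables (T : \bar R) (K : nat) (delta : R) (P : R -> R -> Prop).
Local Notation I := (time_interval T).
Hypothesis delta0 : 0 < delta.
Hypothesis P_pos : forall kap A, P kap A -> 0 <= kap /\ 0 < A.
Hypothesis P_cover : forall t, I t -> exists kap A, [/\ P kap A, kap * sqrt t <= 1 & A <= delta].
Hypothesis P_zero : exists A, P 0 A.
Hypothesis K5 : (5 <= K)%N.
Variables (m : R) (u : 'I_3 -> R -> V -> R).
Hypothesis m0 : 0 < m.
Hypothesis hu : forall i, BD T K delta P m (u i).

Definition stress j k (t : R) (x : V) : R := u j t x * u k t x.

Let N := 2 ^+ K * (m * m) * delta ^+ 2.

Let M0 : 0 <= 2 ^+ K * (m * m).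
Proof. pos. Qed.

Let N0 : 0 <= N.
Proof. exact: mulr_ge0 M0 (exprn_ge0 2 (ltW delta0)). Qed.

Let hF j k : FF T K delta P (2 ^+ K * (m * m)) (stress j k).
Proof. exact: (FF_mul delta0 P_pos (ltW m0) (ltW m0) (hu j) (hu k)). Qed.

Let FX j k : XX I K (fun t => N * rs t ^+ 2) rs (stress j k) := (hF j k).1.

Let FN j k := FF_hyp delta0 P_pos P_cover M0 (hF j k).

Lemma CB_stress j k t : I t -> CB K (stress j k t).
Proof. by move=> It; exact: DB_CB ((FX j k).1 t It). Qed.

Let F3 j k t : I t -> CB 3 (stress j k t).
Proof. by move=> It; apply: CB_le (CB_stress j k It); exact: leq_trans K5. Qed.

Let CB_B s j k t : I t -> CB K (Bk s (stress j k) t).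
Proof. by move=> It; exact: DB_CB ((XX_Bk s N0 (FX j k) (FN j k)).1 t It). Qed.

Lemma partials_Duh i t al x : I t -> (size al <= K)%N -> partials al (Duh u i t) x =
 \sum_(j < 3) \sum_(k < 3) (partials al (Bk [:: i; j; k] (stress j k) t) x - partials al (Bk [:: k; k; j] (stress i j) t) x).
Proof.
move=> It alK.
have h1 j k : CB K (Bk [:: i; j; k] (stress j k) t) := CB_B _ j k It.
have h2 j k : CB K (Bk [:: k; k; j] (stress i j) t) := CB_B _ i j It.
have h3 j k : CB K (Dterm u i j k t) := CB_sub (h1 j k) (h2 j k).
have h4 j : CB K (fun x => \sum_(k < 3) Dterm u i j k t x) := CB_sum (h3 j).
have E1 := congr1 (fun g => g x) (partials_sum h4 alK).
apply: etrans E1 _; apply: eq_bigr => j _.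
have E2 := congr1 (fun g => g x) (partials_sum (h3 j) alK).
apply: etrans E2 _; apply: eq_bigr => k _.
exact: (congr1 (fun g => g x) (partials_sub (h1 j k) (h2 j k) alK)).
Qed.

Lemma is_derive_Duh i (t : R) x : I t -> is_derive t 1 (fun t => Duh u i t x)
 (\sum_(l < 3) partials [:: l; l] (Duh u i t) x +
  \sum_(j < 3) \sum_(k < 3) (R0 [:: i; j; k] (stress j k t) x - R0 [:: k; k; j] (stress i j t) x)).
Proof.
move=> It.
have D s j k : size s = 3 -> is_derive t 1 (fun t => Bk s (stress j k) t x)
  (\sum_(l < 3) partials [:: l; l] (Bk s (stress j k) t) x + R0 s (stress j k t) x).
 by move=> s3; exact: (is_derive_Bk N0 (FX j k) (FN j k) K5 s3 x It).
have H := is_derive_sum3 (fun j => is_derive_sum3 (fun k =>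
 is_deriveB (D [:: i; j; k] j k erefl) (D [:: k; k; j] i j erefl))).
apply: (is_derive_eq H).
have key (a b : 'I_3 -> 'I_3 -> 'I_3 -> R) (r1 r2 : 'I_3 -> 'I_3 -> R) :
  \sum_(j < 3) \sum_(k < 3) ((\sum_(l < 3) a l j k + r1 j k) - (\sum_(l < 3) b l j k + r2 j k)) =
  \sum_(l < 3) \sum_(j < 3) \sum_(k < 3) (a l j k - b l j k) + \sum_(j < 3) \sum_(k < 3) (r1 j k - r2 j k).
 rewrite [X in _ = X + _]exchange_big -big_split; apply: eq_bigr => j _ /=.
 rewrite [X in _ = X + _]exchange_big -big_split; apply: eq_bigr => k _ /=.
 by rewrite sumrB; ring.
apply: etrans (key (fun l j k => partials [:: l; l] (Bk [:: i; j; k] (stress j k) t) x)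
 (fun l j k => partials [:: l; l] (Bk [:: k; k; j] (stress i j) t) x)
 (fun j k => R0 [:: i; j; k] (stress j k t) x) (fun j k => R0 [:: k; k; j] (stress i j t) x)) _.
apply: (congr1 (fun z => z + _)); apply: eq_bigr => l _.
by apply: esym; apply: partials_Duh => //; exact: leq_trans K5.
Qed.

Lemma Bk_perm s s' i i' j k t x : I t -> perm_eq (i :: s) (i' :: s') ->
 Bk s (fun t => partials [:: i] (stress j k t)) t x = Bk s' (fun t => partials [:: i'] (stress j k t)) t x.
Proof.
move=> It ss; apply: eq_Rintegral => r /set_mem/D01P[r0 r1].
have F1 : CB 1 (stress j k (t * r)) by apply: CB_le (F3 j k (I_scale It r0 r1)).
apply: (congr1 (fun z => t * z)).
exact: (Rk_perm x (sqrt_scale (I_gt0 It) r0 r1) F1 ss).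
Qed.

(** Once the outer derivative is exchanged with one of the kernel, both terms of the Duhamel
    integral become the triple sum of S, up to a cyclic renaming of the indices. *)
Lemma divergence_Duh t x : I t -> \sum_(i < 3) partial i (Duh u i t) x = 0.
Proof.
move=> It; pose S i j k := Bk [:: i; j; k] (fun t => partials [:: i] (stress j k t)) t x.
have K1 : (1 <= K)%N by exact: leq_trans K5.
have E s i j k : partials [:: i] (Bk s (stress j k) t) x = Bk s (fun t => partials [:: i] (stress j k t)) t x.
 by rewrite (Bk_partials s N0 (FX j k) (FN j k) (al := [:: i]) K1 It).
have H i : partial i (Duh u i t) x = \sum_(j < 3) \sum_(k < 3) (S i j k - S k i j).
 apply: etrans (@partials_Duh i t [:: i] x It K1) _.
 apply: eq_bigr => j _; apply: eq_bigr => k _.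
 have e : Bk [:: k; k; j] (fun t => partials [:: i] (stress i j t)) t x = S k i j.
  apply: Bk_perm => //; apply/permP => a /=.
  by rewrite addnCA [X in (_ + X)%N]addnCA.
 have k2 (a b c d : R) : a = c -> b = d -> a - b = c - d by move=> -> ->.
 exact: k2 (E [:: i; j; k] i j k) (etrans (E [:: k; k; j] i i j) e).
rewrite (eq_bigr _ (fun i _ => H i)).
under eq_bigr => i _ do under eq_bigr => j _ do rewrite sumrB.
under eq_bigr => i _ do rewrite sumrB.
rewrite sumrB; apply/eqP; rewrite subr_eq0; apply/eqP.
under [RHS]eq_bigr => i _ do rewrite exchange_big.
by rewrite [RHS]exchange_big.
Qed.

(** The sum of D_jk (- Laplacian)^-1 (u_j u_k), split at tau = t, the parabolic scale. *)
Definition pressure (t : R) (x : V) : R := \sum_(j < 3) \sum_(k < 3) P2 [:: j; k] (sqrt t) (stress j k t) x.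

Lemma is_derive_pressure t x i : I t ->
 is_derive x (e_ i) (pressure t) (\sum_(j < 3) \sum_(k < 3) R0 [:: i; j; k] (stress j k t) x).
Proof.
move=> It; have [A PA] := P_zero; have [_ A0] := P_pos PA.
have t0 := I_gt0 It; have st : 0 < sqrt t by pos.
apply: is_derive_sum3 => j; apply: is_derive_sum3 => k.
have NA := (hF j k).2 _ _ PA t It.
have A1 : 0 <= 2 ^+ K * (m * m) * delta * A * rs t.
 exact: mulr_ge0 (mulr_ge0 (mulr_ge0 M0 (ltW delta0)) (ltW A0)) (ltW (rs_gt0 t0)).
exact: (@is_derive_P2 R [:: j; k] (stress j k t) (sqrt t) _ erefl (F3 j k It) st A1 NA x i).
Qed.

Lemma pressure_bounded t : I t -> exists M : R, forall x, `|pressure t x| <= M.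
Proof.
move=> It; have [A PA] := P_zero; have [_ A0] := P_pos PA.
have t0 := I_gt0 It; have st : 0 < sqrt t by pos.
have A1 : 0 <= 2 ^+ K * (m * m) * delta * A * rs t.
 exact: mulr_ge0 (mulr_ge0 (mulr_ge0 M0 (ltW delta0)) (ltW A0)) (ltW (rs_gt0 t0)).
have H j k : exists M : R, forall x, `|P2 [:: j; k] (sqrt t) (stress j k t) x| <= M.
 exact: (@P2_bounded R [:: j; k] (stress j k t) (sqrt t) _ erefl (F3 j k It) st A1 ((hF j k).2 _ _ PA t It)).
have /choice[M HM] : forall jk : 'I_3 * 'I_3, exists M : R, forall x, `|P2 [:: jk.1; jk.2] (sqrt t) (stress jk.1 jk.2 t) x| <= M.
 by move=> [j k]; exact: H.
exists (\sum_(j < 3) \sum_(k < 3) M (j, k)) => x.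
apply: (le_trans (ler_norm_sum _ _ _)); apply: ler_sum => j _.
apply: (le_trans (ler_norm_sum _ _ _)); apply: ler_sum => k _.
exact: (HM (j, k)).
Qed.

Variable L : 'I_3 -> R -> V -> R.
Hypothesis hL : forall i, BD T K delta P 1 (L i).
Hypothesis L_heat : forall i t x, I t ->
 is_derive t 1 (fun t => L i t x) (\sum_(l < 3) partials [:: l; l] (L i t) x).
Hypothesis L_div : forall t x, I t -> \sum_(i < 3) partial i (L i t) x = 0.
Hypothesis uE : forall i t x, I t -> u i t x = L i t x - Duh u i t x.

Let CB_L i t : I t -> CB K (L i t).
Proof. by move=> It; exact: DB_CB ((hL i).1.1 t It). Qed.

Let CB_u i t : I t -> CB K (u i t).
Proof. by move=> It; exact: DB_CB ((hu i).1.1 t It). Qed.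

Let CB_Duh i t : I t -> CB K (Duh u i t).
Proof.
move=> It; have := CB_sub (CB_L i It) (CB_u i It); congr (CB _ _).
by apply/funext => x; rewrite (uE i x It) opprB addrC subrK.
Qed.

Let partials_u i t al x : I t -> (size al <= K)%N ->
 partials al (u i t) x = partials al (L i t) x - partials al (Duh u i t) x.
Proof.
move=> It alK; have -> : u i t = (fun x => L i t x - Duh u i t x) by apply/funext => y; exact: uE.
exact: (congr1 (fun g => g x) (partials_sub (CB_L i It) (CB_Duh i It) alK)).
Qed.

Lemma divergence_free t x : I t -> \sum_(i < 3) partial i (u i t) x = 0.
Proof.
move=> It; have K1 : (1 <= K)%N by exact: leq_trans K5.
rewrite (eq_bigr _ (fun i _ => @partials_u i t [:: i] x It K1)) sumrB.
by rewrite (divergence_Duh x It) L_div// subr0.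
Qed.

(* u_t = Laplacian u - div (u (x) u) - grad p *)
Definition u_t i t x : R := \sum_(l < 3) partials [:: l; l] (u i t) x -
 \sum_(j < 3) partial j (stress i j t) x - \sum_(j < 3) \sum_(k < 3) R0 [:: i; j; k] (stress j k t) x.

(** [R0_trace] turns the boundary contribution of the second part of [Dterm] into the divergence of
    the stress; the first part leaves the pressure gradient. *)
Lemma is_derive_u i (t : R) x : I t -> is_derive t 1 (fun t => u i t x) (u_t i t x).
Proof.
move=> It; have K2 : (2 <= K)%N by exact: leq_trans K5.
have D := is_deriveB (L_heat i x It) (is_derive_Duh i x It).
have n1 : {near t, (fun t => L i t x - Duh u i t x) =1 (fun t => u i t x)}.
 have nI : nbhs t I by apply: open_nbhs_nbhs; split => //; exact: open_I.
 by apply: filterS nI => q Iq; rewrite (uE i x Iq).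
apply: (near_eq_is_derive n1); apply: (is_derive_eq D).
have Eu : \sum_(l < 3) partials [:: l; l] (u i t) x =
  \sum_(l < 3) partials [:: l; l] (L i t) x - \sum_(l < 3) partials [:: l; l] (Duh u i t) x.
 by rewrite -sumrB; apply: eq_bigr => l _; exact: (@partials_u i t [:: l; l] x It K2).
have Et : \sum_(j < 3) \sum_(k < 3) R0 [:: k; k; j] (stress i j t) x = - \sum_(j < 3) partial j (stress i j t) x.
 by rewrite -sumrN; apply: eq_bigr => j _; exact: (R0_trace j x (F3 i j It)).
have Es : \sum_(j < 3) \sum_(k < 3) (R0 [:: i; j; k] (stress j k t) x - R0 [:: k; k; j] (stress i j t) x) =
  \sum_(j < 3) \sum_(k < 3) R0 [:: i; j; k] (stress j k t) x - \sum_(j < 3) \sum_(k < 3) R0 [:: k; k; j] (stress i j t) x.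
 by rewrite -sumrB; apply: eq_bigr => j _; rewrite -sumrB.
have key (a b c d e f g : R) : f = a - b -> g = d - e -> e = - c -> a - (b + g) = f - c - d.
 by move=> -> -> ->; ring.
exact: key Eu Es Et.
Qed.

(** The divergence of the stress is the convection term because u is divergence free. *)
Lemma momentum_equation i (t : R) x : I t ->
 u_t i t x + \sum_(k < 3) u k t x * partial k (u i t) x + partial i (pressure t) x =
 \sum_(l < 3) partials [:: l; l] (u i t) x.
Proof.
move=> It; have -> := partialE (g := fun x => _) (is_derive_pressure x i It); rewrite /u_t.
have dd j k : forall y, derivable (u j t) y (e_ k).
 by move=> y; apply: (@CB_derivable R 0); apply: CB_le (CB_u j It); exact: leq_trans K5.
have E : \sum_(j < 3) partial j (stress i j t) x = \sum_(k < 3) u k t x * partial k (u i t) x.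
 have -> : \sum_(j < 3) partial j (stress i j t) x =
   \sum_(j < 3) (u j t x * partial j (u i t) x + u i t x * partial j (u j t) x).
  apply: eq_bigr => j _; apply: etrans (congr1 (fun g => g x) (partialM (dd i j) (dd j j))) _.
  by rewrite [X in X + _]mulrC.
 by rewrite big_split /= -mulr_sumr (divergence_free x It) mulr0 addr0.
have key (a b c d : R) : b = d -> a - b - c + d + c = a by move=> ->; ring.
exact: key E.
Qed.

End Equation.

(** * Lipschitz functions and Hoelder classes *)

Section LipschitzFunctions.
Context {R : realType}.
Local Notation V := 'rV[R]_3.

Lemma lipschitz_cont (E W : normedModType R) (D : set E) (f : E -> W) (M : R) z : open D -> D z ->
 (forall x y, D x -> D y -> `|f x - f y| <= M * `|x - y|) -> {for z, continuous f}.
Proof.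
move=> oD Dz fM; apply/cvgrPdist_lt => e e0.
have M1 : 0 < `|M| + 1 by pos.
have nD : \forall y \near z, D y by apply: open_nbhs_nbhs.
have nB : \forall y \near z, ball z (e / (`|M| + 1)) y by apply: nbhsx_ballx; rewrite divr_gt0.
apply: filterS2 nD nB => y Dy; rewrite -ball_normE /= ltr_pdivlMr// => h.
apply: le_lt_trans (fM _ _ Dz Dy) _; apply: le_lt_trans h.
rewrite mulrC; apply: ler_wpM2l => //.
by rewrite (le_trans (ler_norm M))// lerDl.
Qed.

(** The Lipschitz bound serves up to distance 1, boundedness beyond. *)
Lemma lipschitz_C0_holder (E W : normedModType R) (D : set E) (f : E -> W) (L M theta : R) : open D -> 0 <= theta < 1 ->
 (forall x, D x -> `|f x| <= M) -> (forall x y, D x -> D y -> `|f x - f y| <= L * `|x - y|) ->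
 C0_holder theta D f.
Proof.
move=> oD /andP[th0 th1] fM fL; split.
- by apply: continuous_in_subspaceT => z; rewrite inE => Dz; exact: lipschitz_cont fL.
- by exists M; split; [exact: num_real|move=> y My x Dx; exact: le_trans (fM x Dx) (ltW My)].
exists (`|L| + 2 * `|M|) => x y Dx Dy.
have [->|xy] := eqVneq x y.
 by rewrite !subrr !normr0 mulr_ge0 ?powR_ge0// addr_ge0// mulr_ge0.
have d0 : 0 < `|x - y| by rewrite normr_gt0 subr_eq0.
have p0 := powR_ge0 `|x - y| theta.
have [d1|d1] := leP `|x - y| 1.
 apply: (le_trans (fL x y Dx Dy)); apply: (@le_trans _ _ (`|L| * `|x - y| `^ theta)).
  apply: (le_trans (ler_wpM2r (ltW d0) (ler_norm L))); apply: ler_wpM2l => //.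
  by rewrite -[leLHS](powRr1 (ltW d0)); apply: ger_powR; [rewrite d0 d1|exact: ltW].
 by apply: ler_wpM2r => //; rewrite lerDl mulr_ge0.
have h1 : 1 <= `|x - y| `^ theta.
 by rewrite -[leLHS](powRr0 `|x - y|); apply: ler_powR => //; exact: ltW.
apply: (@le_trans _ _ (2 * `|M|)).
 rewrite mulr2n mulrDl mul1r; apply: (le_trans (ler_normB _ _)).
 by apply: lerD; [apply: (le_trans (fM x Dx))|apply: (le_trans (fM y Dy))]; rewrite ler_norm.
rewrite -[leLHS]mulr1; apply: ler_pM => //; by rewrite lerDr.
Qed.

Lemma CB1_lipschitz (g : V -> R) (M : R) x y : CB 1 g -> (forall i x, `|partial i g x| <= M) ->
 `|g x - g y| <= 3 * M * `|x - y|.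
Proof.
move=> g1 gM; have M0 : 0 <= M := le_trans (normr_ge0 _) (gM ord0 0).
have D (v z : V) : is_derive z v g (\sum_(i < 3) v 0 i * partial i g z).
 by apply: is_derive_C1; [exact: CB_derivable g1|move=> i; exact: CB_cont (CB_partial i g1)].
pose v := x - y.
have Dl (t : R) : is_derive t 1 (fun h : R => g (h *: v + y)) (\sum_(i < 3) v 0 i * partial i g (t *: v + y)).
 have [dv ev] := D v (t *: v + y); rewrite -ev; exact: derivable_line.
have H := @MVT_le R (fun h : R => g (h *: v + y)) (fun t => \sum_(i < 3) v 0 i * partial i g (t *: v + y))
 (3 * M * `|v|) 0 1 (fun t _ => Dl t) _.
have {H} := H _; rewrite scale1r subrK scale0r add0r subr0 normr1 mulr1; apply => t _.
apply: (le_trans (ler_norm_sum _ _ _)).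
apply: (@le_trans _ _ (\sum_(i < 3) `|v| * M)).
 by apply: ler_sum => i _; rewrite normrM ler_pM// norm_coord.
rewrite sumr_const card_ord; have -> : `|v| * M *+ 3 = 3 * M * `|v| by ring.
by [].
Qed.

Lemma FTC01 (F f : R -> R) : (forall r : R, 0 <= r <= 1 -> is_derive r 1 F (f r)) ->
 (forall r : R, 0 <= r <= 1 -> {for r, continuous f}) -> F 1 - F 0 = \int[leb]_(r in D01) f r.
Proof.
move=> DF cf.
have cF (r : R) : 0 <= r <= 1 -> {for r, continuous F}.
 by move=> h; apply/differentiable_continuous/derivable1_diffP; case: (DF r h).
have i01 : leb.-integrable `[0, 1] (EFin \o f) := intg_segment cf.
have H : (\int[leb]_(x in `[0%R, 1%R]) (f x)%:E = (F 1)%:E - (F 0)%:E)%E.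
 apply: continuous_FTC2 => //.
 - by apply: continuous_in_subspaceT => r; rewrite inE/= in_itv; exact: cf.
 - split.
  + by move=> r; rewrite in_itv/= => /andP[r0 r1]; have [] := DF r _; rewrite ?(ltW r0) ?(ltW r1).
  + by apply: cvg_at_right_filter; apply: cF; rewrite lexx ler01.
  + by apply: cvg_at_left_filter; apply: cF; rewrite lexx ler01.
 - move=> r; rewrite in_itv/= => /andP[r0 r1]; rewrite derive1E.
  by apply: is_derive_val; apply: DF; rewrite (ltW r0) (ltW r1).
have -> : \int[leb]_(r in D01) f r = \int[leb]_(r in `[0, 1]) f r.
 have i2 : leb.-integrable `[0, 1[ (EFin \o f).
  by apply: (integrableS _ _ _ i01) => // x /=; rewrite !in_itv/= => /andP[-> /ltW->].
 rewrite Rintegral_itv_obnd_cbnd; last first.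
  by apply: (integrableS _ _ _ i2) => // x /=; rewrite !in_itv/= => /andP[/ltW-> ->].
 exact: Rintegral_itv_bndo_bndc i2.
by rewrite /Rintegral H.
Qed.

End LipschitzFunctions.

(** * The operator that yields the time derivative *)

Section DifferentialOperator.
Context {R : realType}.
Local Notation V := 'rV[R]_3.
Implicit Types (v w : 'I_3 -> V -> R) (G H : 'I_3 -> 'I_3 -> V -> R) (s : seq 'I_3) (M : R).

Lemma DB_sum3 k M a (F : 'I_3 -> V -> R) : 0 <= a -> (forall i, DB k M a (F i)) ->
 DB k (3 * M) a (fun x => \sum_(i < 3) F i x).
Proof.
move=> a0 hF; have := DB_add a0 (hF ord0) (DB_add a0 (hF o1) (hF o2)).
have -> : M + (M + M) = 3 * M by ring.
by congr (DB _ _ _ _); apply/funext => x; rewrite sum3.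
Qed.

(** The formula of [u_t] with the field and the stress as independent arguments. It is then linear,
    so the increments of the time derivative are its values at increments. *)
Definition NSop i v G x : R := \sum_(l < 3) partials [:: l; l] (v i) x -
 \sum_(j < 3) partial j (G i j) x - \sum_(j < 3) \sum_(k < 3) R0 [:: i; j; k] (G j k) x.

Definition cRsup : R := \sum_(i < 3) \sum_(j < 3) \sum_(k < 3) cR [:: i; j; k].

Lemma cR_le i j k : cR [:: i; j; k] <= cRsup.
Proof.
have n0 i' j' k' : 0 <= @cR R [:: i'; j'; k'] := cR_ge0 _.
have S (g : 'I_3 -> R) l : (forall l, 0 <= g l) -> g l <= \sum_(l < 3) g l.
 by move=> g0; rewrite (bigD1 l)//= lerDl sumr_ge0.
have n1 i' j' : 0 <= \sum_(k < 3) @cR R [:: i'; j'; k] by rewrite sumr_ge0.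
have n2 i' : 0 <= \sum_(j < 3) \sum_(k < 3) @cR R [:: i'; j; k] by rewrite sumr_ge0.
apply: (le_trans (S (fun k => cR [:: i; j; k]) k (n0 i j))).
apply: (le_trans (S (fun j => \sum_(k < 3) cR [:: i; j; k]) j (n1 i))).
exact: (S (fun i => \sum_(j < 3) \sum_(k < 3) cR [:: i; j; k]) i n2).
Qed.

Definition cO : R := 6 + 9 * cRsup.

Lemma cO_ge0 : 0 <= cO.
Proof.
have H : 0 <= cRsup := le_trans (cR_ge0 _) (cR_le ord0 ord0 ord0).
by rewrite /cO; exact: addr_ge0 (ler0n _ _) (mulr_ge0 (ler0n _ _) H).
Qed.

Lemma DB_NSop k M i v G : (forall i, DB (k + 3) M 1 (v i)) -> (forall j k', DB (k + 3) M 1 (G j k')) ->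
 DB k (cO * M) 1 (NSop i v G).
Proof.
move=> hv hG; have M0 := DB_ge0 (hv ord0).
have h1 l : DB k M 1 (partials [:: l; l] (v i)).
 have := @DB_partials R (k + 3) M 1 (v i) [:: l; l] _ (hv i); rewrite expr1n mulr1 => H.
 have {}H := H (leq_trans (isT : (2 <= 3)%N) (leq_addl k 3)).
 by apply: DB_weaken H => //; rewrite /= -addnBA// leq_addr.
have h2 j : DB k M 1 (partial j (G i j)).
 have := @DB_partials R (k + 3) M 1 (G i j) [:: j] _ (hG i j); rewrite expr1n mulr1 => H.
 have {}H := H (leq_trans (isT : (1 <= 3)%N) (leq_addl k 3)).
 by apply: DB_weaken H => //; rewrite /= -addnBA// leq_addr.
have h3 j k' : DB k (cRsup * M) 1 (R0 [:: i; j; k'] (G j k')).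
 have := @DB_R0 R [:: i; j; k'] k (G j k') (DB_CB (hG j k')) M (hG j k') => H.
 by apply: DB_weaken H => //; apply: ler_wpM2r => //; exact: cR_le.
have := DB_sub ler01 (DB_sub ler01 (DB_sum3 ler01 h1) (DB_sum3 ler01 h2))
 (DB_sum3 ler01 (fun j => DB_sum3 ler01 (h3 j))).
by congr (DB _ _ _ _); rewrite /cO; ring.
Qed.

Lemma R0_sub s (f g : V -> R) x : CB (0 + size s) f -> CB (0 + size s) g -> R0 s (fun y => f y - g y) x = R0 s f x - R0 s g x.
Proof.
move=> fs gs; have f0 := CB_le (leq0n _) fs; have g0 := CB_le (leq0n _) gs.
have pf : CB 0 (partials s f) by have := CB_partials fs (leqnn _); rewrite subnn.
have pg : CB 0 (partials s g) by have := CB_partials gs (leqnn _); rewrite subnn.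
have E r : Hh s (fun y => f y - g y) r x = Hh s f r x - Hh s g r x.
 apply: etrans (congr1 (fun h => hk [::] (sqrt r) h x) (partials_sub fs gs (leqnn _))) _.
 exact: (hkB [::] (sqrt r) x pf pg).
have ii h : CB (0 + size s) h -> leb.-integrable D01 (EFin \o (fun r : mR R => Hh s h r x)).
 move=> hs; have ph : CB 0 (partials s h) by have := CB_partials hs (leqnn _); rewrite subnn.
 have [M hM] := CB_bnd ph.
 apply: (le_intg mD01 _ (intg01_cst (cK [::] * (cK [::] * M)))).
  have := @mfun_Hh_scaled R s 0 h hs [::] 1 x isT.
  by under [X in measurable_fun _ X -> _]eq_fun do rewrite mul1r.
 by move=> r _; exact: (@Hh_le R s 0 h hs [::] M r x isT hM).
have E2 : \int[leb]_(r in D01) Hh s (fun y => f y - g y) r x =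
  \int[leb]_(r in D01) Hh s f r x - \int[leb]_(r in D01) Hh s g r x.
 by apply: etrans (RintegralB mD01 (ii f fs) (ii g gs)); apply: eq_Rintegral => r _; exact: E.
have key (a b c d e h : R) : a = b - c -> d = e - h -> a + d = (b + e) - (c + h) by move=> -> ->; ring.
exact: key (RkB s x ltr01 f0 g0) E2.
Qed.

Lemma NSop_sub i v w G H x : (forall i, CB 3 (v i)) -> (forall i, CB 3 (w i)) -> (forall j k, CB 3 (G j k)) ->
 (forall j k, CB 3 (H j k)) ->
 NSop i (fun i x => v i x - w i x) (fun j k x => G j k x - H j k x) x = NSop i v G x - NSop i w H x.
Proof.
move=> hv hw hG hH.
have E1 : \sum_(l < 3) partials [:: l; l] (fun x => v i x - w i x) x =
  \sum_(l < 3) partials [:: l; l] (v i) x - \sum_(l < 3) partials [:: l; l] (w i) x.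
 rewrite -sumrB; apply: eq_bigr => l _.
 exact: (congr1 (fun g => g x) (partials_sub (hv i) (hw i) (isT : (size [:: l; l] <= 3)%N))).
have E2 : \sum_(j < 3) partial j (fun x => G i j x - H i j x) x =
  \sum_(j < 3) partial j (G i j) x - \sum_(j < 3) partial j (H i j) x.
 rewrite -sumrB; apply: eq_bigr => j _.
 exact: (congr1 (fun g => g x) (partials_sub (hG i j) (hH i j) (isT : (size [:: j] <= 3)%N))).
have E3 : \sum_(j < 3) \sum_(k < 3) R0 [:: i; j; k] (fun x => G j k x - H j k x) x =
  \sum_(j < 3) \sum_(k < 3) R0 [:: i; j; k] (G j k) x - \sum_(j < 3) \sum_(k < 3) R0 [:: i; j; k] (H j k) x.
 rewrite -sumrB; apply: eq_bigr => j _; rewrite -sumrB; apply: eq_bigr => k _.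
 exact: (@R0_sub [:: i; j; k] _ _ x (hG j k) (hH j k)).
have key (a b c d e f p q r : R) : a = d - p -> b = e - q -> c = f - r -> a - b - c = (d - e - f) - (p - q - r).
 by move=> -> -> ->; ring.
exact: key E1 E2 E3.
Qed.

End DifferentialOperator.

(** * Regularity in time away from t = 0 *)

Section Regularity.
Context {R : realType}.
Local Notation V := 'rV[R]_3.
Implicit Types (s al : seq 'I_3).
Variables (T : \bar R) (c : R) (u : 'I_3 -> R -> V -> R).
Local Notation I := (time_interval T).
Hypothesis c0 : 0 <= c.
Hypothesis uX : forall i, XX I 6 (fun t => c * rs t) rs (u i).
Hypothesis ut : forall i (t : R) x, I t -> is_derive t 1 (fun t => u i t x) (u_t u i t x).

Let rs0 t : I t -> 0 <= rs t. Proof. by move=> /I_gt0/rs_gt0/ltW. Qed.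

Let N := 2 ^+ 6 * c ^+ 2.

Let FX j k : XX I 6 (fun t => N * rs t ^+ 2) rs (stress u j k).
Proof.
apply: XX_weaken (XX_mul rs0 (@open_I R T) (uX j) (uX k)); first exact: rs0.
by move=> t _; apply: le_of_eq; rewrite /N; ring.
Qed.

Lemma DB_unit_rate k M b (f : V -> R) : 1 <= b -> DB k M b f -> DB k (M * b ^+ k) 1 f.
Proof.
move=> b1 H; have M0 := DB_ge0 H; case: H => fk fM; split=> // al alk x.
apply: (le_trans (fM al alk x)); rewrite expr1n mulr1; apply: ler_wpM2l => //.
exact: ler_weXn2l.
Qed.

(** For t > eta all powers of t^(-1/2) are bounded, so the rate can be normalised to 1. *)
Lemma uniform_bounds (eta : R) : 0 < eta -> exists M : R, forall t, I t -> eta < t ->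
 (forall i, DB 6 M 1 (u i t)) /\ (forall j k, DB 6 M 1 (stress u j k t)).
Proof.
move=> e0; set b := 1 + rs eta; have re := rs_gt0 e0.
have b1 : 1 <= b by rewrite lerDl ltW.
have N0 : 0 <= N by rewrite mulr_ge0 ?exprn_ge0.
exists ((c * b + N * b ^+ 2) * b ^+ 6) => t It et.
have rt : rs t <= b.
 apply: (@le_trans _ _ (rs eta)); last by rewrite lerDr.
 by have t0 := lt_trans e0 et; rewrite /rs lef_pV2 ?posrE ?sqrtr_gt0//; exact: ler_wsqrtr (ltW et).
have r0 := rs0 It; have b0 : 0 <= b := le_trans ler01 b1.
have q1 : 0 <= c * b by pos.
have q2 : 0 <= N * b ^+ 2 by pos.
split=> [i|j k]; apply: DB_unit_rate => //.
 apply: DB_weaken ((uX i).1 t It) => //.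
 by apply: (@le_trans _ _ (c * b)); [exact: ler_wpM2l|rewrite lerDl].
apply: DB_weaken ((FX j k).1 t It) => //.
by apply: (@le_trans _ _ (N * b ^+ 2)); [apply: ler_wpM2l => //; rewrite lerXn2r|rewrite lerDr].
Qed.

Let bounds t : I t -> exists M : R, (forall i, DB 6 M 1 (u i t)) /\ (forall j k, DB 6 M 1 (stress u j k t)).
Proof.
move=> It; have t0 := I_gt0 It; have t2 : 0 < t / 2 by pos.
have [M HM] := uniform_bounds t2; exists M; apply: HM => //; lra.
Qed.

Lemma CB_u_t i t : I t -> CB 3 (u_t u i t).
Proof.
move=> It; have [M [h1 h2]] := bounds It.
exact: (DB_CB (@DB_NSop R 3 M i (fun i => u i t) (fun j k => stress u j k t) h1 h2)).
Qed.

Lemma partials_u_t i t al x : I t -> (size al <= 3)%N -> partials al (u_t u i t) x =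
 \sum_(l < 3) partials (al ++ [:: l; l]) (u i t) x - \sum_(j < 3) partials (al ++ [:: j]) (stress u i j t) x -
 \sum_(j < 3) \sum_(k < 3) partials al (R0 [:: i; j; k] (stress u j k t)) x.
Proof.
move=> It al3; have [M [h1 h2]] := bounds It.
have a1 l : CB 3 (partials [:: l; l] (u i t)).
 by apply: CB_le (CB_partials (DB_CB (h1 i)) (isT : (size [:: l; l] <= 6)%N)).
have a2 j : CB 3 (partial j (stress u i j t)).
 by apply: CB_le (CB_partials (DB_CB (h2 i j)) (isT : (size [:: j] <= 6)%N)).
have a3 j k : CB 3 (R0 [:: i; j; k] (stress u j k t)) := (@R0_partials_CB R [:: i; j; k] 3 (stress u j k t) (DB_CB (h2 j k))).1.
have s3 j := CB_sum (a3 j).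
have e1 := congr1 (fun g => g x) (partials_sum a1 al3).
have e2 := congr1 (fun g => g x) (partials_sum a2 al3).
have e3 := congr1 (fun g => g x) (partials_sum s3 al3).
have e4 j := congr1 (fun g => g x) (partials_sum (a3 j) al3).
have e5 := congr1 (fun g => g x) (partials_sub (CB_sub (CB_sum a1) (CB_sum a2)) (CB_sum s3) al3).
have e6 := congr1 (fun g => g x) (partials_sub (CB_sum a1) (CB_sum a2) al3).
apply: etrans e5 _; rewrite e6 e1 e2 e3 (eq_bigr _ (fun j _ => e4 j)).
under [X in _ = X - _ - _]eq_bigr do rewrite partials_cat.
by under [X in _ = _ - X - _]eq_bigr do rewrite partials_cat.
Qed.

Lemma cont_sum3 (Q : normedModType R) (g : 'I_3 -> Q -> R) (q : Q) :
 (forall i, {for q, continuous (g i)}) -> {for q, continuous (fun z => \sum_(i < 3) g i z)}.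
Proof.
move=> cg; have -> : (fun z => \sum_(i < 3) g i z) = (fun z => g ord0 z + (g o1 z + g o2 z)).
 by apply/funext => z; rewrite sum3.
by apply: continuousD; [exact: cg|apply: continuousD; exact: cg].
Qed.

Lemma u_t_cont i al (t : R) x : I t -> (size al <= 3)%N ->
 {for ((t, x) : R * V), continuous (fun q : R * V => partials al (u_t u i q.1) q.2)}.
Proof.
move=> It al3; have oI := @open_I R T.
have alk n : (n <= 2)%N -> (size al + n <= 6)%N by move=> n2; apply: (leq_trans (leq_add al3 n2)).
pose G (q : R * V) := \sum_(l < 3) partials (al ++ [:: l; l]) (u i q.1) q.2 -
 \sum_(j < 3) partials (al ++ [:: j]) (stress u i j q.1) q.2 -
 \sum_(j < 3) \sum_(k < 3) partials al (R0 [:: i; j; k] (stress u j k q.1)) q.2.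
have c1 : {for ((t, x) : R * V), continuous (fun q : R * V => \sum_(l < 3) partials (al ++ [:: l; l]) (u i q.1) q.2)}.
 apply: (@cont_sum3 _ (fun l q => partials (al ++ [:: l; l]) (u i q.1) q.2)) => l.
 by apply: (uX i).2 => //; rewrite size_cat; exact: alk.
have c2 : {for ((t, x) : R * V), continuous (fun q : R * V => \sum_(j < 3) partials (al ++ [:: j]) (stress u i j q.1) q.2)}.
 apply: (@cont_sum3 _ (fun j q => partials (al ++ [:: j]) (stress u i j q.1) q.2)) => j.
 by apply: (FX i j).2 => //; rewrite size_cat; exact: alk.
have c3 : {for ((t, x) : R * V), continuous (fun q : R * V =>
  \sum_(j < 3) \sum_(k < 3) partials al (R0 [:: i; j; k] (stress u j k q.1)) q.2)}.
 apply: (@cont_sum3 _ (fun j q => \sum_(k < 3) partials al (R0 [:: i; j; k] (stress u j k q.1)) q.2)) => j.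
 apply: (@cont_sum3 _ (fun k q => partials al (R0 [:: i; j; k] (stress u j k q.1)) q.2)) => k.
 apply: (@R0_partials_cont R I (stress u j k) [:: i; j; k] 3 al t x oI _ _ al3 It).
  by move=> t' It'; exact: DB_CB ((FX j k).1 t' It').
 by move=> be be6; exact: (@F_stc R T 6 (stress u j k) N (FX j k) be be6).
have cG : G q @[q --> ((t, x) : R * V)] --> G (t, x) by exact: (cvgB (cvgB c1 c2) c3).
have n1 : \forall q \near ((t, x) : R * V), I q.1.
 have cf : fst @ ((t, x) : R * V) --> t by exact: cvg_fst.
 by apply: (cf I); apply: open_nbhs_nbhs.
have EG q : I q.1 -> G q = partials al (u_t u i q.1) q.2.
 by move=> Iq; apply: esym; exact: (partials_u_t i q.2 Iq al3).
have E : {near ((t, x) : R * V), G =1 (fun q => partials al (u_t u i q.1) q.2)}.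
 by apply: filterS n1 => q Iq; exact: EG.
have E0 : G (t, x) = partials al (u_t u i t) x := EG (t, x) It.
rewrite E0 in cG; exact: (cvg_trans (near_eq_cvg E) cG).
Qed.

Lemma DB_int01 k (C : R) (G : R -> V -> R) : (forall r, 0 < r -> r < 1 -> DB k C 1 (G r)) ->
 (forall al, (size al <= k)%N -> forall x, measurable_fun D01 (fun r : mR R => partials al (G r) x : mR R)) ->
 DB k C 1 (fun x => \int[leb]_(r in D01) G r x).
Proof.
move=> hG mG.
have h1 (r : mR R) : D01 r -> CB k (G r) by move=> /D01P[r0 r1]; exact: DB_CB (hG r r0 r1).
have h3 (al : seq 'I_3) : (size al <= k)%N -> leb.-integrable D01 (EFin \o (fun r : mR R => C)).
 by move=> _; exact: intg01_cst.
have h4 al : (size al <= k)%N -> forall (r : mR R) x, D01 r -> `|partials al (G r) x| <= C.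
 by move=> alk r x /D01P[r0 r1]; have := (hG r r0 r1).2 al alk x; rewrite expr1n mulr1.
split; first exact: (CB_int mD01 h1 mG (b := fun _ _ => C) h3 h4).
move=> al alk x; rewrite expr1n mulr1.
rewrite (partials_int mD01 h1 mG (b := fun _ _ => C) h3 h4 alk).
rewrite -[leRHS](integral01_cst C).
have ih := intg_partials mD01 mG (b := fun _ _ => C) h3 h4 x alk.
apply: (le_trans (le_normr_Rintegral mD01 ih)).
apply: le_Rintegral; [exact: mD01|exact: integrable_norm ih|exact: intg01_cst|].
by move=> r Dr; exact: h4.
Qed.

Section AwayFromZero.
Variables (eta M : R).
Hypothesis eta0 : 0 < eta.
Hypothesis hM : forall t, I t -> eta < t -> (forall i, DB 6 M 1 (u i t)) /\ (forall j k, DB 6 M 1 (stress u j k t)).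

Lemma DB_u_t i t : I t -> eta < t -> DB 3 (cO * M) 1 (u_t u i t).
Proof.
move=> It et; have [h1 h2] := hM It et.
exact: (@DB_NSop R 3 M i (fun i => u i t) (fun j k => stress u j k t) h1 h2).
Qed.

(** The increment is the integral of [u_t] along the segment from t0 to t1, differentiated under the
    integral sign; three of the six derivatives of u remain. *)
Lemma DB_time_increment i (t0 t1 : R) : I t0 -> I t1 -> eta < t0 -> eta < t1 ->
 DB 3 (`|t1 - t0| * (cO * M)) 1 (fun x => u i t1 x - u i t0 x).
Proof.
move=> I0 I1 e0 e1; set h := t1 - t0; pose p (r : R) := t0 + r * h.
have pI r : 0 <= r <= 1 -> I (p r) /\ eta < p r.
 move=> /andP[r0 r1]; have pe : eta < p r.
  have pm : Num.min t0 t1 <= p r by rewrite ge_min /p /h; have [ab|ab] := leP t0 t1; apply/orP; [left|right]; nra.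
  by apply: lt_le_trans pm; rewrite lt_min e0 e1.
 split=> //; split; first exact: lt_trans pe.
 have pm : p r <= Num.max t0 t1 by rewrite le_max /p /h; have [ab|ab] := leP t0 t1; apply/orP; [right|left]; nra.
 apply: (@le_lt_trans _ _ (Num.max t0 t1)%:E); first by rewrite lee_fin.
 by rewrite maxEle; case: ifP => _; [exact: I1.2|exact: I0.2].
have cp : continuous p.
 by move=> r; cts.
have ct r al x : 0 <= r <= 1 -> (size al <= 3)%N -> {for r, continuous (fun r => partials al (u_t u i (p r)) x)}.
 move=> r01 al3; have c1 := @u_t_cont i al (p r) x (pI r r01).1 al3.
 have ci : (fun r : R => (p r, x)) @ r --> ((p r, x) : R * V).
  by apply: cvg_pairN; [exact: cp|exact: cvg_cst].
 exact: (cvg_comp _ _ ci c1).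
have E : (fun x => u i t1 x - u i t0 x) = (fun x => \int[leb]_(r in D01) (h * u_t u i (p r) x)).
 apply/funext => x.
 have D (r : R) : 0 <= r <= 1 -> is_derive r 1 (fun r => u i (p r) x) (h * u_t u i (p r) x).
  move=> r01; have d1 : is_derive r 1 p h.
   have := is_deriveD (is_derive_cst t0 r 1) (is_deriveZ h (is_derive_id r 1)).
   rewrite add0r /GRing.scale/= mulr1 => d; apply: (is_derive_eq _ (erefl h)).
   by move: d; congr (is_derive _ _ _ _); apply/funext => z; rewrite /p [z * h]mulrC.
  have d2 := ut i x (pI r r01).1.
  have d3 := is_derive1_comp (f := fun t => u i t x) (g := p) d2 d1.
  by apply: (is_derive_eq d3); rewrite mulrC.
 have p1 : p 1 = t1 by rewrite /p mul1r /h addrC subrK.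
 have p0 : p 0 = t0 by rewrite /p mul0r addr0.
 have := FTC01 D; rewrite p1 p0; apply => r r01.
 apply: cont_mulR; [exact: cst_continuous|exact: (ct r [::] x r01 isT)].
rewrite E; apply: DB_int01 => [r r0 r1|al al3 x].
 have r01 : 0 <= r <= 1 by rewrite (ltW r0) (ltW r1).
 exact: (DB_scale h ler01 (DB_u_t i (pI r r01).1 (pI r r01).2)).
apply: (@eq_measurable_fun _ _ _ _ _ (fun r : mR R => h * partials al (u_t u i (p r)) x)).
 move=> r /set_mem/D01P[r0 r1]; have r01 : 0 <= r <= 1 by rewrite (ltW r0) (ltW r1).
 exact: esym (congr1 (fun g => g x) (partials_scale h (CB_u_t i (pI r r01).1) al3)).
apply: mfun_cont01 => r r0 r1; have r01 : 0 <= r <= 1 by rewrite (ltW r0) (ltW r1).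
by apply: cont_mulR; [exact: cst_continuous|exact: ct].
Qed.

(** The increments of u and of the stress are Lipschitz in time with three space derivatives,
    exactly what [NSop] consumes. This is why six derivatives are carried from the start. *)
Lemma u_t_increment i (t0 t1 : R) x : I t0 -> I t1 -> eta < t0 -> eta < t1 ->
 `|u_t u i t1 x - u_t u i t0 x| <= cO * (16 * (1 + M) * cO * M) * `|t1 - t0|.
Proof.
move=> I0 I1 e0 e1.
have [a1 a2] := hM I0 e0; have [b1 b2] := hM I1 e1.
have M0 := DB_ge0 (a1 i); have h0 := normr_ge0 (t1 - t0).
have c1 := @cO_ge0 R.
set C := `|t1 - t0| * (cO * M); have C0 : 0 <= C by rewrite !mulr_ge0.
have du j := DB_time_increment j I0 I1 e0 e1.
have u3 j t : I t -> eta < t -> DB 3 M 1 (u j t) by move=> It et; apply: DB_weaken ((hM It et).1 j).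
(* 16 is 2 x 2^3: two products in the difference, each with the Leibniz factor of order 3. *)
have dF j k : DB 3 (16 * (1 + M) * C) 1 (fun x => stress u j k t1 x - stress u j k t0 x).
 have d1 := DB_absorb ler01 (DB_mul ler01 (du j) (u3 k t1 I1 e1)).
 have d2 := DB_absorb ler01 (DB_mul ler01 (u3 j t0 I0 e0) (du k)).
 have := DB_add ler01 d1 d2 => d.
 have -> : (fun x => stress u j k t1 x - stress u j k t0 x) =
   (fun x => (u j t1 x - u j t0 x) * u k t1 x + u j t0 x * (u k t1 x - u k t0 x)).
  by apply/funext => y; rewrite /stress; ring.
 apply: DB_weaken d => //; rewrite -/C; nra.
have dv j : DB 3 (16 * (1 + M) * C) 1 (fun x => u j t1 x - u j t0 x).
 by apply: DB_weaken (du j) => //; rewrite -/C; nra.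
have H := DB0 (@DB_NSop R 0 _ i (fun j x => u j t1 x - u j t0 x) (fun j k x => stress u j k t1 x - stress u j k t0 x) dv dF) x.
have c36 (f : V -> R) : CB 6 f -> CB 3 f by exact: CB_le.
have E := @NSop_sub R i (fun j => u j t1) (fun j => u j t0) (fun j k => stress u j k t1) (fun j k => stress u j k t0) x
 (fun j => c36 _ (DB_CB (b1 j))) (fun j => c36 _ (DB_CB (a1 j))) (fun j k => c36 _ (DB_CB (b2 j k))) (fun j k => c36 _ (DB_CB (a2 j k))).
have key (a b d e f : R) : `|a| <= d -> a = e - f -> d <= b -> `|e - f| <= b by move=> h1 <-; exact: le_trans.
apply: (key _ _ _ _ _ H E); rewrite /C; apply: le_of_eq; ring.
Qed.

End AwayFromZero.
End Regularity.

(** * Window bounds versus the L^3 norm and the local norm *)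

Section NormConversions.
Context {R : realType}.
Local Notation V := 'rV[R]_3.
Implicit Types (f g : V -> R) (u : V -> V) (A kap : R).

Lemma enorm_ge0 (x : V) : 0 <= enorm x. Proof. pos. Qed.

Lemma enorm_sqr (x : V) : enorm x ^+ 2 = \sum_(i < 3) x 0 i ^+ 2.
Proof. by rewrite sqr_sqrtr// sumr_ge0// => i _; exact: sqr_ge0. Qed.

Lemma coord_le_enorm (x : V) i : `|x 0 i| <= enorm x.
Proof.
rewrite -sqrtr_sqr ler_wsqrtr// (bigD1 i)//= lerDl sumr_ge0// => j _.
exact: sqr_ge0.
Qed.

Lemma enorm_le_sum (x : V) : enorm x <= \sum_(i < 3) `|x 0 i|.
Proof.
have key (a b c : R) : a ^+ 2 + (b ^+ 2 + c ^+ 2) <= (`|a| + (`|b| + `|c|)) ^+ 2.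
 rewrite -(real_normK (num_real a)) -(real_normK (num_real b)) -(real_normK (num_real c)).
 move: (normr_ge0 a) (normr_ge0 b) (normr_ge0 c); move: (`|a|) (`|b|) (`|c|) => p q r p0 q0 r0; nra.
have s0 : 0 <= \sum_(i < 3) `|x 0 i| by rewrite sumr_ge0.
have : enorm x ^+ 2 <= (\sum_(i < 3) `|x 0 i|) ^+ 2 by rewrite enorm_sqr !sum3; exact: key.
by rewrite ler_pXn2r ?nnegrE ?enorm_ge0.
Qed.

Lemma cont_coord (i : 'I_3) : continuous (fun x : V => x 0 i).
Proof. by move=> x; apply/differentiable_continuous; exact: differentiable_coord. Qed.

Lemma cont_enorm : continuous (@enorm R).
Proof.
move=> x; apply: (@continuous_comp _ _ _ (fun x : V => \sum_(i < 3) x 0 i ^+ 2) (@sqrt R)); last exact: sqrt_continuous.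
apply: (@cont_sum3 R V (fun i x => x 0 i ^+ 2)) => i.
apply: (@continuous_comp _ _ _ (fun x : V => x 0 i) (fun z => z ^+ 2)); first exact: cont_coord.
exact: exprn_continuous.
Qed.

Lemma mfun_enorm d (S : measurableType d) (D : set S) (c : S -> V) :
 (forall i, measurable_fun D (fun a => c a 0 i : mR R)) ->
 measurable_fun D (fun a => enorm (c a) : mR R).
Proof. by move=> mc; exact: mfun_comp_continuous mc cont_enorm. Qed.

Lemma Lp3_norm_cube (g : V -> R) : ((Lp_norm 3%:E g) `^ 3 = \int[leb3]_z (`|g (vec3 z)| ^+ 3)%:E)%E.
Proof.
rewrite /Lp_norm poweR_Lnorm//; apply: eq_integral => z _.
by rewrite abse_EFin poweR_EFin powR_mulrn.
Qed.

Lemma le_poweR (x y : \bar R) (r : R) : 0 <= r -> (0 <= x)%E -> (x <= y)%E -> (x `^ r <= y `^ r)%E.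
Proof.
move=> r0 x0 xy; apply: gt0_ler_poweR => //; rewrite in_itv/= leey andbT//.
exact: le_trans xy.
Qed.

Lemma Lp3_norm_le g A : 0 <= A ->
 (Lp_norm 3%:E g <= A%:E)%E <-> (\int[leb3]_z (`|g (vec3 z)| ^+ 3)%:E <= (A ^+ 3)%:E)%E.
Proof.
move=> A0; have AE : ((A ^+ 3)%:E = A%:E `^ 3)%E by rewrite poweR_EFin powR_mulrn.
have N0 : (0 <= Lp_norm 3%:E g)%E by exact: Lnorm_ge0.
rewrite -Lp3_norm_cube AE; split=> h.
 exact: le_poweR.
have -> : (Lp_norm 3%:E g = ((Lp_norm 3%:E g) `^ 3) `^ 3^-1)%E by rewrite -poweRrM divff// poweRe1.
have -> : (A%:E = (A%:E `^ 3) `^ 3^-1)%E by rewrite -poweRrM divff// poweRe1.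
by apply: le_poweR => //; exact: poweR_ge0.
Qed.

Lemma Wg_le1 (y : V) : Wg y <= 1.
Proof.
rewrite WgE -[leRHS]expR0 ler_expR mulNr oppr_le0 divr_ge0// sumr_ge0// => i _.
exact: sqr_ge0.
Qed.

Lemma Nb_of_integral kap f A : 0 <= A -> (mfun3 z, f (vec3 z)) ->
 (\int[leb3]_z (`|f (vec3 z)| ^+ 3)%:E <= (A ^+ 3)%:E)%E -> Nb kap f A.
Proof.
move=> A0 mf fA x l l0; have l3 : 0 < l ^+ 3 by pos.
pose g (z : space3 R) := (`|f (vec3 z)| ^+ 3)%:E.
have mg : measurable_fun setT g by apply/measurable_EFinP; apply: measurable_funX; exact: measurableT_comp.
have ln : - l != 0 by rewrite oppr_eq0 gt_eqF.
have E := @ge0_integral_affine3 R x (- l) g ln mg (fun z => _).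
have {}E : (\int[leb3]_z (`|f (x - l *: vec3 z)| ^+ 3)%:E = (l ^- 3)%:E * \int[leb3]_z g z)%E.
 rewrite normrN gtr0_norm// in E; rewrite -E; last by move=> z; rewrite lee_fin exprn_ge0.
 by apply: eq_integral => z _; rewrite /g vec3_affine scaleNr.
have mgx : measurable_fun setT (fun z : space3 R => (`|f (x - l *: vec3 z)| ^+ 3)%:E).
 have -> : (fun z : space3 R => (`|f (x - l *: vec3 z)| ^+ 3)%:E) = g \o affine3 x (- l).
  by apply/funext => z; rewrite /g /= vec3_affine scaleNr.
 by apply: measurableT_comp => //; exact: mfun_affine3.
apply: (@le_trans _ _ ((l ^+ 3)%:E * \int[leb3]_z (`|f (x - l *: vec3 z)| ^+ 3)%:E)%E).
 apply: lee_wpmul2l; first by rewrite lee_fin ltW.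
 apply: ge0_le_integral => //.
 - move=> z _; pos.
 - exact: mfun_Nb.
 - by move=> z _; rewrite lee_fin ler_piMl ?exprn_ge0// Wg_le1.
rewrite E muleA -EFinM divff ?gt_eqF// mul1e; apply: (le_trans fA).
by rewrite lee_fin lerXn2r ?nnegrE ?mulr_ge0 ?le_max ?ler01// ler_peMl// le_max lexx.
Qed.

(** For kap = 0 the bound does not grow with the window, so windows of width tending to infinity and
    Fatou's lemma recover the whole integral. *)
Lemma integral_of_Nb f A : 0 <= A -> (mfun3 z, f (vec3 z)) ->
 Nb 0 f A -> (\int[leb3]_z (`|f (vec3 z)| ^+ 3)%:E <= (A ^+ 3)%:E)%E.
Proof.
move=> A0 mf Nf.
have mf3 : (mfun3 z, `|f (vec3 z)| ^+ 3).
 by apply: measurable_funX; exact: measurableT_comp.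
have mW (a : R) : (mfun3 z, Wg (a *: vec3 z)).
 apply: (@mfun3_cont R (fun y => Wg (a *: y))) => y.
 apply: (@continuous_comp _ _ _ (fun y : V => a *: y) (@Wg R)); last exact: cont_Wg.
 exact: scaler_continuous.
apply: (@fatou_le R _ _ leb3 setT (fun n z => Wg (- n.+1%:R^-1 *: vec3 z) * `|f (vec3 z)| ^+ 3)) => //.
- by move=> n; exact: (measurable_funM (mW _) mf3).
- move=> n z _; pos.
- move=> z _; rewrite -[X in _ --> X]mul1r; apply: cvgM; last exact: cvg_cst.
 have W0 : Wg (0 : V) = 1 by rewrite WgE big1 ?oppr0 ?mul0r ?expR0// => i _; rewrite mxE expr0n.
 have c0 : (fun n : nat => - n.+1%:R^-1 *: vec3 z : V) @ \oo --> (0 : V).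
  rewrite -(scale0r (vec3 z : V)) -oppr0; apply: cvgZ; last exact: cvg_cst.
  by apply: cvgN; exact: cvg_harmonic.
 have := cvg_comp _ _ c0 (@cont_Wg R 0); rewrite W0; exact.
move=> n; set l : R := n.+1%:R; have l0 : 0 < l by [].
have l3 : 0 < l ^+ 3 by pos.
pose g (z : space3 R) := (Wg (- l^-1 *: vec3 z) * `|f (vec3 z)| ^+ 3)%:E.
have mg : measurable_fun setT g by apply/measurable_EFinP; exact: (measurable_funM (mW _) mf3).
have ln : - l != 0 by rewrite oppr_eq0 gt_eqF.
have g0 z : (0 <= g z)%E by rewrite lee_fin mulr_ge0 ?Wg_ge0// exprn_ge0.
have E := @ge0_integral_affine3 R 0 (- l) g ln mg g0.
rewrite normrN gtr0_norm// in E.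
have := Nf 0 l l0; rewrite mul0r (max_idPl ler01) mul1r.
have -> : (\int[leb3]_z (Wg (vec3 z) * `|f (0 - l *: vec3 z)| ^+ 3)%:E = \int[leb3]_z g (affine3 0 (- l) z))%E.
 apply: eq_integral => z _; have e : - l^-1 *: (- l *: vec3 z) = vec3 z.
  by rewrite scalerA mulrNN mulVf ?gt_eqF// scale1r.
 by rewrite /g vec3_affine !add0r e scaleNr.
by rewrite E muleA -EFinM divff ?gt_eqF// mul1e.
Qed.

(** Bounded functions have window integrals that grow like the cube of M l, which the factor kap l
    permits; large kap makes the bound as small as desired. This is how test fields become small
    data on short times. *)
Lemma Nb_of_bounded kap f (M : R) : 0 < kap -> (mfun3 z, f (vec3 z)) ->
 (forall x, `|f x| <= M) -> Nb kap f (cK [::] * M / kap).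
Proof.
move=> k0 mf fM x l l0; have M0 : 0 <= M := le_trans (normr_ge0 _) (fM 0).
have c1 := @cK_ge1 R [::]; have c0 := @cK_gt0 R [::].
have mW := mfun3_cont (@cont_Wg R).
apply: (@le_trans _ _ ((l ^+ 3)%:E * \int[leb3]_z (M ^+ 3 * Wg (vec3 z))%:E)%E).
 apply: lee_wpmul2l; first pos.
 apply: ge0_le_integral => //.
 - move=> z _; pos.
 - exact: mfun_Nb.
 - by apply/measurable_EFinP; exact: measurable_funM.
 - by move=> z _; rewrite lee_fin mulrC ler_wpM2r ?Wg_ge0// lerXn2r// nnegrE.
have M3 : 0 <= M ^+ 3 by pos.
apply: (le_trans (lee_wpmul2l _ (integral_Wg_le [::] M3))); first pos.
rewrite -EFinM lee_fin.
have h : l * cK [::] * M <= Num.max 1 (kap * l) * (cK [::] * M / kap).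
 rewrite [leLHS](_ : _ = (kap * l) * (cK [::] * M / kap)); last by field; rewrite gt_eqF.
 by apply: ler_wpM2r; [rewrite divr_ge0 ?(ltW k0)// mulr_ge0// ltW|rewrite le_max lexx orbT].
apply: (@le_trans _ _ ((l * cK [::] * M) ^+ 3)); last first.
 rewrite lerXn2r// nnegrE; first pos.
 apply: le_trans h; pos.
rewrite !exprMn -mulrA; apply: ler_wpM2l; first pos.
by apply: ler_wpM2r => //; rewrite -[leLHS]expr1 ler_weXn2l.
Qed.

Lemma Nb_raise kap f A : Nb 0 f A -> 0 <= A -> Nb kap f A.
Proof.
move=> Nf A0 x l l0; apply: (le_trans (Nf x l l0)); rewrite mul0r (max_idPl ler01) mul1r lee_fin.
rewrite lerXn2r ?nnegrE ?mulr_ge0 ?le_max ?ler01//.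
by rewrite ler_peMl// le_max lexx.
Qed.

Lemma half_le_Wg (z : V) : enorm z < 1 -> 2^-1 <= Wg z.
Proof.
move=> z1; rewrite WgE -enorm_sqr; apply: le_trans (expR_ge1Dx _).
have : enorm z ^+ 2 <= 1 by rewrite expr_le1 ?enorm_ge0// ltW.
move: (enorm z ^+ 2) => q q1; lra.
Qed.

Lemma enormZ (a : R) (x : V) : enorm (a *: x) = `|a| * enorm x.
Proof.
have -> : `|a| * enorm x = sqrt (a ^+ 2 * \sum_(i < 3) x 0 i ^+ 2).
 by rewrite sqrtrM ?sqr_ge0// sqrtr_sqr.
by congr sqrt; rewrite mulr_sumr; apply: eq_bigr => i _; rewrite mxE exprMn.
Qed.

Lemma mfun_ball3 (x : V) (rho : R) : measurable [set y : space3 R | enorm (vec3 y - x) < rho].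
Proof.
have m : (mfun3 y, enorm (vec3 y - x)).
 apply: mfun_enorm => i.
 have -> : (fun y : space3 R => (vec3 y - x) 0 i) = (fun y => vec3 y 0 i - x 0 i) by apply/funext => y; rewrite !mxE.
 by apply: measurable_funB => //; exact: mfun_vec3.
have := m measurableT _ (measurable_itv `]-oo, rho[); rewrite setTI.
by congr (measurable _); apply/seteqP; split => y /=; rewrite in_itv.
Qed.

(** In the window of width 1 / kap centred at x, the weight is at least 1/2 on the ball. *)
Lemma ball_integral_le kap f A (x : V) : 0 < kap -> (mfun3 z, f (vec3 z)) ->
 Nb kap f A -> (\int[leb3]_(y in [set y | (enorm (vec3 y - x) < kap^-1)%R]) (`|f (vec3 y)| ^+ 3)%:E <= (2 * A ^+ 3)%:E)%E.
Proof.
move=> k0 mf Nf; have l0 : 0 < kap^-1 by pos.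
have l3 : 0 < kap^-1 ^+ 3 by pos.
have := Nf x _ l0; rewrite divff ?gt_eqF// maxxx mul1r => H.
rewrite integral_mkcond.
set D := [set y | _].
have mD : measurable D by exact: mfun_ball3.
have mf3 : measurable_fun setT (fun z : space3 R => (`|f (vec3 z)| ^+ 3)%:E).
 by apply/measurable_EFinP; apply: measurable_funX; exact: measurableT_comp.
pose g := (fun y : space3 R => (`|f (vec3 y)| ^+ 3)%:E) \_ D.
have mg : measurable_fun setT g by apply/(measurable_restrictT _ mD); exact: measurable_funTS.
have g0 z : (0 <= g z)%E by apply: erestrict_ge0 => // y _; rewrite lee_fin exprn_ge0.
have ln : - kap^-1 != 0 by rewrite oppr_eq0 gt_eqF.
have E := @ge0_integral_affine3 R x (- kap^-1) g ln mg g0.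
rewrite normrN gtr0_norm// in E.
have -> : (\int[leb3]_y g y = (kap^-1 ^+ 3)%:E * \int[leb3]_z g (affine3 x (- kap^-1) z))%E.
 by rewrite E muleA -EFinM divff ?gt_eqF// mul1e.
apply: (@le_trans _ _ ((kap^-1 ^+ 3)%:E * (2%:E * \int[leb3]_z (Wg (vec3 z) * `|f (x - kap^-1 *: vec3 z)| ^+ 3)%:E))%E); last first.
 by rewrite muleCA [leRHS]EFinM lee_wpmul2l// lee_fin.
apply: lee_wpmul2l; first by rewrite lee_fin ltW.
rewrite -ge0_integralZl_EFin//; last 2 first.
- move=> z _; pos.
- exact: mfun_Nb.
apply: ge0_le_integral => //.
- by apply: measurableT_comp => //; exact: mfun_affine3.
- by apply: measurable_funeM; exact: mfun_Nb.
move=> z _; rewrite /g patchE vec3_affine scaleNr.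
have p0 : 0 <= `|f (x - kap^-1 *: vec3 z)| ^+ 3 by pos.
case: ifPn => [/set_mem|_]; last by rewrite -EFinM lee_fin mulr_ge0// mulr_ge0// Wg_ge0.
rewrite /D /= vec3_affine scaleNr addrAC subrr sub0r -scaleNr enormZ normrN gtr0_norm//.
rewrite ltr_pdivrMl// mulfV ?gt_eqF// => /half_le_Wg h.
by rewrite -EFinM lee_fin mulrA ler_peMl//; lra.
Qed.

(** Indicator of a cube of side 1/2, whose points have Euclidean norm below 1. Scaled, it stands for
    the small balls of the covering, and its product form makes its integral elementary. *)
Definition box (v : space3 R) : R := \1_(`]0, 2^-1[%classic) v.1.1 * \1_(`]0, 2^-1[%classic) v.1.2 * \1_(`]0, 2^-1[%classic) v.2.

Let mfun_ind : measurable_fun setT (\1_(`]0, 2^-1[%classic) : mR R -> mR R).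
Proof. by apply: measurable_indic; exact: measurable_itv. Qed.

Lemma box_ge0 v : 0 <= box v.
Proof. by rewrite /box !mulr_ge0. Qed.

Lemma mfun_box : measurable_fun setT (box : space3 R -> mR R).
Proof.
apply: measurable_funM; first apply: measurable_funM.
- exact: (measurableT_comp mfun_ind (measurableT_comp measurable_fst measurable_fst)).
- exact: (measurableT_comp mfun_ind (measurableT_comp measurable_snd measurable_fst)).
- exact: (measurableT_comp mfun_ind measurable_snd).
Qed.

Lemma integral_box : (\int[leb3]_v (box v)%:E = (8^-1)%:E)%E.
Proof.
have E : (\int[leb]_x (\1_(`]0, 2^-1[%classic) x : R)%:E = (2^-1)%:E)%E.
 rewrite integral_indic//.
 rewrite setIT; apply: etrans (lebesgue_measure_itv `]0, 2^-1[) _.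
 by rewrite /= lte_fin invr_gt0 ltr0n oppr0 adde0.
by rewrite (@ge0_integral3_prod R)// !E -!EFinM; congr _%:E; field.
Qed.

Lemma box_enorm v : box v != 0 -> enorm (vec3 v) ^+ 2 <= 3 / 4.
Proof.
rewrite /box !mulf_eq0 !negb_or => /andP[/andP[h1 h2] h3].
have H (t : R) : \1_(`]0, 2^-1[%classic) t != 0 :> R -> t ^+ 2 <= 4^-1.
 rewrite indicE; have [|_] := boolP (t \in (`]0, 2^-1[%classic : set R)); last by rewrite eqxx.
 rewrite inE /= in_itv/= => /andP[t0 t1] _; nra.
rewrite enorm_sqr sum3 !mxE /=.
have := H _ h1; have := H _ h2; have := H _ h3; move: (v.1.1 ^+ 2) (v.1.2 ^+ 2) (v.2 ^+ 2) => a b c; lra.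
Qed.

(** Doubling the width of the Gaussian pays for a shift by a vector of the box. *)
Lemma Wg_le_shift (z v : V) (q : R) : 0 < q -> q <= 1 -> enorm v ^+ 2 <= 3 / 4 -> Wg z <= expR 1 * Wg (2^-1 *: (z + q *: v)).
Proof.
move=> q0 q1; rewrite !WgE -expRD ler_expR !enorm_sqr !sum3 !mxE.
move: (z _ _) (z _ _) (z _ _) (v _ _) (v _ _) (v _ _) => a b c a' b' c'.
have H (p p' : R) : (2^-1 * (p + q * p')) ^+ 2 <= 2^-1 * (p ^+ 2 + p' ^+ 2).
 rewrite [leLHS](_ : _ = (p + q * p') ^+ 2 / 4); last by field.
 have qq : (q * p') ^+ 2 <= p' ^+ 2 by rewrite exprMn ler_piMl ?sqr_ge0// expr_le1// ltW.
 have := sqr_ge0 (p - q * p'); have -> : (p - q * p') ^+ 2 = 2 * p ^+ 2 + 2 * (q * p') ^+ 2 - (p + q * p') ^+ 2 by ring.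
 move: ((p + q * p') ^+ 2) ((q * p') ^+ 2) qq => x y; lra.
have := sqr_ge0 a; have := sqr_ge0 b; have := sqr_ge0 c.
have := H a a'; have := H b b'; have := H c c'.
move: ((_ * _) ^+ 2) ((_ * _) ^+ 2) ((_ * _) ^+ 2) (a ^+ 2) (b ^+ 2) (c ^+ 2) (a' ^+ 2) (b' ^+ 2) (c' ^+ 2) => *; lra.
Qed.

Definition comb3 (x : V) (a b : R) (z v : space3 R) : space3 R := affine3 (x + b *: vec3 v) a z.

Lemma vec3_comb x a b z v : vec3 (comb3 x a b z v) = x + b *: vec3 v + a *: vec3 z.
Proof. exact: vec3_affine. Qed.

Lemma mfun_comb3 x a b : measurable_fun setT (fun p : space3 R * space3 R => comb3 x a b p.1 p.2).
Proof.
have mc i (k : space3 R * space3 R -> mR R) : measurable_fun setT k ->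
  measurable_fun setT (fun p : space3 R * space3 R => (x + b *: vec3 p.2) ord0 i + a * k p : mR R).
 move=> mk; have -> : (fun p : space3 R * space3 R => (x + b *: vec3 p.2) ord0 i + a * k p) =
  (fun p => x ord0 i + b * vec3 p.2 ord0 i + a * k p) by apply/funext => p; rewrite !mxE.
 apply: measurable_funD; last exact: measurable_funM.
 apply: measurable_funD => //; apply: measurable_funM => //.
 exact: (measurableT_comp (mfun_vec3 i) measurable_snd).
apply/measurable_fun_pairP; split.
 apply/measurable_fun_pairP; split; apply: mc.
  exact: (measurableT_comp measurable_fst (measurableT_comp measurable_fst measurable_fst)).
 exact: (measurableT_comp measurable_snd (measurableT_comp measurable_fst measurable_fst)).
by apply: mc; exact: (measurableT_comp measurable_snd measurable_fst).
Qed.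

(** The cube of 4 (e cK) dominates 64 e cK: 8 e from averaging over the box of volume 1/8, and 8 cK
    for the mass of the Gaussian of double width. *)
Definition cL : R := 4 * (expR 1 * cK [::]).

Lemma cL_ge1 : 1 <= cL.
Proof.
have c1 := @cK_ge1 R [::]; have e1 : 1 <= expR 1 :> R by rewrite -[leLHS]expR0 ler_expR.
rewrite /cL; nra.
Qed.

Section LocalNorm.
Variables (rho a : R) (f : V -> R).
Hypotheses (rho0 : 0 < rho) (a0 : 0 <= a).
Hypothesis mf : (mfun3 z, f (vec3 z)).
Hypothesis fa : forall x, (\int[leb3]_(y in [set y | (enorm (vec3 y - x) < rho)%R]) (`|f (vec3 y)| ^+ 3)%:E <= (a ^+ 3)%:E)%E.

Let mf3 : (mfun3 z, `|f (vec3 z)| ^+ 3).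
Proof. by apply: measurable_funX; exact: measurableT_comp. Qed.

Lemma box_average_le (c : V) (r : R) : 0 < r -> r <= rho ->
 (\int[leb3]_v (box v * `|f (c + r *: vec3 v)| ^+ 3)%:E <= (r ^- 3 * a ^+ 3)%:E)%E.
Proof.
move=> r0 rr; set D := [set y : space3 R | enorm (vec3 y - c) < rho].
have mD : measurable D by exact: mfun_ball3.
pose g := (fun y : space3 R => (`|f (vec3 y)| ^+ 3)%:E) \_ D.
have mg : measurable_fun setT g by apply/(measurable_restrictT _ mD); apply: measurable_funTS; exact/measurable_EFinP.
have g0 z : (0 <= g z)%E by apply: erestrict_ge0 => // y _; rewrite lee_fin exprn_ge0.
have rn : r != 0 by rewrite gt_eqF.
have E := @ge0_integral_affine3 R c r g rn mg g0; rewrite gtr0_norm// in E.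
apply: (@le_trans _ _ (\int[leb3]_z g (affine3 c r z))%E); last first.
 rewrite E EFinM; apply: lee_wpmul2l; first pos.
 by rewrite /g -integral_mkcond; exact: fa.
apply: ge0_le_integral => //.
- by move=> v _; rewrite lee_fin mulr_ge0 ?box_ge0// exprn_ge0.
- apply/measurable_EFinP; apply: measurable_funM; first exact: mfun_box.
 have -> : (fun v : space3 R => `|f (c + r *: vec3 v)| ^+ 3) = (fun z => `|f (vec3 z)| ^+ 3) \o affine3 c r.
  by apply/funext => v; rewrite /= vec3_affine.
 by apply: measurableT_comp; [exact: mf3|exact: mfun_affine3].
- by apply: measurableT_comp => //; exact: mfun_affine3.
move=> v _; have p0 : 0 <= `|f (c + r *: vec3 v)| ^+ 3 by pos.
have [->|bv] := eqVneq (box v) 0; first by rewrite mul0r.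
rewrite /g patchE vec3_affine mem_set.
 rewrite lee_fin ler_piMl// /box !indicE.
 by do ![case: (_ \in _); rewrite ?mulr1 ?mulr0 ?mul0r ?ler01 ?lexx//].
rewrite /D /= vec3_affine addrAC subrr add0r enormZ gtr0_norm//.
have e1 : enorm (vec3 v) < 1.
 have := box_enorm bv; have := enorm_ge0 (vec3 v); move: (enorm _) => e e0 h; nra.
by apply: lt_le_trans rr; rewrite gtr_pMr.
Qed.

(** A covering made continuous. W(z) is averaged over shifts by q v with v in the box, and z is then
    translated by -q v. For each z there remain a wider Gaussian and an integral of |f|^3 over a
    piece of the ball of radius r = min(l, rho) about x - l z. The ratio l / r is max(1, l / rho),
    the growth that [Nb] permits for kap = 1 / rho. *)
Lemma Nb_of_local : Nb rho^-1 f (cL * a).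
Proof.
move=> x l l0; set r := Num.min l rho.
have r0 : 0 < r by rewrite lt_min l0 rho0.
have rl : r <= l by rewrite ge_min lexx.
have rr : r <= rho by rewrite ge_min lexx orbT.
set q := r / l; have q0 : 0 < q by rewrite divr_gt0.
have q1 : q <= 1 by rewrite ler_pdivrMr// mul1r.
have lq : l * q = r by rewrite /q mulrCA divff ?mulr1// gt_eqF.
have lr : l / r = Num.max 1 (rho^-1 * l).
 rewrite /r; have [h|h] := leP l rho.
  by rewrite divff ?gt_eqF//; apply/esym/max_idPl; rewrite ler_pdivrMl// mulr1.
 by rewrite mulrC; apply/esym/max_idPr; rewrite ler_pdivlMl// mulr1 ltW.
have e0 : 0 < expR 1 :> R := expR_gt0 1.
have mWs (c : V) (p p' : R) : measurable_fun setT (fun w : space3 R * space3 R => Wg (2^-1 *: (p *: vec3 w.1 + p' *: vec3 w.2)) : mR R).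
 apply: (@mfun_comp_continuous R _ _ _ (fun w : space3 R * space3 R => 2^-1 *: (p *: vec3 w.1 + p' *: vec3 w.2)) (@Wg R)) => [i|]; last exact: cont_Wg.
 have -> : (fun w : space3 R * space3 R => (2^-1 *: (p *: vec3 w.1 + p' *: vec3 w.2)) 0 i) =
  (fun w => 2^-1 * (p * vec3 w.1 0 i + p' * vec3 w.2 0 i)) by apply/funext => w; rewrite !mxE.
 apply: measurable_funM => //; apply: measurable_funD; apply: measurable_funM => //.
  exact: (measurableT_comp (mfun_vec3 i) measurable_fst).
 exact: (measurableT_comp (mfun_vec3 i) measurable_snd).
pose F (p : space3 R * space3 R) : \bar R :=
 (box p.2 * (Wg (2^-1 *: (1 *: vec3 p.1 + q *: vec3 p.2)) * `|f (x - l *: vec3 p.1)| ^+ 3))%:E.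
pose H (p : space3 R * space3 R) : \bar R :=
 (Wg (2^-1 *: (1 *: vec3 p.1 + 0 *: vec3 p.2)) * (box p.2 * `|f (x - l *: vec3 p.1 + r *: vec3 p.2)| ^+ 3))%:E.
have mbox : measurable_fun setT (fun p : space3 R * space3 R => box p.2 : mR R).
 exact: (measurableT_comp mfun_box measurable_snd).
have mfc (b : R) : measurable_fun setT (fun p : space3 R * space3 R => `|f (x - l *: vec3 p.1 + b *: vec3 p.2)| ^+ 3 : mR R).
 have -> : (fun p : space3 R * space3 R => `|f (x - l *: vec3 p.1 + b *: vec3 p.2)| ^+ 3) =
   (fun z => `|f (vec3 z)| ^+ 3) \o (fun p : space3 R * space3 R => comb3 x (- l) b p.1 p.2).
  by apply/funext => p; rewrite /= vec3_comb scaleNr addrAC.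
 by apply: measurableT_comp; [exact: mf3|exact: mfun_comb3].
have mF : measurable_fun setT F.
 apply/measurable_EFinP; apply: measurable_funM => //; apply: measurable_funM; first exact: mWs.
 have := mfc 0; congr (measurable_fun _ _); apply/funext => p; by rewrite scale0r addr0.
have mH : measurable_fun setT H.
 by apply/measurable_EFinP; apply: measurable_funM; [exact: mWs|exact: (measurable_funM mbox (mfc r))].
have F0 p : (0 <= F p)%E by rewrite lee_fin !mulr_ge0 ?box_ge0 ?Wg_ge0// exprn_ge0.
have H0 p : (0 <= H p)%E by rewrite lee_fin !mulr_ge0 ?box_ge0 ?Wg_ge0// exprn_ge0.
have mbW z : (mfun3 v, box v * Wg (2^-1 *: (1 *: vec3 z + q *: vec3 v))).
 apply: measurable_funM; first exact: mfun_box.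
 exact: (measurableT_comp (mWs 0 1 q) (measurable_pair1 z)).
have S0 z : ((Wg (vec3 z))%:E <= (8 * expR 1)%:E * \int[leb3]_v (box v * Wg (2^-1 *: (1 *: vec3 z + q *: vec3 v)))%:E)%E.
 have -> : ((Wg (vec3 z))%:E = (8 * expR 1)%:E * (((expR 1)^-1 * Wg (vec3 z))%:E * \int[leb3]_v (box v)%:E))%E.
  by rewrite integral_box -!EFinM; congr _%:E; field; rewrite gt_eqF.
 apply: lee_wpmul2l; first pos.
 have w0 : 0 <= (expR 1)^-1 * Wg (vec3 z) by pos.
 rewrite -ge0_integralZl_EFin//; last 2 first.
 - by move=> v _; rewrite lee_fin box_ge0.
 - by apply/measurable_EFinP; exact: mfun_box.
 apply: ge0_le_integral => //.
 - by move=> v _; rewrite mule_ge0 ?lee_fin ?box_ge0.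
 - by apply: measurable_funeM; apply/measurable_EFinP; exact: mfun_box.
 - by apply/measurable_EFinP; exact: mbW.
 move=> v _; rewrite -EFinM lee_fin mulrC.
 have [->|bv] := eqVneq (box v) 0; first by rewrite !mul0r.
 apply: ler_wpM2l; first exact: box_ge0.
 by rewrite ler_pdivrMl// scale1r; exact: Wg_le_shift q0 q1 (box_enorm bv).
have S1 : (\int[leb3]_z (Wg (vec3 z) * `|f (x - l *: vec3 z)| ^+ 3)%:E <= (8 * expR 1)%:E * \int[leb3]_z \int[leb3]_v F (z, v))%E.
 rewrite -ge0_integralZl_EFin//; last 2 first.
 - by move=> z _; exact: integral_ge0.
 - exact: measurable_fun_fubini_tonelli_F.
 apply: ge0_le_integral => //.
 - move=> z _; pos.
 - exact: mfun_Nb.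
 - by apply: measurable_funeM; exact: measurable_fun_fubini_tonelli_F.
 move=> z _; have p0 : 0 <= `|f (x - l *: vec3 z)| ^+ 3 by pos.
 rewrite EFinM; apply: (le_trans (lee_wpmul2r _ (S0 z))); first by rewrite lee_fin.
 rewrite -muleA; apply: lee_wpmul2l; first pos.
 rewrite muleC -ge0_integralZl_EFin//; last 2 first.
 - by move=> v _; rewrite lee_fin mulr_ge0 ?box_ge0 ?Wg_ge0.
 - by apply/measurable_EFinP; exact: mbW.
 apply: le_of_eq; apply: eq_integral => v _.
 by rewrite /F /= -EFinM; congr _%:E; rewrite mulrC mulrA.
(* The translation by -q v: since l q = r, the argument of f becomes x - l z + r v, and the Gaussian
   no longer depends on v. *)
have S2 v : (\int[leb3]_z F (z, v) = \int[leb3]_z H (z, v))%E.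
 rewrite -(@integral_translation3 R (- (q *: vec3 v)) (fun z => F (z, v))).
  apply: eq_integral => z _; rewrite /F /H /= vec3_affine !scale1r scale0r addr0 addrAC addNr add0r.
  congr _%:E; rewrite mulrCA; congr (_ * (_ * `|f _| ^+ 3)).
  by rewrite scalerDr scalerN scalerA lq opprD opprK addrCA addrC.
 exact: (measurableT_comp mF (measurable_pair2 v)).
apply: (le_trans (lee_wpmul2l _ S1)); first pos.
rewrite (@fubini_tonelli _ _ _ _ R leb3 leb3 F mF F0).
rewrite (eq_integral _ _ (fun v _ => S2 v)) -(@fubini_tonelli _ _ _ _ R leb3 leb3 H mH H0).
have mWh : (mfun3 z, Wg ((2^-1 : R) *: vec3 z)).
 apply: (@mfun3_cont R (fun y => Wg (2^-1 *: y))) => y.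
 by apply: (@continuous_comp _ _ _ (fun y : V => 2^-1 *: y) (@Wg R)); [exact: scaler_continuous|exact: cont_Wg].
have S3 : (\int[leb3]_z \int[leb3]_v H (z, v) <= (r ^- 3 * a ^+ 3)%:E * \int[leb3]_z (Wg (2^-1 *: vec3 z))%:E)%E.
 have ra : 0 <= r ^- 3 * a ^+ 3 by pos.
 rewrite -ge0_integralZl_EFin//; last 2 first.
 - move=> z _; pos.
 - exact/measurable_EFinP.
 apply: ge0_le_integral => //.
 - by move=> z _; exact: integral_ge0.
 - exact: measurable_fun_fubini_tonelli_F.
 - by apply: measurable_funeM; exact/measurable_EFinP.
 move=> z _; rewrite muleC.
 have -> : (\int[leb3]_v H (z, v) = (Wg (2^-1 *: vec3 z))%:E * \int[leb3]_v (box v * `|f (x - l *: vec3 z + r *: vec3 v)| ^+ 3)%:E)%E.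
  rewrite -ge0_integralZl_EFin.
  - by apply: eq_integral => v _; rewrite /H /= scale1r scale0r addr0 EFinM.
  - exact: measurableT.
  - by move=> v _; rewrite lee_fin mulr_ge0 ?box_ge0// exprn_ge0.
  - apply/measurable_EFinP; apply: measurable_funM; first exact: mfun_box.
   exact: (measurableT_comp (mfc r) (measurable_pair1 z)).
  - exact: Wg_ge0.
 by apply: lee_wpmul2l; [rewrite lee_fin Wg_ge0|exact: box_average_le].
have S4 : (\int[leb3]_z (Wg (2^-1 *: vec3 z))%:E <= (8 * @cK R [::])%:E)%E.
 have mW := mfun3_cont (@cont_Wg R).
 have h2 : 2^-1 != 0 :> R by rewrite invr_eq0.
 have := @ge0_integral_affine3 R 0 2^-1 (fun z => (Wg (vec3 z))%:E) h2 _ _.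
 under eq_integral do rewrite vec3_affine add0r.
 move=> -> //; last 2 first.
 - exact/measurable_EFinP.
 - move=> z; pos.
 rewrite ger0_norm ?invr_ge0//; have -> : 2^-1 ^- 3 = 8 :> R by field.
 rewrite [leRHS]EFinM; apply: lee_wpmul2l => //.
 have := @integral_Wg_le R [::] 1 ler01; rewrite mulr1.
 by under eq_integral do rewrite mul1r.
have ra : 0 <= r ^- 3 * a ^+ 3 by pos.
have {}S3 := le_trans S3 (lee_wpmul2l _ S4).
have e8 : 0 <= 8 * expR 1 :> R by pos.
apply: (le_trans (lee_wpmul2l _ (lee_wpmul2l _ (S3 _)))); rewrite ?lee_fin ?exprn_ge0 ?(ltW l0)//.
rewrite -lr.
rewrite [leLHS](_ : _ = 64 * (expR 1 * cK [::]) * (l / r * a) ^+ 3); last by field; rewrite gt_eqF.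
have ec : 1 <= expR 1 * cK [::] :> R.
 have c1 := @cK_ge1 R [::]; have e1 : 1 <= expR 1 :> R by rewrite -[leLHS]expR0 ler_expR.
 by rewrite -[leLHS]mulr1 ler_pM.
have -> : (l / r * (cL * a)) ^+ 3 = 64 * (expR 1 * cK [::]) ^+ 3 * (l / r * a) ^+ 3 by rewrite /cL; ring.
apply: ler_wpM2r; first pos.
by apply: ler_wpM2l => //; rewrite -[leLHS]expr1 ler_weXn2l.
Qed.

End LocalNorm.
End NormConversions.

(** * Test fields as smooth data *)

Section TestFields.
Context {R : realType}.
Local Notation V := 'rV[R]_3.
Implicit Types (s : seq 'I_3) (phi : V -> V).

Lemma partials_coord k s phi i : Ck k phi -> (size s <= k)%N ->
 (fun x => partials s phi x 0 i) = partials s (fun x => phi x 0 i).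
Proof.
move=> [dphi _]; elim: s => [//|j s IH] sk; have sk' : (size s <= k)%N := ltnW sk.
apply/funext => x; rewrite /= /partial derive_mx; last exact: dphi.
by rewrite mxE -(IH sk').
Qed.

Lemma partials_vanish (U : set V) (g : V -> R) s : open U -> (forall x, U x -> g x = 0) ->
 forall x, U x -> partials s g x = 0.
Proof.
move=> oU g0; elim: s => [//|j s IH] x Ux; rewrite /= /partial.
have n1 : {near x, partials s g =1 (fun=> 0 : R)}.
 have nU : nbhs x U by apply: open_nbhs_nbhs.
 by apply: filterS nU => y Uy; exact: IH.
by rewrite (near_eq_derive _ n1) derive_cst.
Qed.

Lemma Nb_compact_support (g : V -> R) (M rho : R) : continuous g -> (forall x, `|g x| <= M) ->
 (forall x, rho < `|x| -> g x = 0) -> exists2 B : R, 0 < B & Nb 0 g B.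
Proof.
move=> cg gM g0; have M0 : 0 <= M := le_trans (normr_ge0 _) (gM 0).
(* Where |x| <= rho, each coordinate is at most rho in absolute value, so W is at least e^(-3 rho^2
   / 8). *)
set Q := M ^+ 3 * expR (3 * rho ^+ 2 / 8).
have Q0 : 0 <= Q by rewrite mulr_ge0 ?expR_ge0// exprn_ge0.
have mg := mfun3_cont cg; have mW := mfun3_cont (@cont_Wg R).
have gW x : `|g x| ^+ 3 <= Q * Wg x.
 have [h|h] := ltP rho `|x|.
  by rewrite (g0 x h) normr0 expr0n mulr_ge0// Wg_ge0.
 rewrite /Q -mulrA WgE -expRD; apply: (@le_trans _ _ (M ^+ 3)); first by rewrite lerXn2r// nnegrE.
 rewrite ler_peMr ?exprn_ge0// -[leLHS]expR0 ler_expR sum3.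
 have H i : x 0 i ^+ 2 <= rho ^+ 2.
  by rewrite -(real_normK (num_real (x 0 i))) lerXn2r ?nnegrE// ?(le_trans (norm_coord x i))// (le_trans (normr_ge0 x)).
 have := H ord0; have := H o1; have := H o2.
 move: (x 0 _ ^+ 2) (x 0 _ ^+ 2) (x 0 _ ^+ 2) (rho ^+ 2) => a b c d; lra.
set B := 1 + cK [::] * Q.
have B1 : 1 <= B by rewrite lerDl mulr_ge0// ltW// cK_gt0.
exists B; first exact: lt_le_trans B1.
apply: Nb_of_integral => //; first exact: le_trans B1.
apply: (@le_trans _ _ (\int[leb3]_z (Q * Wg (vec3 z))%:E)%E).
 apply: ge0_le_integral => //.
 - by apply/measurable_EFinP; apply: measurable_funX; exact: measurableT_comp.
 - by apply/measurable_EFinP; exact: measurable_funM.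
 - by move=> z _; rewrite lee_fin.
apply: (le_trans (integral_Wg_le [::] Q0)); rewrite lee_fin.
apply: (@le_trans _ _ B); first by rewrite lerDr.
by rewrite -[leLHS]expr1 ler_weXn2l.
Qed.

(** Compact support enters twice: for the boundedness of the derivatives, and for the integrability
    of their cubes. *)
Lemma test_field_coord phi i : test_field phi ->
 (forall k, CB k (fun x => phi x 0 i)) /\
 forall s, exists2 B : R, 0 < B & Nb 0 (partials s (fun x => phi x 0 i)) B.
Proof.
move=> [phik phic _]; set S := closure _ in phic.
have oS : open (~` S) by apply: closed_openC; exact: closed_closure.
have v0 s x : (~` S) x -> partials s (fun x => phi x 0 i) x = 0.
 apply: partials_vanish => // y /= nS; have [->|h] := eqVneq (phi y) 0; first by rewrite mxE.
 by exfalso; apply: nS; apply: subset_closure.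
have cs s : continuous (partials s (fun x => phi x 0 i)).
 rewrite -(partials_coord i (phik (size s)) (leqnn _)) => x.
 have c1 : {for x, continuous (partials s phi)} by apply: (phik (size s)).2.
 exact: (continuous_comp c1 (@cont_coord R i _)).
have bs s : exists M : R, forall x, `|partials s (fun x => phi x 0 i) x| <= M.
 have cS : compact (partials s (fun x => phi x 0 i) @` S).
  by apply: continuous_compact phic; apply: continuous_subspaceT; exact: cs.
 have [M0 [Mr HM]] := compact_bounded cS; set M := Num.max 0 M0 + 1.
 have MM : M0 < M by rewrite /M ltr_pwDr// le_max lexx orbT.
 exists M => x; have [Sx|nS] := pselect (S x); last by rewrite v0// normr0 /M addr_ge0// le_max lexx.
 by apply: (HM M MM); exists x.
have [r0 [_ Hr]] := compact_bounded phic.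
have Hr1 : forall x, S x -> `|x| <= r0 + 1 by apply: Hr; rewrite ltrDl.
split=> [k|s]; last first.
 have [M hM] := bs s; apply: (@Nb_compact_support _ M (r0 + 1)) => // x xr.
 by apply: v0 => /Hr1; rewrite leNgt xr.
move=> s sk; split=> // sk' j x.
rewrite -(partials_coord i (phik k) sk).
have := (derivable_mxP (partials s phi) x (e_ j)).1 ((phik k).1 s sk' j x) 0 i.
exact.
Qed.

End TestFields.

(** * The heat flow of smooth data *)

Section HeatFlow.
Context {R : realType}.
Local Notation V := 'rV[R]_3.
Implicit Types (s : seq 'I_3) (g : V -> R) (kap A t : R).

Definition heat g t (x : V) : R := hk [::] (sqrt t) g x.

Definition cX K : R := cKs K [::] ^+ 2.

Lemma cX_ge K s : (size s <= K)%N -> cK s ^+ 2 <= cX K.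
Proof.
move=> sK; have := @cK_le_cKs R K [::] s sK; rewrite cats0 => h.
by rewrite lerXn2r// ?nnegrE ?(ltW (cK_gt0 _))// ltW// cKs_gt0.
Qed.

Lemma cX_ge1 K : 1 <= cX K.
Proof.
by apply: le_trans (@cX_ge K [::] isT); rewrite -[leLHS](expr1n _ 2) lerXn2r ?nnegrE ?(ltW (cK_gt0 _))// cK_ge1.
Qed.

Lemma heat_DB K g t kap A : 0 < t -> 0 <= A -> kap * sqrt t <= 1 -> CB K g -> Nb kap g A ->
 DB K (cX K * A * rs t) (rs t) (heat g t).
Proof.
move=> t0 A0 kt gK Ng; have l0 : 0 < sqrt t by pos.
split; first exact: CB_hk.
move=> s sK x; rewrite (hk_partials _ _ gK sK).
have := @hk_ibps R K s [::] (sqrt t) g x gK sK; rewrite cats0 => E.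
have b := hk_Nb_bound s x l0 A0 (CB_cont gK) (CB_bnd gK) Ng.
rewrite (max_idPl kt) mul1r -E normrM normrX gtr0_norm// in b.
rewrite -(ler_pM2l l0) -(@ler_pM2l _ (sqrt t ^+ size s)) ?exprn_gt0//.
rewrite mulrCA; apply: (le_trans b).
have -> : sqrt t ^+ size s * (sqrt t * (cX K * A * rs t * rs t ^+ size s)) =
  (sqrt t * rs t) ^+ size s * (sqrt t * rs t) * (cX K * A) by rewrite exprMn; ring.
rewrite /rs divff ?gt_eqF// expr1n !mul1r; apply: ler_wpM2r => //; exact: cX_ge.
Qed.

Lemma heat_cont k g s t x : CB k g -> (size s <= k)%N ->
 {for ((t, x) : R * V), continuous (fun q : R * V => partials s (heat g q.1) q.2)}.
Proof.
move=> gk sk.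
have E : (fun q : R * V => partials s (heat g q.1) q.2) = (fun q => hk [::] (sqrt q.1) (partials s g) q.2).
 by apply/funext => q; rewrite /heat (hk_partials _ _ gk sk).
rewrite E; have c := @hk_cont R setT (fun _ : R => partials s g) [::] (sqrt t) 0 x openT (CB_stc (CB_partials gk sk)) I.
have ci : (fun q : R * V => (sqrt q.1, (0 : R, q.2))) @ ((t, x) : R * V) --> ((sqrt t, (0, x)) : R * (R * V)).
 apply: cvg_pairN; last cts.
 have c1 : (@fst R V) @ ((t, x) : R * V) --> t by exact: cvg_fst.
 exact: (cvg_comp _ _ c1 (@sqrt_continuous R t)).
exact: (cvg_comp _ _ ci c).
Qed.

Lemma heat_sub g h t x : CB 0 g -> CB 0 h -> heat (fun y => g y - h y) t x = heat g t x - heat h t x.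
Proof. exact: hkB. Qed.

Lemma is_derive_heat g t x : 0 < t -> CB 2 g ->
 is_derive t 1 (fun t => heat g t x) (\sum_(l < 3) partials [:: l; l] (heat g t) x).
Proof.
move=> t0 g2; have d1 := @is_derive1_sqrt R t t0.
have d2 := is_derive_hk_length x (sqrt t) g2.
have d3 := is_derive1_comp (f := fun l => hk [::] l g x) (g := @sqrt R) d2 d1.
apply: (is_derive_eq d3).
have E l : partials [:: l; l] (heat g t) x = hk [::] (sqrt t) (partial l (partial l g)) x.
 exact: (congr1 (fun h => h x) (hk_partials [::] (sqrt t) g2 (isT : (size [:: l; l] <= 2)%N))).
rewrite (eq_bigr _ (fun l _ => E l)); set S := \sum_(i < 3) _.
by field; rewrite gt_eqF// sqrtr_gt0.
Qed.

Lemma Nb_sum3 kap (F : 'I_3 -> V -> R) B : 0 < B -> (forall i, continuous (F i)) -> (forall i, Nb kap (F i) B) ->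
 Nb kap (fun x => \sum_(i < 3) F i x) (3 * B).
Proof.
move=> B0 cF NF; have -> : (fun x => \sum_(i < 3) F i x) = (fun x => F ord0 x + (F o1 x + F o2 x)).
 by apply/funext => x; rewrite sum3.
have -> : 3 * B = B + (B + B) by ring.
have mF i := mfun3_cont (cF i).
by apply: NbD => //; [pos|exact: (measurable_funD (mF _) (mF _))|exact: NbD].
Qed.

(** The flow is followed along the lengths l r with 0 <= r <= 1 instead of along times; its
    derivative in r is 2 l^2 r times the flow of the Laplacian of g, a sum of three terms. Hence 6 =
    2 x 3, and one factor l^2 = t. *)
Lemma heat_initial g B t : 0 < t -> CB 2 g -> 0 < B -> (forall i, Nb 0 (partials [:: i; i] g) B) ->
 Nb 0 (fun x => heat g t x - g x) (6 * cK [::] ^+ 2 * B * t).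
Proof.
move=> t0 g2 B0 NB; set l := sqrt t; have l0 : 0 < l by pos.
have l2 : l ^+ 2 = t by rewrite sqr_sqrtr// ltW.
have c0 := @cK_gt0 R [::]; set C := 6 * cK [::] ^+ 2 * B * t.
have C0 : 0 < C by rewrite mulr_gt0// mulr_gt0// mulr_gt0// exprn_gt0.
have p0 i : CB 0 (partials [:: i; i] g) by have := CB_partials g2 (isT : (size [:: i; i] <= 2)%N).
have ch r i : continuous (hk [::] (l * r) (partials [:: i; i] g)).
 exact: cont_hk (CB_cont (p0 i)) (CB_bnd (p0 i)).
pose G (r : R) (y : V) := l * (2 * (l * r)) * \sum_(i < 3) hk [::] (l * r) (partials [:: i; i] g) y.
have cG (q : R * V) : {for q, continuous (fun q : R * V => G q.1 q.2)}.
 case: q => r y; apply: continuousM.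
  apply: continuousM; first exact: cvg_cst.
  apply: continuousM; first exact: cvg_cst.
  by apply: continuousM; [exact: cvg_cst|exact: cvg_fst].
 apply: (@cont_sum3 _ _ (fun i (q : R * V) => hk [::] (l * q.1) (partials [:: i; i] g) q.2)) => i.
 exact: (@cont_hk_scaled R 0 [::] l (partials [:: i; i] g) (r, y) (p0 i)).
have cGr (y : V) (r : R) : {for r, continuous (fun r => G r y)}.
 have ci : (fun r : R => (r, y)) @ r --> ((r, y) : R * V) by cts.
 exact: (cvg_comp _ _ ci (cG (r, y))).
have E y : heat g t y - g y = \int[leb]_(r in D01) G r y.
 have D (r : R) : 0 <= r <= 1 -> is_derive r 1 (fun r => hk [::] (l * r) g y) (G r y).
  move=> _; have d1 : is_derive r 1 (fun r : R => l * r) l.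
   by have := is_deriveZ l (is_derive_id r (1 : R)); rewrite /GRing.scale/= mulr1.
  have d2 := is_derive_hk_length y (l * r) g2.
  have d3 := is_derive1_comp (f := fun l => hk [::] l g y) (g := fun r : R => l * r) d2 d1.
  apply: (is_derive_eq d3); rewrite /G; set S := \sum_(i < 3) _.
  by ring.
 by have := FTC01 D (fun r _ => cGr y r); rewrite mulr1 mulr0 hk0.
have iG y : leb.-integrable D01 (EFin \o (fun r : mR R => G r y)).
 apply: (@integrableS _ _ _ leb `[0, 1]%classic); [exact: measurable_itv|exact: measurable_itv| |].
  by move=> r /=; rewrite !in_itv/= => /andP[/ltW-> /ltW->].
 by apply: intg_segment => r _; exact: cGr.
have cE : continuous (fun y => heat g t y - g y).
 have hc : continuous (heat g t) := @cont_hk R [::] (sqrt t) g (CB_cont g2) (CB_bnd g2).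
 by move=> y; apply: continuousB; [exact: hc|exact: (CB_cont g2)].
have Ef : (fun y => heat g t y - g y) = (fun y => \int[leb]_(r in D01) G r y) by apply/funext.
rewrite Ef in cE *; apply: (@Nb_Rintegral R D01 (fun=> C) G _ _ _ _ _ _ C0 _ _ iG cE).
- exact: interval_open.
- exact: mD01.
- exact: measurable_cst.
- by [].
- have := @integral_wt R 0 (lexx _).
 rewrite integral_cst/=; last exact: mD01.
 by rewrite lebesgue_measure_itv/= lte_fin ltr01 oppr0 adde0 mule1.
- by move=> r y _; exact: cG.
move=> r /D01P[r0 r1].
have q0 : 0 <= l * (2 * (l * r)) by pos.
have cB0 : 0 < cK [::] ^+ 2 * B by pos.
have cS : continuous (fun y => \sum_(i < 3) hk [::] (l * r) (partials [:: i; i] g) y).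
 by move=> y; apply: (@cont_sum3 _ _ (fun i y => hk [::] (l * r) (partials [:: i; i] g) y)) => i; exact: ch.
apply: (@Nb_weaken _ _ _ (l * (2 * (l * r)) * (3 * (cK [::] ^+ 2 * B)))).
- pos.
- rewrite [leLHS](_ : _ = (6 * cK [::] ^+ 2 * B * l ^+ 2) * r); last by ring.
 by rewrite l2 -/C ler_piMr ?(ltW C0)// ltW.
apply: Nb_scale q0 cS _.
apply: Nb_sum3; [exact: cB0|by move=> i; exact: ch|move=> i].
exact: (Nb_hk [::] (l * r) (ltW B0) (CB_cont (p0 i)) (CB_bnd (p0 i)) (NB i)).
Qed.

End HeatFlow.

(** * The linear flow of a datum in J^3 *)

Section LinearPart.
Context {R : realType}.
Local Notation V := 'rV[R]_3.
Variables (K : nat) (v0 : 'I_3 -> V -> R) (f : nat -> 'I_3 -> V -> R) (e : nat -> R).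
Hypothesis K3 : (3 <= K)%N.
Hypothesis mv0 : forall i, (mfun3 z, v0 i (vec3 z)).
Hypothesis fk : forall n k i, CB k (f n i).
Hypothesis fB : forall n i s, exists2 B : R, 0 < B & Nb 0 (partials s (f n i)) B.
Hypothesis f_div : forall n x, \sum_(i < 3) partial i (f n i) x = 0.
Hypothesis e_gt0 : forall n, 0 < e n.
Hypothesis e_ni : forall n k, (n <= k)%N -> e k <= e n.
Hypothesis e_cvg : e n @[n --> \oo] --> 0.
Hypothesis fv0 : forall n i, Nb 0 (fun x => v0 i x - f n i x) (e n).

(** The heat flow of the datum as a limit of the flows of test fields: the kernel operators have
    been studied on bounded continuous functions, and the datum is only in L^3. *)
Definition linear_flow i t (x : V) : R := lim (heat (f n i) t x @[n --> \oo]).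

Let mf n i := mfun3_cont (CB_cont (@fk n 0 i)).

(** The error is small in L^3, hence in the window norm for every kap. *)
Lemma Nb_approx kap n i A : 0 < A -> Nb kap (v0 i) A -> Nb kap (f n i) (A + e n).
Proof.
move=> A0 Nv; have := NbB A0 (e_gt0 n) (mv0 i) (measurable_funB (mv0 i) (mf n i)) Nv (Nb_raise kap (fv0 n i) (ltW (e_gt0 n))).
by congr (Nb _ _ _); apply/funext => x; rewrite subKr.
Qed.

Lemma Nb_approx_sub n k i : (n <= k)%N -> Nb 0 (fun x => f k i x - f n i x) (2 * e n).
Proof.
move=> nk; have := NbB (e_gt0 n) (e_gt0 k) (measurable_funB (mv0 i) (mf n i)) (measurable_funB (mv0 i) (mf k i)) (fv0 n i) (fv0 k i).
have -> : (fun x => v0 i x - f n i x - (v0 i x - f k i x)) = (fun x => f k i x - f n i x).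
 by apply/funext => x; ring.
apply: Nb_weaken; first pos.
by have := e_ni nk; lra.
Qed.

Let e_small (c : R) : 0 < c -> exists n, e n <= c.
Proof.
move=> c0; have /cvgrPdist_lt/(_ c c0)[n _ hn] := e_cvg.
by exists n; have := hn n (leqnn n); rewrite sub0r normrN gtr0_norm// => /ltW.
Qed.

Section Interval.
Variable T : \bar R.
Local Notation I := (time_interval T).

Let rs0 t : I t -> 0 <= rs t. Proof. by move=> /I_gt0/rs_gt0/ltW. Qed.

Let rs_cont t : I t -> {for t, continuous (@rs R)}. Proof. by move=> /I_gt0; exact: cont_rs. Qed.

Let k0l t : 0 * sqrt t <= (1 : R). Proof. by rewrite mul0r ler01. Qed.

Lemma heat_approx_XX n i : exists B : R, XX I K (fun t => B * rs t) rs (fun t => heat (f n i) t).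
Proof.
have [B B0 HB] := fB n i [::]; exists (cX K * B); split.
 by move=> t It; apply: (heat_DB (I_gt0 It) (ltW B0) (k0l t)).
by move=> s sK t x It; exact: (@heat_cont R K (f n i) s t x (@fk n K i) sK).
Qed.

(** Smoothing, used with kap = 0, turns the Cauchy bound 2 e n in L^3 into a Cauchy bound in the
    space-time class. *)
Lemma linear_flow_lim i : (forall t x, I t -> heat (f n i) t x @[n --> \oo] --> linear_flow i t x) /\
 forall n, XX I K (fun t => 2 * e n * (cX K * rs t)) rs (fun t x => heat (f n i) t x - linear_flow i t x).
Proof.
have c0 : 0 <= cX K :> R := le_trans ler01 (@cX_ge1 R K).
have e2 : 2 * e n @[n --> \oo] --> (0 : R).
 by rewrite -[X in _ --> X](mulr0 (2 : R)); apply: cvgM; [exact: cvg_cst|exact: e_cvg].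
have /choice[B HB] n := heat_approx_XX n i.
apply: (@XX_lim R I rs (@open_I R T) K (fun t => cX K * rs t) (fun n => 2 * e n) (fun n t => B n * rs t)
 (fun n t => heat (f n i) t)) => //.
- by move=> t It; apply: cont_mulR; [exact: cst_continuous|exact: rs_cont].
- move=> n; pos.
- by move=> t It; rewrite mulr_ge0// rs0.
move=> n k nk; split; last by have := (XX_sub rs0 (@open_I R T) (HB k) (HB n)).2.
move=> t It; have ek : 0 <= 2 * e n by pos.
have := heat_DB (I_gt0 It) ek (k0l t) (CB_sub (@fk k K i) (@fk n K i)) (Nb_approx_sub i nk).
have -> : cX K * (2 * e n) * rs t = 2 * e n * (cX K * rs t) by ring.
congr (DB _ _ _ _); apply/funext => x.
exact: heat_sub (@fk k 0 i) (@fk n 0 i).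
Qed.

Lemma linear_flow_XX i : exists B : R, XX I K (fun t => B * rs t) rs (linear_flow i).
Proof.
have [B HB] := heat_approx_XX 0 i; exists (B + 2 * e 0 * cX K).
have := XX_sub rs0 (@open_I R T) HB ((linear_flow_lim i).2 0%N).
have -> : (fun t x => heat (f 0 i) t x - (heat (f 0 i) t x - linear_flow i t x)) = linear_flow i.
 by apply/funext => t; apply/funext => x; rewrite subKr.
apply: XX_weaken; first exact: rs0.
by move=> t It; apply: le_of_eq; ring.
Qed.

Let CB_linear i t : I t -> CB K (linear_flow i t).
Proof. by move=> It; have [B HB] := linear_flow_XX i; exact: DB_CB (HB.1 t It). Qed.

Lemma partials_linear_flow i t s x : I t -> (size s <= K)%N -> forall n,
 `|partials s (heat (f n i) t) x - partials s (linear_flow i t) x| <= 2 * e n * (cX K * rs t) * rs t ^+ size s.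
Proof.
move=> It sK n; have H := ((linear_flow_lim i).2 n).1 t It.
have <- : partials s (fun x => heat (f n i) t x - linear_flow i t x) x =
  partials s (heat (f n i) t) x - partials s (linear_flow i t) x.
 exact: (congr1 (fun g => g x) (partials_sub (CB_hk _ _ (@fk n K i)) (CB_linear i It) sK)).
exact: H.2.
Qed.

Lemma linear_flow_div t x : I t -> \sum_(i < 3) partial i (linear_flow i t) x = 0.
Proof.
move=> It; have K1 : (1 <= K)%N := leq_trans (isT : (1 <= 3)%N) K3.
have H0 n : \sum_(i < 3) partial i (heat (f n i) t) x = 0.
 have f1 i := @fk n 1 i.
 have Ei i : partial i (heat (f n i) t) x = hk [::] (sqrt t) (partial i (f n i)) x.
  exact: (congr1 (fun h => h x) (hk_partials [::] (sqrt t) (f1 i) (isT : (size [:: i] <= 1)%N))).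
 rewrite (eq_bigr _ (fun i _ => Ei i)) sum3.
 have c0 i : CB 0 (partial i (f n i)) := CB_partial i (f1 i).
 have E : partial ord0 (f n ord0) = (fun x => (fun x => - 1 * partial o1 (f n o1) x) x -
   partial o2 (f n o2) x).
  by apply/funext => y; have := f_div n y; rewrite sum3 => h; lra.
 have E2 : hk [::] (sqrt t) (fun x => - 1 * partial o1 (f n o1) x) x =
   - hk [::] (sqrt t) (partial o1 (f n o1)) x.
  rewrite /hk -[RHS]mulN1r -[RHS]RintegralZl; [|exact: measurableT|exact: intg_hkCB (c0 _)].
  by apply: eq_Rintegral => z _; ring.
 have E3 := congr1 (fun h => hk [::] (sqrt t) h x) E.
 have E4 := hkB [::] (sqrt t) x (CB_scale (-1) (c0 o1)) (c0 o2).
 have key (a b c d : R) : a = d - c -> d = - b -> a + (b + c) = 0 by move=> -> ->; ring.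
 exact: key (etrans E3 E4) E2.
have C0 : 0 <= cX K * rs t * rs t :> R.
 exact: mulr_ge0 (mulr_ge0 (le_trans ler01 (@cX_ge1 R K)) (rs0 It)) (rs0 It).
apply/eqP; rewrite -normr_le0; apply/ler_addgt0Pr => c c0; rewrite add0r.
have d0 : 0 < 6 * (cX K * rs t * rs t + 1) :> R by pos.
have [n en] := e_small (divr_gt0 c0 d0).
have -> : \sum_(i < 3) partial i (linear_flow i t) x =
  - \sum_(i < 3) (partial i (heat (f n i) t) x - partial i (linear_flow i t) x).
 have key (a b : 'I_3 -> R) : \sum_(i < 3) a i = 0 -> \sum_(i < 3) b i = - \sum_(i < 3) (a i - b i).
  by move=> ha; rewrite sumrB ha sub0r opprK.
 exact: key (H0 n).
rewrite normrN.
apply: (le_trans (ler_norm_sum _ _ _)).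
apply: (@le_trans _ _ (\sum_(i < 3) (2 * e n * (cX K * rs t * rs t)))).
 apply: ler_sum => i _; apply: (le_trans (@partials_linear_flow i t [:: i] x It K1 n)).
 by rewrite expr1 !mulrA.
rewrite sumr_const card_ord; move: d0 en C0 (e_gt0 n).
move: (cX K * rs t * rs t) (e n) => q w d0; rewrite ler_pdivlMr// => h q0 w0.
rewrite mulrS mulr2n; nra.
Qed.

Lemma linear_flow_heat i (t : R) x : I t ->
 is_derive t 1 (fun t => linear_flow i t x) (\sum_(l < 3) partials [:: l; l] (linear_flow i t) x).
Proof.
move=> It; have t0 := I_gt0 It; have K2 : (2 <= K)%N := leq_trans (isT : (2 <= 3)%N) K3.
have nI : nbhs t I by apply: open_nbhs_nbhs; split => //; exact: open_I.
have n2 : \forall s \near t, t / 2 < s by apply: lt_nbhsr; rewrite ltr_pdivrMr// ltr_pMr// ltr1n.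
have [d /= d0 hd] := filterI nI n2.
have hs (h : R) : `|h| < d -> I (h *: (1 : R) + t) /\ t / 2 < h *: (1 : R) + t.
 move=> hh; have [] := hd (h *: (1 : R) + t); last by [].
 by rewrite /ball_ /= opprD addrCA subrr addr0 normrN /GRing.scale/= mulr1.
set b := rs (t / 2); have b0 : 0 < b by apply: rs_gt0; rewrite divr_gt0.
have rb s : t / 2 < s -> rs s <= b.
 move=> ts; have t2 : 0 < t / 2 by pos.
 have s0 := lt_trans t2 ts.
 by rewrite /b /rs lef_pV2 ?posrE ?sqrtr_gt0//; exact: ler_wsqrtr (ltW ts).
apply: (@is_derive_ulim R R (fun n t => heat (f n i) t x) (fun n t => \sum_(l < 3) partials [:: l; l] (heat (f n i) t) x)
 (fun t => linear_flow i t x) (fun t => \sum_(l < 3) partials [:: l; l] (linear_flow i t) x) t 1 d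
 (fun n => e n * (6 * (cX K * b * b ^+ 2)))) => //.
- by move=> n h /hs[Ih _]; apply: is_derive_heat (I_gt0 Ih) (@fk n 2 i).
- by move=> h /hs[Ih _]; exact: (linear_flow_lim i).1.
- move=> n h /hs[Ih th]; rewrite -sumrB; apply: (le_trans (ler_norm_sum _ _ _)).
 apply: (@le_trans _ _ (\sum_(l < 3) (e n * (2 * (cX K * b * b ^+ 2))))).
  apply: ler_sum => l _; apply: (le_trans (@partials_linear_flow i _ [:: l; l] x Ih K2 n)).
  have r0 := rs0 Ih; have := rb _ th; set w := rs _ => wb.
  rewrite [leLHS](_ : _ = e n * (2 * (cX K * w * w ^+ 2))); last by ring.
  have x0 : 0 <= cX K :> R := le_trans ler01 (@cX_ge1 R K).
  apply: ler_wpM2l; first exact: ltW.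
  apply: ler_wpM2l => //; apply: ler_pM.
  + pos.
  + pos.
  + exact: ler_wpM2l x0 _ _ wb.
  + by rewrite lerXn2r// nnegrE// ltW.
 by rewrite sumr_const card_ord mulrS mulr2n; apply: le_of_eq; ring.
- rewrite -[X in _ --> X](mul0r (6 * (cX K * b * b ^+ 2))).
 by apply: cvgM; [exact: e_cvg|exact: cvg_cst].
have [B [_ HB]] := linear_flow_XX i.
have p : (fun h : R => (h *: (1 : R) + t, x)) @ (0 : R) --> ((0 *: (1 : R) + t, x) : R * V).
 apply: cvg_pairN; last exact: cvg_cst.
 by apply: cvgD; [apply: cvgZr_tmp; exact: cvg_id|exact: cvg_cst].
apply: (@cont_sum3 _ _ (fun l (h : R) => partials [:: l; l] (linear_flow i (h *: (1 : R) + t)) x)) => l.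
have c := HB [:: l; l] K2 (0 *: (1 : R) + t) x (hs 0 (etrans (congr1 (fun z => z < d) (normr0 _)) d0)).1.
exact: (cvg_comp _ _ p c).
Qed.

(** From some index on the errors are at most A, hence the factor 2. *)
Lemma linear_flow_Nb kap i t A : I t -> 0 < A -> Nb kap (v0 i) A -> Nb kap (linear_flow i t) (2 * cX K * A).
Proof.
move=> It A0 Nv; have [N eN] := e_small A0.
have c1 := @cX_ge R K [::] isT.
apply: (@Nb_lim R kap (fun n => heat (f (n + N)%N i) t)).
- by move=> n; apply: mfun3_cont; exact: CB_cont (CB_hk [::] _ (@fk (n + N) 0 i)).
- by move=> x; have := (linear_flow_lim i).1 t x It; rewrite -(cvg_shiftn N).
move=> n; have fi := @fk (n + N)%N 0 i.
have An : 0 <= A + e (n + N) by pos.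
apply: Nb_weaken (Nb_hk [::] (sqrt t) An (CB_cont fi) (CB_bnd fi) (Nb_approx (n + N)%N A0 Nv)).
 pos.
have -> : 2 * cX K * A = cX K * (2 * A) by ring.
apply: ler_pM => //; first exact: sqr_ge0.
by have := e_ni (leq_addl n N); lra.
Qed.

(** An approximation with error at most A / 3 has window bound A + e n, and its flow differs from
    the limit by 2 e n; the sum stays below 4 A. *)
Lemma linear_flow_DB kap i t A : I t -> 0 < A -> kap * sqrt t <= 1 -> Nb kap (v0 i) A ->
 DB K (4 * cX K * A * rs t) (rs t) (linear_flow i t).
Proof.
move=> It A0 kt Nv; have A4 : 0 < A / 3 by pos.
have [n en] := e_small A4; have r0 := rs0 It; have c1 := @cX_ge1 R K.
have An : 0 <= A + e n by pos.
have H1 := heat_DB (I_gt0 It) An kt (@fk n K i) (Nb_approx n A0 Nv).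
have H2 := ((linear_flow_lim i).2 n).1 t It.
have := DB_sub r0 H1 H2.
have -> : (fun x => heat (f n i) t x - (heat (f n i) t x - linear_flow i t x)) = linear_flow i t.
 by apply/funext => x; rewrite subKr.
apply: DB_weaken => //.
rewrite [leLHS](_ : _ = (A + e n + 2 * e n) * (cX K * rs t)); last by ring.
rewrite [leRHS](_ : _ = (4 * A) * (cX K * rs t)); last by ring.
apply: ler_wpM2r; first by rewrite mulr_ge0// (le_trans ler01 c1).
by lra.
Qed.

(** Three terms: the flow against the flow of f n, that flow against f n, and f n against the datum.
    The index n is fixed first, and only the middle term restricts t. *)
Lemma linear_flow_initial (c : R) : 0 < c -> exists2 tau : R, 0 < tau & forall t i, I t -> t < tau ->
 Nb 0 (fun x => linear_flow i t x - v0 i x) c.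
Proof.
move=> c0; have x1 := @cX_ge1 R K; have xK := @cX_ge R K [::] isT.
have x0 : 0 < cX K :> R := lt_le_trans ltr01 x1.
(* An error of at most c / (6 cX) keeps the first and the third term below c / 3. *)
have [n en] := e_small (divr_gt0 c0 (mulr_gt0 (ltr0Sn R 5) x0)).
have /choice[B HB] : forall i : 'I_3, exists B : R, 0 < B /\ forall j, Nb 0 (partials [:: j; j] (f n i)) B.
 move=> i; have /choice[B HB] : forall j : 'I_3, exists B : R, 0 < B /\ Nb 0 (partials [:: j; j] (f n i)) B.
  by move=> j; have [B] := fB n i [:: j; j]; exists B.
 have S j : B j <= \sum_(j < 3) B j by rewrite (bigD1 j)//= lerDl sumr_ge0// => k _; exact: ltW (HB k).1.
 exists (\sum_(j < 3) B j); split; first by apply: lt_le_trans (S ord0); exact: (HB ord0).1.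
 by move=> j; apply: Nb_weaken (HB j).2; [exact: ltW (HB j).1|exact: S].
set D := 6 * cK [::] ^+ 2 * \sum_(i < 3) B i.
have SB i : B i <= \sum_(j < 3) B j by rewrite (bigD1 i)//= lerDl sumr_ge0// => k _; exact: ltW (HB k).1.
have B0 : 0 < \sum_(j < 3) B j := lt_le_trans (HB ord0).1 (SB ord0).
have k2 : 0 < @cK R [::] ^+ 2 := exprn_gt0 2 (cK_gt0 _).
have D0 : 0 < D by rewrite mulr_gt0// mulr_gt0.
exists (c / (3 * D)); first pos.
move=> t i It tt; have t0 := I_gt0 It.
have fi := @fk n K i; have f0 := @fk n 0 i.
have N1 : Nb 0 (fun x => linear_flow i t x - heat (f n i) t x) (c / 3).
 apply: (@Nb_lim R 0 (fun k x => heat (f (k + n)%N i) t x - heat (f n i) t x)).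
 - move=> k; have h0 := CB_sub (CB_hk [::] (sqrt t) (@fk (k + n)%N 0 i)) (CB_hk [::] (sqrt t) f0).
  exact: (mfun3_cont (CB_cont h0)).
 - move=> x; apply: cvgB; last exact: cvg_cst.
  by have := (linear_flow_lim i).1 t x It; rewrite -(cvg_shiftn n).
 move=> k; have E : (fun x => heat (f (k + n)%N i) t x - heat (f n i) t x) = heat (fun y => f (k + n)%N i y - f n i y) t.
  by apply/funext => x; rewrite (heat_sub t x (@fk (k + n)%N 0 i) f0).
 have ff := CB_sub (@fk (k + n) 0 i) f0.
 have en0 : 0 <= 2 * e n by pos.
 rewrite E; apply: Nb_weaken (Nb_hk [::] (sqrt t) en0 (CB_cont ff) (CB_bnd ff) (Nb_approx_sub i (leq_addl k n))).
  pos.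
 apply: (@le_trans _ _ (cX K * (2 * e n))); first by apply: ler_wpM2r.
 by move: (en); rewrite (ler_pdivlMr _ _ (mulr_gt0 (ltr0Sn R 5) x0)); move: (e n) (@cX R K) => p q h; nra.
have N2 : Nb 0 (fun x => heat (f n i) t x - f n i x) (c / 3).
 apply: Nb_weaken (heat_initial t0 (@fk n 2 i) (HB i).1 (HB i).2).
  exact: mulr_ge0 (mulr_ge0 (mulr_ge0 _ (ltW k2)) (ltW (HB i).1)) (ltW t0).
 apply: (@le_trans _ _ (D * t)); last first.
  by move: tt; rewrite (ltr_pdivlMr _ _ (mulr_gt0 (ltr0Sn R 2) D0)); move: (D) => q h; nra.
 apply: ler_wpM2r; first exact: ltW.
 exact: ler_wpM2l (mulr_ge0 (ler0n _ 6) (ltW k2)) _ _ (SB i).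
have N3 : Nb 0 (fun x => f n i x - v0 i x) (c / 3).
 have := NbN (fv0 n i); have -> : (fun x => - (v0 i x - f n i x)) = (fun x => f n i x - v0 i x).
  by apply/funext => x; rewrite opprB.
 apply: Nb_weaken; first exact: ltW.
 by apply: (le_trans en); apply: ler_wpM2l (ltW c0) _ _ _; rewrite lef_pV2 ?posrE ?ltr0n//; [move: x1; move: (@cX R K) => q; lra|pos].
have c3 : 0 < c / 3 by pos.
have mL : (mfun3 z, linear_flow i t (vec3 z)).
 exact: mfun3_cont (CB_cont (CB_linear i It)).
have mh : (mfun3 z, heat (f n i) t (vec3 z)).
 exact: mfun3_cont (CB_cont (CB_hk [::] (sqrt t) f0)).
have mfn := mf n i.
have := NbD c3 (addr_gt0 c3 c3) (measurable_funB mL mh) (measurable_funD (measurable_funB mh mfn) (measurable_funB mfn (mv0 i))) N1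
 (NbD c3 c3 (measurable_funB mh mfn) (measurable_funB mfn (mv0 i)) N2 N3).
have -> : c / 3 + (c / 3 + c / 3) = c by field.
by congr (Nb _ _ _); apply/funext => x; ring.
Qed.

End Interval.
End LinearPart.

(** * Vector fields from their components *)

Section VectorFields.
Context {R : realType}.
Local Notation V := 'rV[R]_3.
Implicit Types (s : seq 'I_3) (g : 'I_3 -> V -> R) (u : V -> V) (A kap M : R).

Definition vrow g (x : V) : V := \row_i g i x.

Lemma is_derive_row (W : normedModType R) (G : 'I_3 -> W -> R) (d : 'I_3 -> R) (x v : W) :
 (forall i, is_derive x v (G i) (d i)) -> is_derive x v (fun x => \row_i G i x : V) (\row_i d i).
Proof.
move=> dG; have D : derivable (fun x => \row_i G i x : V) x v.
 apply/derivable_mxP => i j; have := @ex_derive _ _ _ _ _ _ _ (dG j).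
 have -> : (fun x => (\row_i G i x : V) i j) = G j by apply/funext => y; rewrite mxE.
 exact.
apply: (DeriveDef (D)); rewrite (derive_mx D); apply/matrixP => i j; rewrite !mxE.
have <- : (fun t => G j t) = (fun t => (\row_i G i t) i j) by apply/funext => y; rewrite mxE.
exact: (@derive_val _ _ _ _ _ _ _ (dG j)).
Qed.

Lemma vrow_bounded (W : Type) (G : 'I_3 -> W -> R) M (y : W) : (forall i, `|G i y| <= M) -> `|\row_i G i y : V| <= M.
Proof.
move=> hG; apply: norm_le_coord; first exact: le_trans (normr_ge0 _) (hG ord0).
by move=> i; rewrite mxE.
Qed.

Lemma vrow_sub_bounded (W : Type) (G : 'I_3 -> W -> R) M (y z : W) : (forall i, `|G i y - G i z| <= M) ->
 `|(\row_i G i y : V) - (\row_i G i z)| <= M.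
Proof.
move=> hG; apply: norm_le_coord; first exact: le_trans (normr_ge0 _) (hG ord0).
by move=> i; rewrite !mxE.
Qed.

Lemma cont_row (W : normedModType R) (G : 'I_3 -> W -> R) (q : W) : (forall i, {for q, continuous (G i)}) ->
 {for q, continuous (fun x => \row_i G i x : V)}.
Proof.
move=> cg; apply/cvgrPdist_le => c c0.
have H i : \forall y \near q, `|G i q - G i y| <= c by apply: (cvgrPdist_le _ _).1 c c0; exact: cg.
have := near_forall H; apply: filterS => y hy.
exact: (@vrow_sub_bounded _ G).
Qed.

Lemma cont_vrow g : (forall i, continuous (g i)) -> continuous (vrow g).
Proof. by move=> cg x; apply: (@cont_row V g) => i; exact: cg. Qed.

Lemma partials_vrow k s g : (forall i, CB k (g i)) -> (size s <= k)%N ->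
 partials s (vrow g) = vrow (fun i => partials s (g i)).
Proof.
move=> gk; elim: s => [//|j s IH] sk; have sk' : (size s <= k)%N := ltnW sk.
apply/funext => x; rewrite /= IH// /partial /vrow.
have D i : is_derive x (e_ j) (partials s (g i)) (partial j (partials s (g i)) x).
 apply: DeriveDef => //; have [_ _ d] := gk i s sk'; exact: d sk j x.
exact: (@derive_val _ _ _ _ _ _ _ (is_derive_row D)).
Qed.

Lemma Ck_vrow k g : (forall i, CB k (g i)) -> Ck k (vrow g).
Proof.
move=> gk; split=> s sk => [i x|]; last first.
 by rewrite (partials_vrow gk sk); apply: cont_vrow => i; have [] := gk i s sk.
rewrite (partials_vrow gk (ltnW sk)); apply: ex_derive; apply: is_derive_row => j.
apply: DeriveDef => //; have [_ _ d] := gk j s (ltnW sk); exact: d sk i x.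
Qed.

Lemma Ck_CB k (f : V -> R) : CB k f -> Ck k f.
Proof.
move=> fk; split=> s sk => [i x|]; last by have [] := fk s sk.
by have [_ _ d] := fk s (ltnW sk); exact: d sk i x.
Qed.

Let norm_bounded (W : normedModType R) (f : V -> W) M : (forall x, `|f x| <= M) -> [bounded f x | x in setT].
Proof.
move=> fM; exists M; split; first exact: num_real.
by move=> N MN x _; exact: le_trans (fM x) (ltW MN).
Qed.

Lemma Ck_holder_DB k theta M (f : V -> R) : 0 <= theta < 1 -> DB k.+1 M 1 f -> Ck_holder k theta f.
Proof.
move=> th H; have fk := DB_CB H.
have b s x : (size s <= k.+1)%N -> `|partials s f x| <= M by move=> sk; have := H.2 s sk x; rewrite expr1n mulr1.
split; first exact: Ck_CB (CB_le (leqnSn _) fk).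
 by move=> s sk; apply: norm_bounded => x; apply: b; exact: leq_trans sk (leqnSn _).
move=> s sk; have sk1 : (size s <= k.+1)%N by rewrite sk.
apply: (@lipschitz_C0_holder R _ _ setT _ (3 * M) M theta openT th) => [x _|x y _ _]; first exact: b.
apply: CB1_lipschitz => [|i z]; first by have := CB_partials fk sk1; rewrite sk subSnn.
by apply: (b (i :: s)); rewrite /= sk.
Qed.

Lemma Ck_holder_vrow k theta M g : 0 <= theta < 1 -> (forall i, DB k.+1 M 1 (g i)) -> Ck_holder k theta (vrow g).
Proof.
move=> th H; have gk1 i := DB_CB (H i); have gk i := CB_le (leqnSn k) (gk1 i).
have b i s x : (size s <= k.+1)%N -> `|partials s (g i) x| <= M by move=> sk; have := (H i).2 s sk x; rewrite expr1n mulr1.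
split; first exact: Ck_vrow.
 move=> s sk; rewrite (partials_vrow gk sk); apply: norm_bounded => x.
 by apply: (@vrow_bounded _ (fun i => partials s (g i))) => i; apply: b; exact: leq_trans sk (leqnSn _).
move=> s sk; have sk1 : (size s <= k.+1)%N by rewrite sk.
rewrite (partials_vrow gk1 sk1).
apply: (@lipschitz_C0_holder R _ _ setT _ (3 * M) M theta openT th) => [x _|x y _ _].
 by apply: (@vrow_bounded _ (fun i => partials s (g i))) => i; exact: b.
apply: (@vrow_sub_bounded _ (fun i => partials s (g i))) => j.
apply: CB1_lipschitz => [|i z]; first by have := CB_partials (gk1 j) sk1; rewrite sk subSnn.
by apply: (b _ (i :: s)); rewrite /= sk.
Qed.

Lemma Lp_norm_oo_le (f : V -> R) M : (forall x, `|f x| <= M) -> (Lp_norm +oo f <= M%:E)%E.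
Proof.
move=> fM; rewrite /Lp_norm unlock; case: ifPn => _.
 by apply/ess_sup_inf.ess_supP; apply: nearW => x /=; rewrite lee_fin.
(* In the other branch the norm has its default value 0. *)
by rewrite lee_fin (le_trans (normr_ge0 _) (fM 0)).
Qed.

Lemma Nb_coord kap u A i :
 (forall i, (mfun3 z, u (vec3 z) 0 i)) ->
 0 <= A -> (vLp_norm 3%:E u <= A%:E)%E -> Nb kap (fun x => u x 0 i) A.
Proof.
move=> mu A0 /(Lp3_norm_le _ A0) H; apply: Nb_of_integral => //; apply: le_trans H.
have me : (mfun3 z, enorm (u (vec3 z))) by exact: mfun_enorm.
have m3 (h : space3 R -> R) : measurable_fun setT (h : _ -> mR R) -> measurable_fun setT (fun z => (`|h z| ^+ 3)%:E).
 by move=> mh; apply/measurable_EFinP; apply: measurable_funX; exact: measurableT_comp (@normr_measurable _ _) mh.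
apply: ge0_le_integral => //.
- exact: m3 (mu i).
- exact: m3 me.
- move=> z _; rewrite lee_fin lerXn2r ?nnegrE// (ger0_norm (enorm_ge0 _)); exact: coord_le_enorm.
Qed.

Lemma vLp_norm3_le u A : 0 < A ->
 (forall i, (mfun3 z, u (vec3 z) 0 i)) ->
 (forall i, Nb 0 (fun x => u x 0 i) A) -> (vLp_norm 3%:E u <= (3 * A)%:E)%E.
Proof.
move=> A0 mu Nu; have A3 : 0 <= 3 * A by pos.
have ma i : (mfun3 z, `|u (vec3 z) 0 i|).
 exact: measurableT_comp (@normr_measurable _ _) (mu i).
have Na i : Nb 0 (fun x => `|u x 0 i|) A.
 by move=> x l l0; under eq_integral do rewrite normr_id; exact: Nu.
have := NbD A0 (addr_gt0 A0 A0) (ma ord0) (measurable_funD (ma o1) (ma o2)) (Na ord0)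
 (NbD A0 A0 (ma o1) (ma o2) (Na o1) (Na o2)).
have -> : A + (A + A) = 3 * A by ring.
have mS := measurable_funD (ma ord0) (measurable_funD (ma o1) (ma o2)).
move=> /(integral_of_Nb A3 mS) H.
apply/(Lp3_norm_le _ A3); apply: le_trans H.
have me : (mfun3 z, enorm (u (vec3 z))) by exact: mfun_enorm.
have m3 (h : space3 R -> R) : measurable_fun setT (h : _ -> mR R) -> measurable_fun setT (fun z => (`|h z| ^+ 3)%:E).
 by move=> mh; apply/measurable_EFinP; apply: measurable_funX; exact: measurableT_comp (@normr_measurable _ _) mh.
apply: ge0_le_integral => //.
- exact: m3 me.
- exact: m3 mS.
- move=> z _; rewrite lee_fin lerXn2r ?nnegrE// (ger0_norm (enorm_ge0 _)).
 by apply: (le_trans (enorm_le_sum _)); rewrite sum3; exact: ler_norm.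
Qed.

Lemma ecvg_right0 (f : R -> \bar R) : (forall t, 0 < t -> (0 <= f t)%E) ->
 (forall c : R, 0 < c -> exists2 d : R, 0 < d & forall t, 0 < t -> t < d -> (f t <= c%:E)%E) ->
 f t @[t --> 0^'+] --> 0%E.
Proof.
move=> f0 H; have fin t (c : R) : 0 < t -> (f t <= c%:E)%E -> f t \is a fin_num.
 by move=> t0 h; rewrite ge0_fin_numE ?f0// (le_lt_trans h)// ltry.
have N (d : R) : 0 < d -> \forall t \near 0^'+, 0 < t /\ t < d.
 move=> d0; near=> t; split; [by near: t; exact: nbhs_right_gt|by near: t; exact: nbhs_right_lt].
apply/fine_cvgP; split.
 by have [d d0 hd] := H 1 ltr01; apply: filterS (N d d0) => t [t0 td]; exact: fin t0 (hd t t0 td).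
apply/cvgrPdist_le => c c0; have [d d0 hd] := H c c0.
apply: filterS (N d d0) => t [t0 td]; have h := hd t t0 td.
rewrite sub0r normrN ger0_norm ?fine_ge0 ?f0//.
by rewrite -lee_fin fineK// (fin _ _ t0 h).
Unshelve. all: by end_near. Qed.

Lemma J3_approx u : J3 u -> exists f : nat -> 'I_3 -> V -> R,
 [/\ forall n k i, CB k (f n i),
   forall n i s, exists2 B : R, 0 < B & Nb 0 (partials s (f n i)) B,
   forall n x, \sum_(i < 3) partial i (f n i) x = 0 &
   forall n i, Nb 0 (fun x => u x 0 i - f n i x) (2 ^- n)].
Proof.
move=> [[mu _] H]; have e0 n : 0 < 2 ^- n :> R by pos.
have /choice[phi hphi] : forall n : nat, exists phi, test_field phi /\ (vLp_norm 3%:E (u \- phi)%R < (2 ^- n)%:E)%E.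
 by move=> n; have [phi h1 h2] := H _ (e0 n); exists phi.
have tf n i := test_field_coord i (hphi n).1.
exists (fun n i x => phi n x 0 i); split.
- by move=> n k i; exact: (tf n i).1.
- by move=> n i; exact: (tf n i).2.
- by move=> n x; have [[_ _ h] _] := hphi n; exact: h.
move=> n i; have mphi j : (mfun3 z, phi n (vec3 z) 0 j).
 exact: (mfun3_cont (CB_cont ((tf n j).1 0%N))).
have mm j : (mfun3 z, (u \- phi n)%R (vec3 z) 0 j).
 have -> : (fun z : space3 R => (u \- phi n)%R (vec3 z) 0 j) = (fun z => u (vec3 z) 0 j - phi n (vec3 z) 0 j).
  by apply/funext => z; rewrite !mxE.
 exact: measurable_funB (mu j) (mphi j).
have := @Nb_coord 0 _ _ i mm (ltW (e0 n)) (ltW (hphi n).2).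
by congr (Nb _ _ _); apply/funext => x; rewrite !mxE.
Qed.

End VectorFields.

(** * The mild solution of a given datum and its bounds *)

Section MildSolution.
Context {R : realType}.
Local Notation V := 'rV[R]_3.
Implicit Types (kap A d t : R) (T : \bar R) (i j : 'I_3).

(** The loss of the linear flow with six derivatives; data bounds are divided by it so that the flow
    has amplitude 1. *)
Definition cP : R := 4 * cX 6.
(** 1 / (8 cE) is the threshold of the iteration; the minimum with 1 simplifies the bounds for the
    pressure. *)
Definition d1 : R := Num.min 1 (8 * cE 6)^-1.

Lemma cP_ge1 : 1 <= cP.
Proof. by rewrite /cP; have := @cX_ge1 R 6; move: (@cX R 6) => q; lra. Qed.

Lemma cP_gt0 : 0 < cP. Proof. exact: lt_le_trans ltr01 cP_ge1. Qed.

Lemma d1_gt0 : 0 < d1.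
Proof. by rewrite lt_min ltr01 invr_gt0; exact: mulr_gt0 (ltr0Sn _ 7) (@cE_gt0 R 6). Qed.

Lemma d1_small d : d <= d1 -> 8 * cE 6 * d <= 1.
Proof.
rewrite le_min => /andP[_]; have h : 0 < 8 * cE 6 :> R := mulr_gt0 (ltr0Sn _ 7) (@cE_gt0 R 6).
by move=> h1; rewrite mulrC -ler_pdivlMr// mul1r.
Qed.

Variables (u0 : V -> V) (f : nat -> 'I_3 -> V -> R) (a : R).
Hypothesis mu0 : forall i, (mfun3 z, u0 (vec3 z) 0 i).
Hypothesis fk : forall n k i, CB k (f n i).
Hypothesis fB : forall n i s, exists2 B : R, 0 < B & Nb 0 (partials s (f n i)) B.
Hypothesis f_div : forall n x, \sum_(i < 3) partial i (f n i) x = 0.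
Hypothesis fu0 : forall n i, Nb 0 (fun x => u0 x 0 i - f n i x) (2 ^- n).
Hypothesis a0 : 0 <= a.
Hypothesis Nb_a : forall i, Nb 0 (fun x => u0 x 0 i) a.

Definition data_bound kap A := [/\ 0 <= kap, 0 < A & forall i, Nb kap (fun x => u0 x 0 i) (A / cP)].

Definition covered T d := forall t, time_interval T t -> exists kap A, [/\ data_bound kap A, kap * sqrt t <= 1 & A <= d].

Local Notation L := (linear_flow f).
Local Notation u := (solution L).

Let v0 (i : 'I_3) (x : V) : R := u0 x 0 i.
Let e (n : nat) : R := 2 ^- n.
Let e_gt0 n : 0 < e n. Proof. by rewrite invr_gt0 exprn_gt0. Qed.
Let e_ni n k : (n <= k)%N -> e k <= e n.
Proof. by move=> nk; rewrite lef_pV2 ?posrE ?exprn_gt0// ler_weXn2l// ler1n. Qed.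
Let e_cvg : e n @[n --> \oo] --> 0.
Proof.
have -> : e = (fun n => 2^-1 ^+ n) by apply/funext => n; rewrite exprVn.
by apply: cvg_expr; rewrite ger0_norm ?invr_ge0// invf_lt1 ?ltr1n.
Qed.

Let pos kap A : data_bound kap A -> 0 <= kap /\ 0 < A. Proof. by case. Qed.

Lemma data_bound0 A : a <= A / cP -> 0 < A -> data_bound 0 A.
Proof. by move=> aA A0; split=> // i; exact: Nb_weaken a0 aA (Nb_a i). Qed.

Let data0 : exists A, data_bound 0 A.
Proof.
exists (cP * (a + 1)); apply: data_bound0; last by apply: mulr_gt0 cP_gt0 _; exact: ltr_wpDl.
by rewrite mulrAC divff ?mul1r ?gt_eqF ?cP_gt0// lerDl.
Qed.

Lemma linear_BD T d : 0 < d -> covered T d -> forall i, BD T 6 d data_bound 1 (L i).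
Proof.
move=> d0 cov i; split.
 have [B HB] := @linear_flow_XX R 6 v0 f e mu0 fk fB e_gt0 e_ni e_cvg fu0 T i.
 split=> [t It|]; last exact: HB.2.
 have [kap [A [[k0 A0 N] kt Ad]]] := cov t It; have A1 : 0 < A / cP := divr_gt0 A0 cP_gt0.
 apply: DB_weaken (@linear_flow_DB R 6 v0 f e mu0 fk fB e_gt0 e_ni e_cvg fu0 T kap i t _ It A1 kt (N i)) => //; last exact: ltW (rs_gt0 (I_gt0 It)).
 have -> : 4 * cX 6 * (A / cP) = A by rewrite -/cP mulrCA divff ?mulr1// gt_eqF ?cP_gt0.
 by rewrite mul1r ler_wpM2r// ltW// rs_gt0// (I_gt0 It).
move=> kap A [k0 A0 N] t It; have A1 : 0 < A / cP := divr_gt0 A0 cP_gt0.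
have := @linear_flow_Nb R 6 v0 f e mu0 fk fB e_gt0 e_ni e_cvg fu0 T kap i t _ It A1 (N i).
have x0 : 0 < cX 6 :> R := lt_le_trans ltr01 (@cX_ge1 R 6).
have -> : 2 * cX 6 * (A / cP) = A / 2.
 by rewrite /cP; move: (cX 6) x0 => q q0; field; rewrite gt_eqF.
by apply: Nb_weaken; lra.
Qed.

Lemma solution_bounds T d : 0 < d -> d <= d1 -> covered T d -> forall i, BD T 6 d data_bound 3 (u i).
Proof. by move=> d0 dd cov; exact: (@solution_BD R T 6 d data_bound d0 pos cov L (d1_small dd) (linear_BD d0 cov)). Qed.

Lemma solutionE T d : 0 < d -> d <= d1 -> covered T d ->
 forall i t x, time_interval T t -> u i t x = L i t x - Duh u i t x.
Proof. by move=> d0 dd cov; exact: (@solution_Duhamel R T 6 d data_bound d0 pos cov L (d1_small dd) (linear_BD d0 cov)). Qed.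

(** The datum is a test field, bounded and therefore small for large kap, plus a remainder that is
    small in L^3. The approximation by test fields thereby gives positive existence times and the
    limits at t = 0. *)
Lemma small_data d : 0 < d -> exists2 kap, 0 < kap & forall i, Nb kap (fun x => u0 x 0 i) d.
Proof.
move=> d0; have d2 : 0 < d / 2 by pos.
have /cvgrPdist_lt/(_ _ d2)[n _ /(_ n (leqnn n))] := e_cvg; rewrite sub0r normrN gtr0_norm// => en.
have /choice[M HM] : forall i, exists M : R, forall x, `|f n i x| <= M by move=> i; exact: CB_bnd (@fk n 0 i).
set m := 1 + \sum_(i < 3) M i.
have M0 i : 0 <= M i := le_trans (normr_ge0 _) (HM i 0).
have m0 : 0 < m by rewrite ltr_pwDl// sumr_ge0.
have Mm i : M i <= m by rewrite /m (bigD1 i)//= addrCA lerDl addr_ge0// sumr_ge0.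
have c0 := @cK_gt0 R [::]; have k0 : 0 < cK [::] * m / (d / 2) by pos.
exists (cK [::] * m / (d / 2)) => // i.
have mf := mfun3_cont (CB_cont (@fk n 0 i)).
have N1 : Nb (cK [::] * m / (d / 2)) (f n i) (d / 2).
 have := Nb_of_bounded k0 mf (fun x => le_trans (HM i x) (Mm i)).
 by have -> // : cK [::] * m / (cK [::] * m / (d / 2)) = d / 2; rewrite invf_div mulrC divfK// gt_eqF// mulr_gt0.
have N2 := Nb_weaken (ltW (e_gt0 n)) (ltW en) (Nb_raise (cK [::] * m / (d / 2)) (fu0 n i) (ltW (e_gt0 n))).
have := NbD d2 d2 mf (measurable_funB (mu0 i) mf) N1 N2.
rewrite -splitr; congr (Nb _ _ _); apply/funext => x; ring.
Qed.

Lemma small_time d : 0 < d -> exists2 T : R, 0 < T & covered T%:E d.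
Proof.
move=> d0; have [kap k0 N] := small_data (divr_gt0 d0 cP_gt0).
(* The largest time with kap sqrt t <= 1. *)
exists (kap ^- 2); first pos.
move=> t [t0]; rewrite lte_fin => tT; exists kap, d; split=> //; first by split=> //; exact: ltW.
rewrite -[leRHS](mulfV (lt0r_neq0 k0)); apply: ler_wpM2l; first exact: ltW.
have -> : kap^-1 = sqrt (kap ^- 2) by rewrite -exprVn sqrtr_sqr ger0_norm ?invr_ge0 ?ltW.
by apply: ler_wsqrtr; exact: ltW.
Qed.

(** When A is below d, the global pair (0, A) is itself the small pair at every time; a sup bound in
    terms of delta thereby becomes linear in A. *)
Lemma covered_min T d A : covered T d -> data_bound 0 A -> covered T (Num.min d A).
Proof.
move=> cov D t It; have [h|h] := leP A d.
 by exists 0, A; split=> //; rewrite mul0r ler01.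
by have [kap [B [D' kt Bd]]] := cov t It; exists kap, B; split.
Qed.

Section Bounds.
Variable T : \bar R.
Hypothesis cov : covered T d1.
Local Notation I := (time_interval T).

Let B1 := solution_bounds d1_gt0 (lexx _) cov.

(** The bounds of the iteration are taken again with delta = min(d1, A), for the same function. *)
Lemma solution_sup_le A t i x : data_bound 0 A -> I t -> `|u i t x| <= 3 * A * rs t.
Proof.
move=> D It; have A0 := (pos D).2; have d0 : 0 < Num.min d1 A by rewrite lt_min d1_gt0.
have dd : Num.min d1 A <= d1 by rewrite ge_min lexx.
have H := solution_bounds d0 dd (covered_min cov D) i.
apply: (le_trans (DB0 (H.1.1 t It) x)); rewrite ler_wpM2r ?(ltW (rs_gt0 (I_gt0 It)))// ler_wpM2l//.
by rewrite ge_min lexx orbT.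
Qed.

Lemma solution_Nb_le A t i : data_bound 0 A -> I t -> Nb 0 (u i t) (3 * A).
Proof. by move=> D It; exact: (B1 i).2 D t It. Qed.

(** On a short interval delta can be as small as desired, and the function does not depend on the
    interval. *)
Lemma solution_decay d : 0 < d -> exists2 tau : R, 0 < tau & forall t i, I t -> t < tau ->
 DB 6 (d * rs t) (rs t) (u i t).
Proof.
move=> d0; set d' := Num.min d1 (d / 3); have d3 : 0 < d / 3 by pos.
have d'0 : 0 < d' by rewrite lt_min d1_gt0.
have dd : d' <= d1 by rewrite ge_min lexx.
have [tau tau0 Ht] := small_time d'0; exists tau => // t i It tt.
have It' : time_interval tau%:E t by split; [exact: I_gt0 It|rewrite lte_fin].
have r0 := ltW (rs_gt0 (I_gt0 It)).
apply: DB_weaken ((solution_bounds d'0 dd Ht i).1.1 t It') => //.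
apply: ler_wpM2r => //; have : d' <= d / 3 by rewrite ge_min lexx orbT.
by lra.
Qed.

(** The linear part tends to the datum. On a short interval the Duhamel part has an L^3 bound 9 cE A
    d', with A fixed by the norm and d' as small as needed. *)
Lemma solution_initial d : 0 < d -> exists2 tau : R, 0 < tau & forall t i, I t -> t < tau ->
 Nb 0 (fun x => u i t x - u0 x 0 i) d.
Proof.
move=> d0; have [A D] := data0; have A0 := (pos D).2.
have d2 : 0 < d / 2 by pos.
have [tau1 tau10 H1] := @linear_flow_initial R 6 v0 f e mu0 fk fB e_gt0 e_ni e_cvg fu0 T _ d2.
have c0 : 0 < cE 6 * 3 ^+ 2 * A by apply: mulr_gt0 A0; exact: mulr_gt0 (@cE_gt0 R 6) (exprn_gt0 2 (ltr0Sn R 2)).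
set d' := Num.min d1 (d / 2 / (cE 6 * 3 ^+ 2 * A)).
have d'0 : 0 < d' by rewrite lt_min d1_gt0; exact: divr_gt0 d2 c0.
have dd : d' <= d1 by rewrite ge_min lexx.
have [tau2 tau20 cov2] := small_time d'0.
have B2 := solution_bounds d'0 dd cov2.
exists (Num.min tau1 tau2); first by rewrite lt_min tau10.
move=> t i It; rewrite lt_min => /andP[t1 t2].
have It' : time_interval tau2%:E t by split; [exact: I_gt0 It|rewrite lte_fin].
have HD := Duh_BD d'0 pos cov2 (ltr0Sn R 2) B2 i.
have N2 : Nb 0 (Duh u i t) (d / 2).
 apply: Nb_weaken (HD.2 0 A D t It').
  exact: mulr_ge0 (mulr_ge0 (mulr_ge0 (ltW (@cE_gt0 R 6)) (exprn_ge0 2 (ler0n _ 3))) (ltW d'0)) (ltW A0).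
 have : d' <= d / 2 / (cE 6 * 3 ^+ 2 * A) by rewrite ge_min lexx orbT.
 rewrite (ler_pdivlMr _ _ c0); move: (cE 6 * 3 ^+ 2) (d') => p q h.
 by apply: le_trans h; apply: le_of_eq; ring.
have mL := XX_measurable (linear_BD d1_gt0 cov i).1 It.
have mD := XX_measurable HD.1 It'.
have := NbB d2 d2 (measurable_funB mL (mu0 i)) mD (H1 t i It t1) N2.
rewrite -splitr; congr (Nb _ _ _); apply/funext => x; rewrite /v0 (solutionE d1_gt0 (lexx _) cov _ _ It).
by move: (L i t x) (Duh _ _ _ _) (u0 x 0 i) => p q r; ring.
Qed.

(** 144 is 8 x 18, for the near part, where a derivative of the stress has L^3 bound 18 A / t. The
    factor 3 + 24 cP bounds 3 A1 + 12 A kap sqrt t in the far part. *)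
Definition cQ : R := \sum_(j < 3) \sum_(k < 3) (144 * cK [:: j] ^+ 2 + 6 * cM [:: j; k] * (3 + 24 * cP)).

(** Two pairs act together: (0, A) measures the L^3 norm, (kap, A1) the local smallness. The
    hypothesis on kap sqrt t A keeps the far part linear in A. *)
Lemma pressure_Nb kap A A1 t : data_bound 0 A -> data_bound kap A1 -> A1 <= d1 -> kap * sqrt t * A <= 2 * cP ->
 I t -> Nb 0 (pressure u t) (9 * (cQ * A * rs t)).
Proof.
move=> D D1 Ad kA It; have A0 := (pos D).2; have [k0 A10] := pos D1.
have t0 := I_gt0 It; have s0 : 0 < sqrt t by pos.
have r0 := rs_gt0 t0; have sr : sqrt t * rs t = 1 by rewrite /rs mulfV// gt_eqF.
have u6 j : CB 6 (u j t) := DB_CB ((B1 j).1.1 t It).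
have u3 j : CB 3 (u j t) := CB_le (isT : (3 <= 6)%N) (u6 j).
have us j k : CB 6 (stress u j k t) := CB_mul (u6 j) (u6 k).
have d11 : d1 <= 1 by rewrite ge_min lexx.
have A3 : 0 < 3 * A by pos.
have b0 j x : `|u j t x| <= 3 * rs t.
 apply: (le_trans (DB0 ((B1 j).1.1 t It) x)); rewrite ler_wpM2r ?(ltW r0)//.
 by move: d11; lra.
have b1 j k x : `|partial k (u j t) x| <= 3 * rs t ^+ 2.
 apply: (le_trans (((B1 j).1.1 t It).2 [:: k] isT x)); rewrite expr1 expr2 -!mulrA ler_wpM2l// ler_piMl//.
 pos.
have Nm (g h : V -> R) M B : (forall x, `|g x| <= M) -> continuous g -> continuous h -> Nb 0 h B -> Nb 0 (fun x => g x * h x) (M * B).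
 move=> gM cg ch Nh; have mg := mfun3_cont cg; have mh := mfun3_cont ch.
 apply: (@Nb_le R 0 _ h) => //; [exact: measurable_funM|exact: le_trans (normr_ge0 _) (gM 0)|].
 by move=> x; rewrite normrM ler_wpM2r.
(* Leibniz gives two products, each of a gradient of size at most 3 / t and a component with L^3
   bound 3 A. *)
set B := 18 * rs t ^+ 2 * A.
have B0 : 0 < B by rewrite /B mulr_gt0// mulr_gt0// exprn_gt0.
have NB j k : Nb 0 (partial k (stress u j k t)) B.
 have du i : CB 5 (partial k (u i t)) := CB_partial k (u6 i).
 have M0 : 0 < 3 * rs t ^+ 2 * (3 * A) by pos.
 have n1 := Nm _ _ _ _ (b1 j k) (CB_cont (du j)) (CB_cont (u6 k)) (solution_Nb_le k D It).
 have n2 := Nm _ _ _ _ (b1 k k) (CB_cont (du k)) (CB_cont (u6 j)) (solution_Nb_le j D It).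
 have m1 := mfun3_cont (CB_cont (CB_mul (CB_le (leq0n _) (du j)) (CB_le (leq0n _) (u6 k)))).
 have m2 := mfun3_cont (CB_cont (CB_mul (CB_le (leq0n _) (du k)) (CB_le (leq0n _) (u6 j)))).
 have := NbD M0 M0 m1 m2 n1 n2.
 have -> : 3 * rs t ^+ 2 * (3 * A) + 3 * rs t ^+ 2 * (3 * A) = B by rewrite /B; ring.
 congr (Nb _ _ _); rewrite (partialM (@CB_derivable R _ _ (u6 j) k) (@CB_derivable R _ _ (u6 k) k)).
 by apply/funext => x; rewrite [in RHS](mulrC (u j t x)).
have Af0 : 0 <= 3 * rs t * (3 * A) by pos.
have Nf j k : Nb 0 (stress u j k t) (3 * rs t * (3 * A)).
 exact: Nm (b0 j) (CB_cont (u6 j)) (CB_cont (u6 k)) (solution_Nb_le k D It).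
have cQ_ge j k : 144 * cK [:: j] ^+ 2 + 6 * cM [:: j; k] * (3 + 24 * cP) <= cQ.
 have p0 i l : 0 <= 144 * cK [:: i] ^+ 2 + 6 * cM [:: i; l] * (3 + 24 * cP).
  have h : 0 <= 3 + 24 * cP by have := cP_gt0; lra.
  exact: addr_ge0 (mulr_ge0 (ler0n _ 144) (sqr_ge0 _)) (mulr_ge0 (mulr_ge0 (ler0n _ 6) (ltW (cM_gt0 _))) h).
 have key (F : 'I_3 -> R) i : (forall i, 0 <= F i) -> F i <= \sum_(i < 3) F i.
  by move=> F0; rewrite (bigD1 i)//= lerDl sumr_ge0.
 apply: le_trans (key _ k (p0 j)) _; apply: (key (fun j => \sum_(k < 3) _)) => i.
 by apply: sumr_ge0 => l _; exact: p0.
have Q0 : 0 < cQ.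
 apply: lt_le_trans (cQ_ge ord0 ord0); apply: ltr_wpDr; last pos.
 have h : 0 <= 3 + 24 * cP by have := cP_gt0; lra.
 exact: mulr_ge0 (mulr_ge0 (ler0n _ 6) (ltW (cM_gt0 _))) h.
have NP j k : Nb 0 (P2 [:: j; k] (sqrt t) (stress u j k t)) (cQ * A * rs t).
 have A13 : 0 < 3 * A1 by pos.
 have H := @Nb_P2 R j k (u j t) (u k t) (sqrt t) kap (3 * A1) (3 * A) B (u3 j) (u3 k) s0 k0 A13 A3 B0 (solution_Nb_le j D It) (solution_Nb_le k D It) ((B1 k).2 kap A1 D1 t It)
  (NB j k) _ Af0 (Nf j k).
 apply: Nb_weaken H.
  have h1 := mulr_ge0 (mulr_ge0 (mulr_ge0 (ltW s0) (sqr_ge0 (@cK R [:: j]))) (ltW B0)) (ler0n R 8).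
  have h2 := mulr_ge0 (ltW A3) (mulr_ge0 k0 (ltW s0)).
  have h3 : 0 <= 2 * cM [:: j; k] / sqrt t * (3 * A).
   exact: mulr_ge0 (divr_ge0 (mulr_ge0 (ler0n _ 2) (ltW (cM_gt0 _))) (ltW s0)) (ltW A3).
  apply: addr_ge0 h1 (mulr_ge0 h3 _).
  pos.
 apply: (@le_trans _ _ ((144 * cK [:: j] ^+ 2 + 6 * cM [:: j; k] * (3 + 24 * cP)) * A * rs t)); last first.
  have key (p q x y : R) : 0 <= x -> 0 <= y -> p <= q -> p * x * y <= q * x * y.
   by move=> x0 y0 pq; rewrite ler_wpM2r// ler_wpM2r.
  exact: key (ltW A0) (ltW r0) (cQ_ge j k).
 have M0 := @cM_gt0 R [:: j; k].
 rewrite /B -/(rs t); move: (cK [:: j] ^+ 2) (cM [:: j; k]) M0 => p q q0.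
 have E1 : sqrt t * p * (18 * rs t ^+ 2 * A) * 8 = 144 * p * A * rs t.
  by transitivity (144 * p * A * rs t * (sqrt t * rs t)); [ring|rewrite sr mulr1].
 rewrite E1 [leRHS](_ : _ = 144 * p * A * rs t + 6 * q * A * rs t * (3 + 24 * cP)); last by ring.
 rewrite lerD2l.
 have h : 3 * A1 + 4 * (3 * A) * (kap * sqrt t) <= 3 + 24 * cP.
  by move: kA Ad d11; move: (sqrt t) cP d1 => w c d; nra.
 rewrite [leLHS](_ : _ = 6 * q * A * rs t * (3 * A1 + 4 * (3 * A) * (kap * sqrt t))); last by ring.
 apply: ler_wpM2l; last exact: h.
 pos.
have q0 : 0 < cQ * A * rs t := mulr_gt0 (mulr_gt0 Q0 A0) r0.
have cP2 j k : continuous (P2 [:: j; k] (sqrt t) (stress u j k t)).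
 exact: (@P2_cont R [:: j; k] (stress u j k t) (sqrt t) _ erefl (CB_le (isT : (3 <= 6)%N) (us j k)) s0 Af0 (Nf j k)).
have -> : 9 * (cQ * A * rs t) = 3 * (3 * (cQ * A * rs t)) by ring.
apply: Nb_sum3.
- pos.
- move=> j x; exact: (@cont_sum3 R V (fun k => P2 [:: j; k] (sqrt t) (stress u j k t)) x (fun k => cP2 j k x)).
- by move=> j; apply: Nb_sum3.
Qed.

End Bounds.
End MildSolution.

(** * Assembling velocity and pressure *)

Section VectorSolution.
Context {R : realType}.
Local Notation V := 'rV[R]_3.
Implicit Types (kap A d t : R) (i j : 'I_3) (T : \bar R).

Lemma DB_of_partial k M (g : V -> R) : continuous g -> (forall x, `|g x| <= M) -> (forall i x, derivable g x (e_ i)) ->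
 (forall i, DB k M 1 (partial i g)) -> DB k.+1 M 1 g.
Proof.
move=> cg bg dg H; split.
 move=> s sk; have [->|[s' [i Es]]] : s = [::] \/ exists s' i, s = rcons s' i.
  by case/lastP: s {sk} => [|s' i]; [left|right; exists s', i].
  by split=> //; exists M.
 have E : partials s g = partials s' (partial i g) by rewrite Es /partials foldr_rcons.
 rewrite E; move: sk; rewrite Es size_rcons !ltnS => sk.
 by have [c b d] := (H i).1 s' sk.
move=> s sk x; rewrite expr1n mulr1.
have [->|[s' [i Es]]] : s = [::] \/ exists s' i, s = rcons s' i.
 by case/lastP: s {sk} => [|s' i]; [left|right; exists s', i].
 exact: bg.
have -> : partials s g = partials s' (partial i g) by rewrite Es /partials foldr_rcons.
move: sk; rewrite Es size_rcons ltnS => sk; have := (H i).2 s' sk x.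
by rewrite expr1n mulr1.
Qed.

(** Admissible window bounds are positive while the norm a may vanish, so estimates are proved for b
    > a and b then tends to a. The restriction b <= a + 1 keeps the condition of the pressure
    bound. *)
Lemma le_limit_slope (c a : R) (X : \bar R) : 0 < c -> (forall b, a < b -> b <= a + 1 -> (X <= (c * b)%:E)%E) ->
 (X <= (c * a)%:E)%E.
Proof.
move=> c0 H; apply/lee_addgt0Pr => e e0; set m := Num.min 1 (e / c).
have m0 : 0 < m by rewrite lt_min ltr01 divr_gt0.
have m1 : m <= 1 by rewrite ge_min lexx.
have me : c * m <= e by rewrite mulrC -ler_pdivlMr// ge_min lexx orbT.
apply: (le_trans (H (a + m) _ _)); [by rewrite ltrDl|by rewrite lerD2l|].
by rewrite -EFinD lee_fin mulrDr lerD2l.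
Qed.

Lemma open_time_slab T (eta : R) : open [set z : R * V | eta < z.1 /\ (z.1%:E < T)%E].
Proof.
have -> : [set z : R * V | eta < z.1 /\ (z.1%:E < T)%E] = fst @^-1` ([set t : R | eta < t] `&` [set t : R | (t%:E < T)%E]).
 by apply/seteqP; split.
apply: open_comp; first by move=> z _; exact: cvg_fst.
apply: openI; first exact: open_gt.
case: T => [r| |].
- by have -> : [set t : R | (t%:E < r%:E)%E] = [set t | t < r] by []; exact: open_lt.
- have -> : [set t : R | (t%:E < +oo)%E] = setT by apply/seteqP; split => // t _ /=; exact: ltry.
 exact: openT.
- by have -> : [set t : R | (t%:E < -oo)%E] = set0 by apply/seteqP; split.
Qed.

(** The norm of the product is the maximum of the two norms, so separate Lipschitz bounds in t and
    in x add up to a joint one. *)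
Lemma time_slab_holder T (eta theta B C1 C2 : R) (G : 'I_3 -> R -> V -> R) (h : R * V -> V) :
 0 <= theta < 1 -> 0 <= C1 -> 0 <= C2 -> let J := [set t : R | eta < t /\ (t%:E < T)%E] in
 (forall t x, J t -> h (t, x) = \row_i G i t x) ->
 (forall i t x, J t -> `|G i t x| <= B) ->
 (forall i t s x, J t -> J s -> `|G i t x - G i s x| <= C1 * `|t - s|) ->
 (forall i t x y, J t -> `|G i t x - G i t y| <= C2 * `|x - y|) ->
 C0_holder theta [set z : R * V | eta < z.1 /\ (z.1%:E < T)%E] h.
Proof.
move=> th C10 C20 J hE bG tG xG.
apply: (@lipschitz_C0_holder R _ _ _ h (C1 + C2) B theta (@open_time_slab T eta) th).
 move=> [t x] Jt; rewrite (hE t x Jt); apply: (@vrow_bounded _ _ (fun i z => G i z.1 z.2) B (t, x)) => i.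
 exact: bG.
move=> [t x] [s y] Jt Js; rewrite (hE t x Jt) (hE s y Js).
have n1 : `|t - s| <= `|(t, x) - (s, y)| by rewrite prod_normE le_max lexx.
have n2 : `|x - y| <= `|(t, x) - (s, y)| by rewrite prod_normE le_max lexx orbT.
have K i : `|G i t x - G i s y| <= (C1 + C2) * `|(t, x) - (s, y)|.
 have -> : G i t x - G i s y = (G i t x - G i s x) + (G i s x - G i s y) by rewrite addrA subrK.
 apply: (le_trans (ler_normD _ _)); rewrite mulrDl; apply: lerD.
  by apply: (le_trans (tG i t s x Jt Js)); exact: ler_wpM2l.
 by apply: (le_trans (xG i s x y Js)); exact: ler_wpM2l.
exact: (@vrow_sub_bounded R _ (fun i z => G i z.1 z.2) _ (t, x) (s, y) K).
Qed.

Variables (u0 : V -> V) (f : nat -> 'I_3 -> V -> R) (a : R) (T : \bar R).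
Hypothesis mu0 : forall i, (mfun3 z, u0 (vec3 z) 0 i).
Hypothesis fk : forall n k i, CB k (f n i).
Hypothesis fB : forall n i s, exists2 B : R, 0 < B & Nb 0 (partials s (f n i)) B.
Hypothesis f_div : forall n x, \sum_(i < 3) partial i (f n i) x = 0.
Hypothesis fu0 : forall n i, Nb 0 (fun x => u0 x 0 i - f n i x) (2 ^- n).
Hypothesis a0 : 0 <= a.
Hypothesis Ea : vLp_norm 3%:E u0 = a%:E.
Hypothesis T0 : (0 < T)%E.
Local Notation I := (time_interval T).
(** The last condition serves the pressure bound, the first three the iteration. *)
Hypothesis cover : forall t, I t -> exists kap A,
 [/\ data_bound u0 kap A, kap * sqrt t <= 1, A <= d1 & kap * sqrt t * a <= 1].

Local Notation u := (solution (linear_flow f)).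

Let Nb_a i : Nb 0 (fun x => u0 x 0 i) a.
Proof. by apply: Nb_coord => //; rewrite Ea. Qed.

Let cov : covered u0 T d1.
Proof. by move=> t It; have [kap [A [D kt Ad _]]] := cover It; exists kap, A; split. Qed.

Let pos kap A : data_bound u0 kap A -> 0 <= kap /\ 0 < A. Proof. by case. Qed.

Let data0 b : a < b -> data_bound u0 0 (cP * b).
Proof.
move=> ab; have b0 := le_lt_trans a0 ab.
apply: (data_bound0 a0 Nb_a); last exact: mulr_gt0 cP_gt0 b0.
by rewrite mulrAC divff ?mul1r ?gt_eqF ?cP_gt0// ltW.
Qed.

Let P_zero : exists A, data_bound u0 0 A.
Proof. by exists (cP * (a + 1)); apply: data0; rewrite ltrDl. Qed.

Let hL := linear_BD mu0 fk fB fu0 d1_gt0 cov.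
Let B1 := solution_bounds mu0 fk fB fu0 d1_gt0 (lexx _) cov.
Let uE := solutionE mu0 fk fB fu0 d1_gt0 (lexx _) cov.

Let e (n : nat) : R := 2 ^- n.
Let v0 (i : 'I_3) (x : V) : R := u0 x 0 i.
Let e_gt0 n : 0 < e n. Proof. by rewrite invr_gt0 exprn_gt0. Qed.
Let e_ni n k : (n <= k)%N -> e k <= e n.
Proof. by move=> nk; rewrite lef_pV2 ?posrE ?exprn_gt0// ler_weXn2l// ler1n. Qed.
Let e_cvg : e n @[n --> \oo] --> 0.
Proof.
have -> : e = (fun n => 2^-1 ^+ n) by apply/funext => n; rewrite exprVn.
by apply: cvg_expr; rewrite ger0_norm ?invr_ge0// invf_lt1 ?ltr1n.
Qed.

Let L_heat i t x (It : I t) := @linear_flow_heat R 6 v0 f e isT mu0 fk fB e_gt0 e_ni e_cvg fu0 T i t x It.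
Let L_div t x (It : I t) := @linear_flow_div R 6 v0 f e isT mu0 fk fB f_div e_gt0 e_ni e_cvg fu0 T t x It.

Let M3 : 0 < 3 :> R. Proof. by []. Qed.

Let du i t x (It : I t) := @is_derive_u R T 6 d1 _ d1_gt0 pos cov isT 3 u M3 B1 _ hL L_heat uE i t x It.
Let mom i t x (It : I t) := @momentum_equation R T 6 d1 _ d1_gt0 pos cov P_zero isT 3 u M3 B1 _ hL L_div uE i t x It.
Let divf t x (It : I t) := @divergence_free R T 6 d1 _ d1_gt0 pos cov isT 3 u M3 B1 _ hL L_div uE t x It.
Let dp t x i (It : I t) := @is_derive_pressure R T 6 d1 _ d1_gt0 pos P_zero isT 3 u M3 B1 t x i It.

Let u6 i t (It : I t) : CB 6 (u i t) := DB_CB ((B1 i).1.1 t It).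
Let us j k t (It : I t) : CB 6 (stress u j k t) := CB_mul (u6 j It) (u6 k It).

Let uX i : XX I 6 (fun t => 3 * d1 * rs t) rs (u i) := (B1 i).1.
Let c0 : 0 <= 3 * d1 :> R := mulr_ge0 (ltW M3) (ltW d1_gt0).

Let bounds eta := @uniform_bounds R T (3 * d1) u c0 uX eta.

(** The bounds on the Picard limit concern positive times; the datum is inserted at t = 0. *)
Definition velocity t : V -> V := if t == 0 then u0 else vrow (fun i => u i t).

Lemma velocityE t : 0 < t -> velocity t = vrow (fun i => u i t).
Proof. by move=> t0; rewrite /velocity gt_eqF. Qed.

Lemma velocity_coord t i : 0 < t -> (fun x => velocity t x 0 i) = u i t.
Proof. by move=> t0; rewrite velocityE//; apply/funext => x; rewrite mxE. Qed.

Let m_u t i : I t -> (mfun3 z, velocity t (vec3 z) 0 i).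
Proof.
move=> It; have := mfun3_cont (CB_cont (u6 i It)).
by rewrite -(velocity_coord i (I_gt0 It)).
Qed.

Lemma is_derive_velocity t x : I t -> is_derive t 1 (fun s => velocity s x) (\row_i u_t u i t x : V).
Proof.
move=> It; have t0 := I_gt0 It.
have D := is_derive_row (fun i => du i x It).
apply: near_eq_is_derive D.
have n0 : \forall s \near t, 0 < s by apply: lt_nbhsr.
by apply: filterS n0 => s s0; rewrite velocityE.
Qed.

Lemma partials_velocity t s x i : I t -> (size s <= 6)%N -> partials s (velocity t) x 0 i = partials s (u i t) x.
Proof.
move=> It sk; rewrite (velocityE (I_gt0 It)) (partials_vrow (fun i => u6 i It) sk).
by rewrite mxE.
Qed.

(** Derivatives are controlled through the gradient, a sum of [R0] terms of the stress; for the
    potential itself, boundedness and continuity are enough. *)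
Lemma pressure_smooth t : I t -> exists M : R, DB 2 M 1 (pressure u t).
Proof.
move=> It; have [A D] := P_zero.
have [M [_ HS]] : exists M : R, (forall i, DB 6 M 1 (u i t)) /\ forall j k, DB 6 M 1 (stress u j k t).
 have t0 := I_gt0 It; have [M H] := bounds (divr_gt0 t0 (ltr0Sn R 1)).
 by exists M; apply: H It _; rewrite ltr_pdivrMr// ltr_pMr// ltr1n.
have [N HN] := @pressure_bounded R T 6 d1 _ d1_gt0 pos P_zero isT 3 u M3 B1 t It.
have Ep i : partial i (pressure u t) = (fun x => \sum_(j < 3) \sum_(k < 3) R0 [:: i; j; k] (stress u j k t) x).
 by apply/funext => x; apply: (partialE (g := fun x => \sum_(j < 3) \sum_(k < 3) R0 [:: i; j; k] (stress u j k t) x)); exact: dp.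
have Hp i : exists M', DB 3 M' 1 (partial i (pressure u t)).
 have /choice[c hc] : forall j, exists c : R, DB 3 c 1 (fun x => \sum_(k < 3) R0 [:: i; j; k] (stress u j k t) x).
  move=> j; have /choice[c hc] : forall k, exists c : R, DB 3 c 1 (R0 [:: i; j; k] (stress u j k t)).
   by move=> k; exists (cR [:: i; j; k] * M); exact: (@DB_R0 R [:: i; j; k] 3 _ (us j k It) M (HS j k)).
  have hc' k : DB 3 (\sum_(k < 3) c k) 1 (R0 [:: i; j; k] (stress u j k t)).
   apply: DB_weaken (hc k) => //; rewrite (bigD1 k)//= lerDl sumr_ge0// => l _; exact: DB_ge0 (hc l).
  by exists (3 * \sum_(k < 3) c k); exact: (DB_sum3 ler01 hc').
 have hc' j : DB 3 (\sum_(j < 3) c j) 1 (fun x => \sum_(k < 3) R0 [:: i; j; k] (stress u j k t) x).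
  apply: DB_weaken (hc j) => //; rewrite (bigD1 j)//= lerDl sumr_ge0// => l _; exact: DB_ge0 (hc l).
 by exists (3 * \sum_(j < 3) c j); rewrite Ep; exact: (DB_sum3 ler01 hc').
have /choice[c hc] := Hp.
set m := N + \sum_(i < 3) c i.
have N0 : 0 <= N := le_trans (normr_ge0 _) (HN 0).
have Sc : 0 <= \sum_(i < 3) c i by apply: sumr_ge0 => i _; exact: DB_ge0 (hc i).
exists m; apply: DB_of_partial.
- have [s0 Af] : 0 < sqrt t /\ 0 <= 2 ^+ 6 * (3 * 3) * d1 * A * rs t.
  split; first by rewrite sqrtr_gt0 (I_gt0 It).
  exact: mulr_ge0 (mulr_ge0 (mulr_ge0 (mulr_ge0 (exprn_ge0 6 (ler0n R 2)) (mulr_ge0 (ltW M3) (ltW M3))) (ltW d1_gt0)) (ltW (pos D).2))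
   (ltW (rs_gt0 (I_gt0 It))).
 have cP2 j k : continuous (P2 [:: j; k] (sqrt t) (stress u j k t)).
  have FM := FF_mul d1_gt0 pos (ltW M3) (ltW M3) (B1 j) (B1 k).
  exact: (@P2_cont R [:: j; k] (stress u j k t) (sqrt t) _ erefl (CB_le (isT : (3 <= 6)%N) (us j k It)) s0 Af (FM.2 0 A D t It)).
 move=> x; apply: (@cont_sum3 R V (fun j x => \sum_(k < 3) P2 [:: j; k] (sqrt t) (stress u j k t) x)) => j.
 exact: (@cont_sum3 R V (fun k => P2 [:: j; k] (sqrt t) (stress u j k t)) x (fun k => cP2 j k x)).
- by move=> x; apply: (le_trans (HN x)); rewrite lerDl.
- by move=> i x; exact: (@ex_derive _ _ _ _ _ _ _ (dp x i It)).
move=> i; apply: DB_weaken (hc i) => //.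
by rewrite /m (bigD1 i)//= addrCA lerDl addr_ge0// sumr_ge0// => l _; exact: DB_ge0 (hc l).
Qed.

Lemma velocity_momentum t x : I t ->
 time_derivative velocity t x + convection (velocity t) x + gradient (pressure u t) x = laplacian (velocity t) x.
Proof.
move=> It; have t0 := I_gt0 It; apply/rowP => i; have := mom i x It.
rewrite /time_derivative derive1E (@derive_val _ _ _ _ _ _ _ (is_derive_velocity x It)).
rewrite /convection /laplacian /gradient !mxE !summxE.
under [in X in _ -> _ + X + _ = _]eq_bigr => k _.
 rewrite mxE (partials_velocity (s := [:: k]) x i It isT).
 have -> : velocity t x 0 k = u k t x by rewrite -(velocity_coord k t0).
 over.
under [in X in _ -> _ = X]eq_bigr => k _ do rewrite (partials_velocity (s := [:: k; k]) x i It isT).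
exact.
Qed.

Lemma velocity_regularity : regularity T velocity.
Proof.
move=> theta th; split=> [t It|eta Ieta D].
 have t0 := I_gt0 It.
 have [M H] := bounds (divr_gt0 t0 (ltr0Sn R 1)).
 have [HM _] : (forall i, DB 6 M 1 (u i t)) /\ forall j k, DB 6 M 1 (stress u j k t).
  by apply: H It _; rewrite ltr_pdivrMr ?ltr_pMr ?ltr1n.
 rewrite (velocityE t0); apply: (Ck_holder_vrow (M := M) th) => i.
 by apply: DB_weaken (HM i).
have e0 := I_gt0 Ieta; have [M HM] := bounds e0.
have th2 : 0 <= theta / 2 < 1.
 by move: th => /andP[h1 h2]; rewrite divr_ge0//= ltr_pdivrMr// mul1r (lt_trans h2)// ltr1n.
have It t : eta < t /\ (t%:E < T)%E -> I t by move=> [h1 h2]; split=> //; exact: lt_trans h1.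
have M0 : 0 <= M.
 have [s [h1 h2]] : exists s : R, eta < s /\ (s%:E < T)%E.
  have [_ eT] := Ieta; case: T eT => [r| |//]; last by exists (eta + 1); rewrite ltrDl ltr01 ltry.
  by rewrite lte_fin => er; exists ((eta + r) / 2); rewrite lte_fin; split; [rewrite midf_lt|rewrite midf_lt].
 exact: DB_ge0 ((HM s (It s (conj h1 h2)) h1).1 ord0).
have cO0 := @cO_ge0 R.
have HuT i t : eta < t -> (t%:E < T)%E -> DB 3 (cO * M) 1 (u_t u i t).
 by move=> h1 h2; apply: (DB_u_t HM) => //; exact: It.
split=> [|i j].
 apply: (@time_slab_holder T eta (theta / 2) (cO * M) (cO * (16 * (1 + M) * cO * M)) (3 * (cO * M)) (u_t u)) => //.
 - pos.
 - pos.
 - move=> t x Jt /=; rewrite /time_derivative derive1E.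
  exact: (@derive_val _ _ _ _ _ _ _ (is_derive_velocity x (It t Jt))).
 - by move=> i t x [h1 h2]; exact: DB0 (HuT i t h1 h2) x.
 - move=> i t s x [h1 h2] [h3 h4].
  exact: (u_t_increment c0 uX du e0 HM i x (It s (conj h3 h4)) (It t (conj h1 h2)) h3 h1).
 - move=> i t x y [h1 h2]; have H := HuT i t h1 h2.
  apply: CB1_lipschitz; first exact: CB_le (isT : (1 <= 3)%N) (DB_CB H).
  by move=> k z; have := H.2 [:: k] isT z; rewrite expr1n mulr1.
apply: (@time_slab_holder T eta (theta / 2) M (cO * M) (3 * M) (fun l t => partials [:: i; j] (u l t))) => //.
- pos.
- pos.
- by move=> t x Jt; apply/rowP => l; rewrite (partials_velocity (s := [:: i; j]) x l (It t Jt) isT) mxE.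
- move=> l t x Jt; have := ((HM t (It t Jt) Jt.1).1 l).2 [:: i; j] isT x.
 by rewrite expr1n mulr1.
- move=> l t s x Jt Js.
 have := (DB_time_increment c0 uX du e0 HM l (It s Js) (It t Jt) Js.1 Jt.1).2 [:: i; j] isT x.
 rewrite expr1n mulr1 (partials_sub (u6 l (It t Jt)) (u6 l (It s Js)) (isT : (size [:: i; j] <= 6)%N)) => h.
 by apply: (le_trans h); rewrite mulrC.
- move=> l t x y Jt; have H := (HM t (It t Jt) Jt.1).1 l.
 apply: CB1_lipschitz => [|k z]; first exact: CB_le (isT : (1 <= 4)%N) (CB_partials (DB_CB H) (isT : (size [:: i; j] <= 6)%N)).
 by have := H.2 [:: k; i; j] isT z; rewrite expr1n mulr1.
Qed.

Lemma cQ_ge0 : 0 <= cQ :> R.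
Proof.
apply: sumr_ge0 => j _; apply: sumr_ge0 => k _.
have h : 0 <= 3 + 24 * cP :> R by have := @cP_gt0 R; lra.
exact: addr_ge0 (mulr_ge0 (ler0n _ 144) (sqr_ge0 _)) (mulr_ge0 (mulr_ge0 (ler0n _ 6) (ltW (cM_gt0 _))) h).
Qed.

(** One constant for all bounds in terms of the norm: 9 cP collects three components, the amplitude
    3 and the loss cP, and 1 + cQ adds the pressure. *)
Definition cS : R := 9 * cP * (1 + cQ).

Lemma cS_ge : 9 * cP <= cS.
Proof.
rewrite -[leLHS]mulr1; apply: ler_wpM2l; first exact: mulr_ge0 (ler0n _ 9) (ltW cP_gt0).
by rewrite lerDl; exact: cQ_ge0.
Qed.

Lemma cS_ge1 : 1 <= cS.
Proof. by apply: le_trans cS_ge; have := @cP_ge1 R; lra. Qed.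

Let a_cS (c : R) (X : \bar R) : 0 < c -> c <= cS ->
 (forall b, a < b -> b <= a + 1 -> (X <= (c * b)%:E)%E) -> (X <= cS%:E * vLp_norm 3%:E u0)%E.
Proof.
move=> c1 cc H; rewrite Ea -EFinM; apply: (le_trans (le_limit_slope c1 H)).
by rewrite lee_fin ler_wpM2r.
Qed.

Let sq t : 0 < t -> sqrt t * rs t = 1.
Proof. by move=> t0; rewrite /rs mulfV// gt_eqF// sqrtr_gt0. Qed.

Let small_T (d : R) : 0 < d -> exists2 d' : R, 0 < d' & forall t, 0 < t -> t < d' -> I t /\ t < d.
Proof.
move=> d0; have [r r0 rT] : exists2 r : R, 0 < r & (r%:E <= T)%E.
 by case: T T0 => [r| |//]; [rewrite lte_fin => r0; exists r|exists 1; rewrite // leey].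
exists (Num.min r d); first by rewrite lt_min r0.
move=> t t0; rewrite lt_min => /andP[tr td]; split=> //; split=> //.
by apply: lt_le_trans rT; rewrite lte_fin.
Qed.

Lemma velocity_norm_oo t (B : R) : I t -> (forall i x, `|u i t x| <= B * rs t) ->
 ((sqrt t)%:E * vLp_norm +oo (velocity t) <= (3 * B)%:E)%E.
Proof.
move=> It H; have t0 := I_gt0 It.
have N : (vLp_norm +oo (velocity t) <= (3 * (B * rs t))%:E)%E.
 apply: Lp_norm_oo_le => x; rewrite ger0_norm ?enorm_ge0//; apply: (le_trans (enorm_le_sum _)).
 apply: (@le_trans _ _ (\sum_(i < 3) B * rs t)).
  apply: ler_sum => i _; have -> : velocity t x 0 i = u i t x by rewrite -(velocity_coord i t0).
  exact: H.
 by rewrite sumr_const card_ord mulr_natl.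
apply: (le_trans (lee_wpmul2l _ N)); first pos.
rewrite -EFinM lee_fin mulrCA (mulrCA _ B) sq// mulr1 lexx.
by [].
Qed.

Lemma velocity_sup_decay : sup_decay cS T u0 velocity.
Proof.
apply: ge_ereal_sup => _ [t It <-]; have P0 := @cP_gt0 R.
apply: (@a_cS (9 * cP)); [pos|exact: cS_ge|].
move=> b ab _; have -> : 9 * cP * b = 3 * (3 * (cP * b)) by ring.
apply: (velocity_norm_oo (It)) => i x; rewrite -mulrA.
by have := solution_sup_le mu0 fk fB fu0 cov i x (data0 ab) It; rewrite -mulrA.
Qed.

Lemma velocity_initial_decay : initial_decay velocity.
Proof.
split; apply: ecvg_right0.
- by move=> t t0; rewrite mule_ge0 ?lee_fin ?sqrtr_ge0// Lnorm_ge0.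
- move=> c cpos; have c3 : 0 < c / 3 by pos.
 have [tau tau0 H] := @solution_decay R u0 f mu0 fk fB fu0 T _ c3.
 have [d' d'0 Hd] := small_T tau0; exists d' => // t t0 /(Hd t t0)[It tt].
 have -> : c = 3 * (c / 3) by rewrite mulrCA divff// mulr1.
 by apply: (velocity_norm_oo (It)) => i x; exact: DB0 (H t i It tt) x.
- by move=> t t0; rewrite mule_ge0 ?lee_fin ?(ltW t0)// Lnorm_ge0.
move=> c cpos; have c3 : 0 < c / 3 by pos.
have [tau tau0 H] := @solution_decay R u0 f mu0 fk fB fu0 T _ c3.
have [d' d'0 Hd] := small_T tau0; exists d' => // t t0 /(Hd t t0)[It tt].
set b := c / 3 * rs t * rs t.
have b0 : 0 <= b := mulr_ge0 (mulr_ge0 (ltW c3) (ltW (rs_gt0 t0))) (ltW (rs_gt0 t0)).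
have N : (Lp_norm +oo (jacobian_norm (velocity t)) <= (3 * b)%:E)%E.
 apply: Lp_norm_oo_le => x; rewrite ger0_norm ?sqrtr_ge0//.
 have -> : 3 * b = sqrt ((3 * b) ^+ 2) by rewrite sqrtr_sqr ger0_norm// mulr_ge0.
 apply: ler_wsqrtr; apply: (@le_trans _ _ (\sum_(k < 3) \sum_(i < 3) b ^+ 2)).
  apply: ler_sum => k _; apply: ler_sum => i _.
  rewrite (partials_velocity (s := [:: k]) x i It isT) -(real_normK (num_real _)) lerXn2r ?nnegrE//.
  exact: (H t i It tt).2 [:: k] isT x.
 by rewrite !sum3; apply: le_of_eq; ring.
apply: (le_trans (lee_wpmul2l _ N)); first by rewrite lee_fin ltW.
rewrite -EFinM lee_fin le_eqVlt; apply/orP; left; apply/eqP.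
have E : t = sqrt t * sqrt t by rewrite -expr2 sqr_sqrtr// ltW.
rewrite [in LHS]E /b; transitivity (c * (sqrt t * rs t) ^+ 2); first by field.
by rewrite sq// expr1n mulr1.
Qed.

Lemma velocity_initial_limit : L3_initial_limit u0 velocity.
Proof.
apply: ecvg_right0; first by move=> t _; exact: Lnorm_ge0.
move=> c cpos; have c3 : 0 < c / 3 by pos.
have [tau tau0 H] := solution_initial mu0 fk fB fu0 a0 Nb_a cov c3.
have [d' d'0 Hd] := small_T tau0; exists d' => // t t0 /(Hd t t0)[It tt].
have -> : c = 3 * (c / 3) by rewrite mulrCA divff// mulr1.
have E i : (fun x => (velocity t \- u0)%R x 0 i) = (fun x => u i t x - u0 x 0 i).
 by apply/funext => x; rewrite !mxE -(velocity_coord i t0).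
apply: vLp_norm3_le => // i; last by rewrite E; exact: H.
have -> : (fun z : space3 R => (velocity t \- u0)%R (vec3 z) 0 i) = (fun z => velocity t (vec3 z) 0 i - u0 (vec3 z) 0 i).
 by apply/funext => z; rewrite !mxE.
exact: measurable_funB (m_u i It) (mu0 i).
Qed.

Lemma velocity_L3_control : L3_control cS T u0 velocity.
Proof.
split; last exact: velocity_initial_limit.
move=> t; rewrite le_eqVlt => /predU1P[<- _|t0 tT].
 by rewrite /velocity eqxx Ea -EFinM lee_fin ler_peMl// cS_ge1.
have It : I t by split.
apply: (@a_cS (9 * cP)); [exact: mulr_gt0 (ltr0Sn R 8) cP_gt0|exact: cS_ge|].
move=> b ab _; have -> : 9 * cP * b = 3 * (3 * (cP * b)) by ring.
apply: vLp_norm3_le => [||i]; first exact: mulr_gt0 M3 (pos (data0 ab)).2.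
 by move=> i; exact: m_u.
by rewrite velocity_coord//; exact: (solution_Nb_le mu0 fk fB fu0 cov i (data0 ab) It).
Qed.

Lemma velocity_pressure_control : pressure_control cS T u0 (pressure u).
Proof.
move=> t It; have t0 := I_gt0 It; have [M HM] := pressure_smooth It.
split; last by move=> theta th; exact: Ck_holder_DB th HM.
have Q0 := cQ_ge0; have P0 := @cP_gt0 R.
apply: (@a_cS cS); [exact: lt_le_trans ltr01 cS_ge1|exact: lexx|].
move=> b ab b1; have bpos := le_lt_trans a0 ab.
have [kap [A [D kt Ad ka]]] := cover It; have [k0 _] := pos D.
(* From b <= a + 1 together with kap sqrt t <= 1 and kap sqrt t a <= 1. *)
have kA : kap * sqrt t * (cP * b) <= 2 * cP.
 have w0 : 0 <= kap * sqrt t by pos.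
 rewrite mulrCA mulrC; apply: ler_wpM2r; first exact: ltW.
 by apply: (le_trans (ler_wpM2l w0 b1)); rewrite mulrDr mulr1; move: ka kt; move: (kap * _) => w; lra.
have N := pressure_Nb mu0 fk fB fu0 cov (data0 ab) D Ad kA It.
have r0 := rs_gt0 t0.
have B0 : 0 <= 9 * (cQ * (cP * b) * rs t).
 pos.
have I3 := integral_of_Nb B0 (mfun3_cont (CB_cont (DB_CB HM))) N.
have {}I3 := (Lp3_norm_le (pressure u t) B0).2 I3.
apply: (le_trans (lee_wpmul2l _ I3)); first pos.
rewrite -EFinM lee_fin; apply: (@le_trans _ _ (9 * cP * cQ * b * (sqrt t * rs t))).
 by apply: le_of_eq; ring.
rewrite sq// mulr1; apply: ler_wpM2r; first exact: ltW.
by rewrite /cS; apply: ler_wpM2l; [exact: mulr_ge0 (ler0n _ 9) (ltW P0)|rewrite lerDr].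
Qed.

Lemma solvable_of_cover : solvable_with_properties cS T u0.
Proof.
exists velocity, (pressure u); split; last split.
- split.
 + move=> t It; split.
  * by rewrite (velocityE (I_gt0 It)); apply: Ck_vrow => i; exact: CB_le (isT : (2 <= 6)%N) (u6 i It).
  * by have [M /DB_CB/(CB_le (isT : (1 <= 2)%N))] := pressure_smooth It; exact: Ck_CB.
  * by move=> x; exact: (@ex_derive _ _ _ _ _ _ _ (is_derive_velocity x It)).
 + by move=> t x It; exact: velocity_momentum.
 + move=> t x It; rewrite -[RHS](divf x It); apply: eq_bigr => i _.
  by rewrite velocity_coord// (I_gt0 It).
 + by rewrite /velocity eqxx.
 + exact: velocity_initial_limit.
- exact: velocity_regularity.
- exact: velocity_sup_decay.
- exact: velocity_initial_decay.
- exact: velocity_L3_control.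
- exact: velocity_pressure_control.
Qed.

End VectorSolution.

(** * The existence time and the smallness condition *)

Section ExistenceTime.
Context {R : realType}.
Local Notation V := 'rV[R]_3.
Implicit Types (kap A d t rho : R) (i j : 'I_3).

(** The constant C of the theorem, large enough that h = 1 / (4 C) satisfies cP cL h <= d1; the
    summand 1 gives C >= 1 and hence h <= 1. *)
Definition cC : R := cP * cL / (4 * d1) + 1.

Lemma cC_ge1 : 1 <= cC.
Proof.
rewrite lerDr; apply: divr_ge0; first exact: mulr_ge0 (ltW cP_gt0) (le_trans ler01 cL_ge1).
exact: mulr_ge0 (ler0n _ 4) (ltW d1_gt0).
Qed.

Definition hC : R := (4 * cC)^-1.

Lemma hC_gt0 : 0 < hC.
Proof. by rewrite invr_gt0; exact: mulr_gt0 (ltr0Sn R 3) (lt_le_trans ltr01 cC_ge1). Qed.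

Lemma hC_le1 : hC <= 1.
Proof.
have c1 := cC_ge1; have c4 : 0 < 4 * cC := mulr_gt0 (ltr0Sn R 3) (lt_le_trans ltr01 c1).
by rewrite /hC invf_le1//; move: c1; lra.
Qed.

Lemma data_size_le : cP * (cL * hC) <= d1.
Proof.
have c1 := cC_ge1; have c4 : 0 < 4 * cC := mulr_gt0 (ltr0Sn R 3) (lt_le_trans ltr01 c1).
rewrite mulrA /hC ler_pdivrMr//.
have d0 := @d1_gt0 R; have d4 : 4 * d1 * (cP * cL / (4 * d1)) = cP * cL :> R by rewrite mulrC divfK// gt_eqF// mulr_gt0.
rewrite -{1}d4 /cC; move: (cP * cL / _) => q; rewrite !mulrDr mulr1; lra.
Qed.

Lemma local_norm_ball rho h (u0 : V -> V) x : 0 <= h -> (local_L3_norm rho u0 <= h%:E)%E ->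
 (\int[leb3]_(y in [set y | (enorm (vec3 y - x) < rho)%R]) (enorm (u0 (vec3 y)) ^+ 3)%:E <= (h ^+ 3)%:E)%E.
Proof.
move=> h0; rewrite /local_L3_norm; set S := ereal_sup _ => H.
have le_S : (\int[leb3]_(y in [set y | (enorm (vec3 y - x) < rho)%R]) (enorm (u0 (vec3 y)) ^+ 3)%:E <= S)%E.
 by apply: ereal_sup_ubound; exists x.
apply: (le_trans le_S).
have S0 : (0 <= S)%E.
 by apply: le_trans le_S; apply: integral_ge0 => y _; rewrite lee_fin exprn_ge0// enorm_ge0.
have := le_poweR (ler0n R 3) (poweR_ge0 _ _) H.
rewrite -poweRrM mulVf ?pnatr_eq0// poweRe1//.
by rewrite poweR_EFin powR_mulrn.
Qed.

Lemma local_norm_le rho h (u0 : V -> V) : 0 <= h ->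
 (forall x, \int[leb3]_(y in [set y | (enorm (vec3 y - x) < rho)%R]) (enorm (u0 (vec3 y)) ^+ 3)%:E <= (h ^+ 3)%:E)%E ->
 (local_L3_norm rho u0 <= h%:E)%E.
Proof.
move=> h0 H; rewrite /local_L3_norm; set S := ereal_sup _.
have S0 : (0 <= S)%E.
 apply: (@le_trans _ _ (\int[leb3]_(y in [set y | (enorm (vec3 y - 0) < rho)%R]) (enorm (u0 (vec3 y)) ^+ 3)%:E)%E).
  by apply: integral_ge0 => y _; rewrite lee_fin exprn_ge0// enorm_ge0.
 by apply: ereal_sup_ubound; exists 0.
have SH : (S <= (h ^+ 3)%:E)%E by apply: ge_ereal_sup => _ [x _ <-]; exact: H.
have i0 : 0 <= 3^-1 :> R by pos.
apply: (le_trans (le_poweR i0 S0 SH)); rewrite poweR_EFin -powR_mulrn// -powRrM mulfV ?pnatr_eq0// powRr1//.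
Qed.

Lemma Nb_of_local_norm rho h (u0 : V -> V) i : 0 < rho -> 0 <= h ->
 (forall i, (mfun3 z, u0 (vec3 z) 0 i)) ->
 (local_L3_norm rho u0 <= h%:E)%E -> Nb rho^-1 (fun x => u0 x 0 i) (cL * h).
Proof.
move=> r0 h0 mu H; apply: Nb_of_local => // x.
have me : (mfun3 z, enorm (u0 (vec3 z))) by exact: mfun_enorm.
apply: le_trans (local_norm_ball x h0 H); apply: ge0_le_integral.
- exact: mfun_ball3.
- move=> z _; pos.
- apply: measurable_funTS; apply/measurable_EFinP; apply: measurable_funX.
 exact: measurableT_comp (@normr_measurable _ _) (mu i).
- by apply: measurable_funTS; apply/measurable_EFinP; exact: measurable_funX.
- by move=> z _; rewrite lee_fin lerXn2r ?nnegrE ?enorm_ge0//; exact: coord_le_enorm.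
Qed.

Lemma local_norm_of_Nb kap d (u0 : V -> V) : 0 < kap -> 0 < d ->
 (forall i, (mfun3 z, u0 (vec3 z) 0 i)) ->
 (forall i, Nb kap (fun x => u0 x 0 i) d) -> (local_L3_norm kap^-1 u0 <= (4 * d)%:E)%E.
Proof.
move=> k0 d0 mu Nu.
have ma i : (mfun3 z, `|u0 (vec3 z) 0 i|).
 exact: measurableT_comp (@normr_measurable _ _) (mu i).
have Na i : Nb kap (fun x => `|u0 x 0 i|) d.
 by move=> x l l0; under eq_integral do rewrite normr_id; exact: Nu.
have := NbD d0 (addr_gt0 d0 d0) (ma ord0) (measurable_funD (ma o1) (ma o2)) (Na ord0)
 (NbD d0 d0 (ma o1) (ma o2) (Na o1) (Na o2)).
have mS := measurable_funD (ma ord0) (measurable_funD (ma o1) (ma o2)).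
move=> NS; apply: local_norm_le => [|x]; first pos.
have me : (mfun3 z, enorm (u0 (vec3 z))) by exact: mfun_enorm.
(* The factor 2 compares ball and window, and three components give 27: 54 <= 64. *)
have b : 2 * (d + (d + d)) ^+ 3 <= (4 * d) ^+ 3.
 have -> : 2 * (d + (d + d)) ^+ 3 = 54 * d ^+ 3 by ring.
 have -> : (4 * d) ^+ 3 = 64 * d ^+ 3 by ring.
 by apply: ler_wpM2r; [rewrite exprn_ge0// ltW|rewrite ler_nat].
apply: (@le_trans _ _ (2 * (d + (d + d)) ^+ 3)%:E); last by rewrite lee_fin.
apply: le_trans (ball_integral_le x k0 mS NS); apply: ge0_le_integral.
- exact: mfun_ball3.
- move=> z _; pos.
- by apply: measurable_funTS; apply/measurable_EFinP; exact: measurable_funX.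
- apply: measurable_funTS; apply/measurable_EFinP; apply: measurable_funX.
 exact: measurableT_comp (@normr_measurable _ _) mS.
- move=> z _; rewrite lee_fin lerXn2r ?nnegrE ?enorm_ge0//.
 by apply: (le_trans (enorm_le_sum _)); rewrite sum3; exact: ler_norm.
Qed.

Section Data.
Variables (u0 : V -> V) (a : R).
Hypothesis mu0 : forall i, (mfun3 z, u0 (vec3 z) 0 i).
Hypothesis a0 : 0 <= a.
Hypothesis Ea : vLp_norm 3%:E u0 = a%:E.

Let h0 := hC_gt0.

Lemma data_boundE kap : 0 <= kap -> (forall i, Nb kap (fun x => u0 x 0 i) (cL * hC)) ->
 data_bound u0 kap (cP * (cL * hC)).
Proof.
move=> k0 N; split=> //; first exact: mulr_gt0 cP_gt0 (mulr_gt0 (lt_le_trans ltr01 cL_ge1) h0).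
by move=> i; rewrite mulrAC divff ?mul1r// gt_eqF// cP_gt0.
Qed.

Lemma data_bound_small : a <= hC -> data_bound u0 0 (cP * (cL * hC)).
Proof.
move=> ah; apply: data_boundE => // i; apply: Nb_coord => //.
 exact: mulr_ge0 (le_trans ler01 cL_ge1) (ltW h0).
rewrite Ea lee_fin; apply: (le_trans ah); rewrite -[leLHS]mul1r.
exact: ler_wpM2r (ltW h0) _ _ cL_ge1.
Qed.

(** Some rho and t' > t satisfy the condition. If sqrt t <= rho, the local norm yields a pair with
    kap = 1 / rho. Otherwise sqrt t' / rho > 1, the condition bounds the whole L^3 norm by hC, and
    kap = 0 works. *)
Lemma existence_time_cover t : time_interval (existence_time cC u0) t -> exists kap A,
 [/\ data_bound u0 kap A, kap * sqrt t <= 1, A <= d1 & kap * sqrt t * a <= 1].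
Proof.
move=> [t0]; rewrite /existence_time => /ereal_sup_gt[_ [rho /= r0 <-]].
(* The default value 0 of the supremum is excluded by t > 0. *)
rewrite /t_rho lt_max => /orP[|/ereal_sup_gt[_ [t' [t'0 H] <-]]]; first by rewrite lte_fin ltNge (ltW t0).
rewrite lte_fin => tt; move: H; rewrite Ea -/hC => H.
have st : sqrt t <= sqrt t' by apply: ler_wsqrtr; exact: ltW.
have l0 : (0 <= local_L3_norm rho u0)%E by exact: poweR_ge0.
have x0 := expR_ge0 (- (rho ^+ 2 / (8 * t'))).
have s0 : 0 <= sqrt t' / rho by pos.
have q0 : 0 <= (expR (- (rho ^+ 2 / (8 * t'))) + sqrt t' / rho) * a by pos.
have Hl : (local_L3_norm rho u0 <= hC%:E)%E.
 by apply: (le_trans _ (ltW H)); apply: leeDl; rewrite -EFinM lee_fin.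
have Hs : sqrt t' / rho * a <= hC.
 rewrite -lee_fin; apply: (le_trans _ (ltW H)).
 apply: (@le_trans _ _ ((expR (- (rho ^+ 2 / (8 * t'))) + sqrt t' / rho) * a)%:E).
  by rewrite lee_fin ler_wpM2r// lerDr.
 by rewrite -EFinM leeDr.
have [tr|tr] := leP (sqrt t) rho.
 exists rho^-1, (cP * (cL * hC)); split.
 - apply: data_boundE; first pos.
  by move=> i; apply: Nb_of_local_norm => //; exact: ltW.
 - by rewrite mulrC ler_pdivrMr// mul1r.
 - exact: data_size_le.
 - apply: le_trans hC_le1; apply: le_trans Hs; rewrite ler_wpM2r// mulrC ler_wpM2r ?invr_ge0//.
  exact: ltW.
exists 0, (cP * (cL * hC)); rewrite !mul0r; split; rewrite ?ler01//; last exact: data_size_le.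
apply: data_bound_small; apply: le_trans Hs; rewrite ler_peMl// ler_pdivlMr// mul1r.
exact: le_trans (ltW tr) st.
Qed.

(** At a scale rho where the local norm is at most hC / 4, the time t = (rho s)^2 makes the
    remaining terms small with s: t^(1/2) / rho is s, and the exponential e^(-1 / (8 s^2)) is at
    most 8 s^2. *)
Lemma existence_time_gt0 : (forall d, 0 < d -> exists2 kap, 0 < kap & forall i, Nb kap (fun x => u0 x 0 i) d) ->
 (0 < existence_time cC u0)%E.
Proof.
move=> small; have d0 : 0 < hC / 16 by pos.
have [kap k0 N] := small _ d0; have Hl := local_norm_of_Nb k0 d0 mu0 N.
have r0 : 0 < kap^-1 by pos.
set rho := kap^-1 in r0 Hl *.
have a1 : 0 < a + 1 by pos.
(* As s <= 1, the remaining terms are at most (8 s^2 + s) a <= 9 s a <= hC / 2, which with hC / 4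
   stays below hC. *)
set s := Num.min 1 (hC / (18 * (a + 1))).
have s0 : 0 < s by rewrite lt_min ltr01 divr_gt0// mulr_gt0.
have s1 : s <= 1 by rewrite ge_min lexx.
have sa : 9 * s * a <= hC / 2.
 have : s <= hC / (18 * (a + 1)) by rewrite ge_min lexx orbT.
 rewrite ler_pdivlMr ?mulr_gt0//; move: s0 a0; move: (hC) (s) => h q q0 b0; nra.
set t := (rho * s) ^+ 2.
have rs0 : 0 < rho * s by pos.
have t0 : 0 < t by rewrite exprn_gt0.
have tE : sqrt t / rho = s by rewrite sqrtr_sqr gtr0_norm// mulrAC divff ?mul1r// gt_eqF.
have xE : expR (- (rho ^+ 2 / (8 * t))) <= 8 * s ^+ 2.
 have -> : rho ^+ 2 / (8 * t) = (8 * s ^+ 2)^-1.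
  by rewrite /t exprMn; field; rewrite !gt_eqF.
 have p0 : 0 < 8 * s ^+ 2 by pos.
 rewrite expRN -[leRHS]invrK lef_pV2 ?posrE ?expR_gt0 ?invr_gt0//.
 by apply: le_trans (expR_ge1Dx _); rewrite lerDr.
have Ht : (local_L3_norm rho u0 + (expR (- (rho ^+ 2 / (8 * t))) + sqrt t / rho)%:E * vLp_norm 3%:E u0 < ((4 * cC)^-1)%:E)%E.
 rewrite -/hC Ea tE -EFinM.
 apply: (@le_lt_trans _ _ ((4 * (hC / 16))%:E + (9 * s * a)%:E)%E).
  apply: leeD => //; rewrite lee_fin ler_wpM2r//; move: xE; move: (expR _) => q; nra.
 by rewrite -EFinD lte_fin; move: sa h0; move: (9 * s * a) hC => w h; lra.
apply: (@lt_le_trans _ _ t%:E); first by rewrite lte_fin.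
apply: (@le_trans _ _ (t_rho cC u0 rho)); last by apply: ereal_sup_ubound; exists rho.
by rewrite /t_rho le_max; apply/orP; right; apply: ereal_sup_ubound; exists t.
Qed.

End Data.
End ExistenceTime.

Theorem theorem1p1 (R : realType) :
 exists C c : R, [/\ 0 < C, 0 < c,
  forall U0 : 'rV[R]_3 -> 'rV[R]_3, J3 U0 ->
   (0 < existence_time C U0)%E /\
   solvable_with_properties c (existence_time C U0) U0 &
  exists2 eps : R, 0 < eps &
   forall U0 : 'rV[R]_3 -> 'rV[R]_3, J3 U0 ->
    (vLp_norm 3%:E U0 < eps%:E)%E ->
    solvable_with_properties c +oo%E U0].
Proof.
have norm_fin (u0 : 'rV[R]_3 -> 'rV[R]_3) : J3 u0 -> exists2 a, 0 <= a & vLp_norm 3%:E u0 = a%:E.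
 move=> [[_ fin] _]; have n0 : (0 <= vLp_norm 3%:E u0)%E by exact: Lnorm_ge0.
 by exists (fine (vLp_norm 3%:E u0)); [exact: fine_ge0|rewrite fineK// ge0_fin_numE].
exists cC, cS; split.
- exact: lt_le_trans ltr01 cC_ge1.
- exact: lt_le_trans ltr01 cS_ge1.
- move=> u0 J; have [[mu _] _] := J; have [f [fk fB fd fu]] := J3_approx J; have [a a0 Ea] := norm_fin u0 J.
 have T0 : (0 < existence_time cC u0)%E.
  apply: (existence_time_gt0 mu a0 Ea) => d d0; exact: (small_data mu fk fu d0).
 split=> //; apply: (solvable_of_cover mu fk fB fd fu a0 Ea T0) => t It.
 by have := existence_time_cover mu a0 Ea It.
(* Below this norm the pair with kap = 0 is small at all times. *)
exists hC; first exact: hC_gt0.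
move=> u0 J sm; have [[mu _] _] := J; have [f [fk fB fd fu]] := J3_approx J; have [a a0 Ea] := norm_fin u0 J.
apply: (solvable_of_cover mu fk fB fd fu a0 Ea (ltry 0)) => t It.
exists 0, (cP * (cL * hC)); rewrite !mul0r; split; rewrite ?ler01//; last exact: data_size_le.
by apply: (data_bound_small mu Ea); rewrite -lee_fin -Ea ltW.
Qed.
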